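(* Let $n\ge3$. (a) Let $(M^n,g)$ be a smooth compact Riemannian manifold with boundary and assume that $(M,g)$ is conformally covered by the standard half sphere $\mathbb{S}^n_+$. Then for any $c\in\mathbb{R}$ there exists a metric $\hat g$ which is conformal to $g$, has constant sectional curvature $1$, and has constant boundary mean curvature $c$. (b) Let $M^n$ be a smooth compact locally conformally flat Riemannian manifold with umbilic boundary. The following statements are equivalent. (i) $M$ is conformally covered by the standard half sphere. (ii) $M$ is of $\Gamma_n$-positive type. (iii) $M$ is of $\tilde\Gamma$-positive type for some $\tilde\Gamma\subset\Gamma_k$, $\frac n2\le k\le n$.
   Context: Manifolds are connected and boundaries are non-empty. $\mathbb{S}^n_+$ is the closed hemisphere of the round sphere; $M$ is conformally covered by $\mathbb{S}^n_+$ if there is a conformal covering map $\mathbb{S}^n_+\to M$. $\Gamma_k=\{\lambda\in\mathbb{R}^n:\sigma_l(\lambda)>0,\ 1\le l\le k\}$, with $\sigma_l$ the $l$-th elementary symmetric function; in particular $\Gamma_n=\{\lambda:\lambda_i>0\ \forall i\}$ and $\Gamma_1=\{\lambda:\sum_i\lambda_i>0\}$. In (iii), $k$ is an integer and $\tilde\Gamma$ is an open convex symmetric (permutation invariant) cone in $\mathbb{R}^n$ with vertex at the origin satisfying $\Gamma_n\subset\tilde\Gamma\subset\Gamma_1$. $A_g=\frac{1}{n-2}\big(Ric_g-\frac{R_g}{2(n-1)}g\big)$ is the Schouten tensor, $\lambda(A_g)$ its eigenvalues with respect to $g$, and $h_g$ the mean curvature (average of principal curvatures) of $\partial M$ with respect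 to the inner normal (positive for Euclidean balls). A hypersurface is umbilic if its second fundamental form is a multiple of the metric. For an open convex symmetric (permutation invariant) cone $\Gamma$ in $\mathbb{R}^n$ with vertex at the origin satisfying $\Gamma_n\subset\Gamma\subset\Gamma_1$, $(M,g)$ is of $\Gamma$-positive type if there is a positive function $w\in C^2(M)$ such that $\tilde g=w^{4/(n-2)}g$ satisfies $\lambda(A_{\tilde g})\in\Gamma$ in $M$ and $h_{\tilde g}\ge0$ on $\partial M$. *)

(* Defs.v *)
From HB Require Import structures.
From mathcomp Require Import all_boot all_order all_algebra all_fingroup.
From mathcomp Require Import all_classical all_reals all_analysis.
Import numFieldNormedType.Exports.

Set Implicit Arguments.
Unset Strict Implicit.
Unset Printing Implicit Defensive.

Import Order.TTheory GRing.Theory Num.Theory.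
Local Open Scope classical_set_scope.
Local Open Scope ring_scope.

(** MathComp-Analysis has no manifolds.  The geometry below is set up in local
    coordinates.  Manifolds have dimension [n = m.+1], so that coordinates are
    vectors of ['rV[R]_m.+1]; coordinate [ord0] is the one that vanishes on the
    boundary, and the coordinates [lift ord0 a], [a : 'I_m], are tangent to the
    boundary. *)

(** * Calculus on subsets of Euclidean space *)

Definition e_ {R : realType} {d : nat} (i : 'I_d) : 'rV[R]_d := delta_mx 0 i.

Fixpoint Ck {R : realType} {d : nat} (k : nat) (U : set 'rV[R]_d)
    (f : 'rV[R]_d -> R) : Prop :=
  (forall x, U x -> {for x, continuous f}) /\
  if k is k'.+1 then
    forall i, (forall x, U x -> derivable f x (e_ i)) /\
              Ck k' U (fun x => 'D_(e_ i) f x)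
  else True.

(** On a set that need not be open (relatively open subsets of a half space,
    subsets of a sphere), differentiability means local extendability. *)
Definition Ck_on {R : realType} {d : nat} (k : nat) (S : set 'rV[R]_d)
    (f : 'rV[R]_d -> R) : Prop :=
  forall x, S x -> exists O F,
    [/\ open O, O x, Ck k O F & forall y, O y -> S y -> F y = f y].

Definition smooth_on {R : realType} {d : nat} (S : set 'rV[R]_d)
    (f : 'rV[R]_d -> R) : Prop :=
  forall x, S x -> exists O F,
    [/\ open O, O x, forall k, Ck k O F & forall y, O y -> S y -> F y = f y].

Definition smooth_map_on {R : realType} {d e : nat} (S : set 'rV[R]_d)
    (f : 'rV[R]_d -> 'rV[R]_e) : Prop :=
  forall j, smooth_on S (fun x => f x 0 j).

(** Partial derivatives are taken from the right: if [x] lies in a relatively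
    open subset of the half space [0 <= x 0 ord0], then so does [x + h *: e_ i]
    for small [h > 0].  This is the usual partial derivative at interior points
    of differentiability, and at the boundary it is the partial derivative of
    any differentiable extension. *)
Definition pd {R : realType} {d : nat} (i : 'I_d) (f : 'rV[R]_d -> R)
    (x : 'rV[R]_d) : R :=
  lim ((fun h : R => h^-1 * (f (x + h *: e_ i) - f x)) @ 0^'+).

(** Acts on row vectors on the right: [v *m jac f x] is the differential of [f]
    at [x] applied to [v]. *)
Definition jac {R : realType} {d e : nat} (f : 'rV[R]_d -> 'rV[R]_e)
    (x : 'rV[R]_d) : 'M[R]_(d, e) :=
  \matrix_(i, j) pd i (fun y => f y 0 j) x.

(** * Smooth manifolds with boundary *)

Definition half_space {R : realType} {m : nat} : set 'rV[R]_m.+1 :=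
  [set x | 0 <= x 0 ord0].

(** Only the values of [phi c] on [dom c] and of [psi c] on the image of [dom c]
    are meaningful. *)
Record atlas (R : realType) (m : nat) (M : topologicalType) := Atlas {
  chart : Type;
  dom : chart -> set M;
  phi : chart -> M -> 'rV[R]_m.+1;
  psi : chart -> 'rV[R]_m.+1 -> M }.

Definition img {R : realType} {m : nat} {M : topologicalType}
    (A : atlas R m M) (c : chart A) : set 'rV[R]_m.+1 := phi c @` dom c.

Definition overlap {R : realType} {m : nat} {M : topologicalType}
    (A : atlas R m M) (c d : chart A) : set 'rV[R]_m.+1 :=
  phi c @` (dom c `&` dom d).

Definition transition {R : realType} {m : nat} {M : topologicalType}
    (A : atlas R m M) (c d : chart A) (x : 'rV[R]_m.+1) : 'rV[R]_m.+1 :=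
  phi d (psi c x).

Record smooth_manifold {R : realType} {m : nat} {M : topologicalType}
    (A : atlas R m M) : Prop := SmoothManifold {
  sm_hausdorff : hausdorff_space M;
  sm_second_countable : @second_countable M;
  sm_connected : connected [set: M];
  sm_cover : forall p : M, exists c : chart A, dom c p;
  sm_dom_open : forall c : chart A, open (dom c);
  sm_img_open : forall c : chart A, exists2 U, open U & img c = U `&` half_space;
  sm_phiK : forall (c : chart A) p, dom c p -> psi c (phi c p) = p;
  sm_phi_cont : forall c : chart A, {within dom c, continuous (phi c)};
  sm_psi_cont : forall c : chart A, {within img c, continuous (psi c)};
  sm_compat : forall c d : chart A, smooth_map_on (overlap c d) (transition c d) }.

Definition mboundary {R : realType} {m : nat} {M : topologicalType}
    (A : atlas R m M) : set M :=
  [set p | exists2 c : chart A, dom c p & phi c p 0 ord0 = 0].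

Definition bimg {R : realType} {m : nat} {M : topologicalType}
    (A : atlas R m M) (c : chart A) : set 'rV[R]_m.+1 :=
  [set x | img c x /\ x 0 ord0 = 0].

Definition compact_manifold_with_boundary {R : realType} {m : nat}
    {M : topologicalType} (A : atlas R m M) : Prop :=
  [/\ smooth_manifold A, compact [set: M] & mboundary A !=set0].

(** * Riemannian metrics *)

(** [g c x] is the matrix of the tensor in the chart [c] at the point with
    coordinates [x]; values at [x] outside [img c] are irrelevant. *)
Definition tensor2 {R : realType} {m : nat} {M : topologicalType}
    (A : atlas R m M) : Type := chart A -> 'rV[R]_m.+1 -> 'M[R]_m.+1.

Definition bil {R : realType} {d : nat} (G : 'M[R]_d) (v w : 'rV[R]_d) : R :=
  (v *m G *m w^T) 0 0.

Record riemannian_metric {R : realType} {m : nat} {M : topologicalType}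
    (A : atlas R m M) (g : tensor2 A) : Prop := RiemannianMetric {
  rm_sym : forall c x, img c x -> (g c x)^T = g c x;
  rm_pos : forall c x, img c x -> forall v, v != 0 -> 0 < bil (g c x) v v;
  rm_smooth : forall c i j, smooth_on (img c) (fun x => g c x i j);
  rm_change : forall c d x, overlap c d x ->
    g c x = jac (transition c d) x *m g d (transition c d x)
              *m (jac (transition c d) x)^T }.

Definition C2_fun {R : realType} {m : nat} {M : topologicalType}
    (A : atlas R m M) (w : M -> R) : Prop :=
  forall c : chart A, Ck_on 2 (img c) (fun x => w (psi c x)).

Definition rescale {R : realType} {m : nat} {M : topologicalType}
    (A : atlas R m M) (u : M -> R) (g : tensor2 A) : tensor2 A :=
  fun c x => u (psi c x) *: g c x.

Definition conformal {R : realType} {m : nat} {M : topologicalType}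
    (A : atlas R m M) (g h : tensor2 A) : Prop :=
  exists2 u : M -> R, forall p, 0 < u p &
    forall c x, img c x -> h c x = rescale u g c x.

(** * Curvature, for a metric [G] given in coordinates *)

Definition christoffel {R : realType} {m : nat}
    (G : 'rV[R]_m.+1 -> 'M[R]_m.+1) (k i j : 'I_m.+1) (x : 'rV[R]_m.+1) : R :=
  2^-1 * \sum_l (invmx (G x)) k l *
    (pd i (fun y => G y j l) x + pd j (fun y => G y i l) x
       - pd l (fun y => G y i j) x).

(** The [l]-th component of [R(e_i, e_j) e_k], for the convention
    [R(X, Y) = [nabla_X, nabla_Y] - nabla_[X, Y]]. *)
Definition riem {R : realType} {m : nat} (G : 'rV[R]_m.+1 -> 'M[R]_m.+1)
    (l k i j : 'I_m.+1) (x : 'rV[R]_m.+1) : R :=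
  pd i (christoffel G l j k) x - pd j (christoffel G l i k) x
  + \sum_p (christoffel G l i p x * christoffel G p j k x
            - christoffel G l j p x * christoffel G p i k x).

Definition curv_op {R : realType} {m : nat} (G : 'rV[R]_m.+1 -> 'M[R]_m.+1)
    (x X Y Z : 'rV[R]_m.+1) : 'rV[R]_m.+1 :=
  \row_l \sum_i \sum_j \sum_k X 0 i * Y 0 j * Z 0 k * riem G l k i j x.

Definition sectional {R : realType} {m : nat} (G : 'rV[R]_m.+1 -> 'M[R]_m.+1)
    (x X Y : 'rV[R]_m.+1) : R :=
  bil (G x) (curv_op G x X Y Y) X /
    (bil (G x) X X * bil (G x) Y Y - bil (G x) X Y ^+ 2).

Definition ricci {R : realType} {m : nat} (G : 'rV[R]_m.+1 -> 'M[R]_m.+1)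
    (x : 'rV[R]_m.+1) : 'M[R]_m.+1 :=
  \matrix_(j, k) \sum_i riem G i k i j x.

Definition scal {R : realType} {m : nat} (G : 'rV[R]_m.+1 -> 'M[R]_m.+1)
    (x : 'rV[R]_m.+1) : R := \tr (invmx (G x) *m ricci G x).

Definition schouten {R : realType} {m : nat} (G : 'rV[R]_m.+1 -> 'M[R]_m.+1)
    (x : 'rV[R]_m.+1) : 'M[R]_m.+1 :=
  let n : R := m.+1%:R in
  (n - 2)^-1 *: (ricci G x - (scal G x / (2 * (n - 1))) *: G x).

(** [lam] lists, with multiplicity, the eigenvalues of the bilinear form [B]
    with respect to the inner product [G]. *)
Definition eigenvalues_wrt {R : realType} {d : nat} (G B : 'M[R]_d)
    (lam : 'rV[R]_d) : Prop :=
  char_poly (invmx G *m B) = \prod_i ('X - (lam 0 i)%:P).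

Definition tangential {R : realType} {m : nat} (B : 'M[R]_m.+1) : 'M[R]_m :=
  \matrix_(a, b) B (lift ord0 a) (lift ord0 b).

(** At a boundary point the inner unit normal is [nu = grad x_0 / |grad x_0|],
    so that [g(nabla_(e_a) e_b, nu) = Gamma^0_(ab) / sqrt (g^(00))]. *)
Definition second_ff {R : realType} {m : nat} (G : 'rV[R]_m.+1 -> 'M[R]_m.+1)
    (x : 'rV[R]_m.+1) : 'M[R]_m :=
  \matrix_(a, b) (christoffel G ord0 (lift ord0 a) (lift ord0 b) x
                    / Num.sqrt ((invmx (G x)) ord0 ord0)).

(** [h] is the average of the [m = n - 1] principal curvatures. *)
Definition mean_curvature {R : realType} {m : nat}
    (G : 'rV[R]_m.+1 -> 'M[R]_m.+1) (x : 'rV[R]_m.+1) (h : R) : Prop :=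
  exists2 kappa, eigenvalues_wrt (tangential (G x)) (second_ff G x) kappa &
    h = (\sum_a kappa 0 a) / m%:R.

Definition constant_sectional_curvature {R : realType} {m : nat}
    {M : topologicalType} (A : atlas R m M) (g : tensor2 A) (K : R) : Prop :=
  forall c x X Y, img c x -> row_free (col_mx X Y) -> sectional (g c) x X Y = K.

Definition constant_mean_curvature {R : realType} {m : nat}
    {M : topologicalType} (A : atlas R m M) (g : tensor2 A) (h : R) : Prop :=
  forall c x, bimg c x -> mean_curvature (g c) x h.

Definition umbilic_boundary {R : realType} {m : nat} {M : topologicalType}
    (A : atlas R m M) (g : tensor2 A) : Prop :=
  forall c x, bimg c x ->
    exists mu : R, second_ff (g c) x = mu *: tangential (g c x).

(** Every point has a neighbourhood that is mapped conformally and
    diffeomorphically onto a subset of flat Euclidean space. *)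
Definition locally_conformally_flat {R : realType} {m : nat}
    {M : topologicalType} (A : atlas R m M) (g : tensor2 A) : Prop :=
  forall p : M, exists (c : chart A) (O : set 'rV[R]_m.+1)
      (f : 'rV[R]_m.+1 -> 'rV[R]_m.+1),
    let S := O `&` img c in
    [/\ dom c p, open O & O (phi c p)] /\
    [/\ smooth_map_on S f, set_inj S f &
        forall y, S y -> exists2 mu : R, 0 < mu &
          jac f y *m (jac f y)^T = mu *: g c y].

(** * Conformal coverings by the standard closed half sphere *)

Definition dotp {R : realType} {d : nat} (v w : 'rV[R]_d) : R :=
  \sum_i v 0 i * w 0 i.

Definition half_sphere {R : realType} {m : nat} : set 'rV[R]_m.+2 :=
  [set x | dotp x x = 1 /\ 0 <= x 0 ord0].

(** [F] restricts to a covering map from the subspace [S] onto [Y]; the sheets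
    over an evenly covered [V] are the images of the local inverses [s i]. *)
Definition covering_map {X Y : topologicalType} (S : set X) (F : X -> Y) : Prop :=
  [/\ {within S, continuous F}, F @` S = [set: Y] &
   forall p : Y, exists (V : set Y) (I : Type) (s : I -> Y -> X),
     [/\ open V, V p & trivIset [set: I] (fun i => s i @` V)] /\
     [/\ forall i, {within V, continuous (s i)},
         forall i y, V y -> S (s i y) /\ F (s i y) = y,
         forall i, exists2 U, open U & s i @` V = U `&` S &
         forall x, S x -> V (F x) -> exists i, s i (F x) = x]].

(** In each chart, [F] is locally the restriction of a smooth map [G] of an open
    subset of [R^(n+1)]; the differential of [F] is the restriction of that of
    [G] to the tangent space [x^perp] of the sphere, whose round metric is the
    Euclidean inner product. *)
Definition conformal_covering {R : realType} {m : nat} {M : topologicalType}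
    (A : atlas R m M) (g : tensor2 A) (F : 'rV[R]_m.+2 -> M) : Prop :=
  covering_map half_sphere F /\
  forall (c : chart A) x, half_sphere x -> dom c (F x) ->
    exists (O : set 'rV[R]_m.+2) (G : 'rV[R]_m.+2 -> 'rV[R]_m.+1) (mu : R),
      [/\ open O, O x, forall k j, Ck k O (fun y => G y 0 j) &
          forall y, O y -> half_sphere y -> dom c (F y) /\ G y = phi c (F y)] /\
      [/\ 0 < mu & forall v w, dotp v x = 0 -> dotp w x = 0 ->
          bil (g c (G x)) ('D_v G x) ('D_w G x) = mu * dotp v w].

Definition covered_by_half_sphere {R : realType} {m : nat}
    {M : topologicalType} (A : atlas R m M) (g : tensor2 A) : Prop :=
  exists F, conformal_covering g F.

(** * Cones and positive type *)

Definition elem_sym {R : realType} {d : nat} (l : nat) (lam : 'rV[R]_d) : R :=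
  \sum_(S : {set 'I_d} | #|S| == l) \prod_(i in S) lam 0 i.

Definition Gamma {R : realType} {d : nat} (k : nat) : set 'rV[R]_d :=
  [set lam | forall l, (1 <= l <= k)%N -> 0 < elem_sym l lam].

Record admissible_cone {R : realType} {d : nat} (C : set 'rV[R]_d) : Prop :=
  AdmissibleCone {
  ac_open : open C;
  ac_convex : convex_set (C : set (convex_lmodType 'rV[R]_d));
  ac_sym : forall a (s : 'S_d), C a -> C (col_perm s a);
  ac_cone : forall a (t : R), C a -> 0 < t -> C (t *: a);
  ac_lower : Gamma d `<=` C;
  ac_upper : C `<=` Gamma 1 }.

Definition positive_type {R : realType} {m : nat} {M : topologicalType}
    (A : atlas R m M) (g : tensor2 A) (C : set 'rV[R]_m.+1) : Prop :=
  let n : R := m.+1%:R in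
  exists2 w : M -> R, (forall p, 0 < w p) /\ C2_fun A w &
    let gt := rescale (fun p => w p `^ (4 / (n - 2))) g in
    (forall c x, img c x -> exists2 lam,
       eigenvalues_wrt (gt c x) (schouten (gt c) x) lam & C lam) /\
    (forall c x, bimg c x -> exists2 h, mean_curvature (gt c) x h & 0 <= h).

(* Main.v *)
(* The rays of the forward light cone C of R^{1,n+1} are the points of S^n, and by Liouville's theorem local
conformal maps of S^n are restrictions of Lorentz maps. Straightening the umbilic boundary, M is locally modelled
on C folded by the reflection in a fixed spacelike vector. A germ of such a model is extended over caps
{X in C : Q N X > 0}. If the extension misses a ray of C, compactness of M provides a germ for which the normalised
size of the largest cap is extremal; Gordan's alternative then either enlarges this cap, or produces a metric of a
cylinder (a flat metric if the caps are unbounded) touching the given conformal metric from one side. At a contact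
point all Schouten eigenvalues are <= a and one is <= -a, for some a >= 0, which is impossible in Gamma_k when
2k >= n. So the model is defined on all of C; its Lorentz symmetries form a finite group with a single mirror, so it
is injective on a half of C and M is conformal to the hemisphere itself. Dividing the metric |dX|^2 of the cone by
(Q N X)^2, N = (sqrt (1 + c^2), - c mv), gives curvature 1 and boundary mean curvature c. *)
Require Import Defs.
From HB Require Import structures.
From mathcomp Require Import all_boot all_order all_algebra all_fingroup.
From mathcomp Require Import all_classical all_reals all_analysis.
From mathcomp Require Import ring lra zify.
Import numFieldNormedType.Exports.
Set Implicit Arguments.
Unset Strict Implicit.
Unset Printing Implicit Defensive.
Import Order.TTheory GRing.Theory Num.Theory.
Local Open Scope classical_set_scope.
Local Open Scope ring_scope.
Implicit Types (R: realType) (m n: nat) (M: topologicalType).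
(* The boundary of a chart is [co x = 0], its interior [0 < co x]. *)
Local Notation co x:= (x 0 ord0).

(** For [Q N N = 1] the metric |dX|^2 / (Q N X)^2 is the hyperbolic metric of the round ball
    [cap N], and a metric of the conformal class is |dX|^2 / dens^2 with [dens] of degree one. The
    normalised size [Q N X / dens] is therefore the ratio of the given metric to the hyperbolic
    metric of a ball; its maximum over the balls to which the germ extends is a lower semicontinuous
    function on M, and the extremal germ is a minimum of it. Seen from [X] inside its maximal ball,
    the missing rays on the boundary sphere are directions. If these lie in an open half space,
    tilting the ball enlarges it. If not, some z and -z lie in their closed convex hull, and every
    ball of a nearby germ, which must avoid the same rays, has its density bounded by that of the
    cylinder with axis z. No universal cover or developing map is formed: a germ is a function on
    all of R^{1,n+1} read near one ray, and extensions are compared through the connectedness of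
    intersections of two caps. Its values record a point of M and a scale, so that equality of germs
    compares metrics as well. *)

Ltac pos := rewrite ?gt_eqF //; repeat first [done|rewrite invr_gt0|rewrite invr_ge0
 |rewrite sqrtr_gt0|rewrite sqrtr_ge0|rewrite normr_ge0|rewrite sqr_ge0
 |apply/mulr_gt0|apply/exprn_gt0|apply/mulr_ge0|apply/exprn_ge0
 |apply/addr_ge0|apply/ltr_wpDl|exact/ltW].

(** * Lorentz geometry of the light cone *)

Section Dot.
Context {R}.
Implicit Types d: nat.

Lemma dotpC d (x y: 'rV[R]_d): dotp x y = dotp y x.
by apply: eq_bigr => i _; rewrite mulrC. Qed.

Lemma dotpDl d (x y z: 'rV[R]_d): dotp (x + y) z = dotp x z + dotp y z.
by rewrite /dotp -big_split; apply: eq_bigr => i _; rewrite mxE mulrDl. Qed.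

Lemma dotpZl d a (x y: 'rV[R]_d): dotp (a *: x) y = a * dotp x y.
by rewrite /dotp mulr_sumr; apply: eq_bigr => i _; rewrite mxE mulrA. Qed.

Lemma dotpDr d (x y z: 'rV[R]_d): dotp z (x + y) = dotp z x + dotp z y.
by rewrite ![dotp z _]dotpC dotpDl. Qed.

Lemma dotpZr d a (x y: 'rV[R]_d): dotp y (a *: x) = a * dotp y x.
by rewrite ![dotp y _]dotpC dotpZl. Qed.

Lemma dotpNl d (x y: 'rV[R]_d): dotp (- x) y = - dotp x y.
by rewrite -scaleN1r dotpZl mulN1r. Qed.

Lemma dotpNr d (x y: 'rV[R]_d): dotp y (- x) = - dotp y x.
by rewrite ![dotp y _]dotpC dotpNl. Qed.

Lemma dotp0l d (x: 'rV[R]_d): dotp 0 x = 0.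
by rewrite -[0 in LHS](scale0r x) dotpZl mul0r. Qed.

Definition dotpE:= (@dotpDl, @dotpDr, @dotpZl, @dotpZr, @dotpNl, @dotpNr).

Lemma dotp_ge0 d (x: 'rV[R]_d): 0 <= dotp x x.
by apply: sumr_ge0 => i _; rewrite -expr2 sqr_ge0. Qed.

Lemma sqr_coord_le d (x: 'rV[R]_d) i: x 0 i ^+ 2 <= dotp x x.
rewrite /dotp (bigD1 i) //= expr2 lerDl. by apply: sumr_ge0=> j _; rewrite -expr2 sqr_ge0.
Qed.

Lemma dotp_eq0 d (x: 'rV[R]_d): dotp x x = 0 -> x = 0.
move=> x0; apply/rowP=> i; rewrite mxE; apply/eqP; rewrite -sqrf_eq0 eq_le.
by rewrite sqr_ge0 andbT -x0 sqr_coord_le.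
Qed.

Lemma dotp_gt0 d (x: 'rV[R]_d): x != 0 -> 0 < dotp x x.
move=> x0; rewrite lt_neqAle dotp_ge0 andbT eq_sym; apply: contra x0. by move=>/eqP /dotp_eq0 ->.
Qed.

(** The quadratic is least at [- b / c]. As [c] may vanish, this gives the Cauchy-Schwarz inequality
    also for forms that are only semidefinite, such as [sp]. *)
Lemma quad_discr (a b c: R) :
  (forall s, 0 <= a + 2 * b * s + c * s ^+ 2) -> b ^+ 2 <= a * c.
move=> H; have c0: 0 <= c.
 rewrite leNgt; apply/negP=> cn. have a0: 0 <= a by have:= H 0; rewrite expr0n /= !mulr0 !addr0.
 have c0: c != 0 by lra. have E: c * (a / - c) = - a by field; rewrite ?oppr_eq0.
 have p0: 0 <= a / - c by rewrite divr_ge0 // oppr_ge0 ltW. have:= H (a / - c + 1); have:= H (- (a / - c + 1)).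
 rewrite !expr2; move: (a / - c) E p0=> k E p0; nra.
case: (eqVneq c 0)=>[c00|cn].
 rewrite c00 mulr0; case: (eqVneq b 0)=>[->|bn]; first by rewrite expr0n.
 have:= H (- (a + 1) / (2 * b)); rewrite c00 mul0r addr0.
 have -> : 2 * b * (- (a + 1) / (2 * b)) = - (a + 1) by field. by lra.
have cp: 0 < c by lra. have:= H (- b / c).
have -> : a + 2 * b * (- b / c) + c * (- b / c) ^+ 2 = (a * c - b ^+ 2) / c by field.
by rewrite pmulr_lge0 ?invr_gt0 // subr_ge0.
Qed.

Lemma dotp_CS d (x y: 'rV[R]_d): dotp x y ^+ 2 <= dotp x x * dotp y y.
apply: quad_discr=> s.
have -> : dotp x x + 2 * dotp x y * s + dotp y y * s ^+ 2 = dotp (x + s *: y) (x + s *: y) by rewrite !dotpE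
(dotpC y x); ring. exact: dotp_ge0.
Qed.

End Dot.

Section Lorentz.
Context {R} {d: nat}.
Local Notation V:= 'rV[R]_d.+1.
Implicit Types X Y Z N T W: V.
(** The Lorentz form with time coordinate 0: [dotp] counts that coordinate with a plus sign, hence
    the factor 2. *)
Definition Q X Y: R:= dotp X Y - 2 * (X 0 0 * Y 0 0).
Definition cone: set V:= [set X | Q X X = 0 /\ 0 < X 0 0].
(** For spacelike [N] the rays of the cap form an open round ball of the sphere of rays, for
    [N = - Y] with [Y] in the cone the complement of one point, and for a past timelike [N] the
    whole sphere. *)
Definition cap N: set V:= [set X | cone X /\ 0 < Q N X].
Definition par X Y:= exists2 t: R, 0 < t & Y = t *: X.

Lemma QC X Y: Q X Y = Q Y X.
by rewrite /Q dotpC (mulrC (X 0 0)). Qed.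

Lemma QDl X Y Z: Q (X + Y) Z = Q X Z + Q Y Z.
by rewrite /Q dotpDl mxE; ring. Qed.

Lemma QZl a X Z: Q (a *: X) Z = a * Q X Z.
by rewrite /Q dotpZl mxE; ring. Qed.

Lemma QDr X Y Z: Q Z (X + Y) = Q Z X + Q Z Y.
by rewrite ![Q Z _]QC QDl. Qed.

Lemma QZr a X Z: Q Z (a *: X) = a * Q Z X.
by rewrite ![Q Z _]QC QZl. Qed.

Lemma QNl X Z: Q (- X) Z = - Q X Z.
by rewrite -scaleN1r QZl mulN1r. Qed.

Lemma QNr X Z: Q Z (- X) = - Q Z X.
by rewrite ![Q Z _]QC QNl. Qed.

Lemma Q0l X: Q 0 X = 0.
by rewrite -(scale0r X) QZl mul0r. Qed.

Lemma Q0r X: Q X 0 = 0.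
by rewrite QC Q0l. Qed.

Definition QE:= (QDl, QDr, QZl, QZr, QNl, QNr, Q0l, Q0r).
Definition sp X Y: R:= dotp X Y - X 0 0 * Y 0 0.

Lemma QspE X Y: Q X Y = sp X Y - X 0 0 * Y 0 0.
by rewrite /Q /sp; ring. Qed.

Lemma sp_ge0 X: 0 <= sp X X.
by rewrite subr_ge0 -expr2 sqr_coord_le. Qed.

Lemma sp_eq0 X: sp X X = 0 -> X = X 0 0 *: e_ 0.
rewrite /sp /dotp (bigD1 ord0) //= addrAC subrr add0r=> s0.
apply/rowP=> j; rewrite !mxE eqxx /=; case: (eqVneq j 0)=>[->|j0]; first by rewrite mulr1.
rewrite mulr0; move/eqP: s0; rewrite psumr_eq0.
 by move=>/allP /(_ j (mem_index_enum _)); rewrite j0 /= mulf_eq0 orbb=>/eqP.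
by move=> i _; rewrite -expr2 sqr_ge0.
Qed.

Lemma sp_CS X Y: sp X Y ^+ 2 <= sp X X * sp Y Y.
apply: quad_discr=> s.
have -> : sp X X + 2 * sp X Y * s + sp Y Y * s ^+ 2 = sp (X + s *: Y) (X + s *: Y) by rewrite /sp !dotpE !mxE
(dotpC Y X); ring. exact: sp_ge0.
Qed.

Lemma ltr_sqr_pos (a b: R): a ^+ 2 < b ^+ 2 -> 0 <= b -> a < b.
by move=> ab b0; rewrite ltNge; apply/negP=> ba; move: ab; rewrite ltNge=>/negP; apply; rewrite ler_sqr ?nnegrE
?(le_trans b0 ba).
Qed.

Lemma ler_sqrp (a b: R): a ^+ 2 <= b ^+ 2 -> 0 <= b -> a <= b.
by move=> ab b0; rewrite leNgt; apply/negP=> ba; move: ab; rewrite leNgt=>/negP; apply; rewrite ltr_sqr ?nnegrE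
?(le_trans b0 (ltW ba)).
Qed.

Lemma Q_lt0 X T: Q X X <= 0 -> 0 < X 0 0 -> Q T T < 0 -> 0 < T 0 0 -> Q X T < 0.
rewrite !QspE=> XX X0 TT T0. have cs:= sp_CS X T; have sX:= sp_ge0 X; have sT:= sp_ge0 T.
rewrite subr_lt0; apply: ltr_sqr_pos; last by pos. apply: (le_lt_trans cs); rewrite exprMn.
have h1: sp X X * sp T T <= X 0 0 ^+ 2 * sp T T by apply: ler_wpM2r=>//; lra.
by apply: (le_lt_trans h1); rewrite ltr_pM2l ?exprn_gt0 //; lra.
Qed.

Lemma Q_le0 X Y: Q X X <= 0 -> 0 < X 0 0 -> Q Y Y <= 0 -> 0 < Y 0 0 -> Q X Y <= 0.
rewrite !QspE=> XX X0 YY Y0. have cs:= sp_CS X Y; have sX:= sp_ge0 X; have sY:= sp_ge0 Y.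
rewrite subr_le0; apply: ler_sqrp; last by pos. apply: (le_trans cs); rewrite exprMn; apply: ler_pM=>//; lra.
Qed.

Lemma sp_orth W T: Q T T < 0 -> Q W T = 0 -> 0 <= Q W W.
rewrite !QspE=> TT WT; have cs:= sp_CS W T; have sW:= sp_ge0 W; have sT:= sp_ge0 T.
have e: sp W T = W 0 0 * T 0 0 by lra. rewrite e exprMn in cs.
have: W 0 0 ^+ 2 * T 0 0 ^+ 2 <= sp W W * T 0 0 ^+ 2.
 apply: (le_trans cs); apply: ler_wpM2l=>//; lra.
by rewrite ler_pM2r //; lra.
Qed.

Lemma sp_orth0 W T: Q T T < 0 -> Q W T = 0 -> Q W W = 0 -> W = 0.
rewrite !QspE=> TT WT WW; have cs:= sp_CS W T; have sW:= sp_ge0 W; have sT:= sp_ge0 T.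
have e: sp W T = W 0 0 * T 0 0 by lra. have e2: sp W W = W 0 0 ^+ 2 by lra. rewrite e exprMn e2 in cs.
have W0: W 0 0 = 0.
 apply/eqP; rewrite -sqrf_eq0; apply: contraT=> Wn. by move: cs; rewrite ler_pM2l //; lra.
by rewrite (@sp_eq0 W) ?W0 ?scale0r // e2 W0 expr0n.
Qed.

Lemma cone_QP X Y: cone X -> cone Y -> Q X Y = 0 -> par X Y.
move=>[XX X0] [YY Y0] XY; exists (Y 0 0 / X 0 0); first exact: divr_gt0. pose D:= Y - (Y 0 0 / X 0 0) *: X.
have D0: D 0 0 = 0 by rewrite !mxE; field; rewrite gt_eqF. have: sp D D = 0.
 have -> : sp D D = Q D D by rewrite QspE D0; ring. by rewrite /D !QE XX YY XY QC XY; ring.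
by move=>/sp_eq0; rewrite D0 scale0r=>/eqP; rewrite subr_eq0=>/eqP.
Qed.

Lemma par_refl X: par X X. by exists 1; rewrite ?scale1r. Qed.

Lemma par_sym X Y: par X Y -> par Y X.
by move=>[t t0 ->]; exists t^-1; rewrite ?invr_gt0 // scalerA mulVf ?gt_eqF // scale1r. Qed.

Lemma par_trans X Y Z: par X Y -> par Y Z -> par X Z.
by move=>[t t0 ->] [s s0 ->]; exists (s * t); rewrite ?mulr_gt0 // scalerA. Qed.

Lemma par_Q X Y N: par X Y -> (0 < Q N Y) = (0 < Q N X).
by move=>[t t0 ->]; rewrite QZr pmulr_rgt0. Qed.

Lemma cone_par X Y: par X Y -> cone X -> cone Y.
by move=>[t t0 ->] [XX X0]; split; [rewrite !QE XX !mulr0|rewrite mxE mulr_gt0]. Qed.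

Lemma cap_par N X Y: par X Y -> cap N X -> cap N Y.
by move=> XY [cX NX]; split; [exact: cone_par XY cX|rewrite (par_Q _ XY)]. Qed.

Lemma cone_Q_le0 X Y: cone X -> cone Y -> Q X Y <= 0.
by move=>[XX X0] [YY Y0]; apply: Q_le0; rewrite ?XX ?YY. Qed.

Lemma coneQ0 X Y: cone X -> cone Y -> ~ par X Y -> Q X Y < 0.
move=> cX cY nXY; rewrite lt_neqAle cone_Q_le0 // andbT; apply/eqP=> e. by apply: nXY; apply: cone_QP.
Qed.

Lemma par_Q0 X Y: cone X -> par X Y -> Q X Y = 0.
by move=>[XX _] [t _ ->]; rewrite QZr XX mulr0. Qed.

Lemma cone_sum X Y: cone X -> cone Y -> ~ par X Y ->
  Q (X + Y) (X + Y) < 0 /\ 0 < (X + Y) 0 0.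
move=> cX cY nXY; have l:= coneQ0 cX cY nXY; case: cX cY=> XX X0 [YY Y0].
by split; [rewrite !QE XX YY QC; move: l; rewrite QC; lra|rewrite mxE addr_gt0].
Qed.

Lemma timelike_fwd Z T: Q Z Z <= 0 -> Q T T < 0 -> 0 < T 0 0 -> Q Z T < 0 -> 0 < Z 0 0.
move=> ZZ TT T0 ZT; rewrite ltNge; apply/negP; rewrite le_eqVlt=>/orP[/eqP Z0|Z0].
 have sZ: sp Z Z = 0 by apply/eqP; rewrite eq_le sp_ge0 andbT; move: ZZ; rewrite QspE Z0; lra.
 by move: ZT; rewrite (sp_eq0 sZ) Z0 scale0r Q0l ltxx.
have:= @Q_lt0 (- Z) T; rewrite !QE opprK mxE oppr_gt0=>/(_ ZZ Z0 TT T0). lra.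
Qed.

(** Under the hypotheses of [npath_cone] this is a null conic, that is, a circle of the sphere of
    rays through [X] and [Y]; the choice of [W] selects the circle. *)
Definition npath X W Y (t: R):= (1 - t) ^+ 2 *: X + (t * (1 - t)) *: W + t ^+ 2 *: Y.

Lemma npath_cone X W Y t: cone X -> cone Y -> ~ par X Y -> Q W X = 0 -> Q W Y = 0 ->
  Q W W = - 2 * Q X Y -> cone (npath X W Y t).
move=> cX cY nXY WX WY WW; have [TT T0]:= cone_sum cX cY nXY.
have lt:= coneQ0 cX cY nXY; move: (cX) (cY)=>[XX _] [YY _].
have ZZ: Q (npath X W Y t) (npath X W Y t) = 0 by rewrite /npath !QE XX YY WW WX WY (QC X W) (QC Y W) (QC Y X)
WX WY; ring. split=>//; apply: (@timelike_fwd _ (X + Y))=>//; first by rewrite ZZ.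
rewrite /npath !QE XX YY WX WY (QC Y X). rewrite [ltLHS](_: _ = ((1 - t) ^+ 2 + t ^+ 2) * Q X Y); last by ring.
by rewrite pmulr_rlt0 //; nra.
Qed.

(** Three linear conditions on at least four unknowns leave a nonzero solution. *)
Lemma exists_orth3 (A B D: V): (3 <= d)%N ->
  exists W, [/\ W != 0, Q W A = 0, Q W B = 0 & Q W D = 0].
move=> d3. pose m (Y: V): 'cV[R]_d.+1:= Y^T - (2 * Y 0 0) *: delta_mx 0 0.
have mE X Y: (X *m m Y) 0 0 = Q X Y.
 rewrite mulmxBr -scalemxAr !mxE /Q /dotp; congr (_ - _).
  by apply: eq_bigr=> i _; rewrite !mxE.
 rewrite (bigD1 ord0) //= big1 ?addr0; last by move=> i i0; rewrite !mxE (negPf i0) mulr0.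
 by rewrite !mxE eqxx mulr1; ring.
pose M: 'M[R]_(d.+1, 1 + (1 + 1)):= row_mx (m A) (row_mx (m B) (m D)). have rk: (0 < \rank (kermx M))%N.
 rewrite mxrank_ker subn_gt0; apply: leq_ltn_trans (rank_leq_col M) _. by [].
have [W /sub_kermxP WM Wn]: exists2 W: V, (W <= kermx M)%MS & W != 0.
 exists (nz_row (kermx M)); first exact: nz_row_sub. by rewrite nz_row_eq0 -mxrank_eq0 -lt0n.
move: WM; rewrite /M mul_mx_row mul_mx_row=>/eqP; rewrite row_mx_eq0 row_mx_eq0.
move=>/and3P[/eqP a /eqP b /eqP c]; exists W; split=>//.
- by rewrite -mE a mxE.
- by rewrite -mE b mxE.
- by rewrite -mE c mxE.
Qed.

End Lorentz.

Section Norm.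
Context {R}.

Lemma sqr_le_dotp d (x: 'rV[R]_d): `|x| ^+ 2 <= dotp x x.
case: (eqVneq (mx_norm x) 0)=>[x0|/mx_norm_neq0 [[i j] /= e]].
 by rewrite [`|x|]x0 expr0n dotp_ge0.
by rewrite [`|x|]e ord1 real_normK ?num_real // sqr_coord_le.
Qed.

Lemma coord_le d (x: 'rV[R]_d) i: `|x 0 i| <= `|x|.
rewrite [`|x|]mx_normrE; apply: (@le_bigmax _ _ _ _ (fun ij=> `|x ij.1 ij.2|) (0, i)).
Qed.

Lemma dotp_le_sqr_norm d (x: 'rV[R]_d): dotp x x <= d%:R * `|x| ^+ 2.
have -> : d%:R * `|x| ^+ 2 = \sum_(i < d) `|x| ^+ 2 by rewrite sumr_const card_ord mulr_natl.
apply: ler_sum=> i _. by rewrite -expr2 -real_normK ?num_real // ler_sqr ?nnegrE // coord_le.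
Qed.

Lemma coordC d (i: 'I_d): continuous (fun x: 'rV[R]_d => x 0 i).
exact: coord_continuous. Qed.

Lemma cvg_bigsum (T: Type) (F: set_system T) {FF: Filter F} (I: Type) (r: seq I) (f: I -> T -> R) (l: I -> R) :
  (forall i, f i x @[x --> F] --> l i) ->
  \sum_(i <- r) f i x @[x --> F] --> \sum_(i <- r) l i.
move=> H; elim: r=>[|a r IH].
 rewrite big_nil; under eq_fun do rewrite big_nil; exact: cvg_cst.
by rewrite big_cons; under eq_fun do rewrite big_cons; apply: cvgD.
Qed.

Lemma dotp_cont d (N: 'rV[R]_d): continuous (dotp N).
move=> x; apply: (@cvg_bigsum _ (nbhs x) _)=> i. by apply: cvgM; [exact: cvg_cst|exact: coordC].
Qed.

Lemma dotp2_cont d: continuous (fun x: 'rV[R]_d => dotp x x).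
move=> x; apply: (@cvg_bigsum _ (nbhs x) _)=> i. by apply: cvgM; exact: coordC.
Qed.

Lemma Q_cont d (N: 'rV[R]_d.+1): continuous (Q N).
move=> x; have h: dotp N y @[y --> x] --> dotp N x:= @dotp_cont _ N x. apply: (cvgB h).
by apply: cvgM; [exact: cvg_cst|apply: cvgM; [exact: cvg_cst|exact: coordC]].
Qed.

Lemma Q2_cont d: continuous (fun x: 'rV[R]_d.+1 => Q x x).
move=> x; have h: dotp y y @[y --> x] --> dotp x x:= @dotp2_cont _ x. apply: (cvgB h).
by apply: cvgM; [exact: cvg_cst|apply: cvgM; exact: coordC].
Qed.

End Norm.

(** * Caps, Lorentz maps and reflections *)

Section Caps.
Context {R} {d: nat}.
Local Notation V:= 'rV[R]_d.+1.
Implicit Types X Y Z N T W: V.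

Lemma Qe0 Z: Q (e_ 0) Z = - Z 0 0.
rewrite /Q /dotp (bigD1 ord0) //= big1 ?addr0=>[|i i0]; last by rewrite !mxE (negPf i0) mul0r.
by rewrite /e_ -[ord0]/(0: 'I_d.+1) !mxE !eqxx /=; ring.
Qed.

Lemma cap_nbhs X (O: set V): cone X -> nbhs X O ->
  exists N, cap N X /\ forall Z, cap N Z -> O ((X 0 0 / Z 0 0) *: Z).
move=>[XX X0] /nbhs_ballP [eps /= e0 HO]. have s0: 0 < eps ^+ 2 / (2 * X 0 0) by pos.
(* For a null [Z'] of the same height as [X], the squared Euclidean distance is [- 2 * Q X Z'], and
   the coefficient makes [0 < Q N Z'] say that this is less than [eps ^+ 2]. *)
exists (X - (eps ^+ 2 / (2 * X 0 0)) *: e_ 0); split.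
 by split=>//; rewrite !QE Qe0 XX; rewrite mulrN opprK add0r mulr_gt0.
move=> Z [[ZZ Z0]]; rewrite !QE Qe0 mulrN opprK=> NZ. apply: HO; rewrite -ball_normE /=; set Z': V:= _ *: Z.
have Z'0: Z' 0 0 = X 0 0 by rewrite !mxE divfK ?gt_eqF. have Z'Z': Q Z' Z' = 0 by rewrite !QE ZZ !mulr0.
have XZ': Q X Z' = X 0 0 / Z 0 0 * Q X Z by rewrite QZr. clearbody Z'. apply: ltr_sqr_pos; last exact: ltW.
apply: le_lt_trans (sqr_le_dotp _) _.
have -> : dotp (X - Z') (X - Z') = Q (X - Z') (X - Z') by rewrite /Q mxE [(- Z') 0 0]mxE Z'0 subrr mulr0 mulr0 subr0.
rewrite !QE XX Z'Z' (QC Z' X). rewrite XZ'.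
have: 0 < X 0 0 / Z 0 0 * (Q X Z + eps ^+ 2 / (2 * X 0 0) * Z 0 0) by pos.
rewrite mulrDr (_: X 0 0 / Z 0 0 * (eps ^+ 2 / (2 * X 0 0) * Z 0 0) = eps ^+ 2 / 2); last first.
 by field; rewrite !gt_eqF.
by lra.
Qed.

Lemma cap_open N X: 0 < Q N X -> nbhs X [set Z | 0 < Q N Z].
move=> NX; apply: (@Q_cont _ _ N X [set r | 0 < r]). exact: lt_nbhsr.
Qed.

Lemma capI X N1 N2: cap N1 X -> cap N2 X ->
  exists N, cap N X /\ forall Z, cap N Z -> cap N1 Z /\ cap N2 Z.
move=>[cX h1] [_ h2]. have [N [NX HN]]:= cap_nbhs cX (filterI (cap_open h1) (cap_open h2)).
exists N; split=>// Z NZ; have [/= a b]:= HN _ NZ; move: a b; case: NZ=> cZ _.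
have k0: 0 < X 0 0 / Z 0 0 by case: cX cZ=> _ X0 [_ Z0]; exact: divr_gt0.
by rewrite !QZr !(pmulr_rgt0 _ k0)=> a b.
Qed.

Lemma cap_ex X: cone X -> exists N, cap N X.
by move=> cX; have [N [NX _]]:= cap_nbhs cX filterT; exists N. Qed.

Lemma cone_cap_all N X Y: cone X -> cone Y -> ~ par X Y -> cap (- X) Y.
by move=> cX cY n; split=>//; rewrite QNl oppr_gt0 coneQ0. Qed.

Definition lor (L: 'M[R]_d.+1) :=
  (forall X Y, Q (X *m L) (Y *m L) = Q X Y) /\ forall X, cone X -> cone (X *m L).

Lemma lor1: lor 1%:M.
by split=>[X Y|X]; rewrite ?mulmx1. Qed.

Lemma lorM L1 L2: lor L1 -> lor L2 -> lor (L1 *m L2).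
by move=>[q1 c1] [q2 c2]; split=>[X Y|X /c1 /c2]; rewrite !mulmxA // q2 q1.
Qed.

Definition qeta: 'M[R]_d.+1:= 1%:M - 2 *: delta_mx 0 0.

Lemma QmxE X Y: Q X Y = (X *m qeta *m Y^T) 0 0.
rewrite /qeta mulmxBr mulmx1 mulmxBl -scalemxAr -scalemxAl !mxE /Q /dotp.
congr (_ - _); first by apply: eq_bigr=> i _; rewrite !mxE. rewrite (bigD1 ord0) //= big1 ?addr0=>[|i i0].
 rewrite !mxE (bigD1 ord0) //= big1 ?addr0=>[|i i0]; first by rewrite !mxE !eqxx mulr1.
 by rewrite !mxE (negPf i0) mulr0.
rewrite !mxE big1 ?mul0r // => j _; by rewrite !mxE (negPf i0) andbF mulr0.
Qed.

Lemma qetaK: qeta *m qeta = 1%:M.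
rewrite /qeta mulmxBr mulmx1 mulmxBl mul1mx -scalemxAr -scalemxAl mul_delta_mx.
by apply/matrixP=> i j; rewrite !mxE; ring.
Qed.

Lemma Q_nondeg (A B: 'M[R]_d.+1) :
  (forall X Y, (X *m A *m Y^T) 0 0 = (X *m B *m Y^T) 0 0) -> A = B.
move=> H; apply/matrixP=> i j; have:= H (delta_mx 0 i) (delta_mx 0 j). by rewrite -!rowE trmx_delta -!colE !mxE.
Qed.

(** The inverse is the adjoint [qeta *m L^T *m qeta]. It keeps the cone forward: a backward preimage
    would be the negative of a cone vector, which [L] maps forward. *)
Lemma lor_inv L: lor L -> exists L', [/\ lor L', L *m L' = 1%:M & L' *m L = 1%:M].
move=>[q c]; have LL: L *m qeta *m L^T = qeta.
 by apply: Q_nondeg=> X Y; rewrite -QmxE -q QmxE trmx_mul !mulmxA.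
have L1: L *m (qeta *m L^T *m qeta) = 1%:M by rewrite !mulmxA LL qetaK.
have L2:= mulmx1C L1; exists (qeta *m L^T *m qeta); split=>//; set L':= _ *m qeta in L1 L2 *; clearbody L'.
have q' X Y: Q (X *m L') (Y *m L') = Q X Y by rewrite -[LHS]q -!mulmxA L2 !mulmx1.
split=>// X [XX X0]; have Y0: Q (X *m L') (X *m L') = 0 by rewrite q'.
split=>//; rewrite ltNge; apply/negP=> Yn. have Yz: X *m L' <> 0.
 move=> e; have: X *m L' *m L = 0 by rewrite e mul0mx.
 by rewrite -mulmxA L2 mulmx1=> X00; move: X0; rewrite X00 mxE ltxx.
move: Yn; rewrite le_eqVlt=>/orP[/eqP Yn|Yn].
 by apply: Yz; rewrite (@sp_eq0 _ _ (X *m L')) ?Yn ?scale0r //; move: Y0; rewrite QspE Yn mulr0 subr0.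
have []:= c (- (X *m L')); first by split; [rewrite !QE Y0 !oppr0|rewrite mxE oppr_gt0].
by move=> _; rewrite mulNmx -mulmxA L2 mulmx1 mxE oppr_gt0; apply/negP; rewrite -leNgt ltW.
Qed.

Lemma lor_par (L: 'M[R]_d.+1) (X Y: V): par X Y -> par (X *m L) (Y *m L).
by move=>[t t0 ->]; exists t; rewrite // scalemxAl. Qed.

Lemma lor_capE (L L': 'M[R]_d.+1) N X: lor L -> L *m L' = 1%:M -> lor L' -> Q N (X *m L) = Q (N *m L') X.
by move=>[q _] LL' [q' _]; rewrite -q' -mulmxA LL' mulmx1. Qed.

Definition refl N: 'M[R]_d.+1:= 1%:M - 2 *: (qeta *m N^T *m N).

Lemma reflE N X: X *m refl N = X - (2 * Q N X) *: N.
rewrite /refl mulmxBr mulmx1 -scalemxAr !mulmxA.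
have -> : X *m qeta *m N^T = (Q N X)%:M by apply/matrixP=> i j; rewrite !ord1 QC QmxE !mxE eqxx mulr1n.
by rewrite mul_scalar_mx scalerA.
Qed.

Lemma Q_refl N X Y: Q N N = 1 -> Q (X *m refl N) (Y *m refl N) = Q X Y.
by move=> NN; rewrite !reflE !QE NN (QC X N); ring. Qed.

Lemma reflK N: Q N N = 1 -> refl N *m refl N = 1%:M.
move=> NN; apply: Q_nondeg=> X Y; congr ((_ *m _) 0 0); rewrite !mulmxA mulmx1 !reflE !QE NN.
by apply/matrixP=> i j; rewrite !mxE; ring.
Qed.

Lemma lor_refl N: Q N N = 1 -> lor (refl N).
move=> NN; split=>[X Y|X cX]; first exact: Q_refl. have [XX X0]:= cX; set Y:= X *m refl N.
have YY: Q Y Y = 0 by rewrite Q_refl. have YX: Q Y X = - 2 * Q N X ^+ 2 by rewrite /Y reflE !QE XX; ring.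
have Yn: Y <> 0.
 move=> e; have: Y *m refl N = 0 by rewrite e mul0mx.
 by rewrite /Y -mulmxA reflK // mulmx1=> X00; move: X0; rewrite X00 mxE ltxx.
split=>//; rewrite ltNge; apply/negP; rewrite le_eqVlt=>/orP[/eqP Y0|Y0].
 by apply: Yn; rewrite (@sp_eq0 _ _ Y) ?Y0 ?scale0r //; move: YY; rewrite QspE Y0 mulr0 subr0.
have cY: cone (- Y) by split; [rewrite !QE YY !oppr0|rewrite mxE oppr_gt0].
have:= cone_Q_le0 cY cX; rewrite QNl YX=> h.
have N0: Q N X = 0 by apply/eqP; rewrite -sqrf_eq0 eq_le sqr_ge0 andbT; lra.
by move: Y0; rewrite /Y reflE N0 mulr0 scale0r subr0; apply/negP; rewrite -leNgt ltW.
Qed.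

End Caps.

(** * Lorentz maps are determined by their rays over a cap *)

Section Rigid.
Context {R} {d: nat}.
Local Notation V:= 'rV[R]_d.+1.
Implicit Types (X Y Z N T W: V) (L: 'M[R]_d.+1).
Context (d3: (3 <= d)%N).

(** With [W] orthogonal to [A], the value of [Q A] along the path combines its end values with
    weights [(1 - t) ^+ 2] and [t ^+ 2], and the sign of [W] is chosen so that the middle term helps
    for [B]. Hence two caps containing both ends contain the whole path: intersections of two caps
    are connected. *)
Lemma npath_ex2 X Y A B: cone X -> cone Y -> ~ par X Y ->
  exists W, [/\ Q W X = 0, Q W Y = 0, Q W W = - 2 * Q X Y, Q A W = 0 & 0 <= Q B W].
move=> cX cY nXY; have [W0 [Wn WX WY WA]]:= exists_orth3 X Y A d3.
have [TT T0]:= cone_sum cX cY nXY; have lt:= coneQ0 cX cY nXY.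
have WT: Q W0 (X + Y) = 0 by rewrite QDr WX WY addr0. have WW: 0 < Q W0 W0.
 rewrite lt_neqAle (sp_orth TT WT) andbT; apply/eqP=> e. by have:= sp_orth0 TT WT (esym e); apply/eqP.
set k:= Num.sqrt (- 2 * Q X Y / Q W0 W0).
have k2: k ^+ 2 = - 2 * Q X Y / Q W0 W0 by rewrite sqr_sqrtr // divr_ge0 ?ltW //; lra.
have kk: k * (k * Q W0 W0) = - 2 * Q X Y by rewrite mulrA -expr2 k2 divfK ?gt_eqF.
have [W [WX' WY' WW' AW]]: exists W, [/\ Q W X = 0, Q W Y = 0, Q W W = - 2 * Q X Y & Q A W = 0] by exists (k
*: W0); rewrite !QE WX WY (QC A) WA kk !mulr0. case: (lerP 0 (Q B W))=> s; first by exists W.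
by exists (- W); rewrite !QE WX' WY' WW' AW !oppr0 opprK; split=>//; rewrite oppr_ge0 ltW.
Qed.

Lemma npath_cont X W Y N: continuous (fun t => Q N (npath X W Y t)).
move=> t; rewrite (_: (fun t=> _) = (fun t: R=> (1 - t) ^+ 2 * Q N X + t * (1 - t) * Q N W + t ^+ 2 * Q N Y)).
 by apply: cvgD; [apply: cvgD|]; apply: cvgM; try exact: cvg_cst; try exact: exprn_continuous; [apply:
 (@cvg_comp _ _ _ (fun t=> 1 - t) (fun x=> x ^+ 2) _ (nbhs (1 - t))); [apply: cvgB; [exact: cvg_cst|exact:
 cvg_id]|exact: exprn_continuous] |apply: cvgM; [exact: cvg_id|apply: cvgB; [exact: cvg_cst|exact: cvg_id]]].
by apply: funext=> s; rewrite /npath !QE.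
Qed.

Lemma npath0 X W Y: npath X W Y 0 = X.
by rewrite /npath subr0 expr1n scale1r mul0r scale0r expr0n scale0r !addr0. Qed.

Lemma npath1 X W Y: npath X W Y 1 = Y.
by rewrite /npath subrr mulr0 expr0n !scale0r expr1n scale1r !add0r. Qed.

Lemma npath_Q X W Y s t: Q X X = 0 -> Q Y Y = 0 -> Q W X = 0 -> Q W Y = 0 ->
  Q W W = - 2 * Q X Y -> Q (npath X W Y s) (npath X W Y t) = Q X Y * (t - s) ^+ 2.
move=> XX YY WX WY WW. by rewrite /npath !QE XX YY WW WX WY (QC X W) (QC Y W) (QC Y X) WX WY; ring.
Qed.

(** The null vectors [e_ 0 + e_ i] and [e_ 0 - e_ i] span the space. *)
Lemma cone_fix L: (forall Y, cone Y -> Y *m L = Y) -> L = 1%:M.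
move=> H; have c0 (i: 'I_d.+1): i != 0 -> cone (e_ 0 + e_ i: V) /\ cone (e_ 0 - e_ i: V).
 move=> i0; have e0i: (e_ 0: V) 0 i = 0 by rewrite mxE (negPf i0) andbF.
 have ei0: (e_ i: V) 0 0 = 0 by rewrite mxE (negPf (_: 0 != i)) ?andbF // eq_sym.
 have e00: (e_ 0: V) 0 0 = 1 by rewrite mxE !eqxx. have eii: Q (e_ i) (e_ i: V) = 1.
  rewrite /Q ei0 /dotp (bigD1 i) //= big1=>[|j ji]; last by rewrite mxE (negPf ji) andbF mul0r.
  by rewrite mxE !eqxx /=; ring.
 have q0: Q (e_ 0) (e_ 0: V) = -1 by rewrite Qe0 e00.
 have qi: Q (e_ 0) (e_ i: V) = 0 by rewrite Qe0 ei0 oppr0. have qi': Q (e_ i) (e_ 0: V) = 0 by rewrite QC.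
 split; split; rewrite ?QE ?eii ?q0 ?qi ?qi'; try by ring.
  by rewrite mxE e00 ei0 addr0 ltr01.
 by rewrite mxE [X in _ + X]mxE e00 ei0 subr0 ltr01.
have f0: (e_ 0: V) *m L = e_ 0.
 have i1: (ord_max: 'I_d.+1) != 0 by rewrite -val_eqE /= -lt0n; apply: leq_trans d3.
 have [/H a /H b]:= c0 _ i1.
 have: (e_ 0 + e_ ord_max: V) *m L + (e_ 0 - e_ ord_max: V) *m L = (e_ 0 + e_ ord_max) + (e_ 0 - e_ ord_max)
 by rewrite a b. rewrite -mulmxDl addrACA subrr addr0 -mulr2n -scaler_nat -scalemxAl=>/scalerI; apply. by [].
apply/row_matrixP=> i; rewrite !rowE mulmx1; change ((e_ i: V) *m L = e_ i).
case: (eqVneq i 0)=>[->//|i0]; have [/H a _]:= c0 _ i0. by move: a; rewrite mulmxDl f0=>/addrI.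
Qed.

Lemma mulmx_cont L j: continuous (fun Y: V => (Y *m L) 0 j).
move=> Y; rewrite (_: (fun Y=> _) = (fun Y: V=> \sum_i Y 0 i * L i j)); last first.
 by apply: funext=> Z; rewrite mxE.
apply: (@cvg_bigsum _ _ (nbhs Y) _)=> i. by apply: cvgM; [exact: coordC|exact: cvg_cst].
Qed.

(** Along a null path inside the cap the map multiplies each point by a factor. Two distinct points
    have nonzero [Q], which is preserved, so any two factors are inverse to each other, and three
    points force all factors to be 1. *)
Lemma rigid1 L X N: lor L -> cap N X -> (forall Z, cap N Z -> par Z (Z *m L)) -> L = 1%:M.
move=> lL NX H; have cX:= NX.1; apply: cone_fix. suff fixY Y: cone Y -> ~ par X Y -> X *m L = X /\ Y *m L = Y.
 move=> Y cY; case: (pselect (par X Y))=>[[t t0 ->]|/(fixY _ cY)[]//]. rewrite -scalemxAl; congr (_ *: _).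
 (* A ray parallel to [X] needs a second ray: the null vector with the spatial part of [X]
    reversed. *)
 have cX': cone (2 * X 0 0 *: e_ 0 - X).
  case: cX=> XX X0; split; last by rewrite !mxE !eqxx /= mulr1; lra.
  by rewrite !QE (QC _ (e_ 0)) XX !Qe0 mxE !eqxx /=; ring.
 have [] // := fixY _ cX'; move=> p; have:= par_Q0 cX p.
 by rewrite !QE (QC _ (e_ 0)) Qe0 cX.1; case: cX=> _ X0; nra.
move=> cY nXY; have [W [WX WY WW NW _]]:= @npath_ex2 X Y N 0 cX cY nXY.
have Pc t:= @npath_cone _ _ X W Y t cX cY nXY WX WY WW.
have [[XX _] [YY _]]:= (cX, cY); have PQ s t:= @npath_Q X W Y s t XX YY WX WY WW. have q0:= coneQ0 cX cY nXY.
have [eps e0 He]: exists2 eps: R, 0 < eps & forall t, 0 <= t <= eps -> cap N (npath X W Y t).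
 have: \forall t \near (0: R), 0 < Q N (npath X W Y t) by apply: (@npath_cont X W Y N 0 [set r | 0 < r]);
 apply: lt_nbhsr; rewrite npath0; case: NX. move=>/nbhs_ballP [e /= e0 He]; exists (e / 2); first by pos.
 move=> t /andP[t0 te]; split=>//; apply: He; rewrite /ball /= sub0r normrN ger0_norm //; lra.
have fixt t: 0 <= t <= eps -> npath X W Y t *m L = npath X W Y t.
 move=> te; have HP s: 0 <= s <= eps -> exists2 a, 0 < a & npath X W Y s *m L = a *: npath X W Y s.
  by move=>/He /H [a a0 ->]; exists a.
 have two s r a b: s != r -> npath X W Y s *m L = a *: npath X W Y s -> npath X W Y r *m L = b *: npath X W Y
 r -> a * b = 1.
  move=> sr e1 e2; have:= lL.1 (npath X W Y s) (npath X W Y r).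
  rewrite e1 e2 QZl QZr PQ; set q:= _ * _ ^+ 2=> e.
  have qn: q != 0 by apply: mulf_neq0; [rewrite lt_eqF|rewrite expf_neq0 // subr_eq0 eq_sym].
  by apply: (mulIf qn); rewrite mul1r -mulrA e.
 have [s [r [sI rI st rt sr]]]: exists s r, [/\ 0 <= s <= eps, 0 <= r <= eps, t != s, t != r & s != r].
  case: (eqVneq t 0)=>[->|t0].
   by exists (eps / 2), eps; split; [lra|lra| | |]; rewrite lt_eqF //; lra.
  case: (eqVneq t eps)=>[->|t1].
   by exists 0, (eps / 2); split; [lra|lra| | |]; first [by rewrite gt_eqF //; lra|by rewrite lt_eqF //; lra].
  by exists 0, eps; split=>//; rewrite ?lexx ?ltW //= lt_eqF.
 have [a a0 ea]:= HP t te; have [b b0 eb]:= HP s sI; have [c c0 ec]:= HP r rI.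
 have ab:= two _ _ _ _ st ea eb; have ac:= two _ _ _ _ rt ea ec; have bc:= two _ _ _ _ sr eb ec.
 have -> : npath X W Y t *m L = a *: npath X W Y t by []. have an: a != 0 by pos.
 have bc': b = c by apply: (mulfI an); rewrite ab ac.
 have b1: b = 1 by apply/eqP; rewrite -(@eqrXn2 _ 2) ?ltW // expr1n expr2 {2}bc' bc.
 by move: ab; rewrite b1 mulr1=>->; rewrite scale1r.
have fX: X *m L = X by have:= fixt 0; rewrite npath0 lexx ltW //; apply. split=>//.
(* Once [X] is fixed, dividing the fixed path points by [t] leaves the fixed vectors
   [(1 - t) W + t Y]; two of them determine [Y]. *)
have fU t: 0 < t <= eps -> ((1 - t) *: W + t *: Y) *m L = (1 - t) *: W + t *: Y.
 move=>/andP[t0 te]; have:= fixt t; rewrite (ltW t0) te=>/(_ isT).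
 rewrite /npath !mulmxDl -!scalemxAl fX -!addrA=>/addrI.
 rewrite -[(t * (1 - t)) *: _]scalerA -[(t * (1 - t)) *: W]scalerA expr2 -!scalerA -!scalerDr.
 by move=>/(scalerI (_: t != 0)); rewrite gt_eqF // =>/(_ isT).
have:= fU eps; have:= fU (eps / 2); rewrite e0 lexx divr_gt0 //=. have -> : eps / 2 <= eps by lra.
move=>/(_ isT) u1 /(_ isT) u2.
have YU: (eps / 2) *: Y = (1 - eps / 2) *: ((1 - eps) *: W + eps *: Y) - (1 - eps) *: ((1 - eps / 2) *: W +
(eps / 2) *: Y) by apply/rowP=> i; rewrite !mxE; field.
have: (eps / 2) *: (Y *m L) = (eps / 2) *: Y by rewrite scalemxAl YU mulmxBl -!scalemxAl u1 u2.
by move=>/(scalerI (_: eps / 2 != 0)); rewrite gt_eqF ?divr_gt0 // =>/(_ isT).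
Qed.

Lemma rigid L1 L2 X N: lor L1 -> lor L2 -> cap N X ->
  (forall Z, cap N Z -> par (Z *m L1) (Z *m L2)) -> L1 = L2.
move=> l1 l2 NX H; have [L1' [l1' L11 L1'1]]:= lor_inv l1.
suff: L2 *m L1' = 1%:M by move=> e; rewrite -[L2]mulmx1 -L1'1 mulmxA e mul1mx.
apply: (rigid1 (lorM l2 l1') NX)=> Z /H /(lor_par L1'). by rewrite -!mulmxA L11 mulmx1.
Qed.

(** If the first alternative fails at one ray [Z], then [Q (Z *m L1) (Z *m L2) < 0] there, which is
    an open condition; on a smaller cap only the second alternative remains and [rigid] applies. *)
Lemma rigid2 L1 L2 L3 X N: lor L1 -> lor L2 -> lor L3 -> cap N X ->
  (forall Z, cap N Z -> par (Z *m L1) (Z *m L2) \/ par (Z *m L1) (Z *m L3)) ->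
  L1 = L2 \/ L1 = L3.
move=> l1 l2 l3 NX H. case: (pselect (forall Z, cap N Z -> par (Z *m L1) (Z *m L2)))=>[H2|].
 by left; apply: rigid NX H2.
move=>/existsNP [Z /not_implyP [NZ nZ]]; right. have c1:= l1.2 _ NZ.1; have c2:= l2.2 _ NZ.1.
have lt0:= coneQ0 c1 c2 nZ. have: nbhs Z [set Y | Q (Y *m L1) (Y *m L2) < 0].
 have cm: {for Z, continuous (fun Y=> Q (Y *m L1) (Y *m L2))}.
  have cj L j: (Y *m L) 0 j @[Y --> Z] --> (Z *m L) 0 j by exact: mulmx_cont.
  apply: (@cvgB _ _ _ (nbhs Z) _ (fun Y=> dotp (Y *m L1) (Y *m L2)) (fun Y=> 2 * ((Y *m L1) 0 0 * (Y *m L2) 0 0))).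
   by apply: (@cvg_bigsum _ _ (nbhs Z) _)=> j; apply: cvgM; exact: cj.
  by apply: cvgM; [exact: cvg_cst|apply: cvgM; exact: cj].
 exact: cm (lt_nbhsl lt0).
move=>/(cap_nbhs NZ.1) [N' [N'Z HN']]. have [N2 [N2Z HN2]]:= capI NZ N'Z.
apply: (rigid l1 l3 N2Z)=> Y N2Y; have [NY N'Y]:= HN2 _ N2Y.
case: (H _ NY)=>// p; have:= HN' _ N'Y; rewrite /= -!scalemxAl !QE.
by rewrite (par_Q0 (l1.2 _ NY.1) p) !mulr0 ltxx.
Qed.

End Rigid.

(** * Compactness and Gordan's alternative *)

Section Compactness.
Context {R}.

Lemma dotp_compact d (A: set 'rV[R]_d) (B: R) :
  closed A -> (forall x, A x -> dotp x x <= B) -> compact A.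
move=> cA HB; apply: bounded_closed_compact=>//. exists (1 + `|B|); split; first by [].
move=> M BM x Ax /=; have B1: B <= `|B| by exact: ler_norm. have M0: 0 <= M by have:= normr_ge0 B; lra.
apply: ler_sqrp=>//; apply: (le_trans (sqr_le_dotp x)).
apply: (le_trans (HB _ Ax)); have:= normr_ge0 B; rewrite expr2; nra.
Qed.

Lemma closedLE (T: topologicalType) (f: T -> R) (a: R) :
  continuous f -> closed [set x | f x <= a].
by move=> cf; apply: (@closed_comp _ _ f [set r | r <= a]); [move=> x _; exact: cf|exact: closed_le]. Qed.

Lemma closedGE (T: topologicalType) (f: T -> R) (a: R) :
  continuous f -> closed [set x | a <= f x].
by move=> cf; apply: (@closed_comp _ _ f [set r | a <= r]); [move=> x _; exact: cf|exact: closed_ge]. Qed.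

Lemma closedEQ (T: topologicalType) (f: T -> R) (a: R) :
  continuous f -> closed [set x | f x = a].
move=> cf; rewrite (_: [set _ | _] = [set x | f x <= a] `&` [set x | a <= f x]).
 by apply: closedI; [exact: closedLE|exact: closedGE].
by apply/seteqP; split=> x /= =>[->//|[a1 a2]]; apply/eqP; rewrite eq_le a1 a2.
Qed.

Lemma closedA (T: topologicalType) (I: Type) (P: I -> T -> Prop) :
  (forall i, closed [set x | P i x]) -> closed [set x | forall i, P i x].
move=> H; rewrite (_: [set _ | _] = \bigcap_(i in [set: I]) [set x | P i x]).
 by apply: closed_bigI=> i _.
by apply/seteqP; split=> x /= Hx i; [move=> _|]; exact: Hx.
Qed.

Lemma closed_imply (T: topologicalType) (P: Prop) (B: set T) :
  closed B -> closed [set x | P -> B x].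
move=> cB; case: (pselect P)=> p.
 by rewrite (_: [set _ | _] = B) //; apply/seteqP; split=> x //= Hx; exact: Hx.
by rewrite (_: [set _ | _] = setT); [exact: closedT|apply/seteqP; split=> x //= _ /p].
Qed.

Lemma seq_cluster (T: topologicalType) (A: set T) (u: nat -> T) :
  compact A -> (forall n, A (u n)) -> exists2 x, A x &
  forall C: set T, closed C -> (exists N, forall n, (N <= n)%N -> C (u n)) -> C x.
move=> cA Au; have FA: (u @ \oo) A by exists 0%N=>// n _; exact: Au. have [x [Ax clx]]:= cA (u @ \oo) _ FA.
exists x=>// C cC [N HN]; apply: cC=> B nB. by apply: clx=>//; exists N=>// n /= /HN.
Qed.

Lemma mul_rowT d (x y: 'rV[R]_d): x *m y^T = (dotp x y)%:M.
apply/matrixP=> i j; rewrite !ord1 [LHS]mxE [RHS]mxE eqxx. by apply: eq_bigr=> b _; rewrite [(_^T) b 0]mxE.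
Qed.

Lemma dotp_mul n d (A: 'M[R]_(n, d)) (w: 'rV[R]_n) k: dotp (w *m A) k = dotp w (k *m A^T).
have e r (x y: 'rV[R]_r): dotp x y = (x *m y^T) 0 0 by rewrite mul_rowT mxE eqxx.
by rewrite !e trmx_mul trmxK mulmxA.
Qed.

(* Induction on the codimension [n] of the span of the orthonormal rows of [A], which are orthogonal to [K]: a unit
vector nonpositive on [K] becomes a new row, and [K] is replaced by its face orthogonal to that vector. *)
Lemma gordan_orth n d r (K: set 'rV[R]_d) (A: 'M[R]_(r, d)): (r + n)%N = d -> compact K ->
  A *m A^T = 1%:M -> (forall k, K k -> k *m A^T = 0 /\ k != 0) ->
  (exists z delta, 0 < delta /\ forall k, K k -> delta <= dotp z k) \/
  (exists2 z, z != 0 & forall nu s, (forall k, K k -> dotp nu k <= s) -> `|dotp nu z| <= s).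
elim: n r K A=>[|n IH] r K A rd cK AA HK; have [[k0 Kk0]|nK]:= pselect (exists k, K k); try by left; exists 0,
1; split=>// k Kk; case: nK; exists k.
 rewrite addn0 in rd; move: rd K A cK AA HK k0 Kk0; case: _ / => K A _ AA HK k0 /HK [kA].
 by rewrite -[k0]mulmx1 -(mulmx1C AA) mulmxA kA mul0mx eqxx.
pose S:= [set v: 'rV[R]_d | v *m A^T = 0 /\ dotp v v = 1].
have unitS v: v *m A^T = 0 -> v != 0 -> exists2 a, 0 < a & S (a^-1 *: v) /\ a ^+ 2 = dotp v v.
 move=> vA /dotp_gt0 v0; exists (Num.sqrt (dotp v v)); rewrite ?sqrtr_gt0 // sqr_sqrtr ?ltW //; split=>//.
 split; first by rewrite -scalemxAl vA scaler0.
 by rewrite dotpZl dotpZr mulrA -invfM -expr2 sqr_sqrtr ?ltW // mulVf // gt_eqF.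
have [kA k0n]:= HK _ Kk0.
(* [S] is the unit sphere orthogonal to the rows of [A]. Either the support function of [K] stays
   above some [c > 0] on it, so that every vector of length [c] in that subspace obeys the linear
   inequalities valid on [K], or a limit of almost separating unit vectors is nonpositive on [K]. *)
have [[c c0 Hc]|nc]:= pselect (exists2 c, 0 < c & forall v, S v -> exists2 k, K k & c < dotp v k).
 right; have [a a0 [[u1A u1] _]]:= unitS _ kA k0n; set u:= _ *: _ in u1A u1.
 exists (c *: u); first by apply/eqP=> e; move: (congr1 (dotp u) e); rewrite dotpZr u1 dotpC dotp0l; lra.
 move=> nu s Hs; pose w:= nu - nu *m A^T *m A.
 have wA: w *m A^T = 0 by rewrite mulmxBl -(mulmxA _ A) AA mulmx1 subrr.
 have wE k: k *m A^T = 0 -> dotp nu k = dotp w k by move=> e; rewrite dotpDl dotpNl dotp_mul e [dotp _ 0]dotpC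
 dotp0l subr0. rewrite wE; last by rewrite -scalemxAl u1A scaler0. have [w0|wn]:= eqVneq w 0.
  by rewrite w0 dotp0l normr0; have:= Hs _ Kk0; rewrite wE // w0 dotp0l.
 have [b b0 [Sb bb]]:= unitS w wA wn; have [k Kk]:= Hc _ Sb.
 rewrite dotpZl -ltr_pdivrMl ?invr_gt0 // invrK=> h; have:= Hs k Kk; rewrite wE ?(HK k Kk).1 // => h2.
 rewrite dotpZr normrM gtr0_norm //; apply: le_trans (ltW (lt_le_trans h h2)).
 rewrite mulrC ler_pM2r //; apply: ler_sqrp; last exact: ltW.
 by rewrite real_normK ?num_real // bb; have:= dotp_CS w u; rewrite u1 mulr1.
have cS: compact S.
 apply: (dotp_compact (B:= 1)); last by move=> v [_ ->].
 have -> : S = [set v | forall j, dotp (row j A) v = 0] `&` [set v | dotp v v = 1].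
  have e (v: 'rV[R]_d) j: dotp (row j A) v = (v *m A^T) 0 j by rewrite mxE; apply: eq_bigr=> i _; rewrite !mxE mulrC.
  apply/seteqP; split=> v [h1 h2]; split=>//; first by move=> j; rewrite e h1 mxE.
  by apply/rowP=> j; rewrite -e h1 mxE.
 apply: closedI; last by apply: closedEQ; exact: dotp2_cont.
 by apply: closedA=> j; apply: closedEQ; exact: dotp_cont.
have un (i: nat): exists v, S v /\ forall k, K k -> dotp v k <= i.+1%:R^-1.
 apply: contrapT=> h; apply: nc; exists i.+1%:R^-1; rewrite ?invr_gt0 // => v Sv.
 apply: contrapT=> h2; apply: h; exists v; split=>// k Kk; rewrite leNgt; apply/negP=> h3.
 by apply: h2; exists k.
have [s Hs]:= choice un. have [v Sv clv]:= seq_cluster cS (fun i=> (Hs i).1). have vK k: K k -> dotp v k <= 0.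
 move=> Kk; apply/ler_addgt0Pr=> e e0; rewrite add0r; apply: (clv [set x | dotp x k <= e]).
  have -> : [set x | dotp x k <= e] = [set x | dotp k x <= e] by apply/seteqP; split=> x /=; rewrite dotpC.
  by apply: closedLE; exact: dotp_cont.
 exists (Num.truncn e^-1)=> i ie; apply: (le_trans ((Hs i).2 k Kk)).
 rewrite -[leRHS]invrK lef_pV2 ?posrE ?invr_gt0 //.
 by apply: ltW; apply: (lt_le_trans (truncnS_gt _)); rewrite ler_nat ltnS.
pose K':= K `&` [set k | dotp v k = 0].
have cK': compact K' by apply: compact_closedI=>//; apply: closedEQ; exact: dotp_cont.
have vv: v *m v^T = 1%:M by rewrite mul_rowT Sv.2.
have AA': col_mx A v *m (col_mx A v)^T = 1%:M by rewrite tr_col_mx mul_col_row AA vv Sv.1 -[A *m _]trmxK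
trmx_mul trmxK Sv.1 trmx0 -scalar_mx_block. have HK' k: K' k -> k *m (col_mx A v)^T = 0 /\ k != 0.
 move=>[/HK [h1 h2] h3]; split=>//; rewrite tr_col_mx mul_mx_row h1 mul_rowT dotpC h3.
 by rewrite raddf0 row_mx0.
have rd': (r + 1 + n)%N = d by rewrite addn1 addSnnS.
have [[z [del [d0 Hz]]]|[z zn Hz]]:= IH _ K' _ rd' cK' AA' HK'; last first.
 by right; exists z=>// nu t Ht; apply: Hz=> k [/Ht].
left; pose K2:= K `&` [set k | dotp z k <= del / 2].
have cK2: compact K2 by apply: compact_closedI=>//; apply: closedLE; exact: dotp_cont.
have [K20|nK2]:= pselect (K2 !=set0); last first.
 exists z, (del / 2); split=>[|k Kk]; first lra.
 by rewrite leNgt; apply/negP=> h; apply: nK2; exists k; split=>//; exact: ltW.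
have cd (w: 'rV[R]_d): {within K2, continuous (dotp w)} by apply: continuous_subspaceT; exact: dotp_cont.
have [k1 /set_mem [Kk1 zk1] Hm]:= EVT_max_rV K20 cK2 (cd v). have [k2 _ Hb]:= EVT_min_rV K20 cK2 (cd z).
have m0: 0 < - dotp v k1.
 rewrite oppr_gt0 lt_neqAle vK // andbT; apply/eqP=> e. by have:= Hz k1 (conj Kk1 e); move: zk1=>/=; lra.
(* On the part [K2] where [z] is too small, [dotp v] is at most [dotp v k1 < 0] and [dotp z] at
   least [dotp z k2]; this multiple of [- v] raises the value there to at least [del]. *)
pose t:= (`|dotp z k2| + del) / - dotp v k1. exists (z - t *: v), (del / 2); split=>[|k Kk]; first lra.
rewrite dotpDl dotpNl dotpZl; have tE: t * - dotp v k1 = `|dotp z k2| + del by rewrite divfK // gt_eqF.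
have t0: 0 <= t by apply: divr_ge0; [rewrite addr_ge0 // ltW|exact: ltW].
have [h|h]:= ltP (del / 2) (dotp z k); first by have:= vK k Kk; nra.
have h1:= Hm k (mem_set (conj Kk h)); have h2:= Hb k (mem_set (conj Kk h)).
have:= ler_wpM2l t0 h1; have:= ler_norm (- dotp z k2); rewrite normrN; lra.
Qed.

(** The induction starts from the empty frame. In the second alternative [z] and [- z] satisfy every
    linear inequality valid on [K], that is, both lie in its closed convex hull. *)
Lemma gordan d (K: set 'rV[R]_d) (r0: R): compact K -> 0 < r0 ->
  (forall k, K k -> r0 <= dotp k k) ->
  (exists z delta, 0 < delta /\ forall k, K k -> delta <= dotp z k) \/
  (exists2 z, z != 0 & forall nu s, (forall k, K k -> dotp nu k <= s) -> `|dotp nu z| <= s).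
move=> cK r00 Hr; apply: (@gordan_orth d d 0 K 0)=>//; first by apply/matrixP=>-[].
move=> k /Hr h; split; first by apply/rowP=>-[]. by apply: contraTneq h=>->; rewrite dotp0l -ltNge.
Qed.

End Compactness.

Section Orth.
Context {R} {d: nat}.
Local Notation V:= 'rV[R]_d.+1.
Implicit Types X Y Z N T W: V.

Lemma Q_CS T X Y: Q T T < 0 -> Q X T = 0 -> Q Y T = 0 -> Q X Y ^+ 2 <= Q X X * Q Y Y.
move=> TT XT YT; apply: quad_discr=> s.
have -> : Q X X + 2 * Q X Y * s + Q Y Y * s ^+ 2 = Q (X + s *: Y) (X + s *: Y) by rewrite !QE (QC Y X); ring.
by apply: (sp_orth TT); rewrite !QE XT YT mulr0 addr0.
Qed.

(** Turns bounds on [Q] into compactness: on the complement of a timelike vector the form is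
    positive definite, so it dominates the Euclidean one. *)
Lemma orth_bound T: Q T T < 0 -> exists2 C: R, 0 < C & forall X, Q X T = 0 -> dotp X X <= C * Q X X.
move=> TT; have sT:= sp_ge0 T; have h: 0 < T 0 0 ^+ 2 - sp T T by move: TT; rewrite QspE expr2; lra.
exists (1 + 2 * (sp T T / (T 0 0 ^+ 2 - sp T T))).
 by rewrite ltr_wpDr // mulr_ge0 // divr_ge0 // ltW.
move=> X XT; have:= sp_orth TT XT=> QX. have e: sp X T = X 0 0 * T 0 0 by move: XT; rewrite QspE; lra.
have cs:= sp_CS X T; rewrite e exprMn in cs. have e2: sp X X = Q X X + X 0 0 ^+ 2 by rewrite QspE; ring.
rewrite e2 in cs.
have: X 0 0 ^+ 2 <= sp T T / (T 0 0 ^+ 2 - sp T T) * Q X X by rewrite mulrAC ler_pdivlMr //; lra.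
have -> : dotp X X = Q X X + 2 * X 0 0 ^+ 2 by rewrite /Q; ring. by lra.
Qed.

Lemma dotp_flat N X: dotp (N *m qeta) X = Q N X.
by rewrite QmxE /dotp !mxE; apply: eq_bigr => i _; rewrite !mxE. Qed.

End Orth.

Section MinOnCompact.
Context {R} {M}.

Lemma closed_if (P: M -> Prop) :
  (forall p, ~ P p -> exists O: set M, [/\ open O, O p & forall q, O q -> ~ P q]) ->
  closed [set p | P p].
move=> HP p clp; apply: contrapT=>/HP [U [oU Up HU]].
by have [q [/= Pq Uq]]:= clp U (open_nbhs_nbhs (conj oU Up)); exact: HU Uq Pq.
Qed.

(** The sets containing some sublevel set [[set p | K p <= K q]] form a proper filter; a cluster
    point lies in every sublevel set, since these are closed. *)
Lemma lsc_min (K: M -> R): compact [set: M] -> (exists p: M, True) ->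
  (forall c, closed [set p | K p <= c]) -> exists p0, forall p, K p0 <= K p.
move=> cM [p1 _] cK. pose F: set_system M:= [set A | exists q, [set p | K p <= K q] `<=` A].
have PF: ProperFilter F.
 apply: Build_ProperFilter; first by move=>[q /(_ q)]; apply=>/=. split; first by exists p1.
  move=> A B [q1 h1] [q2 h2]; case: (lerP (K q1) (K q2))=> h.
   by exists q1=> p /= pq; split; [exact: h1|apply: h2; apply: (le_trans pq h)].
  by exists q2=> p /= pq; split; [apply: h1; apply: (le_trans pq (ltW h))|exact: h2].
 by move=> A B AB [q h]; exists q=> p /h /AB.
have FT: F setT by exists p1. have [p0 [_ cl]]:= cM F PF FT.
exists p0=> q; apply: (cK (K q))=> B nB; apply: cl=>//; by exists q.
Qed.

End MinOnCompact.

(** * Extension of local models over caps *)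

(* [mmap i] is a local model on the conic set [mdom i]; its values record a point of M together with the scale of
the metric there. Models are folded along the boundary by the reflection in [mvec]. *)
Record mirror (R: realType) (d: nat) (M: topologicalType) (T: Type):= Mirror {
  midx: Type;
  mpt: T -> M;
  mdom: midx -> set 'rV[R]_d.+1;
  mmap: midx -> 'rV[R]_d.+1 -> T;
  mvec: 'rV[R]_d.+1 }.
(** [ma_trans] is Liouville's theorem for changes of chart, stated for the full values, so that
    scales are compared as well as points. [ma_fold] and [ma_refl] say that a chart meeting the
    boundary is a half model doubled by the reflection, with no further identification. *)
Record mirror_axioms (R: realType) (d: nat) (M: topologicalType) (T: Type)
    (S: mirror R d M T): Prop:= MirrorAxioms {
  ma_dom_cone: forall i X, mdom (m:= S) i X -> cone X;
  ma_dom_open: forall i X, mdom (m:= S) i X ->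
    exists N, cap N X /\ forall Z, cap N Z -> mdom (m:= S) i Z;
  ma_mvec: Q (mvec S) (mvec S) = 1;
  ma_onto: forall p: M, exists i X, mdom (m:= S) i X /\ mpt S (mmap i X) = p;
  ma_trans: forall i j X Y, mdom (m:= S) i X -> mdom (m:= S) j Y ->
    mpt S (mmap i X) = mpt S (mmap j Y) ->
    exists L, [/\ lor L, par (X *m L) Y & exists N, cap N X /\
      forall Z, cap N Z -> mmap (m:= S) i Z = mmap j (Z *m L)];
  ma_fold: forall i X Y, mdom (m:= S) i X -> mdom (m:= S) i Y ->
    (mpt S (mmap i X) = mpt S (mmap i Y) <->
     par X Y \/ par X (Y *m refl (mvec S)));
  ma_refl: forall i X, mdom (m:= S) i X -> mdom (m:= S) i (X *m refl (mvec S)) ->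
    mmap (m:= S) i (X *m refl (mvec S)) = mmap i X;
  ma_cont: forall i X (O: set M), mdom (m:= S) i X -> open O -> O (mpt S (mmap i X)) ->
    exists N, cap N X /\ forall Z, cap N Z -> O (mpt S (mmap (m:= S) i Z));
  ma_open: forall i X N, mdom (m:= S) i X -> cap N X ->
    exists O: set M, [/\ open O, O (mpt S (mmap (m:= S) i X)) &
      forall p, O p -> exists Z, cap N Z /\ mpt S (mmap (m:= S) i Z) = p] }.

(** [dens] stands for the metric |dX|^2 / dens^2; homogeneity makes this a metric on the sphere of
    rays. The comparison in [wa_usc] is with linear functions because these are the densities of
    caps, and as [c] may be negative it bounds [dens] on both sides. *)
Record weight_axioms (R: realType) (d: nat) (M: topologicalType) (T: Type)
    (S: mirror R d M T) (dens: T -> R): Prop:= WeightAxioms {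
  wa_pos: forall i X, mdom (m:= S) i X -> 0 < dens (mmap i X);
  wa_hom: forall i X t, mdom (m:= S) i X -> 0 < t ->
    dens (mmap (m:= S) i (t *: X)) = t * dens (mmap i X);
  wa_usc: forall i X N c, mdom (m:= S) i X -> c * dens (mmap i X) < Q N X ->
    exists N', cap N' X /\ forall Z, cap N' Z -> c * dens (mmap (m:= S) i Z) < Q N Z }.
(* The density of the metric cannot be touched by that of a cylinder or of a flat metric: this is all that is used
of the Gamma_k condition. *)
Record density_axioms (R: realType) (d: nat) (M: topologicalType) (T: Type)
    (S: mirror R d M T) (dens: T -> R): Prop:= DensityAxioms {
  da_weight: weight_axioms S dens;
  da_cyl: forall i X (tau sig: 'rV[R]_d.+1) c, mdom (m:= S) i X ->
    Q tau tau = -1 -> Q sig sig = 1 -> Q tau sig = 0 -> Q sig X = 0 -> 0 < c ->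
    c * dens (mmap i X) ^+ 2 = Q tau X ^+ 2 ->
    (exists N, cap N X /\ forall Z, cap N Z ->
       c * dens (mmap (m:= S) i Z) ^+ 2 <= Q tau Z ^+ 2 - Q sig Z ^+ 2) -> False;
  da_flat: forall i X Y c, mdom (m:= S) i X -> cone Y -> 0 < c ->
    c * dens (mmap i X) = - Q Y X ->
    (exists N, cap N X /\ forall Z, cap N Z ->
       c * dens (mmap (m:= S) i Z) <= - Q Y Z) -> False }.

Section MirrorTheory.
Context {R} {d: nat} {M} {T: Type} {S: mirror R d M T}.
Local Notation V:= 'rV[R]_d.+1.
Local Notation pt:= (mpt S).
Implicit Types (X Y Z N W: V) (L: 'M[R]_d.+1) (E F: V -> T).

(** * Germs of models and unique continuation *)

Section Mirror.
Context (H: mirror_axioms S) (d3: (3 <= d)%N) (Mhaus: hausdorff_space M).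
Local Notation tau:= (refl (mvec S)).
Definition agree E E' X:= exists N, cap N X /\ forall Z, cap N Z -> E Z = E' Z.
(** These are the germs of models: [E] is a total function, but only its values near the ray of [X]
    matter, and [agree] is equality of germs. Lorentz maps are built in because a chart is
    determined only up to them. *)
Definition adm E X:= exists i L N, [/\ lor L, cap N X &
  forall Z, cap N Z -> mdom (m:= S) i (Z *m L) /\ E Z = mmap (m:= S) i (Z *m L)].

Lemma adm_cone E X: adm E X -> cone X.
by move=>[i [L [N [_ [cX _] _]]]]. Qed.

Lemma adm_near E X: adm E X -> exists N, cap N X /\ forall Z, cap N Z -> adm E Z.
by move=>[i [L [N [lL NX HN]]]]; exists N; split=>// Z NZ; exists i, L, N. Qed.

Lemma agree_near E E' X: agree E E' X -> exists N, cap N X /\ forall Z, cap N Z -> agree E E' Z.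
by move=>[N [NX HN]]; exists N; split=>// Z NZ; exists N. Qed.

Lemma agreeC E E' X: agree E E' X -> agree E' E X.
by move=>[N [NX HN]]; exists N; split=>// Z NZ; rewrite HN. Qed.

Lemma agree_refl E X: cone X -> agree E E X.
by move=>/cap_ex [N NX]; exists N. Qed.

Lemma agreeT E E' E'' X: agree E E' X -> agree E' E'' X -> agree E E'' X.
move=>[N [NX HN]] [N' [NX' HN']]; have [N2 [N2X HN2]]:= capI NX NX'.
by exists N2; split=>// Z /HN2 [a b]; rewrite HN // HN'.
Qed.

Lemma agree_eq E E' X: agree E E' X -> E X = E' X.
by move=>[N [NX HN]]; exact: HN. Qed.

Lemma agree_par E E' X Y: par X Y -> agree E E' X -> agree E E' Y.
by move=> XY [N [NX HN]]; exists N; split=>//; exact: cap_par XY NX. Qed.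

Lemma adm_par E X Y: par X Y -> adm E X -> adm E Y.
by move=> XY [i [L [N [lL NX HN]]]]; exists i, L, N; split=>//; exact: cap_par XY NX. Qed.

Lemma adm_agree E E' X: agree E E' X -> adm E X -> adm E' X.
move=>[N [NX HN]] [i [L [N' [lL NX' HN']]]]; have [N2 [N2X HN2]]:= capI NX NX'.
by exists i, L, N2; split=>// Z /HN2 [a b]; rewrite -HN //; exact: HN'.
Qed.

Lemma cap_lor L N X: lor L -> cap N (X *m L) -> cone X ->
  exists N', cap N' X /\ forall Z, cap N' Z -> cap N (Z *m L).
move=> lL [_ NXL] cX; have [L' [lL' LL' _]]:= lor_inv lL.
exists (N *m L'); split; first by split=>//; rewrite -(lor_capE _ _ lL LL' lL').
by move=> Z [cZ]; rewrite -(lor_capE _ _ lL LL' lL')=> NZ; split=>//; exact: lL.2.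
Qed.

Lemma adm_lor E L X: lor L -> cone X -> adm E (X *m L) -> adm (fun Z => E (Z *m L)) X.
move=> lL cX [i [L' [N [lL' NX HN]]]]; have [N' [N'X HN']]:= cap_lor lL NX cX.
exists i, (L *m L'), N'; split=>//; first exact: lorM. by move=> Z /HN' /HN; rewrite mulmxA.
Qed.

Lemma agree_lor E E' L X: lor L -> cone X -> agree E E' (X *m L) ->
  agree (fun Z => E (Z *m L)) (fun Z => E' (Z *m L)) X.
move=> lL cX [N [NX HN]]; have [N' [N'X HN']]:= cap_lor lL NX cX. by exists N'; split=>// Z /HN' /HN.
Qed.

Lemma adm_cont E X (O: set M): adm E X -> open O -> O (pt (E X)) ->
  exists N, cap N X /\ forall Z, cap N Z -> O (pt (E Z)).
move=>[i [L [N [lL NX HN]]]] oO OX; have [WX EX]:= HN _ NX.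
rewrite EX in OX; have [N1 [N1X HN1]]:= ma_cont H WX oO OX. have [N2 [N2X HN2]]:= cap_lor lL N1X NX.1.
have [N3 [N3X HN3]]:= capI NX N2X.
by exists N3; split=>// Z /HN3 [a b]; rewrite (HN _ a).2; apply: HN1; apply: HN2.
Qed.

Lemma adm_open E X N: adm E X -> cap N X -> exists O: set M,
  [/\ open O, O (pt (E X)) & forall p, O p -> exists Z, cap N Z /\ pt (E Z) = p].
move=>[i [L [N1 [lL N1X HN1]]]] NX; have [N2 [N2X HN2]]:= capI NX N1X. have [L' [lL' LL' L'L]]:= lor_inv lL.
have [WX EX]:= HN1 _ N1X. have c2: cap (N2 *m L) (X *m L) by split; [exact: lL.2 NX.1|rewrite lL.1; case: N2X].
have [U [oU UX HU]]:= ma_open H WX c2. exists U; split=>//; first by rewrite EX.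
move=> p /HU [Z [NZ <-]]; have cZ: cap N2 (Z *m L').
 split; first exact: lL'.2 NZ.1. by rewrite -(lL.1 N2) -mulmxA L'L mulmx1; case: NZ.
have [a b]:= HN2 _ cZ; exists (Z *m L'); split=>//. by rewrite (HN1 _ b).2 -mulmxA L'L mulmx1.
Qed.

Lemma adm_cmp E E' X Y: adm E X -> adm E' Y -> pt (E X) = pt (E' Y) ->
  exists L, [/\ lor L, par (X *m L) Y & agree E (fun Z => E' (Z *m L)) X].
move=>[i [L1 [N1 [l1 N1X HN1]]]] [j [L2 [N2 [l2 N2Y HN2]]]] e.
have [W1 E1]:= HN1 _ N1X; have [W2 E2]:= HN2 _ N2Y; rewrite E1 E2 in e.
have [L3 [l3 p3 [N3 [N3X HN3]]]]:= ma_trans H W1 W2 e. have [L2' [l2' L22 L2'2]]:= lor_inv l2.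
have lL: lor (L1 *m L3 *m L2') by apply: lorM=>//; exact: lorM.
have pL: par (X *m (L1 *m L3 *m L2')) Y by have:= lor_par L2' p3; rewrite -!mulmxA L22 mulmx1.
exists (L1 *m L3 *m L2'); split=>//. have [N4 [N4X HN4]]:= cap_lor l1 N3X N1X.1.
have [N5 [N5X HN5]]:= cap_lor lL (cap_par (par_sym pL) N2Y) N1X.1.
have [N6 [N6X HN6]]:= capI N1X N4X; have [N7 [N7X HN7]]:= capI N6X N5X.
exists N7; split=>// Z /HN7 [/HN6 [a b] c]. rewrite (HN1 _ a).2 (HN2 _ (HN5 _ c)).2 HN3; last exact: HN4.
by rewrite -!mulmxA L2'2 mulmx1.
Qed.

Lemma lor_tau: lor tau. exact: lor_refl (ma_mvec H). Qed.

Lemma adm_pt_eq E E' X: adm E X -> adm E' X ->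
  (forall N, cap N X -> exists Y, cap N Y /\ E Y = E' Y) -> pt (E X) = pt (E' X).
move=> aE aE' HE; apply: contrapT=>/eqP n.
have:= Mhaus; rewrite open_hausdorff=>/(_ _ _ n) [[A B] /= [/set_mem AX /set_mem BX]] [oA oB /eqP AB].
have [N1 [N1X HN1]]:= adm_cont aE oA AX; have [N2 [N2X HN2]]:= adm_cont aE' oB BX.
have [N [NX HN]]:= capI N1X N2X; have [Y [/HN [a b] e]]:= HE _ NX.
have: (A `&` B) (pt (E Y)) by split; [exact: HN1|rewrite e; exact: HN2]. by rewrite AB.
Qed.

(** Rays near [X] at which the two germs agree show that, read in a chart, [L] is the identity or
    the reflection of the chart ([ma_fold] and [rigid2]); in both cases the germ at [X] is
    unchanged. *)
Lemma adm_fixes E L X: adm E X -> lor L -> par (X *m L) X ->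
  (forall N, cap N X -> exists Y, cap N Y /\ agree E (fun Z => E (Z *m L)) Y) ->
  agree E (fun Z => E (Z *m L)) X.
move=>[j [L2 [N2 [l2 N2X HN2]]]] lL pL HL. have [N3 [N3X HN3]]:= cap_lor lL (cap_par (par_sym pL) N2X) N2X.1.
have [N4 [N4X HN4]]:= capI N2X N3X. have [Y [N4Y [N5 [N5Y HN5]]]]:= HL _ N4X.
have [N6 [N6Y HN6]]:= capI N4Y N5Y. have [Hid|Hre]: L2 = L *m L2 \/ L2 = L *m L2 *m tau.
- apply: (@rigid2 _ _ d3 L2 (L *m L2) (L *m L2 *m tau) Y N6)=>//; try exact: lorM.
 by apply: lorM; [exact: lorM|exact: lor_tau].
 move=> Z /HN6 [/HN4 [a /HN3 b] c]; rewrite mulmxA; have e:= HN5 _ c.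
 have [W1 e1]:= HN2 _ a; have [W2 e2]:= HN2 _ b.
 rewrite e1 e2 in e; have []:= (ma_fold H W1 W2).1; first by rewrite e.
  by left.
 by right; rewrite !mulmxA.
- have L1: L = 1%:M by have [L2' [_ L22 _]]:= lor_inv l2; rewrite -[L]mulmx1 -L22 mulmxA -Hid L22.
 by exists N2; split=>// Z _; rewrite L1 mulmx1.
- exists N4; split=>// Z /HN4 [a /HN3 b].
 have [W1 ->]:= HN2 _ a; have [W2 ->]:= HN2 _ b.
 have e: Z *m L2 = Z *m L *m L2 *m tau by rewrite {1}Hre !mulmxA. by rewrite e ma_refl // -e.
Qed.

(** Unique continuation to a limit ray: Hausdorffness gives the same point of M, [adm_cmp] relates
    the germs by a Lorentz map [L] fixing the ray, and [adm_fixes] absorbs [L]. *)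
Lemma adm_unique E E' X: adm E X -> adm E' X ->
  (forall N, cap N X -> exists Y, cap N Y /\ agree E E' Y) -> agree E E' X.
move=> aE aE' HE; have e: pt (E X) = pt (E' X).
 by apply: adm_pt_eq=>// N /HE [Y [NY /agree_eq e]]; exists Y.
have [L [lL pL [N1 [N1X HN1]]]]:= adm_cmp aE aE' e. have f: agree E' (fun Z=> E' (Z *m L)) X.
 apply: adm_fixes=>// N NX; have [N2 [N2X HN2]]:= capI NX N1X.
 have [Y [/HN2 [a b] c]]:= HE _ N2X; exists Y; split=>//. by apply: agreeT (agreeC c) _; exists N1.
by apply: agreeT (agreeC f); exists N1.
Qed.

(** The supremum of the parameters up to which the germs agree is attained by [adm_unique], and it
    can be passed by [agree_near]. *)
Lemma identity_path E E' (P: R -> V) :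
  (forall N, continuous (fun t => Q N (P t))) ->
  (forall t, 0 <= t <= 1 -> adm E (P t) /\ adm E' (P t)) ->
  agree E E' (P 0) -> agree E E' (P 1).
move=> cP aP a0. pose A:= [set t: R | 0 <= t <= 1 /\ forall s, 0 <= s <= t -> agree E E' (P s)].
have A0: A 0 by split; [rewrite lexx ler01|move=> s s0; have -> : s = 0 by lra].
have hA: has_sup A by split; [exists 0 | exists 1=> t [/andP[]]]. pose c:= sup A.
have c0: 0 <= c by apply: ub_le_sup=>//; exact: hA.2.
have c1: c <= 1 by apply: sup_le_ub=>//; [exists 0|move=> t [/andP[]]]. have cc: 0 <= c <= 1 by rewrite c0 c1.
have below s: 0 <= s -> s < c -> agree E E' (P s).
 move=> s0 sc; have [|t [t01 At]]:= @sup_adherent _ A (c - s) _ hA; first by rewrite subr_gt0.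
 rewrite -/c opprB addrC subrK=>/ltW st. by apply: At; rewrite s0.
have nearP N: cap N (P c) -> exists2 e: R, 0 < e & forall s, `|c - s| < e -> 0 < Q N (P s).
 move=>[_ NP]; have:= cP N c [set r | 0 < r] (lt_nbhsr NP).
 by move=>/nbhs_ballP [e /= e0 He]; exists e=>// s /He.
have ac: agree E E' (P c).
 apply: adm_unique; try by have []:= aP _ cc. move=> N NP; have [e e0 He]:= nearP _ NP.
 case: (eqVneq c 0)=>[c00|cn0]; first by exists (P c); split=>//; rewrite c00.
 have [s [s0 sc se]]: exists s, [/\ 0 <= s, s < c & `|c - s| < e].
  exists (Num.max 0 (c - e / 2)); rewrite le_max lexx /=.
  by case: (lerP 0 (c - e / 2))=> h; split; try lra; rewrite ger0_norm; lra.
 have s1: 0 <= s <= 1 by lra. exists (P s); split; last exact: below.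
 by split; [exact: adm_cone (aP _ s1).1|exact: He].
have [N [NP HN]]:= agree_near ac; have [e e0 He]:= nearP _ NP.
case: (eqVneq c 1)=>[<-//|cn1]; have cl: c < 1 by rewrite lt_neqAle cn1.
have [s [cs s1 se]]: exists s, [/\ c < s, s <= 1 & s - c < e].
 exists (Num.min 1 (c + e / 2)); rewrite ge_min lexx /=. by case: (lerP 1 (c + e / 2))=> h; split; lra.
have: A s.
 split; first lra. move=> r /andP[r0 rs]; case: (ltP r c)=> rc; first exact: below. have r1: 0 <= r <= 1 by lra.
 apply: HN; split; first exact: adm_cone (aP _ r1).1. by apply: He; rewrite ltr_norml; lra.
by move=>/(ub_le_sup hA.2); rewrite -/c; lra.
Qed.

Lemma ident2 E E' X Y A B :
  cap A X -> cap A Y -> 0 < Q B X -> 0 < Q B Y ->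
  (forall Z, cap A Z -> 0 < Q B Z -> adm E Z /\ adm E' Z) ->
  agree E E' X -> agree E E' Y.
move=>[cX AX] [cY AY] BX BY HE aX; case: (pselect (par X Y))=>[/agree_par|nXY]; first exact.
have [W [WX WY WW AW BW]]:= npath_ex2 d3 A B cX cY nXY.
rewrite -(npath1 X W Y); apply: identity_path; last by rewrite npath0.
 by move=> N; exact: npath_cont.
move=> t /andP[t0 t1]; apply: HE.
 split; first exact: npath_cone. rewrite /npath !QE AW mulr0 addr0. case: (eqVneq t 0)=>[->|tn]; first by lra.
 apply: ltr_wpDl; first by rewrite mulr_ge0 ?sqr_ge0 ?ltW.
 by rewrite mulr_gt0 // exprn_gt0 // lt_neqAle eq_sym tn.
rewrite /npath !QE; have h: 0 <= t * (1 - t) * Q B W by rewrite !mulr_ge0 // subr_ge0.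
case: (eqVneq t 0)=>[->|tn]; first by lra. apply: ltr_wpDl; first by rewrite addr_ge0 // mulr_ge0 ?sqr_ge0 ?ltW.
by rewrite mulr_gt0 // exprn_gt0 // lt_neqAle eq_sym tn.
Qed.

Lemma identity_all E E' X Y: cone Y -> (forall Z, cone Z -> adm E Z /\ adm E' Z) ->
  cone X -> agree E E' X -> agree E E' Y.
move=> cY HE cX aX; case: (pselect (par X Y))=>[/agree_par|nXY]; first exact.
have [W [WX WY WW AW BW]]:= npath_ex2 d3 0 0 cX cY nXY.
rewrite -(npath1 X W Y); apply: identity_path; last by rewrite npath0.
 by move=> N; exact: npath_cont.
by move=> t _; apply: HE; exact: npath_cone.
Qed.

End Mirror.

(** * Caps over which a germ extends *)

Section Germ.
Context (H: mirror_axioms S) (d3: (3 <= d)%N) (Mhaus: hausdorff_space M).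
(** The extension [E'] is tied to [E] near [X] only, so [E] itself may be meaningless in the rest of
    the cap. *)
Definition ext E X N:= 0 < Q N X /\
  exists E', agree E' E X /\ forall Z, cap N Z -> adm E' Z.
Definition reg E X Y:= exists N, ext E X N /\ cap N Y.

Lemma adm_glue2 E0 E1 N0 N1 X: cap N0 X -> cap N1 X -> agree E0 E1 X ->
  (forall Z, cap N0 Z -> adm E0 Z) -> (forall Z, cap N1 Z -> adm E1 Z) ->
  exists E', agree E' E0 X /\
   (forall Z, cap N0 Z -> agree E' E0 Z) /\ (forall Z, cap N1 Z -> agree E' E1 Z).
move=> N0X N1X a01 H0 H1. pose E' Z:= if pselect (0 < Q N0 Z) then E0 Z else E1 Z.
have e0 Z: cap N0 Z -> E' Z = E0 Z by move=>[_ NZ]; rewrite /E'; case: pselect.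
have e1 Z: cap N1 Z -> E' Z = E1 Z.
 move=> N1Z; rewrite /E'; case: pselect=>// N0Z; apply: agree_eq.
 apply: (ident2 H d3 Mhaus N0X _ N1X.2 N1Z.2 _ a01); first by split=>//; case: N1Z.
 by move=> W N0W N1W; split; [exact: H0|apply: H1; split=>//; case: N0W].
by exists E'; split; [exists N0 | split=> Z NZ; [exists N0 | exists N1]].
Qed.

Lemma ext_adm E X: adm E X -> exists N, ext E X N.
move=> aE; have [N [NX HN]]:= adm_near aE; exists N; split; first by case: NX.
by exists E; split=>//; exact: agree_refl NX.1.
Qed.

Lemma ext_scale E X N c: 0 < c -> ext E X N -> ext E X (c *: N).
move=> c0 [NX [E' [aE' HE']]]; split; first by rewrite QZl mulr_gt0.
by exists E'; split=>// Z [cZ]; rewrite QZl pmulr_rgt0 // => NZ; apply: HE'.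
Qed.

(** All extension caps contain [X] and two caps meet in a connected set, so by [ident2] the
    extensions coincide wherever two are defined, and a pointwise choice among them is coherent. *)
Lemma germ_region E X: adm E X -> exists EU, agree EU E X /\
  forall Y, reg E X Y -> adm EU Y.
move=> aE; have cX:= adm_cone aE.
pose good Y (NE: V * (V -> T)):= [/\ 0 < Q NE.1 X, cap NE.1 Y, agree NE.2 E X & forall Z, cap NE.1 Z -> adm NE.2 Z].
pose EU Y:= if pselect (exists NE, good Y NE) is left p then (projT1 (cid p)).2 Y else E Y.
have key Y N E': good Y (N, E') -> EU Y = E' Y.
 move=> g; rewrite /EU; case: pselect=>[p|n]; last by case: n; exists (N, E').
 case: cid=>-[N1 E1] /= [N1X N1Y a1 H1]; case: g=>/= NX NY a2 H2.
 apply: agree_eq; apply: (ident2 H d3 Mhaus (A:= N1) (B:= N) (conj cX N1X) N1Y NX NY.2).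
  by move=> Z N1Z NZ; split; [exact: H1|apply: H2; split=>//; case: N1Z].
 by apply: agreeT a1 (agreeC a2).
have keyN N E': 0 < Q N X -> agree E' E X -> (forall Z, cap N Z -> adm E' Z) -> forall Y, cap N Y -> agree EU
E' Y by move=> NX aE' HE' Y NY; exists N; split=>// Z NZ; apply: (key Z N). exists EU; split.
 have [N [NX [E' [aE' HE']]]]:= ext_adm aE. apply: (agreeT _ aE'); apply: (keyN N E' NX aE' HE'). by split.
move=> Y [N [[NX [E' [aE' HE']]] NY]]. by apply: adm_agree (HE' _ NY); apply: agreeC; exact: (keyN N E').
Qed.

(** A cap around [X] that contains no missing ray is an extension cap. This turns extendability into
    a closed condition on [N]. *)
Lemma ext_sat E X N: adm E X -> 0 < Q N X -> (forall Z, cap N Z -> reg E X Z) -> ext E X N.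
move=> aE NX HN; have [EU [aU HU]]:= germ_region aE. by split=>//; exists EU; split=>// Z /HN; exact: HU.
Qed.

Lemma ext_reg_le E X N Y: ext E X N -> cone Y -> ~ reg E X Y -> Q N Y <= 0.
by move=> eN cY nY; rewrite leNgt; apply/negP => NY; apply: nY; exists N. Qed.

Lemma reg_self E X: adm E X -> reg E X X.
by move=> aE; have [N eN]:= ext_adm aE; exists N; split=>//; split; [exact: adm_cone aE | case: eN]. Qed.

Lemma reg_par E X Y Z: par Y Z -> reg E X Y -> reg E X Z.
by move=> YZ [N [eN NY]]; exists N; split=>//; exact: cap_par YZ NY. Qed.

(** A cap of a displaced germ cannot reach a missing ray [Y] on the boundary of [cap N0]: gluing the
    extensions over [cap N0] and [cap N'] would extend the germ over [cap (N' + t *: N0)], which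
    lies in their union and contains [Y], as well as [X] for large [t]. *)
Lemma ext_moved E X N0 E0 X' N' Y: adm E X -> 0 < Q N0 X -> agree E0 E X ->
  (forall Z, cap N0 Z -> adm E0 Z) -> cap N0 X' -> ext E0 X' N' ->
  cone Y -> ~ reg E X Y -> Q N0 Y = 0 -> Q N' Y <= 0.
move=> aE N0X a0 H0 N0X' [N'X' [E' [aE' HE']]] cY nY N0Y. rewrite leNgt; apply/negP=> N'Y; apply: nY.
have cX:= adm_cone aE. have [E2 [_ [h0 h1]]]:= adm_glue2 N0X' (conj N0X'.1 N'X') (agreeC aE') H0 HE'.
pose t:= (1 + `|Q N' X|) / Q N0 X. have tX: t * Q N0 X = 1 + `|Q N' X| by rewrite /t divfK ?gt_eqF.
exists (N' + t *: N0); split; last by split=>//; rewrite !QE N0Y mulr0 addr0.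
split; first by rewrite !QE tX; have:= ler_norm (- Q N' X); rewrite normrN; lra. exists E2; split.
 by apply: agreeT a0; apply: h0; split.
move=> Z [cZ]; rewrite !QE=> NZ. have t0: 0 < t by pos. case: (ltrP 0 (Q N0 Z))=> N0Z.
 by apply: adm_agree (H0 _ (conj cZ N0Z)); apply: agreeC; apply: h0; split.
have tN: t * Q N0 Z <= 0 by rewrite pmulr_rle0. have N'Z: 0 < Q N' Z by lra.
by apply: adm_agree (HE' _ (conj cZ N'Z)); apply: agreeC; apply: h1; split.
Qed.

(** Adding a positive multiple of [X] shrinks the cap, keeps [Q N X], and increases [Q N N] by
    [2 * a * Q N X]; the coefficient [a] makes the result at least 1 before it is normalised. *)
Lemma ext_spacelike E X N: cone X -> ext E X N -> exists N', [/\ ext E X N', Q N' N' = 1 & 0 < Q N' X].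
move=> cX [NX [E' [aE' HE']]]. have p2: 0 < 2 * Q N X by pos. pose a:= (1 + `|Q N N|) / (2 * Q N X).
have aN: a * (2 * Q N X) = 1 + `|Q N N| by rewrite divfK ?gt_eqF. have a0: 0 < a by pos.
have eN: ext E X (N + a *: X).
 split; first by rewrite !QE cX.1 mulr0 addr0.
 exists E'; split=>// Z [cZ]; rewrite !QE=> NZ; apply: HE'; split=>//.
 by have:= mulr_ge0_le0 (ltW a0) (cone_Q_le0 cX cZ); lra.
have NN: 0 < Q (N + a *: X) (N + a *: X).
 rewrite !QE cX.1 (QC X N); have:= ler_norm (- Q N N); rewrite normrN; lra.
set N1:= N + _ in eN NN; clearbody N1. have s0: 0 < Num.sqrt (Q N1 N1) by pos.
exists ((Num.sqrt (Q N1 N1))^-1 *: N1); split.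
- by apply: ext_scale; rewrite ?invr_gt0.
- by rewrite !QE mulrA -expr2 exprVn sqr_sqrtr ?ltW // mulVf ?gt_eqF.
- by rewrite QZl mulr_gt0 ?invr_gt0 //; case: eN.
Qed.

(** [N] is split as [a X - b Y0 + nu] with [nu] orthogonal to the null pair, hence of nonnegative
    square. This bounds [2 * a * b * q] by 1, so that a large [b] forces a small [a]. *)
Lemma null_decomp X Y0 N: cone X -> cone Y0 -> ~ par X Y0 -> Q N N = 1 ->
  0 < Q N X -> Q N Y0 <= 0 ->
  let q:= - Q X Y0 in let a:= - Q N Y0 / q in let b:= Q N X / q in
  let nu:= N - a *: X + b *: Y0 in
  [/\ 0 < q, 0 <= a, 0 < b, Q nu nu = 1 - 2 * a * b * q & 0 <= Q nu nu /\ (Q nu X = 0 /\ Q nu Y0 = 0)].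
move=> cX cY nXY NN NX NY q a b nu; have q0: 0 < q by rewrite oppr_gt0 coneQ0. have qn: q != 0 by pos.
have a0: 0 <= a by apply: divr_ge0; [rewrite oppr_ge0|exact: ltW]. have b0: 0 < b by pos.
have aq: a * q = - Q N Y0 by rewrite divfK. have bq: b * q = Q N X by rewrite divfK.
have XY: Q X Y0 = - q by rewrite opprK.
have nX: Q nu X = 0 by rewrite /nu !QE cX.1 (QC Y0 X) XY mulr0 -bq; ring.
have nY: Q nu Y0 = 0 by rewrite /nu !QE cY.1 XY mulr0 -[Q N Y0]opprK -aq; ring.
have nn: Q nu nu = 1 - 2 * a * b * q.
 have -> : Q nu nu = Q N nu by rewrite {1}/nu !QDl QNl !QZl (QC X) (QC Y0) nX nY; ring.
 by rewrite /nu !QE NN -bq -[Q N Y0]opprK -aq; ring.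
have [TT _]:= cone_sum cX cY nXY. by split=>//; split=>//; apply: (sp_orth TT); rewrite QDr nX nY addr0.
Qed.

(** In the splitting of [null_decomp] large caps have large [b], small [a] and [Q nu nu <= 1], so
    [Q N Y] is dominated by [b * y0], which is positive off the ray of [Y0]. *)
Lemma reg_flat E X Y0: adm E X -> cone Y0 -> ~ reg E X Y0 ->
  (forall B, exists N, [/\ ext E X N, Q N N = 1 & B < Q N X]) ->
  forall Y, cone Y -> ~ par Y Y0 -> reg E X Y.
move=> aE cY0 nY0 Hinf Y cY nYY0; have cX:= adm_cone aE.
have nXY0: ~ par X Y0 by move=> p; apply: nY0; apply: reg_par p (reg_self aE).
pose q:= - Q X Y0; pose y0:= - Q Y0 Y; pose x:= - Q X Y. have q0: 0 < q by rewrite oppr_gt0 coneQ0.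
have y00: 0 < y0 by rewrite oppr_gt0 QC coneQ0. have x0: 0 <= x by rewrite oppr_ge0 cone_Q_le0.
pose r:= Num.sqrt (2 * x * y0 / q). have r0: 0 <= r by pos.
have xyq: 0 <= 2 * x * y0 / q by apply: divr_ge0; [apply: mulr_ge0; [exact: mulr_ge0|exact: ltW]|exact: ltW].
have rr: r ^+ 2 = 2 * x * y0 / q by rewrite sqr_sqrtr.
(* The bound makes [b * y0] exceed [x / (2 * q) + r + 1], where [x / (2 * q)] bounds [a * x] and [r]
   bounds the part of [Q N Y] orthogonal to [X] and [Y0]. *)
have [N [eN NN NX]]:= Hinf (q * (1 + (x / (2 * q) + r + 1) / y0)).
have [_ a0 b0 nn [nn0 [nX nY]]]:= null_decomp cX cY0 nXY0 NN eN.1 (ext_reg_le eN cY0 nY0).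
move: a0 b0 nn nn0 nX nY; rewrite -/q; set a:= _ / q; set b:= _ / q; set nu:= N - _ + _=> a0 b0 nn nn0 nX nY.
exists N; split=>//; split=>//. have bB: 1 + (x / (2 * q) + r + 1) / y0 < b by rewrite /b ltr_pdivlMr // mulrC.
have b1: 1 < b.
 have h: 0 <= (x / (2 * q) + r + 1) / y0 by pos. lra.
have by0: x / (2 * q) + r + 1 < b * y0 by rewrite -ltr_pdivrMr //; lra. have aq: a <= 1 / (2 * q).
 rewrite ler_pdivlMr ?mulr_gt0 //; have: a * q <= a * q * b.
  by apply: ler_peMr; [apply: mulr_ge0=>//|]; exact: ltW.
 by lra.
pose Yp:= Y - (y0 / q) *: X - (x / q) *: Y0. have qn: q != 0 by pos.
have YpX: Q Yp X = 0 by rewrite /Yp !QE cX.1 (QC Y X) (QC Y0 X) -[Q X Y]opprK -/x -[Q X Y0]opprK -/q; field.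
have YpY: Q Yp Y0 = 0 by rewrite /Yp !QE cY0.1 (QC Y Y0) -[Q Y0 Y]opprK -/y0 -[Q X Y0]opprK -/q; field.
have YpYp: Q Yp Yp = 2 * x * y0 / q.
 have -> : Q Yp Yp = Q Y Yp by rewrite {1}/Yp !QDl !QNl !QZl (QC X) (QC Y0) YpX YpY; ring.
 by rewrite /Yp !QE cY.1 (QC Y X) (QC Y Y0) -[Q X Y]opprK -/x -[Q Y0 Y]opprK -/y0; field.
have [TT _]:= cone_sum cX cY0 nXY0. have nT: Q nu (X + Y0) = 0 by rewrite (QDr X Y0) nX nY addr0.
have YpT: Q Yp (X + Y0) = 0 by rewrite (QDr X Y0) YpX YpY addr0. have cs: Q nu Yp ^+ 2 <= 1 * (2 * x * y0 / q).
 apply: (le_trans (Q_CS TT nT YpT)); rewrite YpYp; apply: ler_wpM2r=>//.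
 by rewrite nn; have:= mulr_ge0 (mulr_ge0 a0 (ltW b0)) (ltW q0); lra.
rewrite mul1r -rr in cs. have nuY: - r <= Q nu Yp by rewrite lerNl; apply: ler_sqrp=>//; rewrite sqrrN.
have NE: Q N Y = - a * x + b * y0 + Q nu Yp.
 have e1: Q nu Yp = Q nu Y by rewrite /Yp !QDr !QNr !QZr nX nY; ring.
 by rewrite e1 /nu !QE -[Q X Y]opprK -/x -[Q Y0 Y]opprK -/y0; ring.
have ax: a * x <= x / (2 * q) by rewrite [leRHS]mulrC -[_^-1]mul1r ler_wpM2r. rewrite NE; lra.
Qed.

(** By [ext_sat] the caps in question are those with [Q Y N <= 0] on all missing rays, a closed
    condition. The coefficients of [null_decomp] together with [orth_bound] bound the candidates, so
    the linear function [Q X] attains its maximum. *)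
Lemma ext_max E X Y0 B: adm E X -> cone Y0 -> ~ reg E X Y0 ->
  (forall N, ext E X N -> Q N N = 1 -> Q N X <= B) ->
  exists N0, [/\ ext E X N0, Q N0 N0 = 1 & forall N, ext E X N -> Q N N = 1 -> Q N X <= Q N0 X].
move=> aE cY0 nY0 HB; have cX:= adm_cone aE.
have nXY0: ~ par X Y0 by move=> p; apply: nY0; apply: reg_par p (reg_self aE).
have [N1 [eN1 NN1 N1X]]: exists N', [/\ ext E X N', Q N' N' = 1 & 0 < Q N' X] by have [N /(ext_spacelike
cX)]:= ext_adm aE.
pose A:= [set N | [/\ Q N N = 1, Q N1 X <= Q X N & forall Y, cone Y -> ~ reg E X Y -> Q Y N <= 0]].
have Aext N: A N -> ext E X N.
 move=>[NN NX HN]; apply: ext_sat=>//; first by rewrite QC; exact: lt_le_trans NX.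
 move=> Z [cZ NZ]; apply: contrapT=> nZ; have:= HN _ cZ nZ; rewrite QC leNgt=>/negP; exact.
have extA N: ext E X N -> Q N N = 1 -> Q N1 X <= Q N X -> A N by move=> eN NN NX; split=>//; [rewrite (QC
X)|move=> Y cY nY; rewrite QC; exact: ext_reg_le nY].
have [TT _]:= cone_sum cX cY0 nXY0; have [C C0 HC]:= orth_bound TT.
have q0: 0 < - Q X Y0 by rewrite oppr_gt0 coneQ0. have cA: compact A.
 pose D:= 1 / (2 * Q N1 X) * `|X| + B / (- Q X Y0) * `|Y0| + (C + 1).
 apply: (@dotp_compact _ _ _ (d.+1%:R * D ^+ 2)).
  rewrite (_: A = [set N | Q N N = 1] `&` ([set N | Q N1 X <= Q X N] `&` [set N | forall Y, cone Y -> ~ reg E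
  X Y -> Q Y N <= 0])).
   apply: closedI; first by apply: closedEQ; exact: Q2_cont.
   apply: closedI; first by apply: closedGE; exact: Q_cont.
   apply: closedA=> Y; apply: closed_imply; apply: closed_imply. by apply: closedLE; exact: Q_cont.
  by apply/seteqP; split=> N [] // a [].
 move=> N AN; have eN:= Aext _ AN; case: (AN)=> NN NX _. have NX': Q N X <= B:= HB _ eN NN.
 have [q00 a0 b0 nn [nn0 [nX nY]]]:= null_decomp cX cY0 nXY0 NN eN.1 (ext_reg_le eN cY0 nY0).
 move: a0 b0 nn nn0 nX nY; set q:= - Q X Y0; set a:= _ / q; set b:= _ / q; set nu:= N - _ + _=> a0 b0 nn nn0 nX nY.
 apply: (le_trans (dotp_le_sqr_norm N)); rewrite ler_wpM2l // ler_sqr ?nnegrE //; last first.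
  rewrite /D; have h1: 0 <= 1 / (2 * Q N1 X) * `|X| by rewrite mulr_ge0 // divr_ge0 // mulr_ge0 // ltW.
  have h2: 0 <= B / (- Q X Y0) * `|Y0| by rewrite mulr_ge0 // divr_ge0 ?(ltW q0) //; apply: le_trans NX';
  rewrite ltW //; case: eN. by pos.
 have -> : N = a *: X - b *: Y0 + nu by rewrite /nu; apply/rowP=> i; rewrite !mxE; ring.
 apply: (le_trans (ler_normD _ _)); rewrite /D; apply: lerD.
  have e1: `|a *: X| = a * `|X| by rewrite normrZ ger0_norm.
  have e2: `|b *: Y0| = b * `|Y0| by rewrite normrZ gtr0_norm.
  apply: (le_trans (ler_normB _ _)); rewrite e1 e2; apply: lerD.
   apply: ler_wpM2r=>//; rewrite ler_pdivlMr ?mulr_gt0 //. have bq: b * q = Q N X by rewrite /b divfK ?gt_eqF.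
   rewrite (QC X N) in NX; have: a * Q N1 X <= a * Q N X by rewrite ler_wpM2l.
   have: a * Q N X = a * b * q by rewrite -bq mulrA. by move: nn nn0; lra.
  by apply: ler_wpM2r=>//; rewrite ler_pM2r ?invr_gt0.
 apply: ler_sqrp; last by pos. apply: (le_trans (sqr_le_dotp _)).
 have nT: Q nu (X + Y0) = 0 by rewrite (QDr X Y0) nX nY addr0.
 apply: (le_trans (HC _ nT)); have: C * Q nu nu <= C * 1.
  have p: 0 <= 2 * a * b * q by apply: mulr_ge0; [apply: mulr_ge0; [apply: mulr_ge0|]|]; rewrite // ltW.
  by apply: ler_wpM2l; [exact: ltW|rewrite nn lerBlDr lerDl].
 by rewrite expr2; nra.
have [||N0 /set_mem A0 HN0]:= @EVT_max_rV _ _ (Q X) A _ cA.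
- by exists N1; apply: extA.
- by apply: continuous_subspaceT; exact: Q_cont. exists N0; split; [exact: Aext|by case: A0 |].
move=> N eN NN; case: (lerP (Q N1 X) (Q N X))=> h.
 by have:= HN0 N (mem_set (extA _ eN NN h)); rewrite !(QC X).
by apply: (le_trans (ltW h)); case: A0=> _ h2 _; rewrite (QC N0).
Qed.

End Germ.

(** * The cylinder as a barrier *)

Section Barrier.

(** [s], [r] and [a], [b] are the components of [N] and [X] along [tau], [sig], and [u] is the
    product of the remaining parts. If [r ^+ 2 <= s ^+ 2], the reversed Cauchy-Schwarz inequality in
    the plane bounds [s * a - r * b] from below; otherwise the smallness of [b] gives
    [r * b <= s * a], and [u] alone is small enough. *)
Lemma barrier_real (s r a b u C: R): 0 <= s -> `|r| <= C * s -> C * `|b| <= a ->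
  0 <= a -> b ^+ 2 <= a ^+ 2 -> u ^+ 2 <= (1 + s ^+ 2 - r ^+ 2) * (a ^+ 2 - b ^+ 2) ->
  0 < - s * a + r * b + u -> (- s * a + r * b + u) ^+ 2 <= a ^+ 2 - b ^+ 2.
move=> s0 rC bC a0 ba uu v0; set A:= Num.sqrt (a ^+ 2 - b ^+ 2). have A0: 0 <= A:= sqrtr_ge0 _.
have AA: A ^+ 2 = a ^+ 2 - b ^+ 2 by rewrite sqr_sqrtr // subr_ge0.
rewrite -AA; suff h: - s * a + r * b + u <= A by rewrite ler_sqr ?nnegrE // ltW.
case: (lerP (r ^+ 2) (s ^+ 2))=> rs.
 pose q:= Num.sqrt (s ^+ 2 - r ^+ 2). have q0: 0 <= q:= sqrtr_ge0 _.
 have qq: q ^+ 2 = s ^+ 2 - r ^+ 2 by rewrite sqr_sqrtr // subr_ge0.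
 have rs': `|r| <= s by apply: ler_sqrp=>//; rewrite real_normK ?num_real.
 have ba': `|b| <= a by apply: ler_sqrp=>//; rewrite real_normK ?num_real. have h1: 0 <= s * a - r * b.
  rewrite subr_ge0; apply: (le_trans (ler_norm _)); rewrite normrM; exact: ler_pM.
 have h2: q * A <= s * a - r * b by apply: ler_sqrp=>//; rewrite exprMn qq AA; have:= sqr_ge0 (s * b - r * a); lra.
 have h3: u <= (1 + q) * A.
  apply: ler_sqrp; last by pos.
  apply: (le_trans uu); rewrite exprMn -AA; apply: ler_wpM2r; first exact: sqr_ge0. lra.
 lra.
have h1: u <= A.
 apply: ler_sqrp=>//; apply: (le_trans uu); rewrite AA -[leRHS]mul1r; apply: ler_wpM2r; lra.
have h2: r * b <= s * a.
 apply: (le_trans (ler_norm _)); rewrite normrM; apply: (@le_trans _ _ (C * s * `|b|)).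
  exact: ler_wpM2r.
 by rewrite mulrAC mulrC; exact: ler_wpM2l.
lra.
Qed.

(** [Q tau X ^+ 2 - Q sig X ^+ 2] is the squared density of the cylinder metric on the complement of
    two points of the sphere. The bound on [Q N sig] is what remains of the missing rays, and it
    suffices for [X] near the hyperplane [Q sig X = 0]. *)
Lemma barrier_cyl (tau sig N X: V) C: Q tau tau = -1 -> Q sig sig = 1 -> Q tau sig = 0 ->
  Q N N = 1 -> Q X X = 0 -> Q N tau <= 0 -> `|Q N sig| <= C * - Q N tau ->
  C * `|Q sig X| <= - Q tau X -> 0 <= - Q tau X -> 0 < Q N X ->
  Q N X ^+ 2 <= Q tau X ^+ 2 - Q sig X ^+ 2.
move=> tt ss ts NN XX Nt Ns sX tX NX.
pose s:= - Q N tau; pose r:= Q N sig; pose a:= - Q tau X; pose b:= Q sig X.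
pose nu:= N - s *: tau - r *: sig; pose xi:= X - a *: tau - b *: sig. have st: Q sig tau = 0 by rewrite QC.
have Nt': Q N tau = - s by rewrite opprK. have tN: Q tau N = - s by rewrite QC.
have sN: Q sig N = r by rewrite QC. have tX': Q tau X = - a by rewrite opprK.
have Xt: Q X tau = - a by rewrite QC. have Xs: Q X sig = b by rewrite QC.
have nt: Q nu tau = 0 by rewrite /nu !QE tt st Nt'; ring.
have xt: Q xi tau = 0 by rewrite /xi !QE tt st Xt; ring.
have xs: Q xi sig = 0 by rewrite /xi !QE ss ts Xs; ring.
have nn: Q nu nu = 1 + s ^+ 2 - r ^+ 2 by rewrite /nu !QE NN tt ss ts st tN sN Nt' -/r; ring.
have xx: Q xi xi = a ^+ 2 - b ^+ 2 by rewrite /xi !QE XX tt ss ts st Xt Xs tX' -/b; ring.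
have TT: Q tau tau < 0 by rewrite tt; lra. have cs:= Q_CS TT nt xt; rewrite nn xx in cs.
have NXE: Q N X = - s * a + r * b + Q nu xi.
 have -> : Q nu xi = Q N xi by rewrite {1}/nu !QDl !QNl !QZl (QC tau) (QC sig) xt xs; ring.
 by rewrite /xi !QE Nt' -/r; ring.
have -> : Q tau X ^+ 2 = a ^+ 2 by rewrite /a sqrrN.
rewrite NXE; apply: (@barrier_real s r a b (Q nu xi) C)=>//; first by lra.
 by rewrite -subr_ge0 -xx; exact: sp_orth TT xt.
by rewrite -NXE.
Qed.

(** Preservation of [Q] conjugates [L^T] to the inverse of [L], so eigenvalues come in reciprocal
    pairs. *)
Lemma lor_eigen (L: 'M[R]_d.+1) Y0 (l: R): lor L -> Y0 != 0 -> Y0 *m L = l *: Y0 -> l != 0 ->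
  exists2 a: V, a != 0 & a *m L = l^-1 *: a.
move=>[q _] Yn YL ln.
have LL: L *m qeta *m L^T = qeta by apply: Q_nondeg=> X Y; rewrite -QmxE -q QmxE trmx_mul !mulmxA.
have: \det (L - l^-1%:M) = 0.
 have e1: (L - l^-1%:M) *m qeta *m L^T = - (l^-1 *: (qeta *m (L^T - l%:M))).
  rewrite mulmxBl mulmxBl LL mul_scalar_mx -scalemxAl mulmxBr scalerBr mul_mx_scalar.
  by rewrite scalerA mulVf // scale1r opprB.
 have d0: \det (L^T - l%:M) = 0.
  rewrite -det_tr linearB /= trmxK tr_scalar_mx; apply/eqP/det0P; exists Y0=>//.
  by rewrite mulmxBr YL mul_mx_scalar subrr.
 have: \det ((L - l^-1%:M) *m qeta *m L^T) = 0 by rewrite e1 -scaleN1r scalerA detZ detM d0 !mulr0.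
 rewrite !detM=>/eqP; rewrite !mulf_eq0=>/orP[/orP[/eqP //|]|].
  move=> h; have:= congr1 determinant (@qetaK R d); rewrite detM det1 (eqP h) mul0r=>/eqP.
  by rewrite eq_sym oner_eq0.
 rewrite det_tr=> h; have:= congr1 determinant LL; rewrite !detM (eqP h) !mul0r.
 move=> h0; have:= congr1 determinant (@qetaK R d); rewrite detM det1 -h0 mul0r=>/eqP.
 by rewrite eq_sym oner_eq0.
move/eqP/det0P=>[a an aL]; exists a=>//. by move/eqP: aL; rewrite mulmxBr mul_mx_scalar subr_eq0=>/eqP.
Qed.

End Barrier.

Section Weight.
Context (H: mirror_axioms S) (d3: (3 <= d)%N) {dens: T -> R} (HD: weight_axioms S dens).

Lemma adm_gt0 E X: adm E X -> 0 < dens (E X).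
by move=>[i [L [N [lL NX HN]]]]; have [W ->]:= HN _ NX; exact: (wa_pos HD).
Qed.

Lemma adm_hom E X t: adm E X -> 0 < t -> dens (E (t *: X)) = t * dens (E X).
move=>[i [L [N [lL NX HN]]]] t0; have p: par X (t *: X) by exists t.
by rewrite (HN _ (cap_par p NX)).2 (HN _ NX).2 -scalemxAl (wa_hom HD) //; case: (HN _ NX).
Qed.

Lemma adm_usc E X N c: adm E X -> c * dens (E X) < Q N X ->
  exists N', cap N' X /\ forall Z, cap N' Z -> c * dens (E Z) < Q N Z.
move=>[i [L [N1 [lL NX HN]]]] h; have [W e]:= HN _ NX. have [L' [lL' LL' L'L]]:= lor_inv lL.
have h': c * dens (mmap (m:= S) i (X *m L)) < Q (N *m L) (X *m L) by rewrite -e lL.1.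
have [N2 [N2X HN2]]:= wa_usc HD W h'.
have [N3 [N3X HN3]]:= cap_lor lL N2X NX.1; have [N4 [N4X HN4]]:= capI NX N3X.
exists N4; split=>// Z /HN4 [a b]; have:= HN2 _ (HN3 _ b). by rewrite lL.1 -(HN _ a).2.
Qed.

End Weight.

(** * Exclusion of unbounded caps *)

Section Sphere.
Context (H: mirror_axioms S) (d3: (3 <= d)%N).
Context {dens: T -> R} (HD: density_axioms S dens) (Mhaus: hausdorff_space M) (Mcpt: compact [set: M]) (Mconn: connected [set: M]).
Context (M0: exists p: M, True).
Local Notation adm_gt0:= (adm_gt0 (da_weight HD)).
Local Notation adm_hom:= (adm_hom (da_weight HD)).
Local Notation adm_usc:= (adm_usc (da_weight HD)).

Lemma adm_pt_par E X Y: adm E X -> par X Y -> pt (E X) = pt (E Y).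
move=>[i [L [N [lL NX HN]]]] p; have [W1 e1]:= HN _ NX; have [W2 e2]:= HN _ (cap_par p NX).
by rewrite e1 e2; apply/(ma_fold H W1 W2); left; exact: lor_par.
Qed.

Lemma adm_cyl E X (tau sig: V) c: adm E X ->
  Q tau tau = -1 -> Q sig sig = 1 -> Q tau sig = 0 -> Q sig X = 0 -> 0 < c ->
  c * dens (E X) ^+ 2 = Q tau X ^+ 2 ->
  (exists N, cap N X /\ forall Z, cap N Z ->
     c * dens (E Z) ^+ 2 <= Q tau Z ^+ 2 - Q sig Z ^+ 2) -> False.
move=>[i [L [N1 [lL NX HN]]]] tt ss ts sX c0 eX [N2 [N2X HN2]]; have [W e]:= HN _ NX.
have [L' [lL' LL' L'L]]:= lor_inv lL.
apply: (da_cyl HD (tau:= tau *m L) (sig:= sig *m L) W _ _ _ _ c0); rewrite ?lL.1 //.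
 by rewrite -e.
have [N3 [N3X HN3]]:= capI NX N2X.
exists (N3 *m L); split; first by split; [exact: lL.2 NX.1|rewrite lL.1; case: N3X].
move=> Z [cZ NZ]; have N3Z: cap N3 (Z *m L').
 by split; [exact: lL'.2|rewrite -(lL.1 N3) -mulmxA L'L mulmx1].
have [a b]:= HN3 _ N3Z; have:= HN2 _ b; rewrite (HN _ a).2.
by rewrite -mulmxA L'L mulmx1 -(lL.1 tau) -(lL.1 sig) -mulmxA L'L mulmx1.
Qed.

Lemma adm_flat E X Y c: adm E X -> cone Y -> 0 < c ->
  c * dens (E X) = - Q Y X ->
  (exists N, cap N X /\ forall Z, cap N Z -> c * dens (E Z) <= - Q Y Z) -> False.
move=>[i [L [N1 [lL NX HN]]]] cY c0 eX [N2 [N2X HN2]]; have [W e]:= HN _ NX.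
have [L' [lL' LL' L'L]]:= lor_inv lL. apply: (da_flat HD (Y:= Y *m L) W (lL.2 _ cY) c0); rewrite ?lL.1 //.
 by rewrite -e.
have [N3 [N3X HN3]]:= capI NX N2X.
exists (N3 *m L); split; first by split; [exact: lL.2 NX.1|rewrite lL.1; case: N3X].
move=> Z [cZ NZ]; have N3Z: cap N3 (Z *m L').
 by split; [exact: lL'.2|rewrite -(lL.1 N3) -mulmxA L'L mulmx1].
have [a b]:= HN3 _ N3Z; have:= HN2 _ b; rewrite (HN _ a).2.
by rewrite -mulmxA L'L mulmx1 -(lL.1 Y) -mulmxA L'L mulmx1.
Qed.

Lemma germ_at (p: M): exists E X, adm E X /\ pt (E X) = p.
have [i [X [WX e]]]:= ma_onto H p; exists (mmap (m:= S) i), X; split=>//.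
have [N [NX HN]]:= ma_dom_open H WX; exists i, 1%:M, N; split=>//; first exact: lor1.
by move=> Z /HN; rewrite mulmx1.
Qed.

(** [Q N X] and [dens] are both carried along by the comparing Lorentz map and scale alike, so the
    normalised size depends on the point of M only. *)
Lemma ext_transfer E X E' X' N': adm E X -> adm E' X' -> pt (E X) = pt (E' X') ->
  ext E' X' N' -> exists N, [/\ ext E X N, Q N N = Q N' N' &
     Q N X / dens (E X) = Q N' X' / dens (E' X')].
move=> aE aE' e [N'X' [E1 [aE1 HE1]]]; have cX:= adm_cone aE. have [L [lL pL aL]]:= adm_cmp H aE aE' e.
have [L' [lL' LL' L'L]]:= lor_inv lL.
have NL Z: Q (N' *m L') Z = Q N' (Z *m L) by rewrite -(lL.1 (N' *m L')) -mulmxA L'L mulmx1.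
exists (N' *m L'); split.
- split; first by rewrite NL -(par_Q N' pL).
 exists (fun Z=> E1 (Z *m L)); split.
  apply: (agreeT _ (agreeC aL)); apply: agree_lor=>//. exact: agree_par (par_sym pL) aE1.
 move=> Z [cZ]; rewrite NL=> NZ; apply: adm_lor=>//; apply: HE1; split=>//; exact: lL.2.
- by rewrite lL'.1.
- have a1: adm E' (X *m L):= adm_par (par_sym pL) aE'.
 rewrite NL (agree_eq aL); case: pL=> t t0 ->. rewrite QZr adm_hom //; have:= adm_gt0 a1=> p0.
 by field; rewrite !gt_eqF.
Qed.

(** The same cap serves the neighbouring rays with nearly the same ratio: this is the lower
    semicontinuity of the normalised size. *)
Lemma cap_from E X N E0: agree E0 E X -> adm E X -> cap N X -> (forall Z, cap N Z -> adm E0 Z) ->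
  forall c, c * dens (E X) < Q N X -> exists O: set M, [/\ open O, O (pt (E X)) &
   forall p, O p -> exists Z, [/\ adm E0 Z, pt (E0 Z) = p, ext E0 Z N & c < Q N Z / dens (E0 Z)]].
move=> a0 aE NX H0 c hc; have aE0:= H0 _ NX; rewrite -(agree_eq a0) in hc.
have [N1 [N1X HN1]]:= adm_usc aE0 hc; have [N2 [N2X HN2]]:= capI NX N1X.
have [U [oU UX HU]]:= adm_open H aE0 N2X. exists U; split=>//; first by rewrite -(agree_eq a0).
move=> p /HU [Z [/HN2 [NZ N1Z] <-]]; exists Z; split=>//; first exact: H0.
 by split; [case: NZ | exists E0; split=>//; apply: agree_refl; case: NZ].
by rewrite ltr_pdivlMr ?adm_gt0 //; [exact: HN1|exact: H0].
Qed.

Lemma removable E X F Y0 e W D: adm E X -> cone Y0 -> ~ par X Y0 -> agree F E X ->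
  (forall Z, cone Z -> ~ par Z Y0 -> adm F Z) -> cap D Y0 -> (forall Z, cap D Z -> adm e Z) ->
  cap D W -> ~ par W Y0 -> agree F e W -> reg E X Y0.
move=> aE cY0 nXY0 aFE HF DY0 He DW nW aFe; have cX:= adm_cone aE.
have yes Z: cone Z -> ~ par Z Y0 -> cap (- Y0) Z by move=> cZ n; apply: cone_cap_all=>// /par_sym.
have no Z: cap (- Y0) Z -> ~ par Z Y0 by move=>[cZ]; rewrite QNl=> h /par_sym /(par_Q0 cY0) h2; rewrite h2
oppr0 ltxx in h. have HF' Z: cap (- Y0) Z -> adm F Z by move=> h; apply: HF (no _ h); case: h.
have [F2 [_ [h1 h2]]]:= adm_glue2 H d3 Mhaus (yes _ DW.1 nW) DW aFe HF' He. have [TT T0]:= cone_sum cX cY0 nXY0.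
(* [X + Y0] is timelike and forward, so this cap is the whole cone. *)
have lt:= coneQ0 cX cY0 nXY0. exists (- (X + Y0)); split; last first.
 by split=>//; rewrite QNl QDl cY0.1 addr0 oppr_gt0.
split; first by rewrite QNl QDl cX.1 add0r oppr_gt0 QC.
exists F2; split; first by apply: (agreeT _ aFE); apply: h1; exact: yes.
move=> Z [cZ _]; case: (pselect (par Z Y0))=>[p|n].
 have DZ: cap D Z:= cap_par (par_sym p) DY0. by apply: (adm_agree (agreeC (h2 _ DZ))); exact: He.
by apply: (adm_agree (agreeC (h1 _ (yes _ cZ n)))); exact: HF.
Qed.

(** The germ now extends to all rays but [Y0], a Euclidean space with [Y0] at infinity. A Lorentz
    map relating two rays over the same point fixes the vector [Y0], hence [- Q Y0 Z / dens]
    descends to M, and at its minimum the flat metric |dX|^2 / (Q Y0 X)^2 touches the given one. *)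
Lemma no_flat E X Y0: adm E X -> cone Y0 -> ~ reg E X Y0 ->
  (forall B, exists N, [/\ ext E X N, Q N N = 1 & B < Q N X]) -> False.
move=> aE cY0 nY0 Hinf; have cX:= adm_cone aE. have HU:= reg_flat aE cY0 nY0 Hinf.
have nXY0: ~ par X Y0 by move=> p; apply: nY0; apply: reg_par p (reg_self aE).
have [F [aFE HF0]]:= germ_region H d3 Mhaus aE.
have HF Z: cone Z -> ~ par Z Y0 -> adm F Z by move=> cZ n; apply: HF0; exact: HU.
have yes Y Z: cone Y -> cone Z -> ~ par Z Y -> cap (- Y) Z by move=> cY cZ n; apply: cone_cap_all=>// /par_sym.
have no Y Z: cone Y -> cap (- Y) Z -> ~ par Z Y by move=> cY [cZ]; rewrite QNl=> h /par_sym /(par_Q0 cY) h2;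
rewrite h2 oppr0 ltxx in h.  have off N Z A: cap N Z -> cone A -> exists W, cap N W /\ ~ par W A.
 move=> NZ cA; case: (pselect (par Z A))=>[p|n]; last by exists Z.
 have [B [cB nB]]: exists B, cone B /\ ~ par Z B.
  case: (pselect (par Z X))=>[pX|n]; last by exists X.
  by exists Y0; split=>// pY; apply: nXY0; apply: par_trans (par_sym pX) pY.
 have [W [WX WY WW _ _]]:= npath_ex2 d3 0 0 NZ.1 cB nB.
 have: \forall t \near (0: R), 0 < Q N (npath Z W B t) by apply: (@npath_cont _ _ Z W B N 0 [set r | 0 < r]);
 apply: lt_nbhsr; rewrite npath0; case: NZ. move=>/nbhs_ballP [e /= e0 He]; exists (npath Z W B (e / 2)); split.
  split; first by apply: npath_cone=>//; case: NZ. by apply: He; rewrite /ball /= sub0r normrN gtr0_norm; lra.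
 move=> p2; have p3:= par_trans p (par_sym p2).
 have:= par_Q0 NZ.1 p3; rewrite -{1}(npath0 Z W B) npath_Q //; [|by case: NZ.1|by case: cB].
 have:= coneQ0 NZ.1 cB nB=> lt; rewrite subr0=>/eqP; rewrite mulf_eq0 lt_eqF //= sqrf_eq0. by pos.
have key Z Z': cone Z -> cone Z' -> ~ par Z Y0 -> ~ par Z' Y0 -> pt (F Z) = pt (F Z') -> - Q Y0 Z / dens (F Z)
= - Q Y0 Z' / dens (F Z').
 move=> cZ cZ' nZ nZ' e. have [L [lL pL aL]]:= adm_cmp H (HF _ cZ nZ) (HF _ cZ' nZ') e.
 have [L' [lL' LL' L'L]]:= lor_inv lL. have cYL: cone (Y0 *m L'):= lL'.2 _ cY0.
 have parL A B: par (A *m L) B -> par A (B *m L') by move=> p; have:= lor_par L' p; rewrite -mulmxA LL' mulmx1.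
 have aFL A: cone A -> ~ par A (Y0 *m L') -> adm (fun Z=> F (Z *m L)) A.
  move=> cA n; apply: adm_lor=>//; apply: HF; first exact: lL.2. by move=>/parL.
 have nZY: ~ par Z (Y0 *m L').
  move=> p; apply: nZ'; have:= par_trans (par_sym (lor_par L p)) pL. by rewrite -mulmxA L'L mulmx1=>/par_sym.
 have agW W: cone W -> ~ par W Y0 -> ~ par W (Y0 *m L') -> agree F (fun Z=> F (Z *m L)) W.
  move=> cW n1 n2; apply: (ident2 H d3 Mhaus (A:= - Y0) (B:= - (Y0 *m L')) (yes _ _ cY0 cZ nZ) (yes _ _ cY0 cW
  n1) (yes _ _ cYL cZ nZY).2 (yes _ _ cYL cW n2).2 _ aL).
  move=> A h1 h2; split; first exact: HF h1.1 (no _ _ cY0 h1).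
  by apply: (aFL _ h1.1); apply: no cYL (conj h1.1 h2).
 (* Otherwise the transported model [F (Z *m L)] is defined around [Y0], which is then not
    missing. *)
 have pY: par (Y0 *m L') Y0.
  apply: contrapT=> n; apply: nY0. have h:= yes _ _ cYL cY0 (fun p=> n (par_sym p)).
  have [W [hW nW]]:= off _ _ _ h cY0. apply: (removable aE cY0 nXY0 aFE HF h _ hW nW).
   by move=> A hA; apply: (aFL _ hA.1); apply: no cYL hA.
  by apply: agW=>//; [case: hW|exact: no cYL hW].
 (* If [l] were not 1, the reciprocal eigenvalue would give a second fixed ray [b], at which
    [F (b *m L) = F b] contradicts the homogeneity of [dens]. *)
 case: pY=> l l0 YL. have YL2: Y0 *m L = l *: Y0 by rewrite {1}YL -scalemxAl -mulmxA L'L mulmx1. have l1: l = 1.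
  apply: contrapT=>/eqP ln. have Yn: Y0 != 0 by apply/eqP=> y; case: cY0; rewrite y mxE ltxx.
  have [a an aL']:= lor_eigen lL Yn YL2 (lt0r_neq0 l0). have aa: Q a a = 0.
   have:= lL.1 a a; rewrite aL' !QE=> h.
   have: (l^-1 ^+ 2 - 1) * Q a a = 0 by rewrite expr2 mulrBl mul1r -mulrA h subrr.
   move=>/eqP; rewrite mulf_eq0=>/orP[|/eqP //]. rewrite exprVn subr_eq0 invr_eq1=>/eqP h2; exfalso.
   have: (l - 1) * (l + 1) = 0 by lra. move=>/eqP; rewrite mulf_eq0 subr_eq0 (negPf ln) /= gt_eqF //; lra.
  have a0n: a 0 0 != 0.
   apply: contra an=>/eqP a0; rewrite (@sp_eq0 _ _ a) ?a0 ?scale0r //. by move: aa; rewrite QspE a0 mulr0 subr0.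
  have [b cb bL]: exists2 b, cone b & b *m L = l^-1 *: b.
   case: (ltrgt0P (a 0 0))=> a0; last by rewrite a0 eqxx in a0n.
    by exists a.
   by exists (- a); [split; [rewrite !QE aa !oppr0|rewrite mxE oppr_gt0]|rewrite mulNmx aL' scalerN].
  have nb: ~ par b Y0.
   move=>/par_sym [t t0 bE]; move: bL; rewrite bE -scalemxAl YL2 !scalerA=> h.
   have: (t * l - l^-1 * t) *: Y0 = 0 by rewrite scalerBl h subrr.
   move=>/eqP; rewrite scaler_eq0 (negPf Yn) orbF (mulrC t) -mulrBl mulf_eq0 (gt_eqF t0) orbF.
   rewrite subr_eq0=>/eqP h2; have: l * l = 1 by rewrite {2}h2 mulfV ?gt_eqF.
   move=> h3; have: (l - 1) * (l + 1) = 0 by lra.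
   move=>/eqP; rewrite mulf_eq0 subr_eq0 (negPf ln) /= gt_eqF //; lra.
  have nb2: ~ par b (Y0 *m L') by move=> p; apply: nb; apply: par_trans p _; exists l.
  have:= agree_eq (agW _ cb nb nb2); rewrite bL=> h.
  have:= congr1 dens h; have ab:= HF _ cb nb; rewrite adm_hom ?invr_gt0 //. have:= adm_gt0 ab=> p0 h2.
  have: l^-1 = 1 by apply: (mulIf (lt0r_neq0 p0)); rewrite mul1r. by move=>/eqP; rewrite invr_eq1 (negPf ln).
 rewrite l1 scale1r in YL2. rewrite (agree_eq aL); case: pL=> t t0 ->. have cZL: cone (Z *m L):= lL.2 _ cZ.
 have nZL: ~ par (Z *m L) Y0 by move=>/parL. rewrite adm_hom ?QZr; [|exact: HF|by []].
 have:= adm_gt0 (HF _ cZL nZL)=> p0. have q: Q Y0 (Z *m L) = Q Y0 Z by rewrite -{1}YL2 lL.1.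
 by rewrite q; field; rewrite !gt_eqF.
(* The image of [F] is open. It is closed because a chart meeting it is a transport of [F], and the
   only ray that could escape corresponds to [Y0], which would then be removable. *)
have onto p: exists Z, [/\ cone Z, ~ par Z Y0 & pt (F Z) = p].
 pose Im:= [set p | exists Z, [/\ cone Z, ~ par Z Y0 & pt (F Z) = p]]. have oIm: open Im.
  rewrite openE=> q [Z [cZ nZ <-]]. have [U [oU UZ HU2]]:= adm_open H (HF _ cZ nZ) (yes _ _ cY0 cZ nZ).
  apply: (filterS _ (open_nbhs_nbhs (conj oU UZ))).
  by move=> r /HU2 [W [hW <-]]; exists W; split=>//; [case: hW|exact: no cY0 hW].
 have cIm: closed Im.
  apply: closed_if=> q nq; have [e [A [ae eA]]]:= germ_at q.
  have [D [DA HDA]]:= adm_near ae; have [U [oU UA HU2]]:= adm_open H ae DA.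
  exists U; split=>//; first by rewrite -eA. move=> r /HU2 [B [DB <-]] [Z [cZ nZ eZ]]; apply: nq.
  have [L [lL pL aL]]:= adm_cmp H (HF _ cZ nZ) (HDA _ DB) eZ. have [L' [lL' LL' L'L]]:= lor_inv lL.
  have cA:= adm_cone ae. case: (pselect (par (A *m L') Y0))=>[pA|nA].
   exfalso; apply: nY0. have capL W: cap (D *m L') W <-> cap D (W *m L).
    split=>-[c h]; split; try exact: lL.2.
    - by rewrite -(lL'.1 D) -mulmxA LL' mulmx1.
    - by have:= lL'.2 _ c; rewrite -mulmxA LL' mulmx1.
    - by rewrite -(lL.1 (D *m L')) -mulmxA L'L mulmx1.
   have DL: cap (D *m L') Y0 by apply: (cap_par pA); apply/capL; rewrite -mulmxA L'L mulmx1.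
   have DZ: cap (D *m L') Z by apply/capL; exact: cap_par (par_sym pL) DB.
   apply: (removable aE cY0 nXY0 aFE HF DL _ DZ nZ aL)=> W hW.
   by apply: adm_lor=>//; [case: hW|apply: HDA; apply/capL].
  exists (A *m L'); split=>//; first exact: lL'.2. have cYL: cone (Y0 *m L):= lL.2 _ cY0.
  have conv W: par W (Y0 *m L) -> par (W *m L') Y0 by move=>/(lor_par L'); rewrite -mulmxA LL' mulmx1.
  have conv2 W: par (W *m L') Y0 -> par W (Y0 *m L) by move=>/(lor_par L); rewrite -mulmxA L'L mulmx1.
  have nB: ~ par B (Y0 *m L).
   move=> pp; apply: nZ; have:= par_trans pL pp=>/(lor_par L'). by rewrite -!mulmxA LL' !mulmx1.
  have: agree (fun W=> F (W *m L')) e A.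
   apply: (ident2 H d3 Mhaus (A:= D) (B:= - (Y0 *m L)) DB DA (yes _ _ cYL DB.1 nB).2 (yes _ _ cYL cA (fun pp=>
   nA (conv _ pp))).2).
    move=> W h1 h2; split; last exact: HDA.
    apply: adm_lor=>//; [exact: h1.1|apply: HF; first exact: lL'.2 h1.1].
    by move=>/conv2; apply: no cYL (conj h1.1 h2).
   apply: (agree_par pL). have c2: cone (Z *m L):= lL.2 _ cZ.
   have a2: agree F (fun W=> e (W *m L)) (Z *m L *m L') by rewrite -mulmxA LL' mulmx1.
   have:= agree_lor lL' c2 a2=> h; apply: (agreeT h).
   have [N NZL]:= cap_ex c2; exists N; split=>// W _; by rewrite -mulmxA L'L mulmx1.
  by move=>/agree_eq ->.
 have Im0: Im !=set0 by exists (pt (F X)); exists X. have: Im = setT.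
  have:= Mconn; rewrite /connected=>/(_ Im Im0); apply.
   by exists Im=>//; rewrite setTI.
  by exists Im=>//; rewrite setTI.
 by move=> e; have: [set: M] p by []; rewrite -e.
pose Z_ p:= projT1 (cid (onto p)).
have Z_P p: [/\ cone (Z_ p), ~ par (Z_ p) Y0 & pt (F (Z_ p)) = p] by rewrite /Z_; case: cid.
pose K p:= - Q Y0 (Z_ p) / dens (F (Z_ p)).
have hpos Z: cone Z -> ~ par Z Y0 -> 0 < - Q Y0 Z by move=> cZ n; rewrite oppr_gt0 QC coneQ0.
have [|p0 Hp0]:= lsc_min (K:= K) Mcpt M0.
 move=> c; apply: closed_if=> p /negP; rewrite -ltNge=> cK. have [cZ nZ eZ]:= Z_P p; have aZ:= HF _ cZ nZ.
 have c2: c * dens (F (Z_ p)) < Q (- Y0) (Z_ p) by rewrite QNl -ltr_pdivlMr // adm_gt0.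
 have [U [oU Up HU2]]:= cap_from (agree_refl F cZ) aZ (yes _ _ cY0 cZ nZ) (fun Z h=> HF _ h.1 (no _ _ cY0 h)) c2.
 exists U; split=>//; first by rewrite -eZ. move=> q /HU2 [Z [aZ' eq [NZ _] cQ]]; apply/negP; rewrite -ltNge.
 have [cq nq eq']:= Z_P q; have cZ':= adm_cone aZ'. have nZ': ~ par Z Y0 by apply: no cY0 (conj cZ' NZ).
 by rewrite /K (key _ _ cq cZ' nq nZ') ?eq' // -QNl.
have [cZ nZ eZ]:= Z_P p0; have aZ:= HF _ cZ nZ. have d0:= adm_gt0 aZ.
have K0: 0 < K p0 by rewrite divr_gt0 // hpos. apply: (adm_flat aZ cY0 K0); first by rewrite /K divfK // gt_eqF.
exists (- Y0); split; first exact: yes. move=> Z hZ; have nZ':= no _ _ cY0 hZ; have aZ':= HF _ hZ.1 nZ'.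
have [cq nq eq]:= Z_P (pt (F Z)); have:= Hp0 (pt (F Z)). rewrite {2}/K (key _ _ cq hZ.1 nq nZ') // => h.
by rewrite -ler_pdivlMr // adm_gt0.
Qed.

End Sphere.

(** * The extremal germ and the existence of a global model *)

Section Extremal.
Context (H: mirror_axioms S) (d3: (3 <= d)%N).
Context {dens: T -> R} (HD: density_axioms S dens) (Mhaus: hausdorff_space M) (Mcpt: compact [set: M]) (Mconn: connected [set: M]).
Context (M0: exists p: M, True).

(** First variation of a maximal cap: moving [N0] by [e *: Z] raises [Q N X] to first order but
    changes [Q N N] only to second order, while the missing rays stay outside. *)
Lemma ext_improve E X N0 Z: adm E X -> ext E X N0 -> Q N0 N0 = 1 ->
  (forall N, ext E X N -> Q N N = 1 -> Q N X <= Q N0 X) ->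
  Q N0 Z = 0 -> 0 < Q Z X ->
  (forall Y, cone Y -> ~ reg E X Y -> Q N0 Y = 0 -> Q Z Y < 0) -> False.
move=> aE eN0 NN0 Hmax NZ ZX HZ; have cX:= adm_cone aE.
pose K2:= [set Y: V | [/\ Q Y Y = 0, Y 0 0 = 1 & forall N, ext E X N -> Q N Y <= 0]].
have K2P Y: K2 Y -> cone Y /\ ~ reg E X Y.
 move=>[YY Y0 HY]; split; first by split=>//; rewrite Y0 ltr01.
 by move=>[N [eN [_ NY]]]; have:= HY N eN; rewrite leNgt NY.
have cK2: compact K2.
 apply: (@dotp_compact _ _ _ 2).
  rewrite (_: K2 = [set Y: V | Q Y Y = 0] `&` ([set Y: V | Y 0 0 = 1] `&` [set Y: V | forall N, ext E X N
  -> Q N Y <= 0])).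
   apply: closedI; first by apply: closedEQ; exact: Q2_cont.
   apply: closedI; first by apply: closedEQ; exact: coordC. apply: closedA=> N; apply: closed_imply.
   by apply: closedLE; exact: Q_cont.
  by apply/seteqP; split=> Y [] // a [].
 by move=> Y [YY Y0 _]; move: YY; rewrite /Q Y0; lra.
(* The missing rays, taken at height 1, form a compact set. Where [Q Z Y < 0] the move helps; on the
   rest [Q N0] is bounded above by a negative number. *)
have [e0 e00 He0]: exists2 e0: R, 0 < e0 & forall e, 0 < e <= e0 -> forall Y, K2 Y -> Q N0 Y + e * Q Z Y <= 0.
 pose K3:= K2 `&` [set Y | 0 <= Q Z Y].
 have cK3: compact K3 by apply: compact_closedI=>//; apply: closedGE; exact: Q_cont.
 have off e Y: 0 < e -> K2 Y -> Q Z Y < 0 -> Q N0 Y + e * Q Z Y <= 0.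
  move=> e0 KY ZY; have [cY nY]:= K2P _ KY; have:= ext_reg_le eN0 cY nY.
  have pp: e * Q Z Y < 0 by rewrite pmulr_rlt0. by move=> h; lra.
 case: (pselect (K3 !=set0))=>[K30|nK3]; last first.
  exists 1=>// e /andP[e0 _] Y KY; apply: off=>//; rewrite ltNge; apply/negP=> ZY. by apply: nK3; exists Y.
 have [||Ym /set_mem [KYm ZYm] Hm]:= @EVT_max_rV _ _ (Q N0) K3 _ cK3=>//.
  by apply: continuous_subspaceT; exact: Q_cont.
 have [||Yb /set_mem [KYb ZYb] Hb]:= @EVT_max_rV _ _ (Q Z) K3 _ cK3=>//.
  by apply: continuous_subspaceT; exact: Q_cont.
 have m0: 0 < - Q N0 Ym.
  have [cY nY]:= K2P _ KYm; have:= ext_reg_le eN0 cY nY. rewrite le_eqVlt=>/orP[/eqP e|]; last by lra.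
  by have:= HZ _ cY nY e; rewrite ltNge ZYm.
 exists (- Q N0 Ym / (1 + Q Z Yb)); first by rewrite divr_gt0 // ltr_pwDl.
 move=> e /andP[e0]; rewrite ler_pdivlMr ?ltr_pwDl // => eb Y KY. case: (ltrP (Q Z Y) 0)=> ZY; first exact: off.
 have h1:= Hm _ (mem_set (conj KY ZY)); have h2:= Hb _ (mem_set (conj KY ZY)).
 have: e * Q Z Y <= e * Q Z Yb by rewrite ler_pM2l. lra.
set a:= Q N0 X in Hmax; set b:= Q Z X in ZX; set c:= Q Z Z. have a0: 0 < a by case: eN0.
have nc:= normr_ge0 c; have lc:= ler_norm c; have lc2: - c <= `|c| by rewrite -normrN ler_norm.
have ac: 0 <= a ^+ 2 * `|c| by pos. have D0: 0 < 1 + `|c| + a ^+ 2 * `|c| by lra.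
(* Small enough that [1 + e ^+ 2 * c] stays positive and that the gain, of order [e * a * b],
   exceeds the loss [e ^+ 2 * a ^+ 2 * c] caused by normalising. *)
pose e:= Num.min e0 (Num.min 2^-1 (a * b / 2) / (1 + `|c| + a ^+ 2 * `|c|)). have ab:= mulr_gt0 a0 ZX.
have ep: 0 < e by rewrite lt_min e00 divr_gt0 // lt_min invr_gt0 ltr0n divr_gt0.
have: e <= Num.min 2^-1 (a * b / 2) / (1 + `|c| + a ^+ 2 * `|c|) by rewrite ge_min lexx orbT.
rewrite ler_pdivlMr // le_min=>/andP[h1 h2].
have ec: e * (1 + `|c|) <= 2^-1 by have:= mulr_ge0 (ltW ep) ac; lra.
have e1: e <= 2^-1 by have:= mulr_ge0 (ltW ep) nc; lra.
have eac: e * (a ^+ 2 * `|c|) < a * b by have:= mulr_ge0 (ltW ep) nc; lra.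
have QN1: Q (N0 + e *: Z) (N0 + e *: Z) = 1 + e ^+ 2 * c by rewrite !QE NN0 NZ (QC Z N0) NZ -/c; ring.
have QN1X: Q (N0 + e *: Z) X = a + e * b by rewrite !QE. have eec: e ^+ 2 * `|c| <= e * 2^-1.
 rewrite expr2 -mulrA ler_pM2l //; have:= mulr_ge0 (ltW ep) nc; lra.
have Q1p: 0 < 1 + e ^+ 2 * c.
 have: - (e ^+ 2 * `|c|) <= e ^+ 2 * c by rewrite -mulrN ler_wpM2l ?sqr_ge0 // lerNl. lra.
have eN1: ext E X (N0 + e *: Z).
 apply: ext_sat=>//; first by rewrite QN1X; have:= mulr_gt0 ep ZX; lra. move=> W [cW NW]; apply: contrapT=> nW.
 have W0:= cW.2. have KW: K2 ((W 0 0)^-1 *: W).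
  split; [by rewrite !QE cW.1 !mulr0|by rewrite mxE mulVf ?gt_eqF |].
  by move=> N eN; rewrite QZr pmulr_rle0 ?invr_gt0 //; exact: ext_reg_le nW.
 have ee: 0 < e <= e0 by rewrite ep ge_min lexx.
 have:= He0 _ ee _ KW; rewrite !QZr mulrCA -mulrDr pmulr_rle0 ?invr_gt0 //. by move: NW; rewrite !QE; lra.
set N1:= N0 + _ in QN1 QN1X eN1; clearbody N1. set s:= Num.sqrt (1 + e ^+ 2 * c). have s0: 0 < s by pos.
have ss: s ^+ 2 = 1 + e ^+ 2 * c by rewrite sqr_sqrtr // ltW. have si0: 0 < s^-1 by pos.
have u1: Q (s^-1 *: N1) (s^-1 *: N1) = 1 by rewrite QZl QZr QN1 -ss; field; rewrite gt_eqF.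
have:= Hmax _ (ext_scale si0 eN1) u1; rewrite QZl QN1X mulrC ler_pdivrMr // => h3.
have: (a + e * b) ^+ 2 <= (a * s) ^+ 2.
 have p1: 0 <= a + e * b by have:= mulr_gt0 ep ZX; lra. have p2: 0 <= a * s by lra. by rewrite ler_sqr.
rewrite exprMn ss; apply/negP; rewrite -ltNge. have: e ^+ 2 * (a ^+ 2 * c) <= e * (a * b).
 rewrite expr2 -mulrA ler_pM2l //; apply: le_trans (ltW eac); rewrite ler_pM2l //; apply: ler_wpM2l lc; exact: sqr_ge0.
have:= mulr_gt0 ep (mulr_gt0 a0 ZX); have:= sqr_ge0 (e * b).
clear -R; move: (e) (c) (b) (a)=> {}e {}c {}b {}a u1 u2 u3; nra.
Qed.

(** [T0 / a] is the point of the hyperboloid in the complement of [N0] that represents [X] in the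
    hyperbolic ball [cap N0]. The elements of [K] are the directions, all of length [1 / a], in
    which the missing rays on the boundary sphere are seen from it, and [gordan] is applied to
    them. *)
Lemma no_extremal E X N0: adm E X -> ext E X N0 -> Q N0 N0 = 1 ->
  (forall N, ext E X N -> Q N N = 1 -> Q N X <= Q N0 X) ->
  (forall E0 X', agree E0 E X -> (forall Z, cap N0 Z -> adm E0 Z) -> cap N0 X' ->
     exists N', [/\ ext E0 X' N', Q N' N' = 1 & Q N0 X / dens (E X) * dens (E0 X') <= Q N' X']) -> False.
move=> aE eN0 NN0 Hmax Hmin; have cX:= adm_cone aE. set a:= Q N0 X in Hmax Hmin; have a0: 0 < a by case: eN0.
have d0: 0 < dens (E X):= adm_gt0 (da_weight HD) aE. have [T0 T0E]: exists T0, T0 = X - a *: N0 by eexists.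
have XT0: X = T0 + a *: N0 by rewrite T0E subrK. have XN0: Q X N0 = a by rewrite QC.
have TT: Q T0 T0 = - a ^+ 2 by rewrite T0E !QE cX.1 NN0 XN0 -/a; ring.
have TTn: Q T0 T0 < 0 by rewrite TT oppr_lt0 exprn_gt0. have TN: Q T0 N0 = 0 by rewrite T0E !QE NN0 XN0; ring.
have TX: Q T0 X = - a ^+ 2 by rewrite T0E !QE cX.1 -/a; ring. have T00: 0 < T0 0 0.
 have nT: T0 0 0 != 0 by apply/eqP=> t0; have:= sp_ge0 T0; move: TTn; rewrite QspE t0; lra.
 rewrite lt_neqAle eq_sym nT leNgt; apply/negP=> tn.
 have:= @Q_lt0 _ _ X (- T0); rewrite QNl !QNr opprK mxE oppr_gt0 cX.1=>/(_ (lexx _) cX.2 TTn tn).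
 by rewrite (QC X) TX opprK ltNge sqr_ge0.
have [Th ThE]: exists Th, Th = (a ^- 2) *: T0 by eexists. have ai: a ^+ 2 != 0 by pos.
pose K:= [set k: V | exists Y, [/\ Q Y Y = 0, Q T0 Y = -1, Q N0 Y = 0, (forall N, ext E X N -> Q N Y <= 0) & k
= Y - Th]]. have TTh: Q T0 Th = -1 by rewrite ThE QZr TT mulrN mulVf.
have ThTh: Q Th Th = - a ^- 2 by rewrite {1}ThE QZl TTh mulrN1.
have KP k: K k -> [/\ Q (k + Th) (k + Th) = 0, Q T0 k = 0, Q N0 (k + Th) = 0 & forall N, ext E X N -> Q N (k +
Th) <= 0] by move=>[Y [YY TY NY HY ->]]; rewrite subrK QDr QNr TY TTh subrr.
have ThY Y: Q Th Y = a ^- 2 * Q T0 Y by rewrite ThE QZl. have Kq k: K k -> Q k k = a ^- 2.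
 move=>/KP [h1 h2 _ _]; move: h1; rewrite QDl !QDr (QC k Th) ThY h2 mulr0 ThTh; lra.
have [C C0 HC]:= orth_bound TTn. have cK: compact K.
 apply: (@dotp_compact _ _ _ (C * a ^- 2)); last first.
  by move=> k Kk; rewrite -(Kq k Kk); apply: HC; rewrite QC; case: (KP _ Kk).
 rewrite (_: K = [set k | Q (k + Th) (k + Th) = 0] `&` ([set k | Q T0 k = 0] `&` ([set k | Q N0 (k + Th) = 0]
 `&` [set k | forall N, ext E X N -> Q N (k + Th) <= 0]))).
  have tc: continuous (fun k: V=> k + Th) by move=> k; apply: (@cvgD _ _ _ (nbhs k) _ id (cst Th)); [exact:
  cvg_id|exact: cvg_cst].
  have qc N: continuous (fun k: V=> Q N (k + Th)) by move=> k; apply: (continuous_comp (f:= fun k: V=> k +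
  Th) (g:= Q N)); [exact: tc|exact: Q_cont]. apply: closedI.
   apply: closedEQ=> k; apply: (continuous_comp (f:= fun k: V=> k + Th) (g:= fun k: V=> Q k k)); first exact: tc.
   exact: Q2_cont.
  apply: closedI; first by apply: closedEQ; exact: Q_cont. apply: closedI; first by apply: closedEQ; exact: qc.
  by apply: closedA=> N; apply: closed_imply; apply: closedLE; exact: qc.
 apply/seteqP; split=> k /= [].
  by move=> Y h; have [|]:= KP k; [exists Y | split].
 move=> h1 [h2 [h3 h4]]; exists (k + Th); split=>//; last by rewrite addrK. by rewrite QDr h2 TTh add0r.
have singK Y: cone Y -> ~ reg E X Y -> Q N0 Y = 0 -> exists2 t: R, 0 < t & K (t *: Y - Th).
 move=> cY nY NY; have TY: Q T0 Y < 0.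
  by rewrite QC; apply: Q_lt0=>//; [rewrite cY.1 | case: cY].
 exists (- Q T0 Y)^-1; first by rewrite invr_gt0 oppr_gt0. exists ((- Q T0 Y)^-1 *: Y); split=>//.
 - by rewrite !QE cY.1 !mulr0.
 - by rewrite QZr invrN mulNr mulVf // lt_eqF.
 - by rewrite QZr NY mulr0.
 - move=> N eN; rewrite QZr pmulr_rle0 ?invr_gt0 ?oppr_gt0 //; exact: ext_reg_le nY.
have r00: 0 < a ^- 2 by pos. have [|[z0 [del [del0 Hz]]]|[z zn Hz]]:= gordan cK r00.
- move=> k Kk; rewrite -(Kq k Kk) /Q -subr_ge0 opprB addrCA subrr addr0.
 by pos.
- pose z:= z0 *m qeta.
 have Hz' k: K k -> del <= Q z k by move=>/Hz; rewrite -dotp_flat /z -mulmxA qetaK mulmx1.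
 (* The component along [T0] makes [Q Z] at most [- del / 2] on the missing rays normalised by
    [Q T0 Y = -1], and positive at [X]. *)
 have [Z1 Z1E]: exists Z1, Z1 = - z - (Q z Th + del / 2) *: T0 by eexists.
 have [Z ZE]: exists Z, Z = Z1 - Q Z1 N0 *: N0 by eexists. have Z1T: Q Z1 T0 = a ^+ 2 * (del / 2).
  have zT: Q z T0 = a ^+ 2 * Q z Th by rewrite ThE QZr mulrA mulfV // mul1r. by rewrite Z1E !QE TT zT; ring.
 apply: (ext_improve (Z:= Z) aE eN0 NN0 Hmax).
 + by rewrite ZE !QE NN0 (QC N0); ring.
 + have -> : Q Z X = Q Z1 T0 by rewrite {1}XT0 ZE !QE NN0 (QC N0 T0) TN; ring.
  by rewrite Z1T mulr_gt0 ?exprn_gt0 // divr_gt0.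
 + move=> Y cY nY NY; have [t t0 Kt]:= singK _ cY nY NY.
  have:= Hz' _ Kt; rewrite QDr QNr QZr=> h.
  have TY: t * Q T0 Y = -1 by have [_ h2 _ _]:= KP _ Kt; move: h2; rewrite QDr QNr QZr TTh; lra.
  have: t * Q Z Y < 0.
   have -> : t * Q Z Y = - (t * Q z Y) - (Q z Th + del / 2) * (t * Q T0 Y) by rewrite ZE Z1E !QE NY; ring.
   by rewrite TY; lra.
  by rewrite pmulr_rlt0.
 have Hz' nu s: (forall k, K k -> Q nu k <= s) -> `|Q nu z| <= s.
 by move=> h; rewrite -dotp_flat; apply: Hz=> k /h; rewrite dotp_flat.
have zT: Q T0 z = 0 by apply/eqP; rewrite -normr_le0; apply: Hz'=> k /KP [_ ->]. have zN: Q N0 z = 0.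
 apply/eqP; rewrite -normr_le0; apply: Hz'=> k /KP [_ _ h _].
 by move: h; rewrite QDr (QC N0 Th) ThY TN mulr0 addr0=>->.
have zz: 0 < Q z z.
 have zT': Q z T0 = 0 by rewrite QC. rewrite lt_neqAle (sp_orth TTn zT') andbT; apply/eqP=> e.
 by move: zn; rewrite (sp_orth0 TTn zT' (esym e)) eqxx.
set q:= Num.sqrt (Q z z); have q0: 0 < q by pos. have qq: q ^+ 2 = Q z z by rewrite sqr_sqrtr // ltW.
have [tau tauE]: exists tau, tau = a^-1 *: T0 by eexists.
have [sig sigE]: exists sig, sig = q^-1 *: z by eexists.
have tt: Q tau tau = -1 by rewrite tauE !QE TT; field; rewrite gt_eqF.
have ss: Q sig sig = 1 by rewrite sigE !QE -qq; field; rewrite gt_eqF.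
have ts: Q tau sig = 0 by rewrite tauE sigE !QE zT !mulr0.
have sX: Q sig X = 0 by rewrite XT0 sigE !QE (QC z) zT (QC z) zN; ring.
have tX: Q tau X = - a by rewrite tauE QZl TX; field; rewrite gt_eqF.
set kap:= a / dens (E X) in Hmin; have kap0: 0 < kap by pos. have [N0X [E0 [aE0 HE0]]]:= eN0.
have aE0X: adm E0 X by apply: HE0; split. pose C2:= a^-1 / q. have C20: 0 < C2 by pos.
apply: (adm_cyl HD (tau:= tau) (sig:= sig) (c:= kap ^+ 2) aE0X tt ss ts sX).
- by pos.
- by rewrite (agree_eq aE0) tX -exprMn /kap divfK ?gt_eqF // sqrrN.
have c1: cap (- tau + C2 *: sig) X by split=>//; rewrite !QE tX sX mulr0 addr0 opprK.
have c2: cap (- tau - C2 *: sig) X by split=>//; rewrite !QE tX sX mulr0 oppr0 addr0 opprK.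
have [D1 [D1X HD1]]:= capI c1 c2; have [D2 [D2X HD2]]:= capI D1X (conj cX N0X).
exists D2; split=>// W /HD2 [/HD1 [[cW w1] [_ w2]] NW]. have [N' [eN' NN' hN']]:= Hmin _ _ aE0 HE0 NW.
(* By [ext_moved] the cap [N'] of the neighbouring germ contains none of the missing boundary rays
   [k + Th]; the resulting bound passes from [K] to [z] and [- z] and becomes the condition on
   [Q N sig] in [barrier_cyl]. *)
have aW:= adm_gt0 (da_weight HD) (HE0 _ NW). have Hs k: K k -> Q N' k <= - Q N' Th.
 move=>/KP [h1 h2 h3 h4]; rewrite -subr_le0 opprK -QDr. have cY: cone (k + Th).
  split=>//; apply: (@timelike_fwd _ _ _ T0)=>//; first by rewrite h1. by rewrite QC QDr h2 TTh add0r oppr_lt0.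
 apply: (ext_moved H d3 Mhaus aE N0X aE0 HE0 NW eN' cY _ h3).
 by move=>[N [eN [_ NY]]]; have:= h4 _ eN; rewrite leNgt NY.
have Nz:= Hz' _ _ Hs.
have NTh: Q N' Th = a^-1 * Q N' tau by rewrite ThE tauE !QZr mulrA; congr (_ * _); field; rewrite gt_eqF.
have Nt: Q N' tau <= 0.
 have:= le_trans (normr_ge0 _) Nz; rewrite oppr_ge0 NTh pmulr_rle0 // invr_gt0 //.
have:= @barrier_cyl tau sig N' W C2 tt ss ts NN' cW.1 Nt.
have -> : `|Q N' sig| = q^-1 * `|Q N' z| by rewrite sigE QZr normrM gtr0_norm // invr_gt0.
move=> h; apply: le_trans (h _ _ _ _).
- have k1: 0 <= kap * dens (E0 W) by apply: mulr_ge0; exact: ltW.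
 have k2: 0 <= Q N' W by lra. by rewrite -exprMn ler_sqr.
- have: q^-1 * `|Q N' z| <= q^-1 * - Q N' Th by rewrite ler_pM2l ?invr_gt0.
 by rewrite NTh (_: C2 * - Q N' tau = q^-1 * - (a^-1 * Q N' tau)) // /C2; ring.
- move: w1 w2; rewrite !QE=> w1 w2.
 have -> : C2 * `|Q sig W| = `|C2 * Q sig W| by rewrite normrM gtr0_norm. by rewrite ler_norml; lra.
- by move: w1 w2; rewrite !QE; lra.
- by apply: lt_le_trans hN'; rewrite mulr_gt0.
Qed.

Theorem sphere_exists: exists E, forall X, cone X -> adm E X.
apply: contrapT=> nS. have sing E X: adm E X -> exists Y0, cone Y0 /\ ~ reg E X Y0.
 move=> aE; apply: contrapT=> nY; apply: nS; have [F [_ HF]]:= germ_region H d3 Mhaus aE.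
 exists F=> Z cZ; apply: HF; apply: contrapT=> nZ; apply: nY; by exists Z.
have maxi E X: adm E X -> exists N0, [/\ ext E X N0, Q N0 N0 = 1 & forall N, ext E X N -> Q N N = 1 -> Q N X
<= Q N0 X].
 move=> aE; have [Y0 [cY0 nY0]]:= sing _ _ aE.
 have [B HB]: exists B, forall N, ext E X N -> Q N N = 1 -> Q N X <= B.
  apply: contrapT=>/forallNP nB; apply: (no_flat H d3 HD Mhaus Mcpt Mconn M0 aE cY0 nY0)=> B.
  have /existsNP [N /not_implyP [eN /not_implyP [NN /negP nh]]]:= nB B. by exists N; split=>//; rewrite ltNge.
 exact: ext_max aE cY0 nY0 HB.
have HK0 p: exists k, forall E X, adm E X -> pt (E X) = p -> exists N, [/\ ext E X N, Q N N = 1, Q N X / dens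
(E X) = k & forall N, ext E X N -> Q N N = 1 -> Q N X <= k * dens (E X)].
 have [E [X [aE eX]]]:= germ_at H p; have [N0 [eN0 NN0 Hm]]:= maxi _ _ aE.
 exists (Q N0 X / dens (E X))=> E' X' aE' eX'. have ee: pt (E' X') = pt (E X) by rewrite eX'.
 have [N' [eN' NN' r']]:= ext_transfer H HD aE' aE ee eN0. exists N'; split=>//; first by rewrite NN'.
 move=> N eN NN; have [N2 [eN2 NN2 r2]]:= ext_transfer H HD aE aE' (esym ee) eN.
 have d1:= adm_gt0 (da_weight HD) aE; have d2:= adm_gt0 (da_weight HD) aE'.
 rewrite -ler_pdivrMr // -r2 ler_pM2r ?invr_gt0 //; apply: Hm=>//; by rewrite NN2.
pose K p:= projT1 (cid (HK0 p)).
have HK p E X: adm E X -> pt (E X) = p -> exists N, [/\ ext E X N, Q N N = 1, Q N X / dens (E X) = K p &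
forall N, ext E X N -> Q N N = 1 -> Q N X <= K p * dens (E X)] by rewrite /K; case: cid=> k /= h; exact: h.
(* [K p] is the largest normalised size at [p]. It is lower semicontinuous by [cap_from], so the
   extremal germ is taken at a minimum. *)
have [|p0 Hp0]:= lsc_min (K:= K) Mcpt M0.
 move=> c; apply: closed_if=> p /negP; rewrite -ltNge=> cK.
 have [E [X [aE eX]]]:= germ_at H p; have [N [eN NN eK _]]:= HK _ _ _ aE eX. have [NX [E0 [aE0 HE0]]]:= eN.
 have c2: c * dens (E X) < Q N X by rewrite -ltr_pdivlMr ?(adm_gt0 (da_weight HD)) // eK.
 have [U [oU Up HU]]:= cap_from H HD aE0 aE (conj (adm_cone aE) NX) HE0 c2.
 exists U; split=>//; first by rewrite -eX.
 move=> r /HU [Z [aZ eZ eNZ cZ]]; apply/negP; rewrite -ltNge; apply: (lt_le_trans cZ).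
 have [_ [_ _ _ h]]:= HK _ _ _ aZ eZ. by rewrite ler_pdivrMr ?(adm_gt0 (da_weight HD)) //; exact: h.
have [E [X [aE eX]]]:= germ_at H p0; have [N0 [eN0 NN0 eK Hm]]:= HK _ _ _ aE eX.
have d0:= adm_gt0 (da_weight HD) aE. apply: (no_extremal aE eN0 NN0).
 by move=> N eN NN; have:= Hm _ eN NN; rewrite -eK divfK ?gt_eqF.
move=> E0 X' a0 HE0 NX'; have aX':= HE0 _ NX'. have [N' [eN' NN' eK' _]]:= HK _ _ _ aX' erefl.
exists N'; split=>//; rewrite eK -ler_pdivlMr ?(adm_gt0 (da_weight HD)) // eK'. exact: Hp0.
Qed.

End Extremal.

Section Slice.
Definition slice: set V:= [set X | Q X X = 0 /\ X 0 0 = 1].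

Lemma sliceC X: slice X -> cone X.
by move=>[XX X0]; split=>//; rewrite X0 ltr01. Qed.

Lemma slice_compact: compact slice.
apply: (@dotp_compact _ _ _ 2).
 rewrite (_: slice = [set Y: V | Q Y Y = 0] `&` [set Y: V | Y 0 0 = 1]).
  by apply: closedI; apply: closedEQ; [exact: Q2_cont|exact: coordC].
 by [].
by move=> Y [YY Y0]; move: YY; rewrite /Q Y0; lra.
Qed.

Lemma cone_slice X: cone X -> exists2 Y, slice Y & par X Y.
move=>[XX X0]; exists ((X 0 0)^-1 *: X).
 by split; [rewrite !QE XX !mulr0|rewrite mxE mulVf ?gt_eqF].
by exists (X 0 0)^-1; rewrite ?invr_gt0.
Qed.

Lemma mx_row_ext (A B: 'M[R]_d.+1): (forall Z: V, Z *m A = Z *m B) -> A = B.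
by move=> h; apply/row_matrixP => i; rewrite !rowE h. Qed.

Lemma refl_conj (L L': 'M[R]_d.+1) N: lor L -> lor L' -> L *m L' = 1%:M ->
  refl (N *m L') = L *m refl N *m L'.
move=> lL lL' LL'; apply: mx_row_ext=> Z.
rewrite !mulmxA !reflE mulmxBl -mulmxA LL' mulmx1 -scalemxAl; congr (_ - (_ * _) *: _).
by rewrite (lor_capE _ _ lL LL' lL').
Qed.

(** The map is the reflection in the normalised difference [N - N'], which is spacelike because
    [Q N N' <= 0]. *)
Lemma lor_to (N N': V): Q N N = 1 -> Q N' N' = 1 -> Q N N' <= 0 -> exists2 L, lor L & N *m L = N'.
move=> NN NN' le; have q0: 0 < 2 - 2 * Q N N' by lra. set a:= Num.sqrt (2 - 2 * Q N N'). have a0: a != 0 by pos.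
have aa: a ^+ 2 = 2 - 2 * Q N N' by rewrite sqr_sqrtr // ltW. pose u:= a^-1 *: (N - N'). have uu: Q u u = 1.
 rewrite /u !QZl !QZr !QDl !QDr !QNl !QNr NN NN' (QC N').
 rewrite [X in _ * (_ * X)](_: _ = a ^+ 2); last by rewrite aa; ring. by field.
exists (refl u); first exact: lor_refl. rewrite reflE /u QZl QDl QNl NN (QC N') scalerA.
rewrite (_: 2 * _ / a = 1); first by rewrite scale1r subKr.
rewrite (_: 2 * (a^-1 * (1 - Q N N')) = a^-1 * a ^+ 2); last by rewrite aa; ring. by field.
Qed.

End Slice.

(** * Symmetries of a global model *)

Section HalfModel.
Context (H: mirror_axioms S) (d3: (3 <= d)%N).
Context {dens: T -> R} (HW: weight_axioms S dens) (Mhaus: hausdorff_space M) (Mconn: connected [set: M]).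
Local Notation e:= (mvec S).

Lemma sphere_lower E: (forall X, cone X -> adm E X) ->
  exists2 r: R, 0 < r & forall X, slice X -> r <= dens (E X).
move=> aE; apply: contrapT=> nr. have u n: exists X, slice X /\ dens (E X) < n.+1%:R^-1.
 apply: contrapT=> nX; apply: nr; exists n.+1%:R^-1; first by [].
 by move=> X sX; rewrite leNgt; apply/negP=> h; apply: nX; exists X.
pose s n:= projT1 (cid (u n)). have sP n: slice (s n) /\ dens (E (s n)) < n.+1%:R^-1 by rewrite /s; case: cid.
have [X sX Xcl]:= seq_cluster slice_compact (fun n=> (sP n).1).
have cX:= sliceC sX; have p0:= adm_gt0 HW (aE _ cX). set a:= dens (E X) / 2; have a0: 0 < a by pos.
(* With [c = -1] the semicontinuity axiom bounds [dens] from below. *)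
have h: -1 * dens (E X) < Q (a *: e_ 0) X by rewrite QZl Qe0 sX.2 /a; lra.
have [N [NX HN]]:= adm_usc HW (aE _ cX) h. have [k kk]: exists k: nat, forall n, (k <= n)%N -> n.+1%:R^-1 < a.
 have:= @near_infty_natSinv_lt _ (PosNum a0)=>-[k _ Hk]; exists k=> n kn; exact: Hk.
have:= NX.2; apply/negP; rewrite -leNgt.
apply: (Xcl [set Z | Q N Z <= 0]); first by apply: closedLE; exact: Q_cont.
exists k=> n kn /=; rewrite leNgt; apply/negP=> nN. have [sn dn]:= sP n.
have:= HN _ (conj (sliceC sn) nN); rewrite QZl Qe0 sn.2=> h2. have:= lt_trans dn (kk _ kn); lra.
Qed.

Lemma sphere_onto E: (forall X, cone X -> adm E X) -> forall p, exists X, slice X /\ pt (E X) = p.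
move=> aE; pose f X:= pt (E X). have cf: {within slice, continuous f}.
 apply/subspace_continuousP=> X sX O; rewrite /= nbhsE=>-[U [oU UX] UO].
 have [N [NX HN]]:= adm_cont H (aE _ (sliceC sX)) oU UX.
 apply: filterS (cap_open NX.2)=> Z NZ sZ; apply/UO/HN; split=>//; exact: sliceC.
have cl: closed (f @` slice) by apply: compact_closed=>//; apply: continuous_compact=>//; exact: slice_compact.
suff hh: f @` slice = setT.
 by move=> p; have: (f @` slice) p by [rewrite hh]; case=> X sX <-; exists X.
apply: Mconn.
- have [X cX]: exists X: V, cone X.
 exists (e_ 0 + e_ (lift ord0 (Ordinal (leq_trans (ltn0Sn 2) d3)))); split; last first.
  by rewrite !mxE !eqxx /= addr0 ltr01.
 rewrite !QE !Qe0 (QC _ (e_ 0)) Qe0 /Q /dotp (bigD1 (lift ord0 (Ordinal (leq_trans (ltn0Sn 2) d3)))) //= big1.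
  by rewrite !mxE !eqxx /= ; ring.
 by move=> i ni; rewrite !mxE (negPf ni) andbF mulr0. by have [Y sY _]:= cone_slice cX; exists (f Y), Y.
- exists (f @` slice); last by rewrite setTI.
 rewrite openE=> p [X sX <-]; have [N NX]:= cap_ex (sliceC sX). have [U [oU UX HU]]:= adm_open H (aE _ NX.1) NX.
 apply: (@filterS _ (nbhs (f X)) _ U); last exact: open_nbhs_nbhs.
 move=> q /HU [Z [[cZ _] <-]]; have [Y sY pY]:= cone_slice cZ; exists Y=>//.
 by rewrite /f (adm_pt_par H (aE _ cZ) pY).
- by exists (f @` slice)=>//; rewrite setTI.
Qed.

Definition gr E L:= lor L /\ forall X, cone X -> E (X *m L) = E X.

Lemma gr_germ E X L: (forall X, cone X -> adm E X) -> lor L -> cone X ->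
  agree E (fun Z => E (Z *m L)) X -> gr E L.
move=> aE lL cX aX; split=>// Y cY; symmetry.
have aL Z: cone Z -> adm (fun Z=> E (Z *m L)) Z by move=> cZ; apply: adm_lor=>//; apply: aE; exact: lL.2.
apply: (@agree_eq E (fun Z=> E (Z *m L)) Y).
apply: (identity_all H d3 Mhaus cY _ cX aX)=> Z cZ; split; [exact: aE|exact: aL].
Qed.

(** A common fixed point without averaging over the group: the vectors [v] with
    [0 <= - Q v X <= dens (E X)] on the cone form a compact convex set invariant under the
    symmetries, and its longest timelike element is unique, as comparison with midpoints shows. *)
Lemma sphere_center E: (forall X, cone X -> adm E X) ->
  exists2 v, Q v v < 0 /\ 0 < v 0 0 & forall L, gr E L -> v *m L = v.
move=> aE; have [r r0 Hr]:= sphere_lower aE. pose f X:= dens (E X).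
pose K:= [set v: V | forall X, cone X -> 0 <= - Q v X /\ - Q v X <= f X].
have cE (j: 'I_d.+1) (s: R): j != 0 -> s ^+ 2 = 1 -> cone (e_ 0 + s *: e_ j: V).
 move=> j0 s1; split; last by rewrite !mxE !eqxx /= eq_sym (negPf j0) mulr0 addr0 ltr01.
 rewrite QDl !QDr !QZl !QZr (QC (e_ j)) !Qe0 !mxE !eqxx /= eq_sym (negPf j0).
 rewrite /Q /dotp (bigD1 j) //= big1; last by move=> i ni; rewrite !mxE (negPf ni) andbF mulr0.
 rewrite !mxE !eqxx /= eq_sym (negPf j0) /=; transitivity (s ^+ 2 - 1); [by ring|by rewrite s1 subrr].
have Qj v (j: 'I_d.+1): j != 0 -> Q v (e_ j) = v 0 j.
 move=> j0; rewrite /Q /dotp (bigD1 j) //= big1; last by move=> i ni; rewrite !mxE (negPf ni) andbF mulr0.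
 by rewrite !mxE !eqxx /= eq_sym (negPf j0) /=; ring.
have Q0 v: Q v (e_ 0) = - v 0 0 by rewrite QC Qe0.
pose j0: 'I_d.+1:= lift ord0 (Ordinal (leq_trans (ltn0Sn 2) d3)).
have one1: (1: R) ^+ 2 = 1 by rewrite expr1n. have one2: (-1: R) ^+ 2 = 1 by rewrite sqrrN expr1n.
have cj v (j: 'I_d.+1): K v -> j != 0 -> `|v 0 j| <= v 0 0.
 move=> Kv jn; have [h1 _]:= Kv _ (cE j 1 jn one1); have [h2 _]:= Kv _ (cE j (-1) jn one2).
 move: h1 h2; rewrite !QDr !QZr !Q0 !Qj // => h1 h2; rewrite ler_norml; lra.
pose B:= f (e_ 0 + 1 *: e_ j0). have v0B v: K v -> 0 <= v 0 0 <= B + f (e_ 0 + -1 *: e_ j0).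
 move=> Kv; have jn: j0 != 0 by [].
 have [h1 h1']:= Kv _ (cE j0 1 jn one1); have [h2 h2']:= Kv _ (cE j0 (-1) jn one2).
 move: h1 h2 h1' h2'; rewrite -/B !QDr !QZr !Q0 !Qj // => h1 h2; lra.
have cK: compact K.
 apply: (@dotp_compact _ _ _ (\sum_(i < d.+1) (B + f (e_ 0 + -1 *: e_ j0)) ^+ 2)).
  apply: closedA=> X; apply: closed_imply.
  rewrite (_: (fun v: V=> 0 <= - Q v X /\ - Q v X <= f X) = [set v: V | Q X v <= 0] `&` [set v: V | - f X
  <= Q X v]).
   by apply: closedI; [apply: closedLE|apply: closedGE]; exact: Q_cont.
  by apply/seteqP; split=> v /=; rewrite (QC v)=>-[h1 h2]; split; lra.
 move=> v Kv; apply: ler_sum=> i _; have /andP[h1 h2]:= v0B _ Kv.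
 have: `|v 0 i| <= v 0 0 by case: (eqVneq i 0)=>[->|/cj]; [rewrite ger0_norm|exact].
 move=> h3; rewrite -expr2 -real_normK ?num_real // ler_sqr ?nnegrE //; last exact: le_trans h2.
 exact: le_trans h2.
have Kr: K (r *: e_ 0).
 move=> X cX; rewrite QZl Qe0 mulrN opprK; split; first by rewrite mulr_ge0 // ltW //; case: cX.
 have [Y sY [t t0 YX]]:= cone_slice (cX). have:= Hr _ sY; rewrite YX (adm_hom HW (aE _ cX) t0)=> h.
 by rewrite -(ler_pM2l t0) mulrCA; move: sY.2; rewrite YX mxE=>->; rewrite mulr1.
have [||v /set_mem Kv vmax]:= @EVT_min_rV _ _ (fun v: V=> Q v v) K _ cK.
- by exists (r *: e_ 0).
- by apply: continuous_subspaceT; exact: Q2_cont. have vv: Q v v < 0.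
 have:= vmax _ (mem_set Kr); rewrite QZl QZr Qe0 !mxE !eqxx /=; have:= mulr_gt0 r0 r0; lra.
have v0: 0 < v 0 0.
 have /andP[h _]:= v0B _ Kv; rewrite lt_neqAle h andbT; apply/eqP=> e0.
 by have:= sp_ge0 v; move: vv; rewrite QspE -e0; lra.
exists v=>// L [lL HL]; have [L' [lL' LL' L'L]]:= lor_inv lL. have KL: K (v *m L).
 move=> X cX; rewrite QC (lor_capE _ _ lL LL' lL') QC. have [h1 h2]:= Kv _ (lL'.2 _ cX); split=>//.
 have:= HL _ (lL'.2 _ cX); rewrite -mulmxA L'L mulmx1=> e1. by rewrite /f e1.
set w:= v *m L in KL *. have ww: Q w w = Q v v by rewrite lL.1. have Km: K (2^-1 *: (v + w)).
 move=> X cX; have [h1 h2]:= Kv _ cX; have [h3 h4]:= KL _ cX. by rewrite QZl QDl; split; lra.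
have:= vmax _ (mem_set Km); rewrite QZl QZr !QDl !QDr ww (QC w v)=> hm. have vw: Q v w < 0.
 have w0: 0 < w 0 0.
  have /andP[h _]:= v0B _ KL; rewrite lt_neqAle h andbT; apply/eqP=> e0.
  by have:= sp_ge0 w; move: vv; rewrite -ww QspE -e0; lra.
 by apply: Q_lt0=>//; [exact: ltW|rewrite ww].
have TT: Q (v + w) (v + w) < 0 by rewrite !QDl !QDr ww (QC w v); lra.
have uT: Q (v - w) (v + w) = 0 by rewrite QDl !QDr !QNl ww (QC w v); ring. have u0: Q (v - w) (v - w) = 0.
 apply/eqP; rewrite eq_le (sp_orth TT uT) andbT. by rewrite QDl !QDr !QNr !QNl ww (QC w v); lra.
by have /eqP:= sp_orth0 TT uT u0; rewrite subr_eq0=>/eqP <-.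
Qed.

(** [N1] is the mirror vector of a chart, pulled back to the model. By [ma_fold] and [rigid2], a map
    fixing the ray and its germ is trivial or the reflection of that chart. *)
Lemma adm_fix_dich E X: adm E X -> exists N1, Q N1 N1 = 1 /\ forall L, lor L ->
  par (X *m L) X -> agree E (fun Z => E (Z *m L)) X -> L = 1%:M \/ L = refl N1.
move=>[j [L2 [N2 [l2 N2X HN2]]]]; have [L2' [l2' LL' L'L]]:= lor_inv l2.
exists (e *m L2'); split; first by rewrite l2'.1 (ma_mvec H). move=> L lL pL [N [NX HN]].
have [N3 [N3X HN3]]:= cap_lor lL (cap_par (par_sym pL) N2X) N2X.1.
have [N4 [N4X HN4]]:= capI N2X N3X; have [N5 [N5X HN5]]:= capI N4X NX. rewrite (refl_conj _ l2 l2' LL').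
have [Hid|Hre]: L *m L2 = L2 \/ L *m L2 = L2 *m refl e.
- apply: (@rigid2 _ _ d3 (L *m L2) L2 (L2 *m refl e) X N5)=>//; try exact: lorM.
 by apply: lorM=>//; exact: (lor_tau H). move=> Z /HN5 [/HN4 [a /HN3 b] c]; rewrite mulmxA; have e1:= HN _ c.
 have [W1 ee1]:= HN2 _ a; have [W2 ee2]:= HN2 _ b.
 rewrite ee1 ee2 in e1; have []:= (ma_fold H W2 W1).1; first by rewrite e1.
  by left.
 by right; rewrite !mulmxA.
- by left; rewrite -[L]mulmx1 -LL' mulmxA Hid LL'.
- by right; rewrite -[L]mulmx1 -LL' mulmxA Hre.
Qed.

Lemma refl_self N: Q N N = 1 -> N *m refl N = - N.
by move=> NN; rewrite reflE NN mulr1 scaler_nat mulr2n opprD addrA subrr sub0r. Qed.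

Lemma nonzero_mvec: e != - e.
apply/eqP=> h; have:= ma_mvec H; have: Q e e = - Q e e by rewrite -QNl -h.
by move=> h1 h2; move: h1; rewrite h2; lra.
Qed.

Context (bdry: exists i X, mdom (m:= S) i X /\ Q e X = 0).

(** At a ray over the boundary the reflection of a chart is a symmetry of the germ, hence of the
    whole model, and a Lorentz map carries its vector to [mvec S]. The sign condition of [lor_to] is
    met by passing to the opposite vector, which has the same reflection. *)
Lemma sphere_mirror E: (forall X, cone X -> adm E X) -> exists E',
  (forall X, cone X -> adm E' X) /\ forall X, cone X -> E' (X *m refl e) = E' X.
move=> aE; have [i [X [WX eX]]]:= bdry; have ee:= ma_mvec H. have [N [NX HN]]:= ma_dom_open H WX.
have aX: adm (mmap (m:= S) i) X.
 by exists i, 1%:M, N; split=>//; [exact: lor1|move=> Z /HN; rewrite mulmx1].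
have [X' [sX' eqX']]:= sphere_onto aE (pt (mmap (m:= S) i X)). have cX':= sliceC sX'.
have [L [lL pL [N1 [N1X HN1]]]]:= adm_cmp H (aE _ cX') aX eqX'. have [L' [lL' LL' L'L]]:= lor_inv lL.
pose N0:= e *m L'. have NN0: Q N0 N0 = 1 by rewrite lL'.1.
have rf: refl N0 *m L = L *m refl e by rewrite (refl_conj _ lL lL' LL') -!mulmxA L'L mulmx1.
have fX': X' *m refl N0 = X'.
 rewrite reflE /N0 -(lor_capE _ _ lL LL' lL'); case: pL=> t t0 XL.
 have: t * Q e (X' *m L) = 0 by rewrite -QZr -XL.
 by move=>/eqP; rewrite mulf_eq0 gt_eqF //= =>/eqP ->; rewrite mulr0 scale0r subr0.
have gN: gr E (refl N0).
 have lN:= lor_refl NN0. apply: (gr_germ aE lN cX').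
 have [N2 [N2X HN2]]:= cap_lor lL (cap_par (par_sym pL) NX) cX'. have [N3 [N3X HN3]]:= capI N1X N2X.
 have N3X': cap N3 (X' *m refl N0) by rewrite fX'. have [N4 [N4X HN4]]:= cap_lor lN N3X' cX'.
 have [N5 [N5X HN5]]:= capI N3X N4X. exists N5; split=>// Z /HN5 [/HN3 [a /HN2 b] /HN4 /HN3 [a' /HN2 b']].
 rewrite (HN1 _ a) (HN1 _ a') -mulmxA rf mulmxA ma_refl //; first exact: HN.
 by have:= HN _ b'; rewrite -mulmxA rf mulmxA.
have [N' [NN' le gN']]: exists N', [/\ Q N' N' = 1, Q e N' <= 0 & gr E (refl N')].
 case: (lerP (Q e N0) 0)=> h; first by exists N0. exists (- N0); split; first by rewrite QNl QNr opprK.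
  by rewrite QNr oppr_le0 ltW.
 suff -> : refl (- N0) = refl N0 by [].
 by apply: mx_row_ext=> Z; rewrite !reflE QNl mulrN scaleNr scalerN opprK.
have [B lB eB]:= lor_to ee NN' le; have [B' [lB' BB' B'B]]:= lor_inv lB.
have eB': e = N' *m B' by rewrite -eB -mulmxA BB' mulmx1. exists (fun Z=> E (Z *m B)); split=>[Y cY|Y cY].
 by apply: adm_lor=>//; apply: aE; exact: lB.2.
rewrite {1}eB' (refl_conj _ lB lB' BB') -!mulmxA B'B mulmx1 !mulmxA. by rewrite gN'.2 //; exact: lB.2.
Qed.

Theorem half_model: (exists E, forall X, cone X -> adm E X) -> exists E,
  [/\ forall X, cone X -> adm E X,
      forall p, exists X, [/\ slice X, 0 <= Q e X & pt (E X) = p],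
      forall X, cone X -> E (X *m refl e) = E X &
      forall X Y, cone X -> cone Y -> 0 <= Q e X -> 0 <= Q e Y ->
        pt (E X) = pt (E Y) -> par X Y].
move=>[E0 aE0]; have [E [aE eE]]:= sphere_mirror aE0; have ee:= ma_mvec H. have ltau:= lor_tau H.
have [v [vv v0] Hv]:= sphere_center aE. have ge: gr E (refl e) by [].
have mir N1: Q N1 N1 = 1 -> gr E (refl N1) -> Q N1 v = 0.
 move=> NN g; have:= Hv _ g; rewrite reflE=>/eqP.
 rewrite -subr_eq0 addrAC subrr add0r oppr_eq0 scaler_eq0=>/orP[|/eqP N0].
  by rewrite mulf_eq0 (_: 2 == 0 = false) /=; [move/eqP|apply/negbTE; rewrite pnatr_eq0].
 by move: NN; rewrite N0 Q0l=>/esym/eqP; rewrite oner_eq0.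
have agr L X: gr E L -> cone X -> agree E (fun Z=> E (Z *m L)) X by move=>[lL HL] cX; have [N NX]:= cap_ex cX;
exists N; split=>// Z [cZ _]; rewrite HL. have nr1 N1: Q N1 N1 = 1 -> refl N1 <> 1%:M.
 move=> NN h; have:= refl_self NN; rewrite h mulmx1=> h2. have: Q N1 N1 = - Q N1 N1 by rewrite -QNl -h2.
 by rewrite NN; lra.
(* All symmetries fix the centre [v]. A vector [W] orthogonal to [v] and to both mirror vectors
   gives a null vector [a v + b W] fixed by both reflections, and at one ray there is only one
   reflection. *)
have ev:= mir _ ee ge. have uniq N1: Q N1 N1 = 1 -> gr E (refl N1) -> refl N1 = refl e.
 move=> NN g; have Nv:= mir _ NN g. have [W [W0 Wv We WN]]:= exists_orth3 v e N1 d3. have WW: 0 < Q W W.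
  rewrite lt_neqAle (sp_orth vv Wv) andbT eq_sym; apply/eqP=> h. by move: W0; rewrite (sp_orth0 vv Wv h) eqxx.
 pose a:= Num.sqrt (Q W W); pose b:= Num.sqrt (- Q v v). have a0: 0 < a by pos.
 have aa: a ^+ 2 = Q W W by rewrite sqr_sqrtr // ltW.
 have bb: b ^+ 2 = - Q v v by rewrite sqr_sqrtr // oppr_ge0 ltW.
 have [X XE]: exists X, X = a *: v + b *: W by eexists. have cX: cone X.
  have XX: Q X X = 0.
   rewrite XE QDl !QDr !QZl !QZr (QC v W) Wv.
   transitivity (a ^+ 2 * Q v v + b ^+ 2 * Q W W); [by ring|by rewrite aa bb; ring].
  split=>//; apply: (@timelike_fwd _ _ _ v)=>//; first by rewrite XX.
  by rewrite XE QDl !QZl Wv mulr0 addr0 pmulr_rlt0.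
 have fX N2: Q N2 v = 0 -> Q W N2 = 0 -> X *m refl N2 = X by move=> h1 h2; rewrite reflE XE QDr !QZr h1 (QC
 N2) h2 !mulr0 addr0 mulr0 scale0r subr0. have [N2 [NN2 HN2]]:= adm_fix_dich (aE _ cX).
 have [/(nr1 _ NN)//|->]: refl N1 = 1%:M \/ refl N1 = refl N2 by apply: HN2; [exact: lor_refl|rewrite fX //;
 exact: par_refl|exact: agr]. have [/(nr1 _ ee)//|->//]: refl e = 1%:M \/ refl e = refl N2.
 by apply: HN2=>//; [rewrite fX //; exact: par_refl|exact: agr].
(* Such a symmetry fixes the null vector [v + a e], where the dichotomy applies; the reflection is
   excluded because it reverses [e]. *)
have fixe L: gr E L -> e *m L = e -> L = 1%:M.
 move=> g eL; have vL:= Hv _ g. pose a:= Num.sqrt (- Q v v).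
 have aa: a ^+ 2 = - Q v v by rewrite sqr_sqrtr // oppr_ge0 ltW.
 have [X XE]: exists X, X = v + a *: e by eexists. have cX: cone X.
  have XX: Q X X = 0 by rewrite XE QDl !QDr !QZl !QZr (QC v) ev ee; transitivity (Q v v + a ^+ 2);
  [ring|rewrite aa subrr]. split=>//; apply: (@timelike_fwd _ _ _ v)=>//; first by rewrite XX.
  by rewrite XE QDl QZl ev mulr0 addr0.
 have XL: X *m L = X by rewrite XE mulmxDl -scalemxAl vL eL. have [N2 [NN2 HN2]]:= adm_fix_dich (aE _ cX).
 have [//|L2]: L = 1%:M \/ L = refl N2 by apply: HN2; [case: g|rewrite XL; exact: par_refl|exact: agr].
 have g2: gr E (refl N2) by rewrite -L2. have:= eL; rewrite L2 (uniq _ NN2 g2) refl_self // => h.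
 by move/eqP: h; rewrite eq_sym; apply: contraTeq=> _; exact: nonzero_mvec.
(* The conjugate of the mirror is again a mirror, hence the same one, so its vector is preserved up
   to sign. *)
have conj L: gr E L -> e *m L = e \/ e *m L = - e.
 move=> g; have [lL HL]:= g; have [L' [lL' LL' L'L]]:= lor_inv lL.
 have NN: Q (e *m L) (e *m L) = 1 by rewrite lL.1. have rf:= refl_conj e lL' lL L'L.
 have g2: gr E (refl (e *m L)).
  split; first exact: lor_refl. move=> X cX; rewrite rf !mulmxA HL; last by apply: ltau.2; exact: lL'.2.
  rewrite eE; last exact: lL'.2. by rewrite -{2}[X]mulmx1 -L'L mulmxA HL //; exact: lL'.2.
 have:= refl_self NN; rewrite (uniq _ NN g2) reflE=> h. have [w wE]: exists w, w = e *m L by eexists.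
 rewrite -wE in h NN *. have ww: w + w = (2 * Q e w) *: e by rewrite -{2}[w]opprK -h opprB addrC subrK.
 have w2: w = Q e w *: e.
  apply: (scalerI (_: 2 != 0 :> R)); first by []. by rewrite scaler_nat mulr2n ww scalerA.
 have: Q e w ^+ 2 = 1 by rewrite expr2 -NN {3}w2 QZl.
 move/eqP; rewrite sqrf_eq1=>/orP[]/eqP c; rewrite w2 c; [left|right].
  by rewrite scale1r.
 by rewrite scaleN1r.
exists E; split=>//.
- move=> p; have [X [sX XP]]:= sphere_onto aE p.
 case: (lerP 0 (Q e X))=> h; first by exists X. have cY: cone (X *m refl e):= ltau.2 _ (sliceC sX).
 have [Y sY pY]:= cone_slice cY; exists Y; split=>//.
  case: pY=> t t0 ->; rewrite QZr reflE QDr QNr QZr ee. by rewrite pmulr_rge0 //; lra.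
 by rewrite -(adm_pt_par H (aE _ cY) pY) eE //; exact: sliceC.
(* The symmetry relating the two rays preserves [e] up to sign. With the plus sign it is the
   identity; with the minus sign both rays lie on the mirror, and the symmetry composed with the
   reflection is the identity. *)
- move=> X Y cX cY eX eY eXY.
 have [L [lL pL aL]]:= adm_cmp H (aE _ cX) (aE _ cY) eXY. have g: gr E L:= gr_germ aE lL cX aL.
 have [L' [lL' LL' L'L]]:= lor_inv lL. case: (conj _ g)=> eL.
  by move: pL; rewrite (fixe _ g eL) mulmx1.
 have e2: Q e (X *m L) = - Q e X by rewrite -(lL.1 e X) eL QNl opprK. have eX0: Q e X = 0.
  case: pL=> t t0 YX; move: eY; rewrite YX QZr e2 pmulr_rge0 // oppr_ge0=> h. lra.
 have g2: gr E (refl e *m L).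
  split; first exact: lorM. by move=> Z cZ; rewrite mulmxA g.2 ?eE //; exact: ltau.2.
 have eL2: e *m (refl e *m L) = e by rewrite mulmxA refl_self // mulNmx eL opprK.
 have XX: X *m refl e = X by rewrite reflE eX0 mulr0 scale0r subr0.
 by move: pL; rewrite -{1}XX -mulmxA (fixe _ g2 eL2) mulmx1.
Qed.

End HalfModel.

(** * Gluing local models that lift a given map *)

Section Glue.
Context (H: mirror_axioms S) (d3: (3 <= d)%N).
Local Notation tau:= (refl (mvec S)).

(** Points alone determine the germ: the comparing Lorentz map preserves the points of [E'] near
    [X], so it is the identity or the reflection of a chart, and both preserve the scale as well. *)
Lemma adm_pt_unique (E E': V -> T) X N0: adm E X -> adm E' X -> cap N0 X ->
  (forall Z, cap N0 Z -> pt (E Z) = pt (E' Z)) -> agree E E' X.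
move=> aE aE' N0X HN0. have [L [lL pL [N1 [N1X HN1]]]]:= adm_cmp H aE aE' (HN0 _ N0X).
have [j [L2 [N2 [l2 N2X HN2]]]]:= aE'. have [N3 [N3X HN3]]:= cap_lor lL (cap_par (par_sym pL) N2X) N2X.1.
have [N4 [N4X HN4]]:= capI N2X N3X. have [N5 [N5X HN5]]:= capI N0X N1X. have [N6 [N6X HN6]]:= capI N4X N5X.
have lt:= lor_tau H. suff h: forall Z, cap N6 Z -> E' (Z *m L) = E' Z.
 by exists N6; split=>// Z N6Z; rewrite -h //; apply: HN1; have [_ /HN5[]]:= HN6 _ N6Z.
have [Hid|Hre]: L2 = L *m L2 \/ L2 = L *m L2 *m tau.
- apply: (@rigid2 _ _ d3 L2 (L *m L2) (L *m L2 *m tau) X N6)=>//; try exact: lorM.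
 by apply: lorM; [exact: lorM|exact: lt]. move=> Z /HN6 [/HN4 [a /HN3 b] /HN5[c f]]; rewrite !mulmxA.
 have [W1 e1]:= HN2 _ a; have [W2 e2]:= HN2 _ b. have []:= (ma_fold H W1 W2).1; [|by left|by right].
 by rewrite -e1 -e2 -(HN1 _ f); symmetry; exact: HN0.
- have L1: L = 1%:M by have [L2' [_ L22 _]]:= lor_inv l2; rewrite -[L]mulmx1 -L22 mulmxA -Hid L22.
 by move=> Z _; rewrite L1 mulmx1.
- move=> Z /HN6 [/HN4 [a /HN3 b] _].
 have [W1 ->]:= HN2 _ a; have [W2 ->]:= HN2 _ b.
 have e: Z *m L2 = Z *m L *m L2 *m tau by rewrite {1}Hre !mulmxA. by rewrite e ma_refl // -e.
Qed.

(** The diagonal [lo X X] takes at each ray the value of the local model chosen there, and by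
    [adm_pt_unique] neighbouring choices agree. Off the cone the chosen function is the default
    [t0]. *)
Lemma glue_models (p: V -> M) (t0: T): (forall X, cone X -> exists E N,
    [/\ adm E X, cap N X & forall Z, cap N Z -> pt (E Z) = p Z]) ->
  exists E, forall X, cone X -> adm E X.
move=> loc; have h X: exists E: V -> T, cone X -> exists N, [/\ adm E X, cap N X & forall Z, cap N Z -> pt (E
Z) = p Z].
 have [cX|n]:= pselect (cone X); last by exists (fun=> t0).
 by have [E [N HN]]:= loc X cX; exists E=> _; exists N.
have [lo Hlo]:= choice h; exists (fun X=> lo X X)=> X cX.
have [N [aX NX HN]]:= Hlo X cX; have [N2 [N2X HN2]]:= adm_near aX. have [N3 [N3X HN3]]:= capI NX N2X.
apply: (adm_agree _ aX); exists N3; split=>// Z /HN3 [NZ N2Z].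
have [N' [aZ N'Z HN']]:= Hlo Z NZ.1; have [N4 [N4Z HN4]]:= capI NZ N'Z.
apply: agree_eq; apply: (adm_pt_unique (HN2 _ N2Z) aZ N4Z)=> W /HN4 [NW N'W]. by rewrite HN // HN'.
Qed.

End Glue.

End MirrorTheory.

(** * Calculus *)

Section Lines.
Context {R} {V W: normedModType R}.

Lemma derive_line (f: V -> W) x v (t: R): derivable f (x + t *: v) v ->
  is_derive t 1 (fun s => f (x + s *: v)) ('D_v f (x + t *: v)).
move=> df; have e: (fun h: R=> h^-1 *: (((fun s=> f (x + s *: v)) \o shift t) (h *: 1) - f (x + t *: v))) =
(fun h: R=> h^-1 *: ((f \o shift (x + t *: v)) (h *: v) - f (x + t *: v))).
 apply/funext=> h /=; congr (_ *: (f _ - _)). by rewrite [_%:A]mulr1 scalerDl addrCA.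
by apply: DeriveDef; rewrite /derivable /derive /= e.
Qed.

End Lines.

Section Calculus.
Context {R}.

Lemma line_mvt (V: normedModType R) (f: V -> R) x v (s: R) :
  (forall t, `|t| <= `|s| -> derivable f (x + t *: v) v) ->
  exists2 c, `|c| <= `|s| & f (x + s *: v) - f x = s * 'D_v f (x + c *: v).
move=> df; pose g t:= f (x + t *: v).
have dg (t: R): `|t| <= `|s| -> is_derive t 1 g ('D_v f (x + t *: v)) by move=>/df; exact: derive_line.
have cg (i: interval R): (forall t, t \in i -> `|t| <= `|s|) -> {within [set` i], continuous g}.
 move=> hi; apply: derivable_within_continuous=> t /hi /dg h; exact: ex_derive.
have g0: g 0 = f x by rewrite /g scale0r addr0. case: (lerP 0 s)=> s0.
- have b t: t \in `[0, s] -> `|t| <= `|s| by rewrite in_itv /= =>/andP[t0 ts]; rewrite !ger0_norm.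
 have [c cs e]:= @MVT_segment R g (fun t=> 'D_v f (x + t *: v)) 0 s s0 (fun t ts=> dg t (b t (subset_itv_oo_cc
 ts))) (cg _ b). by exists c; [exact: b|rewrite -g0 -/(g s) e subr0 mulrC].
- have b t: t \in `[s, 0] -> `|t| <= `|s| by rewrite in_itv /= =>/andP[t0 ts]; rewrite !ler0_norm ?lerN2 // ltW.
 have [c cs e]:= @MVT_segment R g (fun t=> 'D_v f (x + t *: v)) s 0 (ltW s0) (fun t ts=> dg t (b t
 (subset_itv_oo_cc ts))) (cg _ b). by exists c; [exact: b|rewrite -g0 -/(g s) -opprB e sub0r mulrN opprK mulrC].
Qed.

Lemma derive_dirE d (f: 'rV[R]_d -> R) x v: differentiable f x ->
  'D_v f x = \sum_j v 0 j * 'D_(e_ j) f x.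
move=> df; rewrite deriveE // {1}[v]row_sum_delta linear_sum.
by apply: eq_bigr=> j _; rewrite linearZ /= deriveE.
Qed.

Lemma differentiable_rV (V: normedModType R) e (F: V -> 'rV[R]_e) x :
  (forall j, differentiable (fun y => F y 0 j) x) -> differentiable F x.
move=> dF; have -> : F = \sum_j (fun y=> F y 0 j *: (e_ j: 'rV[R]_e)).
 by apply/funext=> y; rewrite fct_sumE [LHS]row_sum_delta.
by apply: differentiable_sum=> j; exact: differentiableZl.
Qed.

Lemma derive_coord (V: normedModType R) e (F: V -> 'rV[R]_e) x v j :
  derivable F x v -> ('D_v F x) 0 j = 'D_v (fun y => F y 0 j) x.
by move=> dF; rewrite derive_mx // mxE. Qed.

Lemma derive_chain (V: normedModType R) e (F: V -> 'rV[R]_e) (g: 'rV[R]_e -> R) x v :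
  (forall j, differentiable (fun y => F y 0 j) x) -> differentiable g (F x) ->
  is_derive x v (fun y => g (F y)) (\sum_j 'D_v (fun y => F y 0 j) x * 'D_(e_ j) g (F x)).
move=> dF dg; have dF':= differentiable_rV dF. have dc: differentiable (g \o F) x by exact: differentiable_comp.
apply: DeriveDef; first exact: (diff_derivable dc).
rewrite -[LHS]/('D_v (g \o F) x) deriveE // diff_comp //= -deriveE // -deriveE // derive_dirE //.
by apply: eq_bigr=> j _; rewrite derive_coord //; exact: diff_derivable.
Qed.

(** Linearity makes [dotp a] a candidate for the differential in [C1_differentiable]. *)
HB.instance Definition _ d (a: 'rV[R]_d) :=
  GRing.isLinear.Build R 'rV[R]_d R^o *:%R (dotp a: 'rV[R]_d -> R^o) (fun k u v => etrans (dotpDr _ _ _) (congr1 (fun z => z + _) (dotpZr _ _ _))).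

(** The increment is made one coordinate at a time and the mean value theorem is applied to each
    step, so the errors of [k] steps add up. *)
Lemma trunc_estimate d (f: 'rV[R]_d -> R) (x v: 'rV[R]_d) (eps: R) (a: 'I_d -> R) :
  (forall i y, `|y - x| <= `|v| -> derivable f y (e_ i)) ->
  (forall i y, `|y - x| <= `|v| -> `|'D_(e_ i) f y - a i| <= eps) ->
  forall k, (k <= d)%N ->
  `|f (x + \row_j (if (j < k)%N then v 0 j else 0)) - f x - \sum_(j < d | (j < k)%N) v 0 j * a j| <= k%:R * (eps * `|v|).
move=> df He; elim=>[|k IH] kd.
 rewrite mul0r big_pred0 // subr0 (_: \row_j _ = 0) ?addr0 ?subrr ?normr0 //. by apply/rowP=> j; rewrite !mxE.
pose i: 'I_d:= Ordinal kd. set y:= x + \row_j (if (j < k)%N then v 0 j else 0) in IH *.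
have -> : x + \row_j (if (j < k.+1)%N then v 0 j else 0) = y + v 0 i *: e_ i.
 rewrite /y -addrA; congr (_ + _); apply/rowP=> j; rewrite !mxE !eqxx /= ltnS leq_eqVlt.
 case: (eqVneq j i)=>[->|ji]; first by rewrite eqxx ltnn add0r mulr1.
 have -> : (j == k :> nat) = false by apply/negbTE; apply: contra ji=>/eqP h; apply/eqP/val_inj.
 by rewrite mulr0 addr0.
have ny t: `|t| <= `|v 0 i| -> `|y + t *: e_ i - x| <= `|v|.
 move=> tv; rewrite (_: y + t *: e_ i - x = \row_j (if (j < k)%N then v 0 j else 0) + t *: e_ i); last first.
  by apply/rowP=> j; rewrite !mxE; ring.
 rewrite [leLHS]/Num.Def.normr /= mx_normrE; apply: bigmax_le=>// -[i0 j] _ /=. rewrite !mxE !ord1 eqxx /=.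
 case: (eqVneq j i)=>[->|ji]; first by rewrite ltnn add0r mulr1 (le_trans tv) // coord_le.
 rewrite mulr0 addr0; case: ifP=> _; [exact: coord_le|by rewrite normr0].
have [c cv e]:= @line_mvt _ f y (e_ i) (v 0 i) (fun t tv=> df i _ (ny t tv)). rewrite (bigD1 i) //=.
rewrite (eq_bigl (fun j: 'I_d=> (j < k)%N)); last first.
 move=> j; rewrite ltnS leq_eqVlt; case: (eqVneq j i)=>[->|ji] /=; first by rewrite ltnn andbF.
 by rewrite andbT (_: (j == k :> nat) = false) //; apply/negbTE; apply: contra ji=>/eqP h; apply/eqP/val_inj.
have -> : f (y + v 0 i *: e_ i) - f x - (v 0 i * a i + \sum_(i0 < d | (i0 < k)%N) v 0 i0 * a i0) = (f y - f x -
\sum_(i0 < d | (i0 < k)%N) v 0 i0 * a i0) + v 0 i * ('D_(e_ i) f (y + c *: e_ i) - a i) by rewrite mulrBr -e; ring.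
apply: (le_trans (ler_normD _ _)); rewrite [k.+1%:R]mulrSr mulrDl mul1r lerD //; first by apply: IH; exact: ltnW.
rewrite normrM mulrC ler_pM //; [exact: He _ _ (ny _ cv)|exact: coord_le].
Qed.

Lemma C1_differentiable d (U: set 'rV[R]_d) (f: 'rV[R]_d -> R) x: open U -> U x ->
  (forall i y, U y -> derivable f y (e_ i)) ->
  (forall i, {for x, continuous ('D_(e_ i) f)}) -> differentiable f x.
move=> oU Ux df cf. pose a: 'rV[R]_d:= \row_i 'D_(e_ i) f x.
pose f': 'rV[R]_d -> R^o:= f; pose a': 'rV[R]_d -> R^o:= dotp a. have ca': continuous a' by exact: dotp_cont.
have da: 'd f' x = a' :> ('rV[R]_d -> R^o) /\ f' \o shift x = cst (f' x) + a' +o_ (0: 'rV[R]_d) id.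
 have E: f' \o shift x = cst (f' x) + a' +o_ (0: 'rV[R]_d) id.
  apply/eqaddoP=> eps eps0. have e1: 0 < eps / (d%:R + 1) by pos.
  have: \forall y \near x, U y /\ forall i, `|'D_(e_ i) f y - a 0 i| <= eps / (d%:R + 1).
   apply: filterI; first exact: open_nbhs_nbhs.
   have hf i: \forall y \near x, `|'D_(e_ i) f y - a 0 i| <= eps / (d%:R + 1) by rewrite mxE; have
   /cvgrPdist_le /(_ _ e1):= cf i; apply: filterS=> y; rewrite distrC. exact: filter_forall hf.
  move=>/nbhs_ballP [del /= del0 Hd].
  apply/nbhs_ballP; exists del=>// v; rewrite -ball_normE /= sub0r normrN=> vd.
  have Hv y: `|y - x| <= `|v| -> U y /\ forall i, `|'D_(e_ i) f y - a 0 i| <= eps / (d%:R + 1) by move=> yv;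
  apply: Hd; rewrite -ball_normE /= distrC (le_lt_trans yv).
  have:= @trunc_estimate d f x v (eps / (d%:R + 1)) (fun i=> a 0 i) (fun i y yv=> df i y (Hv y yv).1) (fun i y
  yv=> (Hv y yv).2 i) d (leqnn d). rewrite (_: \row_j _ = v); last by apply/rowP=> j; rewrite mxE ltn_ord.
  rewrite (eq_bigl predT); last by move=> j; rewrite ltn_ord.
  rewrite /= => h; rewrite -[X in `|X|]/(f (v + x) - (f x + dotp a v)).
  have -> : f (v + x) - (f x + dotp a v) = f (x + v) - f x - \sum_(j < d) v 0 j * a 0 j by rewrite (addrC v x)
  dotpC /dotp opprD addrA.
  apply: (le_trans h); rewrite mulrA ler_wpM2r // mulrA ler_pdivrMr // mulrC ler_pM2l //. lra.
 by split=>//; exact: (@diff_unique R 'rV[R]_d R^o f' (dotp a: {linear 'rV[R]_d -> R^o}) x ca' E).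
by rewrite -[f]/f'; apply/diff_locallyP; rewrite da.1; split; [exact: ca'|exact: da.2].
Qed.

End Calculus.

(** * Closure properties of C^k functions *)

Section CkTheory.
Context {R}.

Lemma cont_rV (T: topologicalType) e (F: T -> 'rV[R]_e) x :
  (forall j, {for x, continuous (fun y => F y 0 j)}) -> {for x, continuous F}.
move=> cF; apply/cvgrPdist_lt=> eps eps0.
have hf (j: 'I_e): \forall y \near x, `|F x 0 j - F y 0 j| < eps by have /cvgrPdist_lt /(_ _ eps0):= cF j.
near=> y. rewrite [ltLHS]/Num.Def.normr /= mx_normrE; apply: bigmax_lt=>// -[i j] _ /=.
rewrite !mxE !ord1; move: j; near: y; exact: filter_forall hf. Unshelve. all: by end_near. Qed.
 Lemma cont_near (T: topologicalType) (h: T -> R) x eps: {for x, continuous h} -> 0 < eps -> \forall y \near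
x, `|h y - h x| < eps.
by move=> c e0; have /cvgrPdist_lt /(_ _ e0):= c; apply: filterS=> y; rewrite distrC. Qed.
 Section Basic. Context {d: nat}. Implicit Types (U: set 'rV[R]_d) (f g: 'rV[R]_d -> R).
 Lemma Ck_cont k U f x: Ck k U f -> U x -> {for x, continuous f}.
by case: k=>[|k] [cf _] Ux; exact: cf. Qed.
 Lemma Ck_der k U f i x: Ck k.+1 U f -> U x -> derivable f x (e_ i). by move=>[_ /(_ i) [h _]] /h. Qed.
 Lemma Ck_D k U f i: Ck k.+1 U f -> Ck k U ('D_(e_ i) f). by move=>[_ /(_ i) [_]]. Qed.
 Lemma Ck_pred k U f: Ck k.+1 U f -> Ck k U f. elim: k f=>[|k IH] f [cf df]; first by split.
by split=>// i; have [d1 d2]:= df i; split=>//; exact: IH.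
Qed.

Lemma Ck_sub k U U' f: U' `<=` U -> Ck k U f -> Ck k U' f.
move=> UU; elim: k f=>[|k IH] f [cf df]; first by split=>// x /UU /cf.
split=>[x /UU /cf //|i]; have [d1 d2]:= df i. by split=>[x /UU /d1 //|]; exact: IH.
Qed.

Lemma Ck_ext k U f g: open U -> (forall x, U x -> f x = g x) -> Ck k U f -> Ck k U g.
move=> oU; elim: k f g=>[|k IH] f g fg [cf df].
 split=>// x Ux; have nU: nbhs x U by exact: open_nbhs_nbhs.
 have:= cf _ Ux; rewrite /prop_for /continuous_at (fg _ Ux)=> h.
 apply: cvg_trans h; apply: (@near_eq_cvg _ _ (nbhs x)). by apply: (@filterS _ (nbhs x) _ _ _ _ nU)=> y /fg.
have nr x: U x -> \near x, f x = g x by move=> Ux; apply: filterS (open_nbhs_nbhs (conj oU Ux))=> y /fg.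
split=>[x Ux|i].
 have:= cf _ Ux; rewrite /prop_for /continuous_at (fg _ Ux)=> h.
 by apply: cvg_trans h; apply: (@near_eq_cvg _ _ (nbhs x)); exact: nr.
have [d1 d2]:= df i; split=>[x Ux|].
 by apply: near_eq_derivable (d1 _ Ux); exact: nr.
by apply: IH d2=> x Ux; apply: near_eq_derive; exact: nr.
Qed.

Lemma Ck_cst k U (a: R): open U -> Ck k U (cst a).
move=> oU; elim: k a=>[|k IH] a; first by split=>// x _; exact: cst_continuous.
split=>[x _|i]; first exact: cst_continuous. split=>[x _|]; first exact: derivable_cst.
by apply: Ck_ext (IH 0)=>// x _; rewrite derive_cst.
Qed.

Lemma coord_der (j: 'I_d) (x v: 'rV[R]_d): is_derive x v (fun y => y 0 j: R) (v 0 j).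
have h: derivable (id: 'rV[R]_d -> 'rV[R]_d) x v by [].
apply: DeriveDef; first by move/derivable_mxP: h; exact. by rewrite -derive_coord // derive_id.
Qed.

Lemma Ck_coord k U (j: 'I_d): open U -> Ck k U (fun x => x 0 j).
move=> oU; case: k=>[|k]; first by split=>// x _; exact: coordC. split=>[x _|i]; first exact: coordC.
split=>[x _|]; first by have h:= coord_der j x (e_ i); exact: ex_derive.
apply: Ck_ext (Ck_cst k (e_ i 0 j) oU)=>// x _. by have h:= coord_der j x (e_ i); rewrite derive_val.
Qed.

Lemma Ck_add k U f g: open U -> Ck k U f -> Ck k U g -> Ck k U (fun x => f x + g x).
move=> oU; elim: k f g=>[|k IH] f g [cf df] [cg dg].
 by split=>// x Ux; exact: (@cvgD _ _ _ (nbhs x) _ f g _ _ (cf _ Ux) (cg _ Ux)).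
split=>[x Ux|i]; first exact: (@cvgD _ _ _ (nbhs x) _ f g _ _ (cf _ Ux) (cg _ Ux)).
have [d1 d2]:= df i; have [d3 d4]:= dg i. split=>[x Ux|]; first exact: (derivableD (d1 _ Ux) (d3 _ Ux)).
apply: Ck_ext (IH _ _ d2 d4)=>// x Ux. by rewrite -[RHS]/('D_(e_ i) (f + g) x) deriveD; [|exact: d1|exact: d3].
Qed.

Lemma Ck_mul k U f g: open U -> Ck k U f -> Ck k U g -> Ck k U (fun x => f x * g x).
move=> oU; elim: k f g=>[|k IH] f g Hf Hg; have [cf df]:= Hf; have [cg dg]:= Hg.
 by split=>// x Ux; exact: (@cvgM _ _ (nbhs x) _ f g _ _ (cf _ Ux) (cg _ Ux)).
split=>[x Ux|i]; first exact: (@cvgM _ _ (nbhs x) _ f g _ _ (cf _ Ux) (cg _ Ux)).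
have [d1 d2]:= df i; have [d3 d4]:= dg i. split=>[x Ux|]; first exact: (derivableM (d1 _ Ux) (d3 _ Ux)).
apply: Ck_ext (Ck_add oU (IH _ _ (Ck_pred Hf) d4) (IH _ _ (Ck_pred Hg) d2))=>// x Ux.
by rewrite -[RHS]/('D_(e_ i) (f * g) x) deriveM; [|exact: d1|exact: d3].
Qed.

Lemma Ck_scal k U f a: open U -> Ck k U f -> Ck k U (fun x => a * f x).
by move=> oU; apply: Ck_mul=>//; exact: Ck_cst. Qed.

Lemma Ck_opp k U f: open U -> Ck k U f -> Ck k U (fun x=>- f x).
by move=> oU /(Ck_scal (-1) oU); apply: Ck_ext=>// x _; rewrite mulN1r. Qed.

Lemma Ck_sum k U (I: Type) (r: seq I) (P: pred I) (F: I -> 'rV[R]_d -> R): open U ->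
  (forall i, Ck k U (F i)) -> Ck k U (fun x => \sum_(i <- r | P i) F i x).
move=> oU HF; elim: r=>[|i r IH].
 by apply: Ck_ext (Ck_cst k 0 oU)=>// x _; rewrite big_nil.
case: (boolP (P i))=> Pi.
 by apply: Ck_ext (Ck_add oU (HF i) IH)=>// x _; rewrite big_cons Pi.
by apply: Ck_ext IH=>// x _; rewrite big_cons (negPf Pi).
Qed.

Lemma Ck_prod k U (I: Type) (r: seq I) (P: pred I) (F: I -> 'rV[R]_d -> R): open U ->
  (forall i, Ck k U (F i)) -> Ck k U (fun x => \prod_(i <- r | P i) F i x).
move=> oU HF; elim: r=>[|i r IH].
 by apply: Ck_ext (Ck_cst k 1 oU)=>// x _; rewrite big_nil.
case: (boolP (P i))=> Pi.
 by apply: Ck_ext (Ck_mul oU (HF i) IH)=>// x _; rewrite big_cons Pi.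
by apply: Ck_ext IH=>// x _; rewrite big_cons (negPf Pi).
Qed.

Lemma Ck_diff k U f x: open U -> Ck k.+1 U f -> U x -> differentiable f x.
move=> oU Hf Ux; apply: (C1_differentiable oU Ux).
 by move=> i y; exact: Ck_der Hf.
by move=> i; exact: Ck_cont (Ck_D i Hf) Ux.
Qed.

End Basic.

Lemma Ck_comp d e k (U: set 'rV[R]_d) (W: set 'rV[R]_e) (F: 'rV[R]_d -> 'rV[R]_e) g :
  open U -> open W -> (forall x, U x -> W (F x)) ->
  (forall j, Ck k U (fun x => F x 0 j)) -> Ck k W g -> Ck k U (fun x => g (F x)).
move=> oU oW UW; elim: k g=>[|k IH] g HF Hg.
 split=>// x Ux; apply: (@continuous_comp _ _ _ F g).
  by apply: cont_rV=> j; exact: Ck_cont (HF j) Ux.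
 by apply: Ck_cont Hg _; exact: UW.
have dF j x: U x -> differentiable (fun x=> F x 0 j) x by move=> Ux; exact: Ck_diff (HF j) Ux.
have dg x: U x -> differentiable g (F x) by move=>/UW; exact: Ck_diff Hg.
have dd x i (Ux: U x):= derive_chain (e_ i) (fun j=> dF j x Ux) (dg x Ux). split=>[x Ux|i].
 apply: (@continuous_comp _ _ _ F g).
  by apply: cont_rV=> j; exact: Ck_cont (HF j) Ux.
 by apply: Ck_cont Hg _; exact: UW.
split=>[x Ux|]; first by have:= dd x i Ux=> h; exact: ex_derive.
apply: (@Ck_ext _ k U (fun x=> \sum_j 'D_(e_ i) (fun y=> F y 0 j) x * 'D_(e_ j) g (F x)))=>//.
 by move=> x Ux; have h:= dd x i Ux; rewrite derive_val.
apply: Ck_sum=>// j; apply: Ck_mul=>//; first exact: Ck_D.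
by apply: (IH ('D_(e_ j) g)); [move=> j'; exact: Ck_pred|exact: Ck_D].
Qed.

Lemma Ck_powR d k (U: set 'rV[R]_d) f a: open U -> (forall x, U x -> 0 < f x) ->
  Ck k U f -> Ck k U (fun x => f x `^ a).
move=> oU f0; have dp x b: U x -> is_derive (f x) 1 (fun r=> r `^ b) (b * f x `^ (b - 1)).
 by move=> Ux; apply: is_derive1_powR; exact: f0.
have dfp x b: U x -> differentiable (fun r=> r `^ b) (f x) by move=> Ux; apply/derivable1_diffP; have:= dp x b
Ux=> h; exact: ex_derive.
have cp x b: U x -> {for f x, continuous (fun r=> r `^ b)} by move=> Ux; apply: differentiable_continuous; exact: dfp.
elim: k a=>[|k IH] a Hf.
 by split=>// x Ux; apply: (@continuous_comp _ _ _ f (fun r=> r `^ a)); [exact: Ck_cont Hf Ux|exact: cp].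
split=>[x Ux|i].
 by apply: (@continuous_comp _ _ _ f (fun r=> r `^ a)); [exact: Ck_cont Hf Ux|exact: cp].
have dd x: U x -> is_derive x (e_ i) (fun x=> f x `^ a) (a * (f x `^ (a - 1) * 'D_(e_ i) f x)).
 move=> Ux; have df:= Ck_diff oU Hf Ux.
 have dc: differentiable ((fun r=> r `^ a) \o f) x by apply: differentiable_comp=>//; exact: dfp.
 apply: DeriveDef; first exact: (diff_derivable dc).
 rewrite -[LHS]/('D_(e_ i) ((fun r=> r `^ a) \o f) x) deriveE // diff_comp //=; last exact: dfp.
 rewrite diff1E; last exact: dfp. have h:= dp x a Ux; rewrite derive1E derive_val -deriveE //.
 by rewrite -[LHS]/(_ * _); ring.
split=>[x Ux|]; first by have h:= dd x Ux; exact: ex_derive.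
apply: (@Ck_ext _ k U (fun x=> a * (f x `^ (a - 1) * 'D_(e_ i) f x)))=>//.
 by move=> x Ux; have h:= dd x Ux; rewrite derive_val.
apply: Ck_scal=>//; apply: Ck_mul=>//; [exact: IH (Ck_pred Hf)|exact: Ck_D].
Qed.

Lemma Ck_inv d k (U: set 'rV[R]_d) f: open U -> (forall x, U x -> 0 < f x) ->
  Ck k U f -> Ck k U (fun x => (f x)^-1).
move=> oU f0 /(Ck_powR (-1) oU f0); apply: Ck_ext=>// x Ux. by rewrite powRN powRr1 // ltW // f0.
Qed.

Lemma Ck_sqrt d k (U: set 'rV[R]_d) f: open U -> (forall x, U x -> 0 < f x) ->
  Ck k U f -> Ck k U (fun x => Num.sqrt (f x)).
by move=> oU f0 /(Ck_powR 2^-1 oU f0); apply: Ck_ext=>// x Ux; rewrite powR12_sqrt // ltW // f0.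
Qed.

Lemma Ck_invn d k (U: set 'rV[R]_d) f: open U -> (forall x, U x -> f x != 0) ->
  Ck k U f -> Ck k U (fun x => (f x)^-1).
move=> oU f0 Hf; have ff x: U x -> 0 < f x * f x by move=> Ux; rewrite -expr2 exprn_even_gt0 //= f0.
have:= Ck_mul oU Hf (Ck_inv oU ff (Ck_mul oU Hf Hf)); apply: Ck_ext=>// x Ux. by field; exact: f0.
Qed.

(** The second difference of [f] in two directions is symmetric, and two applications of the mean
    value theorem make it [s ^+ 2] times a value, near [x], of either mixed derivative. *)
Lemma schwarz d (U: set 'rV[R]_d) f x i j: open U -> Ck 2 U f -> U x ->
  'D_(e_ i) ('D_(e_ j) f) x = 'D_(e_ j) ('D_(e_ i) f) x.
move=> oU Hf Ux.
have key a b eps: 0 < eps -> \forall s \near (0: R), exists q, `|q - 'D_(e_ b) ('D_(e_ a) f) x| < eps /\ f (x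
+ s *: e_ a + s *: e_ b) - f (x + s *: e_ a) - f (x + s *: e_ b) + f x = s * (s * q).
 move=> eps0; have c: {for x, continuous ('D_(e_ b) ('D_(e_ a) f))}.
  exact: Ck_cont (Ck_D b (Ck_D a Hf)) Ux.
 have: \forall y \near x, U y /\ `|'D_(e_ b) ('D_(e_ a) f) y - 'D_(e_ b) ('D_(e_ a) f) x| < eps.
  apply: filterI; first exact: open_nbhs_nbhs. exact: (@cont_near 'rV[R]_d _ x eps c eps0).
 move=>/nbhs_ballP [del /= del0 Hd]. have ne (k: 'I_d): `|e_ k: 'rV[R]_d| <= 1.
  rewrite [leLHS]/Num.Def.normr /= mx_normrE; apply: bigmax_le=>// -[u v] _ /=.
  by rewrite mxE; case: (_ && _); rewrite ?normr1 ?normr0.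
 have Hin t r: `|t| < del / 2 -> `|r| < del / 2 -> ball x del (x + t *: e_ a + r *: e_ b).
  move=> ht hr; rewrite -ball_normE /= -addrA opprD addrA subrr add0r normrN.
  apply: (le_lt_trans (ler_normD _ _)); rewrite !normrZ.
  have:= ler_wpM2l (normr_ge0 t) (ne a); have:= ler_wpM2l (normr_ge0 r) (ne b); lra.
 apply/nbhs_ballP; exists (del / 2); first by pos. move=> s; rewrite -ball_normE /= sub0r normrN=> sd.
 pose g y:= f (y + s *: e_ b) - f y.
 have dg t: `|t| <= `|s| -> is_derive (x + t *: e_ a) (e_ a) g ('D_(e_ a) f (x + t *: e_ a + s *: e_ b) -
 'D_(e_ a) f (x + t *: e_ a)).
  move=> ts; have td:= le_lt_trans ts sd.
  have h1: is_derive (x + t *: e_ a) (e_ a) f ('D_(e_ a) f (x + t *: e_ a)).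
   apply: derivableP; apply: Ck_der Hf _.
   by have:= (Hd _ (Hin t 0 td _)).1; rewrite scale0r addr0 normr0; apply; rewrite divr_gt0.
  have h2: is_derive (x + t *: e_ a) (e_ a) (fun y=> f (y + s *: e_ b)) ('D_(e_ a) f (x + t *: e_ a + s *: e_ b)).
   have e: (fun h: R=> h^-1 *: (((fun y=> f (y + s *: e_ b)) \o shift (x + t *: e_ a)) (h *: e_ a) - f (x + t
   *: e_ a + s *: e_ b))) = (fun h: R=> h^-1 *: ((f \o shift (x + t *: e_ a + s *: e_ b)) (h *: e_ a) - f (x +
   t *: e_ a + s *: e_ b))) by apply/funext=> h /=; rewrite !addrA.
   have dd: derivable f (x + t *: e_ a + s *: e_ b) (e_ a) by apply: Ck_der Hf _; exact: (Hd _ (Hin t s td sd)).1.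
   by apply: DeriveDef; rewrite /derivable /derive /= e.
  exact: (is_deriveB h2 h1).
 have [c1 c1s e1]:= @line_mvt _ _ g x (e_ a) s (fun t ts=> @ex_derive _ _ _ _ _ _ _ (dg t ts)).
 have c1d:= le_lt_trans c1s sd.
 have [c2 c2s e2]:= @line_mvt _ _ ('D_(e_ a) f) (x + c1 *: e_ a) (e_ b) s (fun t ts=> Ck_der (Ck_D a Hf) (Hd _
 (Hin c1 t c1d (le_lt_trans ts sd))).1). exists ('D_(e_ b) ('D_(e_ a) f) (x + c1 *: e_ a + c2 *: e_ b)); split.
  exact: (Hd _ (Hin _ _ c1d (le_lt_trans c2s sd))).2.
 rewrite -e2; have h:= dg _ c1s; have <- := @derive_val _ _ _ _ _ _ _ h. by rewrite -e1 /g; ring.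
apply/eqP; rewrite -subr_eq0 -normr_le0; apply/ler_addgt0Pl=> eps eps0. have e2: 0 < eps / 2 by pos.
have: \forall s \near (0: R), (exists q, `|q - 'D_(e_ i) ('D_(e_ j) f) x| < eps / 2 /\ f (x + s *: e_ j + s
*: e_ i) - f (x + s *: e_ j) - f (x + s *: e_ i) + f x = s * (s * q)) /\ exists q, `|q - 'D_(e_ j) ('D_(e_ i)
f) x| < eps / 2 /\ f (x + s *: e_ i + s *: e_ j) - f (x + s *: e_ i) - f (x + s *: e_ j) + f x = s * (s * q) by
apply: filterI; exact: key. move=>/nbhs_ballP [del /= del0 Hd].
have [|[q1 [h1 e1]] [q2 [h2 e2']]]:= Hd (del / 2).
 by rewrite -ball_normE /= sub0r normrN gtr0_norm; lra.
have s0: del / 2 != 0 by pos. have qq: q1 = q2.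
 apply: (mulfI s0); apply: (mulfI s0); rewrite -e1 -e2'.
 rewrite (_: x + (del / 2) *: e_ j + (del / 2) *: e_ i = x + (del / 2) *: e_ i + (del / 2) *: e_ j); last by
 rewrite addrAC. ring.
rewrite -qq in h2; rewrite addr0; clear -h1 h2; move: h1 h2.
move: ('D_(e_ i) ('D_(e_ j) f) x) ('D_(e_ j) ('D_(e_ i) f) x)=> A B h1 h2.
have -> : A - B = (q1 - B) - (q1 - A) by ring. by apply: (le_trans (ler_normB _ _)); lra.
Qed.

End CkTheory.
(** Two-sided counterpart of [jac]. The calculus is done with it on open sets, for extensions across
    the boundary, and [pd_half] brings the results back to one-sided derivatives. *)
Definition Dj {R: realType} {d e: nat} (F: 'rV[R]_d -> 'rV[R]_e) (x: 'rV[R]_d): 'M[R]_(d, e) :=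
  \matrix_(i, j) 'D_(e_ i) (fun y => F y 0 j) x.
Definition Cks {R: realType} {d e: nat} (U: set 'rV[R]_d) (F: 'rV[R]_d -> 'rV[R]_e) :=
  forall k j, Ck k U (fun x => F x 0 j).

Section Jacobian.
Context {R}.

Lemma Cks_diff d e (U: set 'rV[R]_d) (F: 'rV[R]_d -> 'rV[R]_e) x j: open U -> Cks U F -> U x ->
  differentiable (fun y => F y 0 j) x.
by move=> oU HF Ux; exact: Ck_diff oU (HF 1%N j) Ux. Qed.

Lemma Cks_cont d e (U: set 'rV[R]_d) (F: 'rV[R]_d -> 'rV[R]_e) x: Cks U F -> U x ->
  {for x, continuous F}.
by move=> HF Ux; apply: cont_rV => j; exact: Ck_cont (HF 0%N j) Ux. Qed.

Lemma derive_Dj d e (F: 'rV[R]_d -> 'rV[R]_e) x v j: differentiable (fun y => F y 0 j) x ->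
  'D_v (fun y => F y 0 j) x = (v *m Dj F x) 0 j.
by move=> dF; rewrite derive_dirE // mxE; apply: eq_bigr => i _; rewrite mxE. Qed.

Lemma Dj_comp d e e' (F: 'rV[R]_d -> 'rV[R]_e) (g: 'rV[R]_e -> 'rV[R]_e') x :
  (forall j, differentiable (fun y => F y 0 j) x) ->
  (forall j, differentiable (fun y => g y 0 j) (F x)) ->
  Dj (fun y => g (F y)) x = Dj F x *m Dj g (F x).
move=> dF dg; apply/matrixP=> i j; rewrite !mxE. have h:= derive_chain (e_ i) dF (dg j); rewrite derive_val.
by apply: eq_bigr=> k _; rewrite !mxE.
Qed.

Lemma Dj_eq d e (U: set 'rV[R]_d) (F G: 'rV[R]_d -> 'rV[R]_e) x: open U -> U x ->
  (forall y, U y -> F y = G y) -> Dj F x = Dj G x.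
move=> oU Ux FG; apply/matrixP=> i j; rewrite !mxE; apply: near_eq_derive.
by apply: filterS (open_nbhs_nbhs (conj oU Ux))=> y /FG ->.
Qed.

Lemma Dj_id d (x: 'rV[R]_d): Dj id x = 1%:M.
apply/matrixP=> i j; rewrite !mxE; have h:= coord_der j x (e_ i). by rewrite derive_val !mxE eqxx /= eq_sym.
Qed.

Lemma Dj_mul d e (L: 'M[R]_(d, e)) x: Dj (fun y => y *m L) x = L.
apply/matrixP=> i j; rewrite mxE.
have -> : (fun y: 'rV[R]_d=> (y *m L) 0 j) = \sum_k (fun y: 'rV[R]_d=> L k j *: (y 0 k: R^o)) by
apply/funext=> y; rewrite fct_sumE mxE; apply: eq_bigr=> k _; rewrite mulrC. rewrite derive_sum; last first.
 move=> k; apply: (@derivableZ _ _ _ (fun y: 'rV[R]_d=> y 0 k: R^o)).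
 by have h:= coord_der k x (e_ i); exact: ex_derive.
rewrite (bigD1 i) //= big1 ?addr0=>[|k ki].
 rewrite (@deriveZ _ _ _ (fun y: 'rV[R]_d=> y 0 i: R^o)); last first.
  by have h:= coord_der i x (e_ i); exact: ex_derive.
 by have h:= coord_der i x (e_ i); rewrite derive_val mxE !eqxx /= -[LHS]/(_ * 1) mulr1.
rewrite (@deriveZ _ _ _ (fun y: 'rV[R]_d=> y 0 k: R^o)); last first.
 by have h:= coord_der k x (e_ i); exact: ex_derive.
by have h:= coord_der k x (e_ i); rewrite derive_val mxE (negPf ki) andbF scaler0.
Qed.

Lemma Cks_mul d e (U: set 'rV[R]_d) (L: 'M[R]_(d, e)): open U -> Cks U (fun y => y *m L).
move=> oU k j. apply: (@Ck_ext _ _ k U (fun y: 'rV[R]_d=> \sum_i y 0 i * L i j))=>//.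
 by move=> x _; rewrite mxE.
by apply: Ck_sum=>// i; apply: Ck_mul=>//; [exact: Ck_coord|exact: Ck_cst].
Qed.

Lemma Cks_id d (U: set 'rV[R]_d): open U -> Cks U id.
by move=> oU k j; exact: Ck_coord. Qed.

Lemma Cks_sub d e (U U': set 'rV[R]_d) (F: 'rV[R]_d -> 'rV[R]_e): U' `<=` U -> Cks U F -> Cks U' F.
by move=> UU HF k j; exact: Ck_sub UU (HF k j). Qed.

Lemma Cks_comp d e e' (U: set 'rV[R]_d) (W: set 'rV[R]_e) (F: 'rV[R]_d -> 'rV[R]_e) (g: 'rV[R]_e -> 'rV[R]_e') :
  open U -> open W -> (forall x, U x -> W (F x)) -> Cks U F -> Cks W g -> Cks U (fun x => g (F x)).
move=> oU oW UW HF Hg k j.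
exact: (@Ck_comp _ _ _ k U W F (fun y => g y 0 j) oU oW UW (HF k) (Hg k j)). Qed.

Lemma Ck_Dj d e k (U: set 'rV[R]_d) (F: 'rV[R]_d -> 'rV[R]_e) i j: open U -> Cks U F ->
  Ck k U (fun x => Dj F x i j).
by move=> oU HF; apply: Ck_ext (Ck_D i (HF k.+1 j))=>// x _; rewrite mxE. Qed.

Lemma Ck_det d k n (U: set 'rV[R]_d) (A: 'rV[R]_d -> 'M[R]_n): open U ->
  (forall i j, Ck k U (fun x => A x i j)) -> Ck k U (fun x => \det (A x)).
move=> oU HA; rewrite /determinant; apply: Ck_sum=>// s; apply: Ck_mul=>//; first exact: Ck_cst.
by apply: Ck_prod.
Qed.

Lemma Ck_invmx d k n (U: set 'rV[R]_d) (A: 'rV[R]_d -> 'M[R]_n) i j: open U ->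
  (forall x, U x -> A x \in unitmx) ->
  (forall i j, Ck k U (fun x => A x i j)) -> Ck k U (fun x => invmx (A x) i j).
move=> oU uA HA.
apply: (@Ck_ext _ _ k U (fun x=> (\det (A x))^-1 * ((-1) ^+ (j + i) * \det (row' j (col' i (A x))))))=>//.
 by move=> x Ux; rewrite /invmx uA // !mxE.
apply: Ck_mul=>//.
 apply: Ck_invn=>//; last exact: Ck_det. by move=> x /uA; rewrite unitmxE unitfE.
apply: Ck_mul=>//; first exact: Ck_cst.
apply: Ck_det=>// a b; apply: Ck_ext (HA (lift j a) (lift i b))=>// x _; by rewrite !mxE.
Qed.

Lemma mulmx_norm_le d e (v: 'rV[R]_d) (L: 'M[R]_(d, e)): `|v *m L| <= `|v| * (\sum_i \sum_j `|L i j|).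
rewrite [leLHS]/Num.Def.normr /= mx_normrE; apply: bigmax_le=>[|[i j] _ /=].
 by rewrite mulr_ge0 // sumr_ge0 // => i _; rewrite sumr_ge0.
rewrite mxE ord1 mulr_sumr; apply: (le_trans (ler_norm_sum _ _ _)); apply: ler_sum=> k _.
rewrite normrM ler_pM //; first exact: coord_le. by rewrite (bigD1 j) //= lerDl sumr_ge0.
Qed.

Lemma diff_estimate d e (F: 'rV[R]_d -> 'rV[R]_e) x eps :
  (forall j, differentiable (fun y => F y 0 j) x) -> 0 < eps ->
  \forall y \near x, `|F y - F x - (y - x) *m Dj F x| <= eps * `|y - x|.
move=> dF eps0.
have h (j: 'I_e): \forall y \near x, `|F y 0 j - F x 0 j - ((y - x) *m Dj F x) 0 j| <= eps * `|y - x|.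
 have /diff_locally /eqaddoP /(_ _ eps0):= dF j.
 move=>/nbhs_ballP [del /= del0 Hd]; apply/nbhs_ballP; exists del=>// y. rewrite -ball_normE /= distrC=> yd.
 have:= Hd (y - x); rewrite -ball_normE /= sub0r normrN=>/(_ yd). rewrite -derive_Dj // deriveE //.
 by rewrite -[X in `|X| <= _]/(F (y - x + x) 0 j - (F x 0 j + 'd (fun y: 'rV[R]_d=> F y 0 j) x (y - x))) subrK
 opprD addrA.
near=> y; rewrite [leLHS]/Num.Def.normr /= mx_normrE; apply: bigmax_le=>[|[i j] _ /=].
 by pos.
rewrite ord1 [X in `|X|]mxE [X in `|X + _|]mxE [X in `|_ + X + _|]mxE [X in `|_ + X|]mxE.
by move: j {i}; near: y; exact: filter_forall h. Unshelve. all: by end_near. Qed.  End Jacobian.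

 (** * The inverse function theorem *)

 Section Inverse. Context {R} {d: nat}. Local Notation P:= 'rV[R]_d.
 Lemma closed_ball_compact (x0: P) (del: R): compact [set x: P | `|x - x0| <= del]. Proof.
apply: bounded_closed_compact.
 exists (del + `|x0|); split; first by rewrite num_real. move=> M dM x /= xd; apply: ltW; apply: le_lt_trans dM.
 by rewrite -[x in leLHS](subrK x0); apply: (le_trans (ler_normD _ _)); rewrite lerD2r.
apply: closedLE=> x; apply: (@continuous_comp _ _ _ (fun x: P=> x - x0) (fun x: P=> `|x|)).
 by apply: (@cvgB _ _ _ (nbhs x) _ id (cst x0)); [exact: cvg_id|exact: cvg_cst].
exact: norm_continuous.
Qed.

Definition convex_at (U: set P):= forall x y t, U x -> U y -> 0 <= t <= 1 -> U (x + t *: (y - x)).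

Lemma segment_mvt (U: set P) (f: P -> R) x y: open U -> convex_at U -> Ck 1 U f -> U x -> U y ->
  exists2 z, U z & f y - f x = \sum_j (y - x) 0 j * 'D_(e_ j) f z.
move=> oU cU sf Ux Uy; pose v:= y - x.
have dl (t: R): t \in `[0, 1] -> is_derive t 1 (fun t=> f (x + t *: v)) ('D_v f (x + t *: v)).
 rewrite in_itv /= => t01; apply: derive_line; apply: diff_derivable. by apply: Ck_diff oU sf _; exact: cU.
have [|c]:= @MVT R (fun t=> f (x + t *: v)) (fun t=> 'D_v f (x + t *: v)) 0 1 ltr01 (fun t ts=> dl t
(subset_itv_oo_cc ts)).
 by apply: derivable_within_continuous=> t /dl ht; exact: ex_derive.
rewrite in_itv /= =>/andP[c0 c1]; rewrite scale1r scale0r addr0 subr0 mulr1 (addrC x) subrK=> e.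
have Uc: U (x + c *: v) by apply: cU=>//; rewrite !ltW.
by exists (x + c *: v)=>//; rewrite e; apply: derive_dirE; exact: Ck_diff oU sf Uc.
Qed.

Lemma ball_convex (x: P) r: convex_at (ball x r).
move=> a b t; rewrite -!ball_normE /= => ha hb /andP[t0 t1].
have -> : x - (a + t *: (b - a)) = (1 - t) *: (x - a) + t *: (x - b) by apply/rowP=> u; rewrite !mxE; ring.
apply: (le_lt_trans (ler_normD _ _)); rewrite !normrZ ger0_norm ?subr_ge0 // (ger0_norm t0).
apply: (@le_lt_trans _ _ (Num.max `|x - a| `|x - b|)); last by rewrite gt_max ha hb.
have h1: `|x - a| <= Num.max `|x - a| `|x - b| by rewrite le_max lexx.
have h2: `|x - b| <= Num.max `|x - a| `|x - b| by rewrite le_max lexx orbT.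
move: (Num.max _ _) h1 h2=> s h1 h2; nra.
Qed.

Lemma near_identity (U: set P) (F: P -> P) x0: open U -> Cks U F -> U x0 -> Dj F x0 = 1%:M ->
  exists2 del: R, 0 < del & forall x x', `|x - x0| <= del -> `|x' - x0| <= del ->
    U x /\ `|F x - F x' - (x - x')| <= 2^-1 * `|x - x'|.
move=> oU HF Ux0 DF. pose eps: R:= 2^-1 / (d%:R + 1). have e0: 0 < eps by pos.
have h (ij: 'I_d * 'I_d): \forall y \near x0, `|Dj F y ij.1 ij.2 - (1%:M: 'M[R]_d) ij.1 ij.2| < eps.
 rewrite -DF; apply: (@cont_near _ _ (fun y=> Dj F y ij.1 ij.2))=>//.
 exact: Ck_cont (Ck_Dj 0 ij.1 ij.2 oU HF) Ux0.
have h2: \forall y \near x0, U y /\ forall ij: 'I_d * 'I_d, `|Dj F y ij.1 ij.2 - (1%:M: 'M[R]_d) ij.1 ij.2| < eps.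
 apply: filterI; first exact: open_nbhs_nbhs. exact: filter_forall h.
move: h2=>/nbhs_ballP [r /= r0 Hr]. exists (r / 2); first by pos.
have inb x: `|x - x0| <= r / 2 -> U x /\ forall ij: 'I_d * 'I_d, `|Dj F x ij.1 ij.2 - (1%:M: 'M[R]_d) ij.1
ij.2| < eps by move=> hx; apply: Hr; rewrite -ball_normE /= distrC; lra.
move=> x x' hx hx'; split; first exact: (inb _ hx).1.
rewrite [leLHS]/Num.Def.normr /= mx_normrE; apply: bigmax_le=>[|[i j] _ /=].
 by [].
rewrite !ord1=> {i}.
have bx y: `|y - x0| <= r / 2 -> ball x0 r y by move=> hy; rewrite -ball_normE /= distrC; lra.
have ob: open (ball x0 r) by exact: ball_open.
have [z Bz e1]:= segment_mvt ob (@ball_convex x0 r) (Ck_sub (fun y h=> (Hr y h).1) (HF 1%N j)) (bx _ hx') (bx _ hx).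
have [_ Hy]:= Hr _ Bz. rewrite [X in `|X|]mxE [X in `|X + _|]mxE [X in `|_ + X + _|]mxE e1.
rewrite (_: _ + _ = \sum_i (x - x') 0 i * (Dj F z i j - (1%:M: 'M[R]_d) i j)); last first.
 have -> : (- (x - x')) 0 j = - ((x - x') *m 1%:M) 0 j by rewrite mulmx1 [LHS]mxE.
 by rewrite [X in _ - X]mxE -sumrB; apply: eq_bigr=> i _; rewrite [Dj F z i j]mxE mulrBr.
apply: (le_trans (ler_norm_sum _ _ _)). apply: (@le_trans _ _ (\sum_(i < d) `|x - x'| * eps)).
 apply: ler_sum=> i _; rewrite normrM ler_pM //; first exact: coord_le. exact: ltW (Hy (i, j)).
have de: d%:R * eps <= 2^-1 by rewrite /eps mulrA ler_pdivrMr // mulrC ler_pM2l ?invr_gt0 // lerDl.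
rewrite sumr_const card_ord -[leLHS]mulr_natl mulrCA [leLHS]mulrC. by apply: ler_wpM2r.
Qed.

(** On a small closed ball [F] differs from the identity by a map of Lipschitz constant 1/2, which
    gives injectivity and a Lipschitz inverse. Solvability comes from minimising the norm of
    [F x - y] on the ball, and smoothness of the inverse from the formula for its derivative, by
    induction on the order. *)
Lemma inverse_normalized (U: set P) (F: P -> P) x0: open U -> Cks U F -> U x0 -> Dj F x0 = 1%:M ->
  exists (O W: set P) (h: P -> P),
  [/\ open O /\ open W, O x0 /\ O `<=` U, forall x, O x -> Dj F x \in unitmx,
      forall x, O x -> W (F x) /\ h (F x) = x &
      (forall y, W y -> O (h y) /\ F (h y) = y) /\ Cks W h].
move=> oU HF Ux0 DF. have cdet: {for x0, continuous (fun x=> \det (Dj F x))}.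
 apply: (@Ck_cont _ _ 0 U)=>//; apply: Ck_det=>// i j; exact: Ck_Dj.
have [U1 [oU1 U1x0 U1P]]: exists U1: set P, [/\ open U1, U1 x0 & forall x, U1 x -> U x /\ Dj F x \in unitmx].
 have h1: (0: R) < 1 by [].
 have h: \forall y \near x0, U y /\ `|\det (Dj F y) - \det (Dj F x0)| < 1 by apply: filterI; [exact:
 open_nbhs_nbhs|exact: (@cont_near _ _ _ _ _ cdet h1)].
 move: h=>/nbhs_ballP [r /= r0 Hr]; exists (ball x0 r); split; [exact: ball_open|exact: ballxx|move=> x /Hr [Ux hx]].
 split=>//; rewrite unitmxE unitfE; apply/eqP=> e0. by move: hx; rewrite e0 DF det1 sub0r normrN normr1 ltxx.
have HF1: Cks U1 F by apply: Cks_sub HF=> x /U1P []. have [del del0 Hd]:= near_identity oU1 HF1 U1x0 DF.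
pose B:= [set x: P | `|x - x0| <= del]. have Bx0: B x0 by rewrite /B /= subrr normr0 ltW.
have inj x x': B x -> B x' -> `|x - x'| <= 2 * `|F x - F x'|.
 move=> hx hx'; have [_ h]:= Hd _ _ hx hx'. have: `|x - x'| <= `|F x - F x' - (x - x')| + `|F x - F x'|.
  have e: x - x' = (F x - F x') - (F x - F x' - (x - x')) by rewrite subKr.
  by rewrite {1}e; apply: le_trans (ler_normB _ _) _; rewrite addrC.
 lra.
pose W:= [set y: P | `|y - F x0| < del / 2]. have oW: open W.
 rewrite (_: W = ball (F x0) (del / 2)); first exact: ball_open.
 by apply/seteqP; split=> y; rewrite -ball_normE /W /= distrC.
have sol y: W y -> exists x, `|x - x0| < del /\ F x = y.
 move=> Wy; pose g x:= `|F x - y|. have cg: {within B, continuous g}.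
  apply: continuous_in_subspaceT=> x /set_mem Bx.
  apply: (@continuous_comp _ _ _ (fun x=> F x - y) (fun z: P=> `|z|)); last exact: norm_continuous.
  apply: (@cvgB _ _ _ (nbhs x) _ F (cst y)); last exact: cvg_cst. exact: Cks_cont HF1 (Hd _ _ Bx Bx0).1.
 have [|x /set_mem Bx Hmin]:= @EVT_min_rV R d g B _ (@closed_ball_compact x0 del) cg.
  by exists x0.
 have Fy: F x = y.
  (* One Newton step, with the identity as differential, stays in the ball and at least halves the
     residual. *)
  apply/eqP; rewrite -subr_eq0 -normr_le0 leNgt; apply/negP=> m0. pose x1:= x - (F x - y).
  have xx1: x1 - x = - (F x - y) by rewrite /x1 addrAC subrr add0r. have Bx1: B x1.
   rewrite /B /=.
   have -> : x1 - x0 = - (F x - F x0 - (x - x0)) + (y - F x0) by rewrite /x1; apply/rowP=> j; rewrite !mxE; ring.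
   apply: (le_trans (ler_normD _ _)); rewrite normrN.
   have [_ h]:= Hd _ _ Bx Bx0; move: Wy Bx; rewrite /W /B /= => h1 h2; lra.
  have:= Hmin _ (mem_set Bx1); rewrite /g; apply/negP; rewrite -ltNge.
  have -> : F x1 - y = F x1 - F x - (x1 - x) by rewrite xx1 opprK addrA subrK.
  have [_ h]:= Hd _ _ Bx1 Bx; apply: (le_lt_trans h); rewrite xx1 normrN; lra.
 exists x; split=>//; apply: (le_lt_trans (inj _ _ Bx Bx0)); rewrite Fy. by move: Wy; rewrite /W /=; lra.
pose h y:= if pselect (W y) is left w then projT1 (cid (sol y w)) else 0.
have hP y: W y -> `|h y - x0| < del /\ F (h y) = y by rewrite /h; case: pselect=>// w _; case: cid.
pose O:= [set x: P | `|x - x0| < del /\ W (F x)].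
have Bh y: W y -> B (h y) by move=>/hP [h1 _]; rewrite /B /= ltW.
have OB x: O x -> B x by move=>[h1 _]; rewrite /B /= ltW.
have lip y y': W y -> W y' -> `|h y - h y'| <= 2 * `|y - y'| by move=> Wy Wy'; have:= inj _ _ (Bh _ Wy) (Bh _
Wy'); rewrite (hP _ Wy).2 (hP _ Wy').2. have oO: open O.
 rewrite openE=> x Ox; have [xd Wx]:= Ox.
 have cF: {for x, continuous F} by exact: Cks_cont HF1 (Hd _ _ (OB _ Ox) Bx0).1.
 have n1: nbhs x (ball x0 del) by apply: open_nbhs_nbhs; split; [exact: ball_open|rewrite -ball_normE /= distrC].
 have n2: nbhs x (F @^-1` W) by apply: cF; exact: open_nbhs_nbhs.
 by apply: filterS (filterI n1 n2)=> z []; rewrite -ball_normE /= distrC.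
have OU x: O x -> U x /\ Dj F x \in unitmx by move=>/OB Bx; apply: U1P; exact: (Hd _ _ Bx Bx0).1.
have Oh y: W y -> O (h y) by move=> Wy; have [h1 h2]:= hP _ Wy; split=>//; rewrite h2.
have hF x: O x -> h (F x) = x.
 move=> Ox; have [xd Wx]:= Ox; apply/eqP; rewrite -subr_eq0 -normr_le0.
 by apply: le_trans (inj _ _ (Bh _ Wx) (OB _ Ox)) _; rewrite (hP _ Wx).2 subrr normr0 mulr0.
have ch y: W y -> {for y, continuous h}.
 move=> Wy; apply: cont_rV=> k; apply/(@cvgrPdist_lt _ _ _ (nbhs y))=> eps eps0.
 have n1: nbhs y W by exact: open_nbhs_nbhs.
 have n2: nbhs y (ball y (eps / 2)) by apply: nbhsx_ballx; rewrite divr_gt0.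
 apply: filterS (filterI n1 n2)=> z [Wz]; rewrite -ball_normE /= => hz.
 rewrite (_: _ - _ = (h y - h z) 0 k); last by rewrite !mxE.
 apply: (le_lt_trans (coord_le _ _)); apply: (le_lt_trans (lip _ _ Wy Wz)); lra.
have dh y i k: W y -> is_derive y (e_ i) (fun z=> h z 0 k) (invmx (Dj F (h y)) i k).
 move=> Wy; set x:= h y; set J:= Dj F x. have [Ux uJ]:= OU _ (Oh _ Wy). have ne: `|e_ i: P| <= 1.
  rewrite [leLHS]/Num.Def.normr /= mx_normrE; apply: bigmax_le=>// -[u v] _ /=.
  by rewrite mxE; case: (_ && _); rewrite ?normr1 ?normr0.
 pose C: R:= 1 + \sum_a \sum_b `|invmx J a b|.
 have C0: 0 < C by rewrite ltr_pwDl // sumr_ge0 // => a _; rewrite sumr_ge0.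
 suff lim: (fun t: R=> t^-1 *: (((fun z=> h z 0 k) \o shift y) (t *: e_ i) - h y 0 k)) @ 0^' --> (invmx J i k: R).
  apply: DeriveDef; first by apply/cvg_ex; exists (invmx J i k). by apply: cvg_lim lim.
 apply/cvgrPdist_le=> eps eps0. pose eta1:= eps / (2 * C). have eta0: 0 < eta1 by pos.
 have est: \forall z \near x, `|F z - F x - (z - x) *m J| <= eta1 * `|z - x| by apply: diff_estimate=>// j;
 exact: Cks_diff oU HF Ux. have est2: \forall z \near y, W z /\ `|z - y - (h z - x) *m J| <= eta1 * `|h z - x|.
  have n1: nbhs y W by exact: open_nbhs_nbhs. have n2:= ch _ Wy _ est.
  by apply: filterS (filterI n1 n2)=> z [Wz]; rewrite /= (hP _ Wz).2 (hP _ Wy).2.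
 move: est2=>/nbhs_ballP [r /= r0 Hr].
 apply/nbhs_ballP; exists r=>// t; rewrite -ball_normE /= sub0r normrN=> tr t0.
 have yt: ball y r (t *: e_ i + y).
  rewrite -ball_normE /= opprD addrCA subrr addr0 normrN normrZ. by have:= ler_wpM2l (normr_ge0 t) ne; lra.
 have [Wz hz]:= Hr _ yt. set z:= t *: e_ i + y in Wz hz *. have zy: z - y = t *: e_ i by rewrite /z addrK.
 have lz:= lip _ _ Wz Wy; rewrite zy normrZ in lz.
 have lz2: `|h z - x| <= 2 * `|t| by have:= ler_wpM2l (normr_ge0 t) ne; rewrite -/x in lz; lra.
 have e1: (z - y - (h z - x) *m J) *m invmx J = t *: (e_ i *m invmx J) - (h z - x) by rewrite mulmxBl -mulmxA
 mulmxV // mulmx1 zy -scalemxAl. have e2: `|t *: (e_ i *m invmx J) - (h z - x)| <= eps * `|t|.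
  rewrite -e1; apply: (le_trans (mulmx_norm_le _ _)).
  have s0: 0 <= \sum_a \sum_b `|invmx J a b| by rewrite sumr_ge0 // => a _; rewrite sumr_ge0.
  have sC: \sum_a \sum_b `|invmx J a b| <= C by rewrite lerDr. apply: (@le_trans _ _ (eta1 * (2 * `|t|) * C)).
   apply: ler_pM=>//; apply: (le_trans hz); rewrite ler_pM2l //.
  have eC: eta1 * (2 * C) = eps by rewrite divfK // gt_eqF // mulr_gt0.
  by rewrite mulrA mulrAC -(mulrA eta1 2 C) eC.
 have -> : invmx J i k - t^-1 *: (h z 0 k - h y 0 k) = t^-1 * (t *: (e_ i *m invmx J) - (h z - x)) 0 k.
  have -> : (t *: (e_ i *m invmx J) - (h z - x)) 0 k = t * invmx J i k - (h z 0 k - h y 0 k) by rewrite /e_ -rowE !mxE.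
  by rewrite mulrBr mulrA mulVf // mul1r.
 rewrite normrM normfV ler_pdivrMl ?normr_gt0 // mulrC. by apply: le_trans e2; exact: coord_le.
exists O, W, h; split=>//.
- split; last by move=> x /OU [].
 by split; rewrite /W /= subrr normr0 // divr_gt0.
- by move=> x /OU [].
- by move=> x Ox; split; [case: Ox|exact: hF].
- split; first by move=> y Wy; split; [exact: Oh|exact: (hP _ Wy).2].
 move=> k; elim: k=>[|k IH] j.
  split=>// y Wy; apply: (@continuous_comp _ _ _ h (fun z: P=> z 0 j)); [exact: ch|exact: coordC].
 split=>[y Wy|i].
  by apply: (@continuous_comp _ _ _ h (fun z: P=> z 0 j)); [exact: ch|exact: coordC].
 split=>[y Wy|]; first by have hh:= dh y i j Wy; exact: ex_derive.
 apply: (@Ck_ext _ _ k W (fun y=> (fun x=> invmx (Dj F x) i j) (h y)))=>//.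
  by move=> y Wy; have hh:= dh y i j Wy; rewrite derive_val.
 apply: (@Ck_comp _ _ _ k W O h (fun x=> invmx (Dj F x) i j))=>//.
 apply: Ck_invmx=>//; first by move=> x /OU [].
 move=> a b; apply: Ck_Dj=>//; apply: Cks_sub HF=> x /OU []; done.
Qed.

Theorem loc_inverse (U: set P) (f: P -> P) x0: open U -> Cks U f -> U x0 -> Dj f x0 \in unitmx ->
  exists (O W: set P) (h: P -> P),
  [/\ open O /\ open W, O x0 /\ O `<=` U, forall x, O x -> Dj f x \in unitmx,
      forall x, O x -> W (f x) /\ h (f x) = x &
      (forall y, W y -> O (h y) /\ f (h y) = y) /\ Cks W h].
move=> oU Hf Ux0 uJ; set J:= Dj f x0 in uJ. pose F x:= f x *m invmx J. have oT: open [set: P] by exact: openT.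
have HF: Cks U F:= @Cks_comp _ _ _ _ U setT f (fun y=> y *m invmx J) oU oT (fun _ _=> Logic.I) Hf (Cks_mul _ oT).
have DF x: U x -> Dj F x = Dj f x *m invmx J.
 move=> Ux; rewrite -[RHS](congr1 (mulmx _) (Dj_mul (invmx J) (f x))).
 apply: Dj_comp=> j; first exact: Cks_diff oU Hf Ux.
 exact: (@Cks_diff _ _ _ setT (fun y=> y *m invmx J) (f x) j oT (Cks_mul _ oT)).
have [|O [W [h [[oO oW] [Ox0 OU] uD fO [hW sh]]]]]:= inverse_normalized oU HF Ux0.
 by rewrite DF // mulmxV.
pose W':= [set y: P | W (y *m invmx J)]. have oW': open W'.
 apply: open_comp=>// y _; exact: (@Cks_cont _ _ _ setT (fun y=> y *m invmx J) y (Cks_mul _ oT)).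
exists O, W', (fun y=> h (y *m invmx J)); split=>//.
- move=> x Ox; have:= uD _ Ox; rewrite DF; last exact: OU.
 by rewrite unitmx_mul=>/andP[].
- split; last exact: (@Cks_comp _ _ _ _ W' W (fun y=> y *m invmx J) h oW' oW (fun _ w=> w) (Cks_mul _ oW') sh).
 move=> y /hW [Oh e]; split=>//. by rewrite -[LHS]mulmx1 -(mulVmx uJ) mulmxA -/(F _) e -mulmxA mulVmx // mulmx1.
Qed.

End Inverse.

(** * Liouville's theorem *)

Section Iota.
Context {R n}.
Local Notation V:= 'rV[R]_n.+2.
Implicit Types (x y z: 'rV[R]_n) (X Y: V).
(** Index 0 is time and [li] the last spatial index; the indices [yi i] in between carry the flat
    coordinates of [lcone]. *)
Definition yi (i: 'I_n): 'I_n.+2:= lift ord0 (lift ord_max i).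
Definition li: 'I_n.+2:= lift ord0 ord_max.

Lemma sum_ix (Z: nmodType) (F: 'I_n.+2 -> Z): \sum_j F j = F 0 + (\sum_i F (yi i) + F li).
rewrite big_ord_recl big_ord_recr /=; congr (_ + (_ + _)).
apply: eq_bigr=> i _; congr (F (lift ord0 _)); apply/val_inj=>/=. by rewrite /bump leqNgt ltn_ord.
Qed.

Definition vec (t l: R) y: V:= \row_j
  if unlift ord0 j is Some j' then (if unlift ord_max j' is Some i then y 0 i else l) else t.

Lemma vec0 t l y: vec t l y 0 0 = t. by rewrite mxE unlift_none. Qed.

Lemma vecl t l y: vec t l y 0 li = l. by rewrite mxE liftK unlift_none. Qed.

Lemma vecy t l y i: vec t l y 0 (yi i) = y 0 i. by rewrite mxE !liftK. Qed.

Lemma ixP (P: 'I_n.+2 -> Prop): P 0 -> P li -> (forall i, P (yi i)) -> forall j, P j.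
move=> h0 hl hy j; case: (unliftP 0 j)=>[j' ->|->] //. by case: (unliftP ord_max j')=>[i ->|->] //; exact: hy.
Qed.

Lemma vecP X Y: X 0 0 = Y 0 0 -> X 0 li = Y 0 li -> (forall i, X 0 (yi i) = Y 0 (yi i)) -> X = Y.
by move=> h0 hl hy; apply/rowP; exact: ixP. Qed.

Lemma Q_ix X Y: Q X Y = \sum_i X 0 (yi i) * Y 0 (yi i) + X 0 li * Y 0 li - X 0 0 * Y 0 0.
by rewrite /Q /dotp sum_ix; ring. Qed.

(* The flat section of the cone: Q (lcone x) (lcone y) = - |x - y|^2 / 2. *)
Definition lcone y: V:= vec ((1 + dotp y y) / 2) ((1 - dotp y y) / 2) y.

Lemma Q_vec t l y t' l' y': Q (vec t l y) (vec t' l' y') = dotp y y' + l * l' - t * t'.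
by rewrite Q_ix !vec0 !vecl; congr (_ + _ - _); apply: eq_bigr => i _; rewrite !vecy. Qed.

Lemma Q_lcone y z: Q (lcone y) (lcone z) = - (dotp (y - z) (y - z)) / 2.
by rewrite Q_vec !dotpE (dotpC z y); field. Qed.

Lemma lconeC y: cone (lcone y).
split; first by rewrite Q_lcone subrr dotp0l oppr0 mul0r. by rewrite vec0 divr_gt0 // ltr_pwDl // dotp_ge0.
Qed.

(** On the cone it vanishes along a single ray, the point at infinity of the stereographic
    projection [stereo]. *)
Definition hgt X: R:= X 0 0 + X 0 li.
Definition stereo X: 'rV[R]_n:= \row_i (X 0 (yi i) / hgt X).

Lemma hgt_lcone y: hgt (lcone y) = 1.
by rewrite /hgt vec0 vecl; field. Qed.

Lemma hgtZ t X: hgt (t *: X) = t * hgt X.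
by rewrite /hgt !mxE mulrDr. Qed.

Lemma stereoK y: stereo (lcone y) = y.
by apply/rowP => i; rewrite mxE vecy hgt_lcone divr1. Qed.

Lemma stereo_par X Y: par X Y -> stereo X = stereo Y.
move=>[t t0 ->]; apply/rowP=> i; rewrite !mxE hgtZ -mulf_div divff ?mul1r //. by pos.
Qed.

Lemma hgt_ge0 X: cone X -> 0 <= hgt X.
move=>[XX X0]; rewrite /hgt -lerBlDl sub0r lerNl; apply: ler_normlW; rewrite normrN.
apply: ler_sqrp; last exact: ltW. rewrite real_normK ?num_real //; move: XX; rewrite Q_ix=> h.
have s0: 0 <= \sum_i X 0 (yi i) * X 0 (yi i) by rewrite sumr_ge0 // => i _; rewrite -expr2 sqr_ge0.
by rewrite !expr2; lra.
Qed.

Lemma lconeK X: cone X -> 0 < hgt X -> X = hgt X *: lcone (stereo X).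
move=>[XX X0] h0; have hn: hgt X != 0 by pos. move: XX; rewrite Q_ix=> XX.
have e: dotp (stereo X) (stereo X) = (X 0 0 - X 0 li) / hgt X.
 rewrite /dotp (eq_bigr (fun i=> (X 0 (yi i) * X 0 (yi i)) / hgt X ^+ 2)); last first.
  by move=> i _; rewrite !mxE; field.
 rewrite -mulr_suml (_: \sum_i _ = (X 0 0 - X 0 li) * hgt X); last by rewrite /hgt; lra. by field.
apply: vecP=>[||i]; rewrite mxE.
- by rewrite vec0 e; rewrite /hgt in hn *; field.
- by rewrite vecl e; rewrite /hgt in hn *; field.
- by rewrite vecy mxE; field.
Qed.

End Iota.
HB.lock Definition Dr {R: realType} {n N: nat} (i: 'I_n) (F: 'rV[R]_n -> 'rV[R]_N.+1) (x: 'rV[R]_n): 'rV[R]_N.+1 :=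
  \row_j 'D_(e_ i) (fun y => F y 0 j) x.

Section RowDerivative.
Context {R} {n N: nat}.
Local Notation P:= 'rV[R]_n.
Local Notation V:= 'rV[R]_N.+1.

Lemma DrE i (F: P -> V) x j: Dr i F x 0 j = 'D_(e_ i) (fun y => F y 0 j) x.
by rewrite unlock mxE. Qed.

Lemma Dr_row i (F: P -> V) x: Dr i F x = row i (Dj F x).
by apply/rowP => j; rewrite DrE !mxE. Qed.

Lemma Cks_Dr U i (F: P -> V): open U -> Cks U F -> Cks U (Dr i F).
by move=> oU HF k j; apply: Ck_ext (Ck_D i (HF k.+1 j))=>// x _; rewrite DrE.
Qed.

Lemma Dr_ext U i (F G: P -> V) x: open U -> U x -> (forall y, U y -> F y = G y) -> Dr i F x = Dr i G x.
by move=> oU Ux h; rewrite !Dr_row (Dj_eq oU Ux h). Qed.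

Lemma Dr_C U (F: P -> V) x i j: open U -> Cks U F -> U x -> Dr i (Dr j F) x = Dr j (Dr i F) x.
move=> oU HF Ux; apply/rowP=> k; rewrite (DrE i (Dr j F)) (DrE j (Dr i F)).
have e a b: 'D_(e_ a) (fun y=> Dr b F y 0 k) x = 'D_(e_ a) ('D_(e_ b) (fun y=> F y 0 k)) x by congr ('D_(_) _
x); apply/funext=> y; exact: DrE. by rewrite !e (schwarz _ _ oU (HF 2%N k) Ux).
Qed.

Lemma is_derive_Q U (F G: P -> V) x i: open U -> Cks U F -> Cks U G -> U x ->
  is_derive x (e_ i) (fun y => Q (F y) (G y)) (Q (Dr i F x) (G x) + Q (F x) (Dr i G x)).
move=> oU HF HG Ux.
have dF j: is_derive x (e_ i) (fun y=> F y 0 j) (Dr i F x 0 j) by rewrite DrE; apply: derivableP; exact: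
Ck_der (HF 1%N j) Ux.
have dG j: is_derive x (e_ i) (fun y=> G y 0 j) (Dr i G x 0 j) by rewrite DrE; apply: derivableP; exact:
Ck_der (HG 1%N j) Ux.
have e: (fun y=> Q (F y) (G y)) = (\sum_j ((fun y=> F y 0 j) * (fun y=> G y 0 j))) - (2 *: ((fun y=> F y 0 0) *
(fun y=> G y 0 0): P -> R^o)) by apply/funext=> y; rewrite -[RHS]/(_ - _) fct_sumE.
rewrite e; apply: is_derive_eq. rewrite /Q /dotp -[2 *: _]/(2 * _).
rewrite (eq_bigr (fun j=> Dr i F x 0 j * G x 0 j + F x 0 j * Dr i G x 0 j)); last first.
 by move=> j _; rewrite -[LHS]/(F x 0 j * Dr i G x 0 j + G x 0 j * Dr i F x 0 j); ring.
rewrite big_split /= -[X in _ - X]/(2 * (F x 0 0 * Dr i G x 0 0 + G x 0 0 * Dr i F x 0 0)); ring.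
Qed.

Lemma Q_const U (F G: P -> V) x i c: open U -> Cks U F -> Cks U G -> U x ->
  (forall y, U y -> Q (F y) (G y) = c) -> Q (Dr i F x) (G x) + Q (F x) (Dr i G x) = 0.
move=> oU HF HG Ux h; have d:= is_derive_Q i oU HF HG Ux.
rewrite -(@derive_val _ _ _ _ _ _ _ d) (_: 0 = 'D_(e_ i) (cst c) x); last by rewrite derive_cst.
apply: near_eq_derive; apply: filterS (open_nbhs_nbhs (conj oU Ux))=> y /h //.
Qed.

Lemma Dr_add U (F G: P -> V) x i: open U -> Cks U F -> Cks U G -> U x ->
  Dr i (fun y => F y + G y) x = Dr i F x + Dr i G x.
move=> oU HF HG Ux; apply/rowP=> j; rewrite [RHS]mxE (DrE i F) (DrE i G) DrE -deriveD.
- by congr ('D_(_) _ x); apply/funext=> y; rewrite mxE.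
- exact: Ck_der (HF 1%N j) Ux.
- exact: Ck_der (HG 1%N j) Ux.
Qed.

Lemma Dr_scal U (s: P -> R) (F: P -> V) x i: open U -> Ck 1 U s -> Cks U F -> U x ->
  Dr i (fun y => s y *: F y) x = 'D_(e_ i) s x *: F x + s x *: Dr i F x.
move=> oU Hs HF Ux; apply/rowP=> j; rewrite [RHS]mxE [X in _ = X + _]mxE [X in _ = _ + X]mxE (DrE i F) DrE.
have -> : (fun y=> (s y *: F y) 0 j) = s * (fun y=> F y 0 j) by apply/funext=> y; rewrite mxE.
rewrite deriveM; last first.
- exact: Ck_der (HF 1%N j) Ux.
- exact: Ck_der Hs Ux. by rewrite addrC; congr (_ + _); rewrite -[LHS]/(_ * _) mulrC.
Qed.

Lemma const_convex U (f: P -> R) x y: open U -> convex_at U -> Ck 1 U f ->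
  (forall z i, U z -> 'D_(e_ i) f z = 0) -> U x -> U y -> f x = f y.
move=> oU cU Hf Df Ux Uy; have [z Uz]:= segment_mvt oU cU Hf Ux Uy. rewrite big1=>[/eqP|i _]; first by lra.
by rewrite Df // mulr0.
Qed.

Lemma Dr_convex U (F: P -> V) x y: open U -> convex_at U -> Cks U F ->
  (forall z i, U z -> Dr i F z = 0) -> U x -> U y -> F x = F y.
move=> oU cU HF DF Ux Uy; apply/rowP=> j. apply: (const_convex oU cU (HF 1%N j))=>// z i Uz.
by have /rowP /(_ j):= DF z i Uz; rewrite DrE mxE.
Qed.

End RowDerivative.

Section NullSpan.
Context {R n}.
Local Notation V:= 'rV[R]_n.+2.

(** The matrix with rows [X], [E i] and [Y] is singular, since [X] is orthogonal to all of them;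
    pairing a linear dependence with [E k] kills the coefficient of [E k]. *)
Lemma null_span (X Y: V) (E: 'I_n -> V): Q X X = 0 -> X != 0 ->
  (forall i, Q X (E i) = 0) -> (forall i j, Q (E i) (E j) = (i == j)%:R) ->
  Q Y X = 0 -> (forall i, Q Y (E i) = 0) -> exists s, Y = s *: X.
move=> XX X0 XE EE YX YE.
pose rowf (j: 'I_n.+2): V:= if unlift ord0 j is Some j' then (if unlift ord_max j' is Some i then E i else Y) else X.
have r0: rowf 0 = X by rewrite /rowf unlift_none. have rl: rowf li = Y by rewrite /rowf liftK unlift_none.
have ry i: rowf (yi i) = E i by rewrite /rowf !liftK. pose A: 'M[R]_n.+2:= \matrix_j rowf j.
have rowA j: row j A = rowf j by rewrite rowK. have sing: \det A == 0.
 rewrite -det_tr; apply/det0P; exists (X *m qeta).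
  apply: contra X0=>/eqP h; rewrite -[X]mulmx1 -qetaK mulmxA h mul0mx //.
 apply/rowP=> j; rewrite [RHS]mxE.
 have -> : (X *m qeta *m A^T) 0 j = Q X (rowf j) by rewrite QmxE -rowA !mxE; apply: eq_bigr=> k _; rewrite !mxE.
 move: j; apply: ixP; rewrite ?r0 ?rl //; first by rewrite QC. by move=> i; rewrite ry XE.
have /det0P [u u0 uA]:= sing. have comb: u 0 0 *: X + (\sum_i u 0 (yi i) *: E i + u 0 li *: Y) = 0.
 transitivity (u *m A); last exact: uA.
 symmetry; rewrite mulmx_sum_row (eq_bigr (fun i=> u 0 i *: rowf i)); last by move=> i _; rewrite rowA.
 rewrite sum_ix r0 rl; congr (_ + (_ + _)). by apply: eq_bigr=> i _; rewrite ry.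
have Qsum (Z: V) (c: 'I_n -> R): Q Z (\sum_i c i *: E i) = \sum_i c i * Q Z (E i).
 elim/big_rec2: _=>[|i a b _ <-]; first by rewrite Q0r. by rewrite QDr QZr.
have uy k: u 0 (yi k) = 0.
 have: Q (E k) (u 0 0 *: X + (\sum_i u 0 (yi i) *: E i + u 0 li *: Y)) = 0 by rewrite comb Q0r.
 rewrite QDr QDr !QZr (QC (E k)) XE (QC _ Y) YE !mulr0 add0r addr0 Qsum (bigD1 k) //= EE eqxx mulr1.
 rewrite big1 ?addr0 // => i ik; by rewrite EE eq_sym (negPf ik) mulr0.
move: comb; rewrite big1 ?add0r=>[comb|i _]; last by rewrite uy scale0r. have ul: u 0 li != 0.
 apply: contra u0=>/eqP h; move: comb; rewrite h scale0r addr0=>/eqP.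
 rewrite scaler_eq0 (negPf X0) orbF=>/eqP h0; apply/eqP; apply: vecP; rewrite ?mxE //.
 by move=> i; rewrite uy mxE.
exists (- (u 0 0 / u 0 li)); apply: (scalerI ul); rewrite scalerA mulrN mulrCA divff // mulr1.
by rewrite scaleNr; apply/eqP; rewrite -subr_eq0 opprK addrC comb.
Qed.

End NullSpan.

Section Polynomials.
Context {R n}.

Lemma derive_sqr_dist (x: 'rV[R]_n) i: is_derive x (e_ i) (fun y => dotp y y / 2) (x 0 i).
have dc j:= coord_der j x (e_ i); have dm j:= is_deriveM (dc j) (dc j).
have -> : (fun y: 'rV[R]_n=> dotp y y / 2) = (2^-1: R) *: (\sum_j ((fun y: 'rV[R]_n=> y 0 j: R^o) * (fun y
: 'rV[R]_n=> y 0 j: R^o))) by apply/funext=> y; rewrite mulrC -[RHS]/(2^-1 * _) fct_sumE.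
apply: is_derive_eq; rewrite (bigD1 i) //= big1 ?addr0.
 rewrite !mxE !eqxx /= -[LHS]/(2^-1 * (x 0 i * 1 + x 0 i * 1)). by rewrite mulr1; field.
by move=> j ji; rewrite !mxE (negPf ji) andbF -[LHS]/(x 0 j * 0 + x 0 j * 0) mulr0 addr0.
Qed.

Lemma Ck_sqr_dist k (U: set 'rV[R]_n): open U -> Ck k U (fun y => dotp y y / 2).
move=> oU; apply: Ck_mul=>//; last exact: Ck_cst. by apply: Ck_sum=>// j; apply: Ck_mul=>//; exact: Ck_coord.
Qed.

Lemma Dr_sub_scal N (U: set 'rV[R]_n) (F: 'rV[R]_n -> 'rV[R]_N.+1) (s: 'rV[R]_n -> R) K x i :
  Cks U F -> Ck 1 U s -> U x ->
  Dr i (fun y => F y - s y *: K) x = Dr i F x - 'D_(e_ i) s x *: K.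
move=> HF Hs Ux; apply/rowP=> j; rewrite DrE [RHS]mxE [X in _ + X]mxE [X in _ - X]mxE (DrE i F).
have dF: derivable (fun y=> F y 0 j) x (e_ i):= Ck_der (HF 1%N j) Ux.
have ds: derivable (s: _ -> R^o) x (e_ i):= Ck_der Hs Ux.
have -> : (fun y=> (F y - s y *: K) 0 j) = (fun y=> F y 0 j: R^o) - (K 0 j *: (s: _ -> R^o)) by
apply/funext=> y; rewrite !mxE mulrC. by rewrite deriveB //; [rewrite deriveZ // mulrC|exact: derivableZ].
Qed.

Lemma Cks_sub_scal N (U: set 'rV[R]_n) (F: 'rV[R]_n -> 'rV[R]_N.+1) (s: 'rV[R]_n -> R) K :
  open U -> Cks U F -> (forall k, Ck k U s) -> Cks U (fun y => F y - s y *: K).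
move=> oU HF Hs k j; apply: (@Ck_ext _ _ k U (fun y=> F y 0 j + - (s y * K 0 j)))=>//.
 by move=> y _; rewrite !mxE.
by apply: Ck_add=>//; apply: Ck_opp=>//; apply: Ck_mul=>//; exact: Ck_cst.
Qed.

Lemma Dr_mul N (B: 'M[R]_(n, N.+1)) x i: Dr i (fun y => y *m B) x = row i B.
by rewrite Dr_row Dj_mul. Qed.

End Polynomials.

Section Liouville.
Context {R n} (n3: (3 <= n)%N).
Local Notation V:= 'rV[R]_n.+2.
Context (B: set 'rV[R]_n) (oB: open B) (cB: convex_at B) (x0: 'rV[R]_n) (Bx0: B x0).
Context (Xi: 'rV[R]_n -> V) (sX: Cks B Xi) (coneX: forall x, B x -> cone (Xi x))
  (isoX: forall x i j, B x -> Q (Dr i Xi x) (Dr j Xi x) = (i == j)%:R).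

Let sD i: Cks B (Dr i Xi). exact: Cks_Dr. Qed.

Let sDD i j: Cks B (Dr i (Dr j Xi)). exact: Cks_Dr. Qed.

Let DC x i j: B x -> Dr i (Dr j Xi) x = Dr j (Dr i Xi) x. exact: Dr_C. Qed.

Lemma third_index (i j: 'I_n): exists k: 'I_n, k != i /\ k != j.
apply: contrapT=> h; have: (#|'I_n| <= #|[set i; j]%SET|)%N.
 rewrite -cardsT; apply: subset_leq_card; apply/fintype.subsetP=> k _; rewrite !inE.
 by apply/negPn/negP; rewrite negb_or=>/andP[h1 h2]; apply: h; exists k.
by rewrite card_ord cards2=> h2; have:= leq_trans n3 h2; case: (i != j).
Qed.

Let s1 x i: B x -> Q (Xi x) (Dr i Xi x) = 0.
move=> Bx; have XX y: B y -> Q (Xi y) (Xi y) = 0 by move=>/coneX [].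
by have:= Q_const i oB sX sX Bx XX; rewrite (QC (Dr i Xi x)); lra.
Qed.

Let s2 x i j: B x -> Q (Xi x) (Dr j (Dr i Xi) x) = - (i == j)%:R.
move=> Bx; have:= Q_const j oB sX (sD i) Bx (fun y By=> s1 i By). by rewrite isoX // eq_sym; lra.
Qed.

(** The permutation argument by which a constant metric has vanishing Christoffel symbols. *)
Let s3 x i j k: B x -> Q (Dr k (Dr i Xi) x) (Dr j Xi x) = 0.
move=> Bx.
have t a b c: Q (Dr c (Dr a Xi) x) (Dr b Xi x) + Q (Dr c (Dr b Xi) x) (Dr a Xi x) = 0 by have:= Q_const c oB
(sD a) (sD b) Bx (fun y By=> isoX a b By); rewrite (QC (Dr a Xi x)).
have sw a b c: Q (Dr a (Dr b Xi) x) (Dr c Xi x) = Q (Dr b (Dr a Xi) x) (Dr c Xi x) by rewrite DC.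
have e1:= t i j k; have e2:= t k i j; have e3:= t j k i.
have e4:= sw i k j; have e5:= sw j k i; have e6:= sw i j k; lra.
Qed.

Let s2d x i: B x -> Q (Xi x) (Dr i (Dr i Xi) x) = -1.
by move=> Bx; rewrite s2 // eqxx. Qed.

Let s2o x i j: B x -> i != j -> Q (Xi x) (Dr j (Dr i Xi) x) = 0.
by move=> Bx ij; rewrite s2 // (negPf ij) oppr0. Qed.

Let Xnz x: B x -> Xi x != 0.
by move=>/coneX [_ h]; apply: contraTneq h=>->; rewrite mxE ltxx. Qed.

Let span x Y: B x -> Q Y (Xi x) = 0 -> (forall i, Q Y (Dr i Xi x) = 0) -> exists s, Y = s *: Xi x.
move=> Bx h1 h2; apply: (null_span _ (Xnz Bx) _ _ h1 h2); first by case: (coneX Bx).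
 by move=> i; exact: s1.
by move=> i j; exact: isoX.
Qed.

Let D3 x k i j: B x -> Dr k (Dr i (Dr j Xi)) x = Dr j (Dr i (Dr k Xi)) x.
move=> Bx; rewrite (Dr_C k i oB (sD j) Bx) (Dr_ext i oB Bx (fun y By=> DC k j By)).
by rewrite (Dr_C i j oB (sD k) Bx).
Qed.

(** By [null_span] the mixed derivative is a multiple [s] of [Xi]. For a third index [k], two
    expressions of the same third derivative, paired with [Dr k Xi], give [s = 0]; this needs
    [n >= 3]. *)
Let s4 x i j: B x -> i != j -> Dr i (Dr j Xi) x = 0.
move=> Bx ij; have [k [ki kj]]:= third_index i j.
have sp a b: a != b -> exists s, Dr a (Dr b Xi) x = s *: Xi x by move=> ab; apply: span=>// [|l]; [rewrite QC
s2o // eq_sym|exact: s3]. have [s es]:= sp _ _ ij; have ik: i != k by rewrite eq_sym. have [s' es']:= sp _ _ ik.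
have e1:= Q_const k oB (sDD i j) (sD k) Bx (fun y By=> s3 j k i By).
have e2:= Q_const j oB (sDD i k) (sD k) Bx (fun y By=> s3 k k i By).
move: e1 e2; rewrite (D3 k i j Bx) es es' !QZl s2d // s2o // => e1 e2. have s0: s = 0 by lra.
by rewrite s0 scale0r.
Qed.

Let zero_on (F: 'rV[R]_n -> V) x i: B x -> (forall y, B y -> F y = 0) -> Dr i F x = 0.
move=> Bx h; rewrite (Dr_ext (G:= fun y=> 0) i oB Bx) //.
by apply/rowP=> j; rewrite DrE mxE (_: (fun _=> _) = cst 0) ?derive_cst //; apply/funext=> y; rewrite mxE.
Qed.

Let s5 x i k: B x -> k != i -> Dr k (Dr i (Dr i Xi)) x = 0.
move=> Bx ki; rewrite (Dr_C k i oB (sD i) Bx); apply: zero_on=>// y By; exact: s4.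
Qed.

Let s6 x i j: B x -> Dr i (Dr i Xi) x = Dr j (Dr j Xi) x.
move=> Bx; case: (eqVneq i j)=>[->//|ij]; have [k [ki kj]]:= third_index i j.
have [s es]: exists s, Dr i (Dr i Xi) x - Dr j (Dr j Xi) x = s *: Xi x.
 apply: span=>// [|l]; rewrite QDl QNl; last by rewrite !s3 // subrr. by rewrite !(QC _ (Xi x)) !s2d // subrr.
have e1:= Q_const k oB (sDD i i) (sD k) Bx (fun y By=> s3 i k i By).
have e2:= Q_const k oB (sDD j j) (sD k) Bx (fun y By=> s3 j k j By).
move: e1 e2; rewrite !s5 // !Q0l !add0r=> e1 e2.
have: Q (s *: Xi x) (Dr k (Dr k Xi) x) = 0 by rewrite -es QDl QNl e1 e2 subrr.
rewrite QZl s2d // => h; have s0: s = 0 by lra. by move: es; rewrite s0 scale0r=>/eqP; rewrite subr_eq0=>/eqP.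
Qed.

Let s7 x i k: B x -> Dr k (Dr i (Dr i Xi)) x = 0.
move=> Bx; case: (eqVneq k i)=>[->|]; last exact: s5. have [j [ji _]]:= third_index i i.
by rewrite (Dr_ext i oB Bx (fun y By=> s6 i j By)) s5 // eq_sym.
Qed.

(** [Xi] is an isometric lift of a flat domain to the cone. Its mixed second derivatives vanish and
    the pure ones equal one constant vector [K], so [Xi x] is [c + x Bm + (|x|^2 / 2) K]. The
    relations among the coefficients say that [c], [Bm] and [K] form the image under a Lorentz map
    of the corresponding frame of [lcone]. *)
Theorem liouville: exists L, lor L /\ forall x, B x -> Xi x = lcone x *m L.
pose o: 'I_n:= Ordinal (leq_trans (ltn0Sn 2) n3). have [j1 [j1o _]]:= third_index o o.
have [K KE]: exists K, K = Dr o (Dr o Xi) x0 by eexists.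
have s8 x i j: B x -> Dr i (Dr j Xi) x = (i == j)%:R *: K.
 move=> Bx; case: (eqVneq i j)=>[->|ij]; last by rewrite s4 // scale0r. rewrite scale1r KE (s6 j o Bx).
 by apply: (Dr_convex oB cB (sDD _ _))=>// z k Bz; exact: s7.
have s8d x i: B x -> Dr i (Dr i Xi) x = K by move=> Bx; rewrite s8 // eqxx scale1r. have KK: Q K K = 0.
 have:= Q_const j1 oB (sDD o o) (sD j1) Bx0 (fun y By=> s3 o j1 o By). by rewrite s7 // Q0l add0r !s8d.
have [b bE]: exists b: 'I_n -> V, forall i, b i = Dr i Xi x0 - x0 0 i *: K by eexists.
pose Bm: 'M[R]_(n, n.+2):= \matrix_i b i. have rB i: row i Bm = b i by rewrite rowK. clearbody Bm.
have s9 x i: B x -> Dr i Xi x = b i + x 0 i *: K.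
 move=> Bx; apply/eqP; rewrite -subr_eq bE; apply/eqP.
 have sc k: Ck k B (fun y: 'rV[R]_n=> y 0 i) by exact: Ck_coord.
 apply: (Dr_convex (F:= fun y=> Dr i Xi y - y 0 i *: K) oB cB)=>//.
  exact: Cks_sub_scal.
 move=> z k Bz; rewrite (Dr_sub_scal _ _ (sD i) (sc 1%N) Bz) s8 //.
 have h:= coord_der i z (e_ k); rewrite derive_val !mxE eqxx /= eq_sym subrr //.
have [c cE]: exists c, c = Xi x0 - x0 *m Bm - (dotp x0 x0 / 2) *: K by eexists.
have s10 x: B x -> Xi x = c + x *m Bm + (dotp x x / 2) *: K.
 move=> Bx; suff -> : c = Xi x - x *m Bm - (dotp x x / 2) *: K by rewrite addrAC subrK subrK.
 have sq k: Ck k B (fun y: 'rV[R]_n=> dotp y y / 2) by exact: Ck_sqr_dist.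
 have sM: Cks B (fun y=> Xi y + y *m - Bm).
  move=> k j; apply: (@Ck_ext _ _ k B (fun y=> Xi y 0 j + (y *m - Bm) 0 j))=>//.
   by move=> y _; rewrite [in RHS]mxE.
  by apply: Ck_add=>//; exact: Cks_mul.
 have:= Dr_convex (F:= fun y=> (Xi y + y *m - Bm) - (dotp y y / 2) *: K) oB cB (Cks_sub_scal K oB sM sq) _ Bx0 Bx.
 rewrite cE !mulmxN; apply=> z i Bz.
 rewrite (Dr_sub_scal _ _ sM (sq 1%N) Bz) (Dr_add i oB sX (Cks_mul (- Bm) oB) Bz) Dr_mul s9 //.
 have h:= derive_sqr_dist z i; rewrite derive_val. by rewrite linearN /= rB addrAC addrK subrr.
have bK i: Q (b i) K = 0.
 have:= s3 i i i Bx0; rewrite s8d // QC s9 // QDl QZl KK mulr0 addr0; exact.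
have bb i j: Q (b i) (b j) = (i == j)%:R by have:= isoX i j Bx0; rewrite !s9 // !QDl !QDr !QZl !QZr KK (QC K)
!bK !mulr0 !addr0. have QBm x Y: Q (x *m Bm) Y = \sum_i x 0 i * Q (b i) Y.
 rewrite mulmx_sum_row; elim/big_rec2: _=>[|i a1 a2 _ <-]; first by rewrite Q0l. by rewrite QDl QZl rB.
have QBb x i: Q (x *m Bm) (b i) = x 0 i.
 rewrite QBm (bigD1 i) //= bb eqxx mulr1 big1 ?addr0 // => j ji. by rewrite bb (negPf ji) mulr0.
have QBK x: Q (x *m Bm) K = 0 by rewrite QBm big1 // => i _; rewrite bK mulr0.
have cK: Q c K = -1 by have:= s2d o Bx0; rewrite s8d // (s10 _ Bx0) !QDl QZl KK QBK mulr0 !addr0.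
have cb i: Q c (b i) = 0.
 have:= s1 i Bx0; rewrite (s10 _ Bx0) s9 // !QDl !QZl !QDr !QZr KK QBK QBb cK (QC K) bK. lra.
have cc: Q c c = 0.
 have [XX _]:= coneX Bx0; move: XX; rewrite (s10 _ Bx0).
 have e1: Q (x0 *m Bm) (x0 *m Bm) = dotp x0 x0 by rewrite QBm /dotp; apply: eq_bigr=> i _; rewrite QC QBb.
 have e2: Q (x0 *m Bm) c = 0 by rewrite QBm big1 // => i _; rewrite QC cb mulr0.
 rewrite !QDl !QDr !QZl !QZr e1 e2 (QC c (x0 *m Bm)) e2 (QC K (x0 *m Bm)) QBK KK (QC K c) cK; lra.
pose rowf (j: 'I_n.+2): V:= if unlift ord0 j is Some j' then (if unlift ord_max j' is Some i then b i else c
- 2^-1 *: K) else c + 2^-1 *: K. have r0: rowf 0 = c + 2^-1 *: K by rewrite /rowf unlift_none.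
have rl: rowf li = c - 2^-1 *: K by rewrite /rowf liftK unlift_none.
have ry i: rowf (yi i) = b i by rewrite /rowf !liftK. pose L: 'M[R]_n.+2:= \matrix_j rowf j.
have Q00: Q (rowf 0) (rowf 0) = -1 by rewrite r0 !QDl !QDr !QZl !QZr cc KK (QC K) cK; field.
have Qll: Q (rowf li) (rowf li) = 1 by rewrite rl !QDl !QDr !QNl !QNr !QZl !QZr cc KK (QC K) cK; field.
have Q0l': Q (rowf 0) (rowf li) = 0 by rewrite r0 rl !QDl !QDr !QNr !QZl !QZr cc KK (QC K) cK; field.
have Q0y i: Q (rowf 0) (rowf (yi i)) = 0 by rewrite r0 ry !QDl !QZl cb (QC K) bK mulr0 addr0.
have Qly i: Q (rowf li) (rowf (yi i)) = 0 by rewrite rl ry !QDl !QNl !QZl cb (QC K) bK mulr0 subr0.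
have Qyy i j: Q (rowf (yi i)) (rowf (yi j)) = (i == j)%:R by rewrite !ry bb.
have ortho: L *m qeta *m L^T = qeta.
 apply/matrixP=> j k.
 have -> : (L *m qeta *m L^T) j k = Q (rowf j) (rowf k) by rewrite QmxE -!(rowK rowf) -/L -!row_mul !mxE;
 apply: eq_bigr=> a _; rewrite !mxE. rewrite !mxE; move: j k; apply: ixP=>[||i]; apply: ixP=>[||i'] /=.
 - by rewrite Q00; ring.
 - by rewrite Q0l' /= mulr0 subr0.
 - by rewrite Q0y /= mulr0 subr0.
 - by rewrite QC Q0l' /= mulr0 subr0.
 - by rewrite Qll eqxx /= mulr0 subr0.
 - rewrite Qly mulr0 subr0 (_: (li == yi i') = false) //.
  by apply/negbTE; rewrite (inj_eq (@lift_inj _ _)); exact: neq_lift.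
 - by rewrite QC Q0y /= mulr0 subr0.
 - rewrite QC Qly mulr0 subr0 (_: (yi i == li) = false) //.
  by apply/negbTE; rewrite eq_sym (inj_eq (@lift_inj _ _)); exact: neq_lift.
 - by rewrite Qyy mulr0 subr0 !(inj_eq (@lift_inj _ _)).
have QL X Y: Q (X *m L) (Y *m L) = Q X Y by rewrite !QmxE trmx_mul -!mulmxA (mulmxA L) (mulmxA (L *m qeta)) ortho.
have XL x: B x -> Xi x = lcone x *m L.
 move=> Bx; rewrite s10 // [lcone x *m L]mulmx_sum_row.
 rewrite (eq_bigr (fun j=> lcone x 0 j *: rowf j)); last by move=> j _; rewrite rowK.
 rewrite sum_ix r0 rl vec0 vecl [x *m Bm]mulmx_sum_row.
 have -> : \sum_i x 0 i *: row i Bm = \sum_i lcone x 0 (yi i) *: rowf (yi i) by apply: eq_bigr=> i _; rewrite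
 vecy ry rB. move: (\sum_i _)=> Sg; by apply/rowP=> j; rewrite !mxE; field.
exists L; split=>//; split=>// X cX. have Z0:= coneX Bx0; rewrite XL // in Z0.
have XLn: Q (X *m L) (X *m L) = 0 by rewrite QL; case: cX. case: (pselect (par (lcone x0) X))=>[p|np].
 by apply: cone_par Z0; case: p=> t t0 ->; exists t=>//; rewrite scalemxAl.
have neg: Q (lcone x0 *m L) (X *m L) < 0 by rewrite QL; apply: coneQ0=>//; exact: lconeC.
split=>//; rewrite ltNge; apply/negP; rewrite le_eqVlt=>/orP[/eqP h|h].
 have: X *m L = (X *m L) 0 0 *: e_ 0 by apply: sp_eq0; move: XLn; rewrite QspE h mulr0 subr0.
 by rewrite h scale0r=> h2; move: neg; rewrite h2 Q0r ltxx.
have cN: cone (- (X *m L)) by split; [rewrite QNl QNr opprK|rewrite mxE oppr_gt0].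
by have:= cone_Q_le0 Z0 cN; rewrite QNr oppr_le0 leNgt neg.
Qed.

End Liouville.

(** * Curvature of conformally flat metrics *)

Section HalfDerivative.
Context {R m}.
Local Notation P:= 'rV[R]_m.+1.

(** A positive step from a point of the half space stays in it, so the one-sided derivative sees
    only values that [f] and [g] share. *)
Lemma pd_half (U: set P) (f g: P -> R) x i: open U -> U x -> half_space x ->
  (forall y, U y -> half_space y -> f y = g y) -> derivable g x (e_ i) ->
  pd i f x = 'D_(e_ i) g x.
move=> oU Ux hx fg dg; rewrite /pd /derive cvg_at_rightE //; congr (lim _).
have nU: nbhs x U by exact: open_nbhs_nbhs. have: \forall h \near (0: R), U (x + h *: e_ i).
 have c: {for 0, continuous (fun h: R=> x + h *: (e_ i: P))}.
  move=> A; rewrite scale0r addr0=> nA.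
  apply: (@cvgD _ _ _ (nbhs (0: R)) _ (cst x) (fun h: R=> h *: (e_ i: P)) x 0); last by rewrite addr0.
   exact: cvg_cst.
  rewrite -[X in _ --> X](scale0r (e_ i: P)).
  by apply: (@cvgZr_tmp _ _ _ (nbhs (0: R)) _ id _ (e_ i: P)); exact: cvg_id.
 by apply: c; rewrite scale0r addr0.
move=>/nbhs_ballP [r /= r0 Hr].
have e (h: R): 0 < h -> h < r -> h^-1 * (f (x + h *: e_ i) - f x) = h^-1 *: (g (h *: e_ i + x) - g x).
 move=> h0 hr; rewrite [_ *: _ + x]addrC -(fg x Ux hx) -(fg (x + h *: e_ i)) //.
  by apply: Hr; rewrite -ball_normE /= sub0r normrN gtr0_norm.
 by rewrite /half_space /= !mxE addr_ge0 // mulr_ge0 // ?ltW //; case: (_ && _).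
rewrite eqEsubset; split=> A; rewrite /nbhs /=.
 move=>[d /= d0 Hd]; exists (Num.min d r); first by rewrite /= lt_min d0.
 move=> h /=; rewrite lt_min sub0r normrN=>/andP[hd hr] h0.
 rewrite -e //; first by apply: Hd=>//=; rewrite sub0r normrN. by rewrite gtr0_norm in hr.
move=>[d /= d0 Hd]; exists (Num.min d r); first by rewrite /= lt_min d0.
move=> h /=; rewrite lt_min sub0r normrN=>/andP[hd hr] h0.
rewrite e //; first by apply: Hd=>//=; rewrite sub0r normrN. by rewrite gtr0_norm in hr.
Qed.

End HalfDerivative.

(** * Curvature of a metric [E J J^T] computed in the flat frame [J] *)

Section Gauge.
Context {R m}.
Local Notation n:= m.+1.
Local Notation P:= 'rV[R]_n.

(** The algebraic core of [RrJ]: the third derivative [T] and all terms without [ti] and [tj]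
    cancel, and what remains is the Kulkarni-Nomizu product of the metric with the tensor [t]. *)
Lemma gauge_curvature (Ji Jj Jk v ti tj Fij Fik Fjk T: P) (ui uj uk vv: R) :
  ui = dotp Ji v -> uj = dotp Jj v -> uk = dotp Jk v -> vv = dotp v v ->
  dotp ti Jj = dotp tj Ji ->
  let Kjk:= Fjk - uj *: Jk - uk *: Jj + dotp Jj Jk *: v in
  let Kik:= Fik - ui *: Jk - uk *: Ji + dotp Ji Jk *: v in
  let dvi:= ti - ui *: v + (vv / 2) *: Ji in
  let dvj:= tj - uj *: v + (vv / 2) *: Jj in
  let dKi:= T - (dotp Fij v + dotp Jj dvi) *: Jk - uj *: Fik - (dotp Fik v + dotp Jk dvi) *: Jj
             - uk *: Fij + (dotp Fij Jk + dotp Jj Fik) *: v + dotp Jj Jk *: dvi in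
  let dKj:= T - (dotp Fij v + dotp Ji dvj) *: Jk - ui *: Fjk - (dotp Fjk v + dotp Jk dvj) *: Ji
             - uk *: Fij + (dotp Fij Jk + dotp Ji Fjk) *: v + dotp Ji Jk *: dvj in
  dKi - dKj + (- ui *: Kjk - dotp Kjk v *: Ji + dotp Ji Kjk *: v)
     - (- uj *: Kik - dotp Kik v *: Jj + dotp Jj Kik *: v)
  = dotp tj Jk *: Ji - dotp ti Jk *: Jj + dotp Jj Jk *: ti - dotp Ji Jk *: tj.
move=> hi hj hk hv hs Kjk Kik dvi dvj dKi dKj; rewrite /dKi /dKj /dvi /dvj /Kjk /Kik {dKi dKj dvi dvj Kjk Kik}.
rewrite !dotpE (dotpC Jj ti) hs (dotpC Ji tj) (dotpC Jk ti) (dotpC Jk tj) (dotpC Ji Jj).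
rewrite (dotpC Jj Ji) (dotpC Jk Ji) (dotpC Jk Jj) -!hi -!hj -!hk -!hv. by apply/rowP=> b; rewrite !mxE; field.
Qed.

Context (O: set P) (oO: open O) (G: P -> 'M[R]_n) (J Pm tm: P -> 'M[R]_n) (E: P -> R) (v: P -> P)
  (F: P -> 'I_n -> 'I_n -> P) (T: P -> 'I_n -> 'I_n -> 'I_n -> P).
Local Notation H x i j:= (dotp (row i (J x)) (row j (J x))).
Local Notation u x i:= (dotp (row i (J x)) (v x)).
Context (E0: forall x, O x -> 0 < E x) (GE: forall x, O x -> half_space x -> G x = E x *: (J x *m (J x)^T)).
Context (JP: forall x, O x -> J x *m Pm x = 1%:M) (dJ: forall x i j a, O x -> is_derive x (e_ i) (fun y => J y j a) (F x i j 0 a)).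
Context (dF: forall x k i j a, O x -> is_derive x (e_ k) (fun y => F y i j 0 a) (T x k i j 0 a)) (FC: forall x i j, O x -> F x i j = F x j i).
Context (TC: forall x k i j, O x -> T x k i j = T x i k j) (dE: forall x i, O x -> is_derive x (e_ i) E (- 2 * (E x * u x i))).
Context (dv: forall x i a, O x -> is_derive x (e_ i) (fun y => v y 0 a)
   (tm x i a - u x i * v x 0 a + dotp (v x) (v x) / 2 * J x i a)).
Context (tC: forall x i j, O x -> dotp (row i (tm x)) (row j (J x)) = dotp (row j (tm x)) (row i (J x))) (dP: forall x i k l, O x -> derivable (fun y => Pm y k l) x (e_ i)).

Lemma is_derive_dotp (A B: P -> P) (dA dB: P) x i :
  (forall a, is_derive x (e_ i) (fun y => A y 0 a) (dA 0 a)) ->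
  (forall a, is_derive x (e_ i) (fun y => B y 0 a) (dB 0 a)) ->
  is_derive x (e_ i) (fun y => dotp (A y) (B y)) (dotp dA (B x) + dotp (A x) dB).
move=> hA hB; have hM a:= is_deriveM (hA a) (hB a).
have -> : (fun y=> dotp (A y) (B y)) = \sum_a ((fun y=> A y 0 a: R^o) * (fun y=> B y 0 a: R^o)) by
apply/funext=> y; rewrite fct_sumE. apply: is_derive_eq; rewrite /dotp -big_split /=; apply: eq_bigr=> a _.
by rewrite -[LHS]/(A x 0 a * dB 0 a + B x 0 a * dA 0 a); ring.
Qed.

Lemma dJr x i j: O x -> forall a, is_derive x (e_ i) (fun y => row j (J y) 0 a) (F x i j 0 a).
move=> Ox a; have -> : (fun y=> row j (J y) 0 a) = (fun y=> J y j a) by apply/funext=> y; rewrite mxE.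
exact: dJ.
Qed.

Lemma dH x i j k: O x -> is_derive x (e_ i) (fun y => H y j k)
  (dotp (F x i j) (row k (J x)) + dotp (row j (J x)) (F x i k)).
by move=> Ox; apply: is_derive_dotp => a; exact: dJr. Qed.

Definition dvr x i: P:= row i (tm x) - u x i *: v x + (dotp (v x) (v x) / 2) *: row i (J x).

Lemma dvrE x i a: O x -> is_derive x (e_ i) (fun y => v y 0 a) (dvr x i 0 a).
by move=> Ox; rewrite !mxE; exact: dv. Qed.

Lemma du x i j: O x -> is_derive x (e_ i) (fun y => u y j)
  (dotp (F x i j) (v x) + dotp (row j (J x)) (dvr x i)).
by move=> Ox; apply: is_derive_dotp => a; [exact: dJr|exact: dvrE]. Qed.

(** The Christoffel symbols in the flat frame: multiplication by [Pm], the inverse of [J], gives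
    [christoffel]. Here [v] is minus half the gradient of log [E], and the frame spares an explicit
    derivative of the inverse metric. *)
Definition Kr x i j: P:= F x i j - u x i *: row j (J x) - u x j *: row i (J x) + H x i j *: v x.
Definition dKr x i j k: P:= T x i j k - (dotp (F x i j) (v x) + dotp (row j (J x)) (dvr x i)) *: row k (J x)
  - u x j *: F x i k - (dotp (F x i k) (v x) + dotp (row k (J x)) (dvr x i)) *: row j (J x)
  - u x k *: F x i j + (dotp (F x i j) (row k (J x)) + dotp (row j (J x)) (F x i k)) *: v x
  + H x j k *: dvr x i.

Lemma dKrE x i j k b: O x -> is_derive x (e_ i) (fun y => Kr y j k 0 b) (dKr x i j k 0 b).
move=> Ox. have h1:= dF i j k b Ox; have h2:= du i j Ox; have h3:= dJr i k Ox b.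
have h4:= du i k Ox; have h5:= dJr i j Ox b; have h6:= dH i j k Ox; have h7:= dvrE i b Ox.
have m1:= is_deriveM h2 h3; have m2:= is_deriveM h4 h5; have m3:= is_deriveM h6 h7.
have -> : (fun y=> Kr y j k 0 b) = (fun y=> F y j k 0 b: R^o) - (fun y=> u y j: R^o) * (fun y=> row k (J y) 0
b: R^o) - (fun y=> u y k: R^o) * (fun y=> row j (J y) 0 b: R^o) + (fun y=> H y j k: R^o) * (fun y=> v y 0 b: R^o).
 apply/funext=> y; rewrite /Kr.
 rewrite -[RHS]/(F y j k 0 b - u y j * row k (J y) 0 b - u y k * row j (J y) 0 b + H y j k * v y 0 b).
 move: (u y j) (u y k) (H y j k) (row k (J y)) (row j (J y)) (F y j k) (v y)=> *. by rewrite !mxE.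
apply: is_derive_eq; rewrite /dKr. move: (dvr x i) h2 h4 h7 m1 m2 m3=> dd _ _ _ _ _ _. rewrite !mxE.
move: (dotp _ _) (dotp _ _) (dotp _ _) (dotp _ _)=> *.
rewrite -[LHS]/(_ - (_ * _ + _ * _) - (_ * _ + _ * _) + (_ * _ + _ * _)) /=; ring.
Qed.

Lemma dG x i j l: O x -> half_space x -> pd i (fun y => G y j l) x =
  E x * (- 2 * u x i * H x j l + dotp (F x i j) (row l (J x)) + dotp (row j (J x)) (F x i l)).
move=> Ox hx; have h1:= dH i j l Ox; have h2:= dE i Ox; have h3:= is_deriveM h2 h1.
rewrite (pd_half (g:= (E: _ -> R^o) * (fun y=> H y j l: R^o)) oO Ox hx).
- by rewrite derive_val -[LHS]/(_ * _ + _ * _) /=; ring.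
- move=> y Oy hy; rewrite GE // -[RHS]/(E y * H y j l) mxE; congr (_ * _).
 by rewrite mxE; apply: eq_bigr=> a _; rewrite !mxE.
- exact: ex_derive.
Qed.

Lemma PJ x: O x -> Pm x *m J x = 1%:M.
by move=> Ox; apply: mulmx1C; exact: JP. Qed.

Lemma invG x: O x -> half_space x -> invmx (G x) = (E x)^-1 *: ((Pm x)^T *m Pm x).
move=> Ox hx; have En: E x != 0 by rewrite gt_eqF // E0.
have gi: ((E x)^-1 *: ((Pm x)^T *m Pm x)) *m G x = 1%:M.
 rewrite GE // -scalemxAl -scalemxAr scalerA mulVf // scale1r -mulmxA (mulmxA (Pm x)) PJ // mul1mx.
 by rewrite -trmx_mul JP // trmx1.
have [_ uG]:= mulmx1_unit gi. by rewrite -[LHS]mul1mx -gi -mulmxA mulmxV // mulmx1.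
Qed.

Lemma christoffelE x k i j: O x -> half_space x -> christoffel G k i j x = (Kr x i j *m Pm x) 0 k.
move=> Ox hx; have En: E x != 0 by rewrite gt_eqF // E0. rewrite /christoffel.
have br l: pd i (fun y=> G y j l) x + pd j (fun y=> G y i l) x - pd l (fun y=> G y i j) x = 2 * E x * dotp (Kr
x i j) (row l (J x)).
 rewrite !dG // /Kr !dotpE (FC j i Ox) (FC l i Ox) (FC l j Ox).
 rewrite (dotpC (row j (J x)) (F x i l)) (dotpC (row i (J x)) (F x j l)).
 by rewrite (dotpC (v x) (row l (J x))); ring.
rewrite (eq_bigr (fun l=> 2 * (((Pm x)^T *m Pm x) k l * (J x *m (Kr x i j)^T) l 0))); last first.
 move=> l _; rewrite br invG // [X in X * _]mxE.
 have -> : dotp (Kr x i j) (row l (J x)) = (J x *m (Kr x i j)^T) l 0 by rewrite dotpC mxE; apply: eq_bigr=> a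
 _; rewrite !mxE. by move: (_ k l) (_ l 0)=> a b; field.
rewrite -mulr_sumr mulrA mulVf ?pnatr_eq0 // mul1r.
transitivity (((Pm x)^T *m Pm x *m (J x *m (Kr x i j)^T)) k 0); first by rewrite [RHS]mxE.
by rewrite -mulmxA (mulmxA (Pm x)) PJ // mul1mx -trmx_mul mxE.
Qed.

Definition Gr x i j: P:= Kr x i j *m Pm x.

Lemma GrJ x i j: O x -> Gr x i j *m J x = Kr x i j.
by move=> Ox; rewrite /Gr -mulmxA PJ // mulmx1. Qed.

Lemma derivable_Gr x i j k l: O x -> derivable (fun y => Gr y j k 0 l) x (e_ i).
move=> Ox; have -> : (fun y=> Gr y j k 0 l) = \sum_a ((fun y=> Kr y j k 0 a: R^o) * (fun y=> Pm y a l: R^o)).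
 by apply/funext=> y; rewrite fct_sumE mxE.
apply: derivable_sum=> a; apply: derivableM; last exact: dP. by have h:= dKrE i j k a Ox; exact: ex_derive.
Qed.

Definition dGr x i j k: P:= \row_l 'D_(e_ i) (fun y => Gr y j k 0 l) x.

Lemma dGrJ x i j k: O x -> dGr x i j k *m J x = dKr x i j k - \sum_l Gr x j k 0 l *: F x i l.
move=> Ox; apply/eqP; rewrite eq_sym subr_eq; apply/eqP/rowP=> b.
have hK:= dKrE i j k b Ox; rewrite -(@derive_val _ _ _ _ _ _ _ hK).
have hG l: is_derive x (e_ i) (fun y=> Gr y j k 0 l) ('D_(e_ i) (fun y=> Gr y j k 0 l) x) by apply:
derivableP; exact: derivable_Gr. have hJ l:= dJ i l b Ox; have hM l:= is_deriveM (hG l) (hJ l).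
rewrite (@near_eq_derive _ _ _ _ (\sum_l ((fun y=> Gr y j k 0 l: R^o) * (fun y=> J y l b: R^o)))); last first.
 apply: filterS (open_nbhs_nbhs (conj oO Ox))=> y Oy. by rewrite fct_sumE -(GrJ j k Oy) mxE.
rewrite derive_val [RHS]mxE summxE [X in _ = X + _]mxE -big_split /=; apply: eq_bigr=> l _.
rewrite [dGr _ _ _ _ 0 l]mxE [(_ *: F x i l) 0 b]mxE -[LHS]/(_ * _ + _ * _) /= addrC; congr (_ + _).
by rewrite mulrC.
Qed.

Lemma riemE x l k i j: O x -> half_space x -> riem G l k i j x =
  dGr x i j k 0 l - dGr x j i k 0 l + \sum_p (Gr x i p 0 l * Gr x j k 0 p - Gr x j p 0 l * Gr x i k 0 p).
move=> Ox hx; rewrite /riem. have hp a b: pd a (christoffel G l b k) x = dGr x a b k 0 l.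
 rewrite (pd_half (g:= fun y=> Gr y b k 0 l) oO Ox hx); first by rewrite mxE.
  by move=> y Oy hy; rewrite christoffelE.
 exact: derivable_Gr.
rewrite !hp; congr (_ + _); apply: eq_bigr=> p _; by rewrite !christoffelE.
Qed.

Definition Rr x k i j: P:= \row_l riem G l k i j x.

Lemma sum_Gr (L: P -> P) x (g: P): (forall c a b, L (c *: a + b) = c *: L a + L b) ->
  \sum_q g 0 q *: L (row q (J x)) = L (g *m J x).
move=> linL. have L0: L 0 = 0.
 have:= linL 1 0 0; rewrite !scale1r addr0=> h. by apply: (addrI (L 0)); rewrite addr0 -h.
rewrite mulmx_sum_row; elim/big_rec2: _=>[|q a b _ ->]; first by []. by [].
Qed.

Lemma RrJ x k i j: O x -> half_space x -> Rr x k i j *m J x =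
  dotp (row j (tm x)) (row k (J x)) *: row i (J x) - dotp (row i (tm x)) (row k (J x)) *: row j (J x)
  + H x j k *: row i (tm x) - H x i k *: row j (tm x).
move=> Ox hx.
have Rsum: Rr x k i j = dGr x i j k - dGr x j i k + (\sum_p Gr x j k 0 p *: Gr x i p - \sum_p Gr x i k 0 p *: Gr x j p).
 apply/rowP=> l; rewrite [LHS]mxE riemE // [RHS]mxE.
 congr (_ + _); first by rewrite [RHS]mxE [X in _ = _ + X]mxE.
 rewrite [RHS]mxE [X in _ = _ + X]mxE !summxE -sumrB; apply: eq_bigr=> p _.
 by rewrite !mxE mulrC [X in _ - X]mulrC.
have sumK a b c: \sum_p Gr x b c 0 p *: Gr x a p *m J x = \sum_p Gr x b c 0 p *: F x a p + (- u x a *: Kr x b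
c - dotp (Kr x b c) (v x) *: row a (J x) + dotp (row a (J x)) (Kr x b c) *: v x).
 pose L (Y: P): P:= - u x a *: Y - dotp Y (v x) *: row a (J x) + dotp (row a (J x)) Y *: v x.
 have linL t A B: L (t *: A + B) = t *: L A + L B by rewrite /L !dotpE; apply/rowP=> q; rewrite !mxE; ring.
 rewrite -/(L (Kr x b c)) -GrJ // -(sum_Gr x (Gr x b c) linL) -big_split /=; apply: eq_bigr=> p _.
 rewrite -scalemxAl GrJ // -scalerDr; congr (_ *: _); rewrite /L /Kr.
 by apply/rowP=> q; rewrite !mxE (dotpC (row p _) (v x)) (dotpC (v x)); ring.
rewrite Rsum mulmxDl mulmxBl !dGrJ // mulmxBl !mulmx_suml !sumK.
have h:= gauge_curvature (Ji:= row i (J x)) (Jj:= row j (J x)) (Jk:= row k (J x)) (v:= v x) (ti:= row i (tm x))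
(tj:= row j (tm x)) (F x i j) (F x i k) (F x j k) (T x i j k) erefl erefl erefl erefl (tC i j Ox).
rewrite -h /= /dKr /Kr (FC j i Ox) (TC j i k Ox) /dvr. move: (\sum_p _) (\sum_p _)=> S1 S2.
by apply/rowP=> b; rewrite !mxE; ring.
Qed.

Lemma rowJP x i: O x -> row i (J x) *m Pm x = delta_mx 0 i.
by move=> Ox; rewrite -row_mul JP // row1. Qed.

Lemma dotp_rows (A B: 'M[R]_n) i j: dotp (row i A) (row j B) = (A *m B^T) i j.
by rewrite [RHS]mxE; apply: eq_bigr => a _; rewrite !mxE. Qed.

Lemma RrE x k i j: O x -> half_space x -> Rr x k i j =
  (tm x *m (J x)^T) j k *: delta_mx 0 i - (tm x *m (J x)^T) i k *: delta_mx 0 j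
  + (J x *m (J x)^T) j k *: row i (tm x *m Pm x) - (J x *m (J x)^T) i k *: row j (tm x *m Pm x).
move=> Ox hx; rewrite -[LHS]mulmx1 -(JP Ox) mulmxA RrJ // !dotp_rows.
by rewrite !mulmxDl !mulNmx -!scalemxAl !rowJP // !row_mul.
Qed.

Lemma GEij x i j: O x -> half_space x -> G x i j = E x * H x i j.
by move=> Ox hx; rewrite GE // mxE dotp_rows. Qed.

Definition Am x:= tm x *m (J x)^T.
Definition tau x:= \tr (tm x *m Pm x).

Lemma ricciE x: O x -> half_space x ->
  ricci G x = (n%:R - 2) *: Am x + tau x *: (J x *m (J x)^T).
move=> Ox hx; apply/matrixP=> j k; rewrite mxE.
rewrite (eq_bigr (fun i=> Rr x k i j 0 i)); last by move=> i _; rewrite [RHS]mxE.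
pose H2:= J x *m (J x)^T; pose tP:= tm x *m Pm x.
rewrite (eq_bigr (fun i=> Am x j k - Am x i k * (i == j)%:R + H2 j k * tP i i - tP j i * H2 i k)); last first.
 move=> i _; rewrite RrE // -/(Am x) -/H2 -/tP; move: (Am x) (H2) tP=> A1 A2 A3.
 by rewrite !mxE !eqxx /= mulr1 [A2 i k * _]mulrC.
rewrite !sumrB !big_split /= sumr_const card_ord -mulr_sumr. have -> : \sum_i tP j i * H2 i k = Am x j k.
 transitivity ((tP *m H2) j k); first by rewrite [RHS]mxE.
 by rewrite /tP /H2 -mulmxA (mulmxA (Pm x)) PJ // mul1mx.
rewrite sumrN (bigD1 j) //= eqxx mulr1 big1 ?addr0; last by move=> i ij; rewrite (negPf ij) mulr0.
rewrite -/H2 -[\sum_i tP i i]/(tau x) -[Am x j k *+ n]mulr_natl.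
by move: (Am x) H2 (tau x)=> A1 A2 tt; rewrite !mxE; ring.
Qed.

Lemma scalE x: O x -> half_space x -> scal G x = (E x)^-1 * ((2 * n%:R - 2) * tau x).
move=> Ox hx; rewrite /scal invG // ricciE // -scalemxAl mxtraceZ mulmxDr -!scalemxAr mxtraceD !mxtraceZ.
have -> : \tr ((Pm x)^T *m Pm x *m Am x) = tau x.
 rewrite /Am /tau mulmxA mxtrace_mulC !mulmxA -trmx_mul -(mulmxA _ (Pm x)).
 by rewrite (_: (Pm x *m J x)^T = 1%:M) ?mul1mx 1?mxtrace_mulC // PJ // trmx1.
have -> : \tr ((Pm x)^T *m Pm x *m (J x *m (J x)^T)) = n%:R by rewrite -mulmxA (mulmxA (Pm x)) PJ // mul1mx
-trmx_mul JP // trmx1 mxtrace1. congr (_ * _); ring.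
Qed.

Context (m2: (2 <= m)%N).

Lemma schoutenE x: O x -> half_space x -> schouten G x = Am x.
move=> Ox hx; have En: E x != 0 by rewrite gt_eqF // E0. rewrite /schouten scalE // ricciE // GE //.
have m0: (n%:R - 2: R) != 0 by rewrite subr_eq0 eqr_nat eqSS gtn_eqF.
have m1: (n%:R - 1: R) != 0 by rewrite -natr1 addrK pnatr_eq0 -lt0n; apply: leq_trans m2.
move: (Am x) (J x *m _) (tau x) (n%:R: R) m0 m1=> A1 A2 tt nn m0 m1.
by apply/matrixP=> a b; rewrite !mxE; field; rewrite En m0 m1.
Qed.

Lemma sectional_const x K X Y: O x -> half_space x -> row_free (col_mx X Y) ->
  tm x = (K * E x / 2) *: J x -> sectional G x X Y = K.
move=> Ox hx rf tK; pose H2:= J x *m (J x)^T. have En: E x != 0 by rewrite gt_eqF // E0.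
have rE l k i j: riem G l k i j x = K * E x * (H2 j k * (l == i)%:R - H2 i k * (l == j)%:R).
 transitivity (Rr x k i j 0 l); first by rewrite [RHS]mxE.
 rewrite RrE // tK -!scalemxAl JP // -/H2; move: H2 (K * E x)=> A c.
 by rewrite !mxE !eqxx /= [i == l]eq_sym [j == l]eq_sym; move: (l == i)%:R (l == j)%:R=> p q; field.
pose q U W:= dotp (U *m J x) (W *m J x). have qE U W: q U W = \sum_a \sum_b U 0 a * W 0 b * H2 a b.
 transitivity ((U *m H2 *m W^T) 0 0).
  rewrite /H2 mulmxA -mulmxA -trmx_mul mxE; apply: eq_bigr=> a _; by congr (_ * _); rewrite [RHS]mxE.
 rewrite mxE exchange_big /=; apply: eq_bigr=> b _; rewrite !mxE mulr_suml. by apply: eq_bigr=> a _; ring.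
have GbE U W: bil (G x) U W = E x * q U W.
 rewrite /bil GE // -scalemxAr -scalemxAl mxE; congr (_ * _).
 rewrite (mulmxA U) -(mulmxA (U *m J x)) -trmx_mul mxE; apply: eq_bigr=> a _; by congr (_ * _); rewrite [LHS]mxE.
have cE: curv_op G x X Y Y = (K * E x) *: (q Y Y *: X - q X Y *: Y).
 apply/rowP=> l; rewrite mxE.
 have e1 i j: \sum_k X 0 i * Y 0 j * Y 0 k * riem G l k i j x = K * E x * ((l == i)%:R * X 0 i * (\sum_k Y 0 j
 * Y 0 k * H2 j k) - (l == j)%:R * Y 0 j * (\sum_k X 0 i * Y 0 k * H2 i k)).
  rewrite !mulr_sumr -sumrB mulr_sumr; apply: eq_bigr=> k _; rewrite rE; ring.
 rewrite (eq_bigr (fun i=> \sum_j K * E x * ((l == i)%:R * X 0 i * (\sum_k Y 0 j * Y 0 k * H2 j k) - (l ==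
 j)%:R * Y 0 j * (\sum_k X 0 i * Y 0 k * H2 i k)))); last first.
  by move=> i _; apply: eq_bigr=> j _; exact: e1.
 rewrite (eq_bigr (fun i=> K * E x * ((l == i)%:R * X 0 i * q Y Y - Y 0 l * \sum_k X 0 i * Y 0 k * H2 i k)));
 last first.
  move=> i _; rewrite -mulr_sumr sumrB -mulr_sumr -qE; congr (_ * (_ - _)).
  move: (\sum_k X 0 i * Y 0 k * H2 i k)=> S0. rewrite (bigD1 l) //= eqxx mul1r big1 ?addr0 // => j jl.
  by rewrite eq_sym (negPf jl) !mul0r.
 rewrite -mulr_sumr sumrB -mulr_sumr -qE -mulr_suml (bigD1 l) //= eqxx mul1r big1 ?addr0; last first.
  by move=> i il; rewrite eq_sym (negPf il) mul0r.
 by rewrite !mxE; ring.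
have qDl a b U W Z: q (a *: U - b *: W) Z = a * q U Z - b * q W Z by rewrite /q mulmxBl -!scalemxAl !dotpE.
have qC U W: q U W = q W U by rewrite /q dotpC. have D0: q X X * q Y Y - q X Y ^+ 2 != 0.
 have qJ U: q U U = 0 -> U = 0 by move=>/dotp_eq0 h; rewrite -[U]mulmx1 -(JP Ox) mulmxA h mul0mx.
 have rf0 a b: a *: X - b *: Y = 0 -> a = 0.
  move=> h; have h2: row_mx a%:M (- b)%:M *m col_mx X Y = 0.
   by rewrite mul_row_col !mul_scalar_mx scaleNr.
  move/eqP: h2; rewrite mulmx_free_eq0 // row_mx_eq0=>/andP[/eqP /matrixP /(_ 0 0)]. by rewrite !mxE eqxx.
 apply/eqP=> D0. have qY: q Y Y = 0.
  apply: (rf0 _ (q X Y)); apply: qJ; rewrite qDl !(qC _ (_ - _)) !qDl.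
  transitivity (q Y Y * (q X X * q Y Y - q X Y ^+ 2)); last by rewrite D0 mulr0. by rewrite (qC Y X); ring.
 have Y0:= qJ _ qY; have: (0: R) = 1.
  have h2: row_mx 0%:M (- 1)%:M *m col_mx X Y = 0 by rewrite mul_row_col !mul_scalar_mx Y0 scaler0 scale0r addr0.
  move/eqP: h2; rewrite mulmx_free_eq0 // row_mx_eq0=>/andP[_ /eqP /matrixP /(_ 0 0)].
  by rewrite !mxE eqxx=>/eqP; rewrite oppr_eq0=>/eqP.
 by move=>/esym/eqP; rewrite oner_eq0.
rewrite /sectional cE !GbE (_: q (_ *: _) X = K * E x * (q Y Y * q X X - q X Y * q Y X)); last first.
 by rewrite -qDl /q -scalemxAl !dotpE.
rewrite (qC Y X). move: (q X X) (q Y Y) (q X Y) D0=> a b c D0; field.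
have -> : E x * a * (E x * b) - (E x * c) ^+ 2 = E x ^+ 2 * (a * b - c ^+ 2) by ring.
by rewrite mulf_neq0 // expf_neq0.
Qed.

Lemma second_ff_gauge x: O x -> co x = 0 ->
  (forall a, J x (lift ord0 a) 0 = 0) -> (forall a b, F x (lift ord0 a) (lift ord0 b) 0 0 = 0) ->
  0 < J x 0 0 -> second_ff G x = (v x 0 0 / Num.sqrt (E x)) *: tangential (G x).
move=> Ox x0 J0 F0 J00; have hx: half_space x by rewrite /half_space /= x0.
have Ep:= E0 Ox; have sE: 0 < Num.sqrt (E x) by pos. have PJ1:= PJ Ox. have Pc c: Pm x (lift ord0 c) 0 = 0.
 have: (Pm x *m J x) (lift ord0 c) 0 = 0 by rewrite PJ1 mxE.
 rewrite mxE big_ord_recl big1 ?addr0; last by move=> b _; rewrite J0 mulr0.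
 by move/eqP; rewrite mulf_eq0 (gt_eqF J00) orbF=>/eqP.
have P00: Pm x 0 0 = (J x 0 0)^-1.
 have: (Pm x *m J x) 0 0 = 1 by rewrite PJ1 mxE.
 rewrite mxE big_ord_recl big1 ?addr0; last by move=> b _; rewrite J0 mulr0.
 by move=> h; have J0n: J x 0 0 != 0 by [rewrite gt_eqF]; rewrite -[LHS]mulr1 -(mulfV J0n) mulrA h mul1r.
have i00: (invmx (G x)) 0 0 = (E x)^-1 * (J x 0 0)^-1 ^+ 2.
 rewrite invG // mxE [X in _ * X]mxE big_ord_recl big1 ?addr0; last by move=> b _; rewrite Pc mulr0.
 by rewrite mxE P00 expr2.
apply/matrixP=> a b; rewrite !mxE christoffelE // i00. have Jp: 0 < (J x 0 0)^-1 by pos.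
rewrite sqrtrM ?invr_ge0 ?ltW // sqrtr_sqr gtr0_norm // sqrtrV ?ltW //.
rewrite mxE big_ord_recl big1 ?addr0; last by move=> c _; rewrite Pc mulr0.
have K0: Kr x (lift ord0 a) (lift ord0 b) 0 ord0 = H x (lift ord0 a) (lift ord0 b) * v x 0 0 by rewrite /Kr
!mxE F0 !J0; ring. rewrite P00 K0 GEij //. have sE2: Num.sqrt (E x) ^+ 2 = E x by rewrite sqr_sqrtr // ltW.
move: (Num.sqrt (E x)) sE sE2 (dotp _ _)=> s s0 <- dd; field. by pos.
Qed.

(** Conformal invariance of umbilicity: the conformal factor adds a multiple of the metric to the
    second fundamental form, so the tangential second derivatives of the flat map have normal part
    proportional to the flat metric. *)
Lemma umbilic_gauge x mu: O x -> co x = 0 -> second_ff G x = mu *: tangential (G x) ->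
  exists rho, forall a b, (F x (lift ord0 a) (lift ord0 b) *m Pm x) 0 0 = rho * H x (lift ord0 a) (lift ord0 b).
move=> Ox x0 /matrixP um; have hx: half_space x by rewrite /half_space /= x0.
set s:= Num.sqrt ((invmx (G x)) ord0 ord0). exists (mu * E x * s - (v x *m Pm x) 0 0)=> a b. have s0: s != 0.
 rewrite gt_eqF // sqrtr_gt0 invG // mxE mulr_gt0 ?invr_gt0 ?E0 // mxE.
 rewrite (eq_bigr (fun c=> Pm x c 0 ^+ 2)); last by move=> c _; rewrite mxE expr2.
 rewrite lt_neqAle sumr_ge0 ?andbT; last by move=> c _; exact: sqr_ge0.
 apply/eqP=>/esym/eqP; rewrite psumr_eq0; last by move=> c _; exact: sqr_ge0.
 move=>/allP h; have: (J x *m Pm x) 0 0 = 0.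
  rewrite mxE big1 // => c _; have:= h c (mem_index_enum c); rewrite /= sqrf_eq0=>/eqP ->. by rewrite mulr0.
 by rewrite JP // mxE=>/eqP; rewrite oner_eq0.
have h0:= um a b; rewrite !mxE christoffelE // -/s GEij // in h0.
have jP (c: 'I_m): (row (lift ord0 c) (J x) *m Pm x) 0 ord0 = 0 by rewrite rowJP // mxE.
have KP: (Kr x (lift ord0 a) (lift ord0 b) *m Pm x) 0 ord0 = (F x (lift ord0 a) (lift ord0 b) *m Pm x) 0 ord0 +
H x (lift ord0 a) (lift ord0 b) * (v x *m Pm x) 0 ord0.
 rewrite /Kr !mulmxDl !mulNmx -!scalemxAl; move: (jP a) (jP b).
 move: (row _ _ *m _) (row _ _ *m _) (F x _ _ *m _) (v x *m _) (dotp _ _) (dotp _ _) (dotp _ _)=> r1 r2 FP vP d1 d2 d3.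
 by rewrite !mxE=>-> ->; ring.
rewrite KP in h0; move: h0.
rewrite -[(F x _ _ *m Pm x) 0 0]/((F x _ _ *m Pm x) 0 ord0) -[(v x *m Pm x) 0 0]/((v x *m Pm x) 0 ord0).
move: ((F x _ _ *m _) 0 ord0) ((v x *m _) 0 ord0) (dotp _ _)=> A B C h0.
have: A + C * B = mu * (E x * C) * s by rewrite -h0 divfK. lra.
Qed.

End Gauge.

Lemma line_near {R: realType} {d: nat} (U: set 'rV[R]_d) (x v: 'rV[R]_d): open U -> U x ->
  \forall s \near (0: R), U (x + s *: v).
move=> oU Ux; have c: {for 0, continuous (fun s: R=> x + s *: v)}.
 move=> A; rewrite scale0r addr0=> nA.
 apply: (@cvgD _ _ _ (nbhs (0: R)) _ (cst x) (fun s: R=> s *: v) x 0); last by rewrite addr0.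
  exact: cvg_cst.
 rewrite -[X in _ --> X](scale0r v). by apply: (@cvgZr_tmp _ _ _ (nbhs (0: R)) _ id _ v); exact: cvg_id.
by apply: c; rewrite scale0r addr0; exact: open_nbhs_nbhs.
Qed.

Lemma derive_inv {R: realType} {V: normedModType R} (f: V -> R) x v df :
  f x != 0 -> is_derive x v f df -> is_derive x v (fun y => (f y)^-1) (- (f x) ^- 2 * df).
move=> f0 [dv <-]; apply: DeriveDef; first exact: derivableV. by rewrite deriveV.
Qed.

Lemma is_derive_invn2 {R: realType} {V: normedModType R} (f: V -> R) x v df :
  f x != 0 -> is_derive x v f df -> is_derive x v (fun y => f y ^- 2) (- 2 * (f x ^- 3 * df)).
move=> f0 hf; have pn: (f * f) x != 0 by rewrite -[X in X != 0]/(f x * f x) mulf_neq0.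
have hV:= derive_inv pn (is_deriveM hf hf). apply: (is_derive_eq hV).
rewrite -[LHS]/(- (f x * f x) ^- 2 * (f x * df + f x * df)). by field.
Qed.

(** * Metrics that are conformally flat in other coordinates *)

Section ConformalGauge.
Context {R m} (m2: (2 <= m)%N).
Local Notation n:= m.+1.
Local Notation P:= 'rV[R]_n.
Definition gradS (Phi: P -> R) (y: P): P:= \row_a 'D_(e_ a) Phi y.

(* The Schouten tensor of the metric Phi^-2 |dy|^2. *)
Definition schS (Phi: P -> R) (y: P): 'M[R]_n :=
  \matrix_(a, b) ('D_(e_ a) ('D_(e_ b) Phi) y / Phi y
    - (a == b)%:R * (dotp (gradS Phi y) (gradS Phi y) / (2 * Phi y ^+ 2))).

Let schSE Phi y a b: schS Phi y a b = 'D_(e_ a) ('D_(e_ b) Phi) y / Phi y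
    - (a == b)%:R * (dotp (gradS Phi y) (gradS Phi y) / (2 * Phi y ^+ 2)).
exact: mxE. Qed.
Context (O W: set P) (oO: open O) (oW: open W) (f h: P -> P) (Phi: P -> R) (G: P -> 'M[R]_n).
Context (sf: Cks O f) (sh: Cks W h) (fW: forall x, O x -> W (f x)) (hf: forall x, O x -> h (f x) = x).
Context (Phi2: Ck 2 W Phi) (Phi0: forall y, W y -> 0 < Phi y) (GE: forall x, O x -> half_space x -> G x = (Phi (f x) ^- 2) *: (Dj f x *m (Dj f x)^T)).

Let J x:= Dj f x.

Let Pm x:= Dj h (f x).

Let E x:= Phi (f x) ^- 2.

Let v x: P:= \row_a ('D_(e_ a) Phi (f x) / Phi (f x)).

Let F x i j: P:= \row_a 'D_(e_ i) ('D_(e_ j) (fun y => f y 0 a)) x.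

Let T x k i j: P:= \row_a 'D_(e_ k) ('D_(e_ i) ('D_(e_ j) (fun y => f y 0 a))) x.

Let tm x:= Dj f x *m schS Phi (f x).

Let dcoord x j: O x -> differentiable (fun y => f y 0 j) x.
exact: Cks_diff. Qed.

Let JP x: O x -> J x *m Pm x = 1%:M.
move=> Ox; rewrite /J /Pm -Dj_comp; last 2 first.
- by move=> j; exact: dcoord.
- by move=> j; apply: Cks_diff oW sh _; exact: fW. by rewrite (Dj_eq (G:= id) oO Ox) ?Dj_id.
Qed.

Let chain x i (g: P -> R): O x -> Ck 1 W g ->
  is_derive x (e_ i) (fun y => g (f y)) (\sum_c J x i c * 'D_(e_ c) g (f x)).
move=> Ox Hg; have dg: differentiable g (f x) by apply: Ck_diff oW Hg _; exact: fW.
have:= derive_chain (e_ i) (fun j=> dcoord j Ox) dg.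
by rewrite (eq_bigr (fun c=> J x i c * 'D_(e_ c) g (f x))) // => c _; rewrite mxE.
Qed.

Let Phi1: Ck 1 W Phi:= Ck_pred Phi2.

Let E0 x: O x -> 0 < E x.
by move=> Ox; rewrite invr_gt0 exprn_gt0 //; apply: Phi0; exact: fW. Qed.

Let dJ x i j a: O x -> is_derive x (e_ i) (fun y => J y j a) (F x i j 0 a).
move=> Ox; rewrite mxE; have -> : (fun y=> J y j a) = 'D_(e_ j) (fun y=> f y 0 a).
 by apply/funext=> y; rewrite mxE.
by apply: derivableP; exact: Ck_der (Ck_D j (sf 2%N a)) Ox.
Qed.

Let dF x k i j a: O x -> is_derive x (e_ k) (fun y => F y i j 0 a) (T x k i j 0 a).
move=> Ox; rewrite mxE; have -> : (fun y=> F y i j 0 a) = 'D_(e_ i) ('D_(e_ j) (fun y=> f y 0 a)).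
 by apply/funext=> y; rewrite mxE.
by apply: derivableP; exact: Ck_der (Ck_D i (Ck_D j (sf 3%N a))) Ox.
Qed.

Let FC x i j: O x -> F x i j = F x j i.
by move=> Ox; apply/rowP => a; rewrite [LHS]mxE [RHS]mxE; exact: (schwarz i j oO (sf 2%N a) Ox). Qed.

Let TC x k i j: O x -> T x k i j = T x i k j.
by move=> Ox; apply/rowP => a; rewrite [LHS]mxE [RHS]mxE; exact: (schwarz k i oO (Ck_D j (sf 3%N a)) Ox). Qed.

Let uE x i: dotp (row i (J x)) (v x) = (\sum_c J x i c * 'D_(e_ c) Phi (f x)) / Phi (f x).
by rewrite /dotp mulr_suml; apply: eq_bigr => c _; rewrite [v x 0 c]mxE [row i _ 0 c]mxE mulrA. Qed.

Let dE x i: O x -> is_derive x (e_ i) E (- 2 * (E x * dotp (row i (J x)) (v x))).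
move=> Ox; have hc:= chain i Ox Phi1; have p0:= Phi0 (fW Ox).
rewrite uE; apply: (is_derive_eq (is_derive_invn2 (lt0r_neq0 p0) hc)); rewrite /E.
move: (\sum_c _) (Phi (f x)) p0=> s p p0. by field; rewrite gt_eqF.
Qed.

Let vvE x: O x -> dotp (v x) (v x) = dotp (gradS Phi (f x)) (gradS Phi (f x)) / Phi (f x) ^+ 2.
move=> Ox; have p0:= Phi0 (fW Ox); rewrite /dotp mulr_suml; apply: eq_bigr=> a _.
by rewrite !mxE; field; rewrite gt_eqF.
Qed.

Let dv x i a: O x -> is_derive x (e_ i) (fun y => v y 0 a)
   (tm x i a - dotp (row i (J x)) (v x) * v x 0 a + dotp (v x) (v x) / 2 * J x i a).
move=> Ox; have p0:= Phi0 (fW Ox). have h1:= chain i Ox (Ck_D a Phi2); have h2:= chain i Ox Phi1.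
have e: (fun y=> v y 0 a) = (fun y=> 'D_(e_ a) Phi (f y): R^o) * (fun y=> (Phi (f y))^-1: R^o) by
apply/funext=> y; rewrite mxE. have h3:= derive_inv (lt0r_neq0 p0) h2.
rewrite e; have h4:= is_deriveM h1 h3; apply: is_derive_eq.
rewrite -[LHS]/('D_(e_ a) Phi (f x) * (- Phi (f x) ^- 2 * (\sum_c J x i c * 'D_(e_ c) Phi (f x))) + (Phi (f
x))^-1 * (\sum_c J x i c * 'D_(e_ c) ('D_(e_ a) Phi) (f x))). rewrite uE vvE // [v x 0 a]mxE.
have -> : tm x i a = (\sum_c J x i c * 'D_(e_ c) ('D_(e_ a) Phi) (f x)) / Phi (f x) - J x i a * (dotp (gradS
Phi (f x)) (gradS Phi (f x)) / (2 * Phi (f x) ^+ 2)).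
 rewrite [LHS]mxE (eq_bigr (fun c=> J x i c * 'D_(e_ c) ('D_(e_ a) Phi) (f x) / Phi (f x) - J x i c * ((c ==
 a)%:R * (dotp (gradS Phi (f x)) (gradS Phi (f x)) / (2 * Phi (f x) ^+ 2))))); last first.
  by move=> c _; rewrite schSE mulrBr; congr (_ - _); exact: mulrA.
 rewrite sumrB -mulr_suml; congr (_ - _). rewrite (bigD1 a) //= eqxx mul1r big1 ?addr0 // => c ca.
 by rewrite (negPf ca) mul0r mulr0.
move: (\sum_c _) (\sum_c _) (dotp _ _) (J x i a) ('D_(e_ a) Phi (f x)) (Phi (f x)) p0=> s1 s2 d j b p p0.
by field; rewrite gt_eqF.
Qed.

Let Ssym x: O x -> (schS Phi (f x))^T = schS Phi (f x).
move=> Ox; apply/matrixP=> a b; rewrite !mxE (schwarz _ _ oW Phi2 (fW Ox)). by rewrite eq_sym.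
Qed.

Let tC x i j: O x -> dotp (row i (tm x)) (row j (J x)) = dotp (row j (tm x)) (row i (J x)).
move=> Ox; rewrite !dotp_rows /tm -/(J x).
by rewrite -[in RHS](trmxK (J x *m schS Phi (f x) *m (J x)^T)) [RHS]mxE !trmx_mul trmxK Ssym // mulmxA.
Qed.

Let dP x i k l: O x -> derivable (fun y => Pm y k l) x (e_ i).
move=> Ox; have hc: Ck 1 W (fun y=> Dj h y k l) by exact: Ck_Dj. by have hh:= chain i Ox hc; exact: ex_derive.
Qed.

Theorem conf_sch x: O x -> half_space x ->
  schouten G x = Dj f x *m schS Phi (f x) *m (Dj f x)^T.
exact: (schoutenE oO (J:= J) (Pm:= Pm) (tm:= tm) (E:= E) (v:= v) (F:= F) (T:= T) E0 GE JP dJ dF FC TC dE dv tC dP m2).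
Qed.

Theorem conformal_sectional x K X Y: O x -> half_space x -> row_free (col_mx X Y) ->
  schS Phi (f x) = (K / 2 * Phi (f x) ^- 2)%:M -> sectional G x X Y = K.
move=> Ox hx rf Sx.
apply: (sectional_const oO (J:= J) (Pm:= Pm) (tm:= tm) (E:= E) (v:= v) (F:= F) (T:= T) E0 GE JP dJ dF FC TC dE
dv tC dP Ox hx rf). by rewrite /tm Sx mul_mx_scalar /E; congr (_ *: _); ring.
Qed.

Lemma tan_derive (g: P -> R) x a: O x -> co x = 0 ->
  (forall y, O y -> co y = 0 -> g y = 0) -> 'D_(e_ (lift ord0 a)) g x = 0.
move=> Ox x0 g0; rewrite /derive.
apply/cvg_lim=>//; apply: (@cvg_trans _ (cst (0: R^o) @ 0^')); last exact: cvg_cst. apply: near_eq_cvg.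
have nO:= line_near (e_ (lift ord0 a)) oO Ox. apply: (@filterS _ (0^') _ _ _ _ (cvg_within _ nO))=> s Os.
have y0: (x + s *: (e_ (lift ord0 a): P)) 0 ord0 = 0 by rewrite !mxE x0 eqxx /= mulr0 addr0.
by rewrite /= [_ *: _ + x]addrC (g0 _ Os y0) (g0 _ Ox x0) subrr scaler0.
Qed.

Context (f0: forall x, O x -> co x = 0 -> f x 0 ord0 = 0) (f1: forall x, O x -> half_space x -> 0 <= f x 0 ord0).

(** Nonnegative because [f] preserves the half space, and nonzero because [Dj f x] is invertible
    while the other entries of that column vanish. *)
Lemma boundary_J00 x: O x -> co x = 0 -> 0 < Dj f x 0 0.
move=> Ox x0. have J0 a: Dj f x (lift ord0 a) 0 = 0 by rewrite mxE; exact: tan_derive f0.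
rewrite lt_neqAle; apply/andP; split.
 apply/eqP=>/esym J00. have: (Pm x *m J x) 0 0 = 1 by rewrite (mulmx1C (JP Ox)) mxE.
 rewrite mxE big_ord_recl /J J00 mulr0 add0r big1=>[/esym/eqP|a _]; first by rewrite oner_eq0.
 by rewrite J0 mulr0.
have hx: half_space x by rewrite /half_space /= x0.
rewrite mxE -(@pd_half _ _ O (fun y=> f y 0 0) (fun y=> f y 0 0)) //; last first.
 exact: Ck_der (sf 1%N 0) Ox.
rewrite /pd; apply: limr_ge; last first.  have /nbhs_ballP [r /= r0 Hr]:= line_near (e_ 0) oO Ox.
 exists r; first exact: r0. move=> s; rewrite /= sub0r normrN=> hr h0. apply: mulr_ge0; first by pos.
 rewrite (f0 Ox x0) subr0; apply: f1; first by apply: Hr; rewrite -ball_normE /= sub0r normrN.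
 by rewrite /half_space /= !mxE x0 add0r !eqxx /= mulr1 ltW.
have df: derivable (fun y=> f y 0 0) x (e_ 0):= Ck_der (sf 1%N 0) Ox.
apply: (cvgP ('D_(e_ 0) (fun y=> f y 0 0) x)).
apply: cvg_dnbhs_at_right; have:= df; rewrite /derivable /derive=> cd.
apply: cvg_trans cd; apply: near_eq_cvg; near=> s. by rewrite /= [_ *: _ + x]addrC. Unshelve. all: by end_near.
Qed.

(** In the coordinates [y] the boundary is a hyperplane, totally geodesic for |dy|^2; the factor
    [Phi ^- 2] contributes the inner normal derivative of [Phi]. *)
Theorem conf_sff x: O x -> co x = 0 ->
  second_ff G x = 'D_(e_ 0) Phi (f x) *: tangential (G x).
move=> Ox x0; have p0:= Phi0 (fW Ox).
rewrite (second_ff_gauge oO (J:= J) (Pm:= Pm) (E:= E) (v:= v) (F:= F) E0 GE JP dJ FC dE Ox x0).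
- congr (_ *: _); rewrite mxE /E sqrtrV ?sqr_ge0 // sqrtr_sqr gtr0_norm //.
 by rewrite invrK divfK // gt_eqF.
- by move=> a; rewrite /J mxE; exact: tan_derive f0.
- move=> a b; rewrite mxE; apply: tan_derive=>// y Oy y0.
 exact: tan_derive f0.
- exact: boundary_J00.
Qed.

End ConformalGauge.

(** * Eigenvalues and the cones Gamma_k *)

Section CharPoly.
Context {R}.

Lemma char_poly_intertwine n (P A B: 'M[R]_n) :
  P \in unitmx -> P *m B = A *m P -> char_poly B = char_poly A.
move=> uP PB; pose Pc:= map_mx (@polyC R) P.
have h: Pc *m char_poly_mx B = char_poly_mx A *m Pc by rewrite /char_poly_mx mulmxBr mulmxBl /Pc -!map_mxM PB
scalar_mxC. have:= congr1 (fun X=> \det X) h; rewrite !det_mulmx mulrC=>/mulIf; apply.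
rewrite det_map_mx polyC_eq0; move: uP; rewrite unitmxE unitfE //.
Qed.

(** Turns eigenvalues with respect to [G] into those of a matrix in orthonormal flat coordinates, up
    to the conformal factor. *)
Lemma eigenvalues_conj n (G J S: 'M[R]_n) mu lam: J \in unitmx -> mu != 0 ->
  G = mu *: (J *m J^T) ->
  eigenvalues_wrt G (J *m S *m J^T) lam <-> char_poly (mu^-1 *: S) = \prod_i ('X - (lam 0 i)%:P).
move=> uJ mu0 ->; have uJT: J^T \in unitmx by rewrite unitmx_tr.
have iG: invmx (mu *: (J *m J^T)) = mu^-1 *: (invmx J^T *m invmx J).
 have uG: mu *: (J *m J^T) \in unitmx by rewrite unitmxZ ?unitfE // unitmx_mul uJ.
 apply: (can_inj (mulKmx uG)); rewrite mulmxV //.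
 rewrite -scalemxAl -scalemxAr scalerA mulfV // scale1r mulmxA -(mulmxA J) mulmxV // mulmx1 mulmxV //.
rewrite /eigenvalues_wrt (@char_poly_intertwine _ J^T (mu^-1 *: S)) // iG.
rewrite -scalemxAl -scalemxAr -scalemxAl; congr (_ *: _). rewrite !mulmxA mulmxV // mul1mx mulVmx // mul1mx //.
Qed.

Lemma char_poly_scalar n (k: R): char_poly (k%:M: 'M[R]_n) = ('X - k%:P) ^+ n.
rewrite char_poly_trig ?scalar_mx_is_trig // (eq_bigr (fun=> 'X - k%:P)) ?prodr_const ?card_ord // => i _.
by rewrite mxE eqxx.
Qed.

Lemma root_prod_linear n (lam: 'rV[R]_n) k :
  root (\prod_i ('X - (lam 0 i)%:P)) k <-> exists i, lam 0 i = k.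
rewrite /root horner_prod; split=>[/prodf_eq0[i _]|[i <-]].
 by rewrite hornerXsubC subr_eq0=>/eqP ->; exists i.
by apply/prodf_eq0; exists i; rewrite // hornerXsubC subrr.
Qed.

Lemma mean_curvatureP m (G: 'rV[R]_m.+1 -> 'M[R]_m.+1) x k: (0 < m)%N ->
  tangential (G x) \in unitmx -> second_ff G x = k *: tangential (G x) ->
  forall s, mean_curvature G x s <-> s = k.
move=> m0 uT ff s; have e lam: eigenvalues_wrt (tangential (G x)) (second_ff G x) lam <-> forall a, lam 0 a = k.
 rewrite /eigenvalues_wrt ff -scalemxAr mulVmx // scalemx1 char_poly_scalar; split=>[h a|h].
  have: root (('X - k%:P) ^+ m) (lam 0 a) by rewrite h; apply/root_prod_linear; exists a.
  by rewrite /root !hornerE expf_eq0 m0 subr_eq0=>/eqP.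
 by rewrite (eq_bigr (fun=> 'X - k%:P)) ?prodr_const ?card_ord // => a _; rewrite h.
have mn: m%:R != 0 :> R by rewrite pnatr_eq0 -lt0n.
have sm (f: 'I_m -> R): (forall a, f a = k) -> (\sum_a f a) / m%:R = k by move=> fk; rewrite (eq_bigr (fun=>
k)) // sumr_const card_ord -[k *+ m]mulr_natr mulfK. split=>[[lam /e lk ->]|->]; first exact: sm.
by exists (const_mx k); [apply/e=> a; rewrite mxE|rewrite sm // => a; rewrite mxE].
Qed.

End CharPoly.

Section Rayleigh.
Context {R} {d: nat}.
Local Notation V:= 'rV[R]_d.
Context (A: 'M[R]_d) (As: A^T = A) (lam: V) (charA: char_poly A = \prod_i ('X - (lam 0 i)%:P)).

Let bl v w:= dotp (v *m A) w.

Let blC v w: bl v w = bl w v.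
have e u z: bl u z = (u *m A *m z^T) 0 0 by rewrite mxE; apply: eq_bigr=> i _; rewrite [z^T _ _]mxE.
by rewrite !e -[in RHS](trmxK (w *m A *m v^T)) [RHS]mxE !trmx_mul trmxK As mulmxA.
Qed.

Let eigP k: (exists2 v: V, v != 0 & v *m A = k *: v) <-> exists i, lam 0 i = k.
have e: eigenvalue A k <-> exists i, lam 0 i = k by rewrite eigenvalue_root_char charA; exact: root_prod_linear.
split=>[[v v0 vA]|/e /eigenvalueP[v vA v0]]; last by exists v. by apply/e/eigenvalueP; exists v.
Qed.

Lemma eigenvalue_le k: (forall v, dotp (v *m A) v <= k * dotp v v) -> forall i, lam 0 i <= k.
move=> H i; have [v v0 vA]: exists2 v: V, v != 0 & v *m A = lam 0 i *: v by apply/eigP; exists i.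
have vv: 0 < dotp v v by rewrite lt_neqAle dotp_ge0 andbT eq_sym; apply: contra v0=>/eqP/dotp_eq0 ->.
by have:= H v; rewrite vA dotpZl ler_pM2r.
Qed.

(** The minimum [r] of the Rayleigh quotient on the unit sphere is an eigenvalue: at a minimiser [w]
    the first variation, read from a nonnegative quadratic in [s], gives [w *m A = r *: w]. *)
Lemma exists_eigenvalue_le k z: z != 0 -> dotp (z *m A) z <= k * dotp z z -> exists i, lam 0 i <= k.
move=> z0 Hz; have pos (v: V): v != 0 -> 0 < dotp v v.
 by move=> v0; rewrite lt_neqAle dotp_ge0 andbT eq_sym; apply: contra v0=>/eqP/dotp_eq0 ->.
pose K:= [set v: V | dotp v v = 1]. have nK: K !=set0.
 have zz:= pos z z0; exists ((Num.sqrt (dotp z z))^-1 *: z).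
 by rewrite /K /= dotpZl dotpZr mulrA -expr2 exprVn sqr_sqrtr ?ltW // mulVf // gt_eqF.
have cb: continuous (fun v: V=> bl v v).
 move=> v; rewrite (_: (fun v=> bl v v) = fun v: V=> \sum_i (v *m A) 0 i * v 0 i) //.
 apply: (@cvg_bigsum _ _ (nbhs v) _ _ _ (fun i (v: V)=> (v *m A) 0 i * v 0 i))=> i; apply: cvgM; last exact: coordC.
 have -> : (fun x: V=> (x *m A) 0 i) = dotp (\row_j A j i) by apply/funext=> x; rewrite mxE; apply: eq_bigr=>
 j _; rewrite mxE mulrC. rewrite [X in _ --> X](_: _ = dotp (\row_j A j i) v); first exact: dotp_cont.
 by rewrite mxE; apply: eq_bigr=> j _; rewrite mxE mulrC.
have [||w /set_mem Kw wmin0]:= EVT_min_rV nK (@dotp_compact R d K 1 _ _) (continuous_subspaceT cb).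
- by apply: closedEQ; exact: dotp2_cont.
- by move=> x ->. have wmin v: K v -> bl w w <= bl v v by move=>/mem_set/wmin0.
have wmin2 v: bl w w * dotp v v <= bl v v.
 have [->|v0]:= eqVneq v 0; first by rewrite /bl mul0mx !dotp0l mulr0.
 have vv:= pos v v0; set s:= Num.sqrt (dotp v v). have ss: s ^+ 2 = dotp v v by rewrite sqr_sqrtr // ltW.
 have:= wmin (s^-1 *: v); rewrite /K /= /bl -scalemxAl !dotpZl !dotpZr mulrA -expr2 exprVn ss mulVf ?gt_eqF //
 =>/(_ erefl). by rewrite mulrA -expr2 exprVn ss ler_pdivlMl // mulrC.
set r:= bl w w in wmin2. have crit u: bl w u = r * dotp w u.
 have q s: 0 <= 2 * s * (bl w u - r * dotp w u) + s ^+ 2 * (bl u u - r * dotp u u).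
  have:= wmin2 (w + s *: u); rewrite /bl mulmxDl -scalemxAl !(dotpDl, dotpDr, dotpZl, dotpZr) -!/(bl _ _) (blC
  u w) -/r (dotpC u w).
  rewrite (_: dotp w w = 1) //; move: (bl w u) (bl u u) (dotp w u) (dotp u u)=> ? ? ? ?; nra.
 have:= quad_discr (a:= 0) (b:= bl w u - r * dotp w u) (c:= bl u u - r * dotp u u).
 rewrite mul0r=> h; apply/eqP; rewrite -subr_eq0 -sqrf_eq0 eq_le sqr_ge0 andbT h // => s. by have:= q s; lra.
have [i hi]: exists i, lam 0 i = r.
 apply/eigP; exists w; first by apply: contra_eq_neq (Kw)=>->; rewrite dotp0l eq_sym oner_eq0.
 apply/eqP; rewrite -subr_eq0; apply/eqP/dotp_eq0. by rewrite {1}dotpDl dotpNl -/(bl _ _) dotpZl crit subrr.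
exists i; rewrite hi; have:= le_trans (wmin2 z) Hz. by rewrite ler_pM2r // pos.
Qed.

End Rayleigh.

(** * Elementary symmetric functions and their generating polynomial *)

Section ElementarySymmetric.
Context {R} {d: nat} (lam: 'rV[R]_d).
Implicit Type D: {set 'I_d}.

Let gen D: {poly R}:= \prod_(i in D) (1 + (lam 0 i) *: 'X).

Let es D l:= (gen D)`_l.

Lemma elem_sym_coef l: elem_sym l lam = (\prod_i (1 + (lam 0 i) *: 'X: {poly R}))`_l.
under eq_bigr do rewrite addrC.
rewrite bigA_distr coef_sum /elem_sym [RHS](bigID (fun S: {set 'I_d} => #|S| == l)) /=.
have e (S: {set 'I_d}): \prod_i (if i \in S then lam 0 i *: 'X else 1: {poly R}) = (\prod_(i in S) lam 0 i)
*: 'X^#|S|.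
 rewrite -big_mkcond /= -[in RHS]prodr_const. elim/big_rec3: _=>[|i p q r _ ->]; first by rewrite scale1r.
 by rewrite -scalerAl -scalerAr scalerA.
rewrite [X in _ = _ + X]big1=>[|S /negPf h]; last by rewrite e coefZ coefXn eq_sym h mulr0.
by rewrite addr0; apply: eq_bigr=> S /eqP h; rewrite e coefZ coefXn h eqxx mulr1.
Qed.

Let es_setT l: elem_sym l lam = es [set: 'I_d] l.
by rewrite elem_sym_coef /es /gen; congr ((_: {poly R})`_l); apply: eq_bigl => i; rewrite finset.in_setT. Qed.

Let es0 D: es D 0 = 1.
rewrite /es /gen -horner_coef0 horner_prod big1 // => i _. by rewrite !hornerE.
Qed.

Let genD1 D i: i \in D -> gen D = (1 + lam 0 i *: 'X) * gen (D :\ i).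
by move=> iD; rewrite /gen (big_setD1 i). Qed.

Let esS D i l: i \in D -> es D l.+1 = es (D :\ i) l.+1 + lam 0 i * es (D :\ i) l.
by move=> iD; rewrite /es (genD1 iD) mulrDl mul1r coefD -scalerAl coefZ coefXM.
Qed.

Let es_der D l: l.+1%:R * es D l.+1 = \sum_(i in D) lam 0 i * es (D :\ i) l.
rewrite /es mulr_natl -coef_deriv. have -> : (gen D)^`() = \sum_(i in D) lam 0 i *: gen (D :\ i).
 elim: {D}#|D| {-2}D (erefl #|D|)=>[|k IH] D hD.
  by rewrite (cards0_eq hD) /gen !big_set0 -[1]/(1%:P) derivC.
 have [i iD]: exists i, i \in D by apply/set0Pn; rewrite -card_gt0 hD.
 have hD1: #|D :\ i| = k by have:= cardsD1 i D; rewrite iD hD=>-[].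
 rewrite (genD1 iD) derivM derivD derivZ derivX -{1}[1: {poly R}]/(1%:P) derivC add0r (IH _ hD1).
 rewrite [RHS](big_setD1 i) //= alg_polyC mul_polyC; congr (_ + _).
 rewrite mulr_sumr; apply: eq_bigr=> j; rewrite in_setD1=>/andP[ji jD].
 rewrite (@genD1 (D :\ j) i) ?in_setD1 1?eq_sym ?ji // -scalerAr; congr (_ *: (_ * gen _)).
 by apply/setP=> u; rewrite !in_setD1; case: (u == i); case: (u == j).
by rewrite coef_sum; apply: eq_bigr=> i _; rewrite coefZ.
Qed.

Let es_count D l: (#|D|%:R - l%:R) * es D l = \sum_(i in D) es (D :\ i) l.
case: l=>[|l].
 by rewrite es0 subr0 mulr1 (eq_bigr (fun=> 1)) ?sumr_const // => i _; rewrite es0.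
rewrite mulrBl es_der mulr_natl -sumr_const -sumrB; apply: eq_bigr=> i iD. by rewrite (esS l iD) addrK.
Qed.

(** Let [s l] be the elementary symmetric functions of the entries other than [lam 0 j]. Positivity
    of the full functions gives [s l.+1 > a * s l] for [l < k]. On the other hand [es_der],
    [es_count] and [lam 0 i <= a] give [k * s k <= a * (d - k) * s k.-1], which is at most
    [a * k * s k.-1]. *)
Lemma Gamma_spread k a: (d <= 2 * k)%N -> (k <= d)%N -> 0 < a -> (forall i, lam 0 i <= a) ->
  (exists j, lam 0 j <= - a) -> Gamma k lam -> False.
move=> dk kd a0 la [j lj] Gk; have d0: (0 < d)%N:= leq_ltn_trans (leq0n j) (ltn_ord j).
have k0: (0 < k)%N by case: (k) dk=>//; rewrite muln0 leqn0=>/eqP e; rewrite e in d0.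
set D:= [set: 'I_d] :\ j; set s:= es D. have step l: (l < k)%N -> 0 < s l -> a * s l < s l.+1.
 move=> lk sl; have:= Gk l.+1 lk; rewrite es_setT (esS l (finset.in_setT j)) -/D -/s=> h.
 have h2: lam 0 j * s l <= - a * s l by rewrite ler_pM2r. lra.
have sp l: (l <= k)%N -> 0 < s l.
 elim: l=>[|l IH lk]; first by rewrite /s es0.
 by apply: lt_trans (step l lk (IH (ltnW lk))); rewrite mulr_gt0 // IH // ltnW.
(* If [lam 0 i] is nonnegative, removing it decreases the functions, and [s l.+1 > a * s l]
   outweighs [lam 0 i * es (D :\ i) l]; if it is negative, the recursion gives positivity at
   once. *)
have si i: i \in D -> forall l, (l < k)%N -> 0 <= es (D :\ i) l.
 move=> iD l lk; suff []: 0 <= es (D :\ i) l /\ (0 <= lam 0 i -> es (D :\ i) l <= s l) by [].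
 elim: l lk=>[|l IH lk]; first by rewrite /s !es0.
 have [h1 h2]:= IH (ltnW lk); have e1:= esS l iD; rewrite -/s in e1.
 split; last by move=> li; rewrite e1 lerDl mulr_ge0. have [li|/ltW li]:= leP 0 (lam 0 i); last first.
  have:= sp _ (ltnW lk); rewrite e1. have: lam 0 i * es (D :\ i) l <= 0 by rewrite mulr_le0_ge0. lra.
 have:= step l (ltnW lk) (sp _ (ltnW (ltnW lk))); rewrite e1.
 have: lam 0 i * es (D :\ i) l <= a * s l by apply: ler_pM=>//; exact: h2. lra.
case: k k0 kd dk Gk step sp si=>// k _ kd dk Gk step sp si.
have:= step k (ltnSn k) (sp k (leqnSn k)); apply/negP; rewrite -leNgt. have kp: 0 < k.+1%:R :> R by [].
rewrite -(ler_pM2l kp) es_der.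
have cD: #|D| = d.-1 by have e:= cardsD1 j [set: 'I_d]; rewrite finset.in_setT cardsT card_ord -/D in e;
rewrite [in RHS]e. apply: (@le_trans _ _ (\sum_(i in D) a * es (D :\ i) k)).
 by apply: ler_sum=> i iD; apply: ler_wpM2r; [exact: si|exact: la].
rewrite -mulr_sumr -es_count -/(s k) cD [leRHS]mulrCA; apply: ler_wpM2l; first exact: ltW.
(* [k] now denotes the predecessor and [D] has [d.-1] elements, so the claim is
   [d.-1 - k <= k.+1]. *)
apply: ler_wpM2r; first by apply/ltW/sp. rewrite lerBlDr -natrD ler_nat; lia.
Qed.

End ElementarySymmetric.

Section PositiveCone.
Context {R} {d: nat}.

(** If [lam 0 i < 0], the polynomial with coefficients [elem_sym l lam] vanishes at the positive
    number [- (lam 0 i)^-1], although its constant term is 1 and no coefficient is negative. *)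
Lemma Gamma_full (lam: 'rV[R]_d): Gamma d lam <-> forall i, 0 < lam 0 i.
split=>[G i|pos l /andP[l0 ld]]; last first.
 pose S0: {set 'I_d}:= [set j in take l (enum 'I_d)]%SET.
 have S0l: #|S0| == l by rewrite cardsE (card_uniqP _) ?take_uniq ?enum_uniq // size_takel // size_enum_ord.
 rewrite /elem_sym (bigD1 S0) //= ltr_pwDl //; first exact: prodr_gt0.
 by apply: sumr_ge0=> S _; apply/ltW/prodr_gt0.
have [//|]:= ltP 0 (lam 0 i); rewrite le_eqVlt=>/orP[/eqP li|li].
 have d0: (0 < d)%N:= leq_ltn_trans (leq0n i) (ltn_ord i). have:= G d; rewrite d0 leqnn /elem_sym=>/(_ isT).
 rewrite big1 ?ltxx // => S /eqP Sd; have -> : S = [set: 'I_d]%SET.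
  by apply/eqP; rewrite eqEcard finset.subsetT cardsT card_ord Sd leqnn.
 by rewrite (bigD1 i) ?finset.in_setT //= li mul0r.
pose p: {poly R}:= \prod_i (1 + (lam 0 i) *: 'X). have p0: p.[- (lam 0 i)^-1] = 0.
 rewrite /p horner_prod (bigD1 i) //= !hornerE mulrN mulfV ?lt_eqF // subrr mul0r //.
have: 0 < p.[- (lam 0 i)^-1]; last by lra. have t0: 0 < - (lam 0 i)^-1 by rewrite oppr_gt0 invr_lt0.
have c0: p`_0 = 1.
 rewrite -horner_coef0 /p horner_prod big1 // => j _; by rewrite !hornerE.
have sp: (size p <= d.+1)%N.
 apply: leq_trans (size_prod_leq _ _) _; rewrite card_ord leq_subLR addnS ltnS.
 rewrite addnn -muln2 -[X in (_ <= X * _)%N]card_ord -sum_nat_const; apply: leq_sum=> j _.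
 apply: leq_trans (size_polyD _ _) _; rewrite size_poly1 geq_max /=.
 by apply: leq_trans (size_scale_leq _ _) _; rewrite size_polyX.
rewrite (horner_coef_wide _ sp) big_ord_recl c0 expr0 mulr1 ltr_pwDl // sumr_ge0 // => j _.
rewrite mulr_ge0 ?exprn_ge0 // ?ltW // /p -elem_sym_coef; apply: G. by rewrite /= /bump /= ltn_ord.
Qed.

Lemma Gamma_full_cone: (0 < d)%N -> @admissible_cone R d (Gamma d).
move=> d0; split=>//.
- rewrite (_: Gamma d = \bigcap_(i in [set: 'I_d]) [set lam: 'rV[R]_d | 0 < lam 0 i]).
 rewrite openE=> lam H.
 have hf (i: 'I_d): nbhs lam (fun x: 'rV[R]_d=> 0 < x 0 i) by apply: (@coordC R d i lam [set r | 0 < r]);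
 apply: open_nbhs_nbhs; split; [exact: open_gt|exact: (H i I)].
 rewrite /interior /=; have: nbhs lam (fun x: 'rV[R]_d=> forall i, 0 < x 0 i) by exact: filter_forall hf.
 by apply: (@filterS _ (nbhs lam) _)=> x hx i _; exact: hx.
 apply/seteqP; split=> lam; first by move=>/Gamma_full H i _; exact: H.
 by move=> H; apply/Gamma_full=> i; exact: (H i I).
- move=> x y t /set_mem/Gamma_full hx /set_mem/Gamma_full hy; apply/mem_set/Gamma_full=> i.
 rewrite -[conv _ _ _]/(t%:num *: (x: 'rV[R]_d) + (1 - t%:num) *: (y: 'rV[R]_d)) !mxE.
 have t0: 0 <= t%:num :> R by []. have xi:= hx i; have yi:= hy i; have [->|tn]:= eqVneq (t%:num: R) 0; first by lra.
 rewrite ltr_wpDr // ?mulr_ge0 ?subr_ge0 // ?ltW // mulr_gt0 // lt_neqAle eq_sym tn //.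
- by move=> a s /Gamma_full H; apply/Gamma_full=> i; rewrite mxE.
- by move=> a t /Gamma_full H t0; apply/Gamma_full=> i; rewrite mxE mulr_gt0.
- by move=> a H l /andP[l0 l1]; apply: H; rewrite l0 (leq_trans l1).
Qed.

Lemma Gamma_trace k (lam: 'rV[R]_d): (0 < k)%N -> Gamma k lam -> 0 < \sum_i lam 0 i.
move=> k0 /(_ 1%N); rewrite k0=>/(_ isT); rewrite /elem_sym.
rewrite (eq_bigl (fun S: {set 'I_d} => S \in [set [set i]%SET | i: 'I_d]%SET)); last first.
 move=> S; apply/cards1P/imsetP=>[[i ->]|[i _ ->]]; by exists i.
rewrite big_imset /=; last by move=> i j _ _; exact: set1_inj.
by rewrite (eq_bigr (fun i=> lam 0 i)) // => i _; rewrite big_set1.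
Qed.

End PositiveCone.

(** * Touching metrics *)

Section Potential.
Context {R n}.
Local Notation P:= 'rV[R]_n.
Local Notation V:= 'rV[R]_n.+2.
Implicit Types (N: V) (x y v: P).
(** A quadratic polynomial with Hessian [curv N] times the identity. The metric |dy|^2 / (pot N)^2
    has constant curvature [- Q N N], by [grad_pot]. *)
Definition pot N y: R:= Q N (lcone y).
Definition curv N: R:= - (N 0 li + N 0 0).

Lemma potE N y: pot N y = (\sum_i N 0 (yi i) * y 0 i) + (N 0 li - N 0 0) / 2 + curv N * (dotp y y / 2).
rewrite /pot Q_ix vec0 vecl (eq_bigr (fun i=> N 0 (yi i) * y 0 i))=>[|i _]; last by rewrite vecy.
by rewrite /curv; field.
Qed.

Lemma is_derive_pot N y i: is_derive y (e_ i) (pot N) (N 0 (yi i) + curv N * y 0 i).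
have hc j:= coord_der j y (e_ i). pose c1: P -> R^o:= fun z=> curv N * (dotp z z / 2).
pose c2: P -> R^o:= fun z=> \sum_j N 0 (yi j) * z 0 j.
have h1: is_derive y (e_ i) c1 (curv N * y 0 i) by have:= is_deriveZ (curv N) (derive_sqr_dist y i).
have h2: is_derive y (e_ i) c2 (N 0 (yi i)).
 rewrite /c2 (_: (fun z=> _) = \sum_j (fun z: P=> N 0 (yi j) * z 0 j: R^o)); last first.
  by apply/funext=> z; rewrite fct_sumE.
 have:= @is_derive_sum R _ _ n (fun j (z: P)=> N 0 (yi j) * z 0 j: R^o) y (e_ i) (fun j=> N 0 (yi j) * (e_ i
 : P) 0 j). have -> : \sum_j N 0 (yi j) * (e_ i: P) 0 j = N 0 (yi i).
  rewrite (bigD1 i) //= big1 ?addr0=>[|j ji]; first by rewrite /e_ mxE !eqxx mulr1.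
  by rewrite /e_ mxE (negPf ji) andbF mulr0.
 apply=> j; exact: is_deriveZ.
have -> : pot N = c2 + (cst ((N 0 li - N 0 0) / 2): P -> R^o) + c1 by apply/funext=> z; rewrite potE.
have h3:= is_deriveD (is_deriveD h2 (is_derive_cst ((N 0 li - N 0 0) / 2: R^o) y (e_ i))) h1.
by apply: (is_derive_eq h3); rewrite addr0.
Qed.

Lemma Ck_pot k (U: set P) N: open U -> Ck k U (pot N).
move=> oU; apply: (@Ck_ext _ _ _ _ (fun y=> (\sum_i N 0 (yi i) * y 0 i) + (N 0 li - N 0 0) / 2 + curv N * (dotp
y y / 2)))=>//.
 by move=> x _; rewrite potE.
apply: Ck_add=>//; last by apply: Ck_scal=>//; exact: Ck_sqr_dist. apply: Ck_add=>//; last exact: Ck_cst.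
by apply: Ck_sum=>// i; apply: Ck_scal=>//; exact: Ck_coord.
Qed.

Lemma D_pot N i y: 'D_(e_ i) (pot N) y = N 0 (yi i) + curv N * y 0 i.
by have h:= is_derive_pot N y i; exact: derive_val. Qed.

Lemma D2_pot N i j y: 'D_(e_ i) ('D_(e_ j) (pot N)) y = (i == j)%:R * curv N.
have -> : 'D_(e_ j) (pot N) = (cst (N 0 (yi j)): P -> R^o) + (fun z=> curv N * z 0 j: R^o) by apply/funext=>
z; rewrite D_pot.
have h:= is_deriveD (is_derive_cst (N 0 (yi j): R^o) y (e_ i)) (is_deriveZ (curv N) (coord_der j y (e_ i))).
rewrite derive_val add0r -[LHS]/(_ * _) mxE eqxx /= eq_sym mulrC //.
Qed.

End Potential.

Section SecondOrder.
Context {R n}.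
Local Notation P:= 'rV[R]_n.
Context (U: set P) (oU: open U).
Implicit Types (D f g: P -> R) (y v: P).

Lemma dir_derive_ge0 D y v d: derivable D y v -> 0 < d ->
  (forall s, 0 < s < d -> D y <= D (y + s *: v)) -> 0 <= 'D_v D y.
move=> dD d0 H; have cd: (fun h=> h^-1 *: ((D \o shift y) (h *: v) - D y)) @ 0^'+ --> 'D_v D y.
 exact: cvg_dnbhs_at_right dD.
rewrite -(cvg_lim _ cd) //; apply: limr_ge; first exact: cvgP cd.
exists d=>// s; rewrite /= sub0r normrN=> sd s0. apply: mulr_ge0; first by pos.
rewrite subr_ge0 addrC; apply: H. by rewrite s0 -[s](gtr0_norm s0).
Qed.

(** Only positive [s] occur, since [y] may lie on the boundary. A negative second derivative would
    make the first derivative negative along the half line near [y], against the mean value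
    theorem. *)
Lemma hessian_ge0 D y v d: Ck 2 U D -> U y -> D y = 0 -> (forall a, 'D_(e_ a) D y = 0) -> 0 < d ->
  (forall s, 0 < s < d -> 0 <= D (y + s *: v)) ->
  0 <= \sum_a \sum_b v 0 a * v 0 b * 'D_(e_ a) ('D_(e_ b) D) y.
move=> D2 Uy Dy0 Dy1 d0 H; set h:= \sum_a _. pose q y:= \sum_b v 0 b * 'D_(e_ b) D y.
have q1: Ck 1 U q by apply: Ck_sum=>// b; apply: Ck_scal=>//; exact: Ck_D.
have qE z: U z -> 'D_v D z = q z by move=> Uz; apply: derive_dirE; apply: Ck_diff oU (Ck_pred D2) Uz.
have dq: 'D_v q y = h.
 rewrite derive_dirE; last exact: Ck_diff oU q1 Uy.
 apply: eq_bigr=> a _; pose g b: P -> R^o:= fun z=> v 0 b * 'D_(e_ b) D z.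
 have hb b: is_derive y (e_ a) (g b) (v 0 b * 'D_(e_ a) ('D_(e_ b) D) y) by apply: is_deriveZ; apply:
 derivableP; exact: Ck_der (Ck_D b D2) Uy. have qs: q = \sum_b g b by apply/funext=> z; rewrite fct_sumE.
 by rewrite qs derive_val mulr_sumr; apply: eq_bigr=> b _; rewrite mulrA.
have q0: q y = 0 by rewrite /q big1 // => b _; rewrite Dy1 mulr0. rewrite leNgt; apply/negP=> h0.
have dqv: derivable q y v by apply: diff_derivable; exact: Ck_diff oU q1 Uy.
have: \forall s \near (0: R)^', s^-1 *: ((q \o shift y) (s *: v) - q y) < 0.
 have c: (fun s=> s^-1 *: ((q \o shift y) (s *: v) - q y)) @ 0^' --> 'D_v q y by [].
 apply: (c [set r | r < 0]); rewrite dq; apply: open_nbhs_nbhs; split; [exact: open_lt|exact: h0].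
move=>/nbhs_ballP [r1 /= r10 H1]. have /nbhs_ballP [r2 /= r20 H2]:= line_near v oU Uy.
pose s:= Num.min d (Num.min r1 r2) / 2. have s0: 0 < s by rewrite divr_gt0 // !lt_min d0 r10 r20.
have: s < Num.min d (Num.min r1 r2) by rewrite gtr_pMr ?invf_lt1 ?ltr1n // !lt_min d0 r10 r20.
rewrite !lt_min=>/and3P[sd s1 s2].
have dl t: t \in `[0, s] -> is_derive t 1 (fun t=> D (y + t *: v)) ('D_v D (y + t *: v)).
 rewrite in_itv /= =>/andP[t0 ts]; apply: derive_line; apply: diff_derivable.
 apply: Ck_diff oU (Ck_pred D2) _; apply: H2.
 by rewrite -ball_normE /= sub0r normrN ger0_norm //; exact: le_lt_trans s2.
have [|c]:= @MVT R (fun t=> D (y + t *: v)) (fun t=> 'D_v D (y + t *: v)) 0 s s0 (fun t ts=> dl t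
(subset_itv_oo_cc ts)).
 by apply: derivable_within_continuous=> t /dl ht; exact: ex_derive.
rewrite in_itv /= =>/andP[c0 cs]; rewrite scale0r addr0 Dy0 !subr0=> e.
have:= H s; rewrite s0 sd e=>/(_ isT); rewrite pmulr_lge0 //; apply/negP; rewrite -ltNge.
have cn: `|c| = c by rewrite gtr0_norm.
have Uc: U (y + c *: v) by apply: H2; rewrite -ball_normE /= sub0r normrN cn; exact: lt_trans s2.
have:= H1 c; rewrite -ball_normE /= sub0r normrN cn=>/(_ (lt_trans cs s1)).
rewrite gt_eqF // =>/(_ isT); rewrite q0 subr0 qE // addrC -[_ *: q _]/(c^-1 * q _).
by rewrite pmulr_rlt0 // invr_gt0.
Qed.

End SecondOrder.

Section Touch.
Context {R m}.
Local Notation P:= 'rV[R]_m.+1.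
Local Notation V:= 'rV[R]_m.+3.
Implicit Types (y v: P) (tau sig N: V).

Lemma grad_pot N y: dotp (gradS (pot N) y) (gradS (pot N) y) = Q N N + 2 * curv N * pot N y.
rewrite Q_ix potE; set b:= curv N; set A:= \sum_i N 0 (yi i) * N 0 (yi i).
set p:= \sum_i _ * _; have -> : dotp (gradS (pot N) y) (gradS (pot N) y) = A + 2 * b * p + b ^+ 2 * dotp y y.
 rewrite /A /p /dotp !mulr_sumr -!big_split; apply: eq_bigr=> i _ /=.
 by rewrite !mxE !D_pot -/b; move: b=> b; ring.
by rewrite /b /curv; field.
Qed.

Definition mrefl y: P:= \row_i (if i == ord0 then - y 0 i else y 0 i).
Context (U: set P) (Phi: P -> R) (y1: P) (c: R) (oU: open U) (Phi2: Ck 2 U Phi) (Uy: U y1) (Phi0: 0 < Phi y1) (c0: 0 < c).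

(** Squares are compared rather than densities, so that the derivatives are polynomial in those of
    the potentials and of [Phi]. *)
Let gap tau sig y:= pot tau y * pot tau y - pot sig y * pot sig y - c * (Phi y * Phi y).

Let Ck_gap tau sig: Ck 2 U (gap tau sig).
have sq f: Ck 2 U f -> Ck 2 U (fun y=> f y * f y) by move=> hf; exact: (Ck_mul oU hf hf).
have ht:= sq _ (Ck_pot 2 tau oU); have hs:= sq _ (Ck_pot 2 sig oU).
exact: (Ck_add oU (Ck_add oU ht (Ck_opp oU hs)) (Ck_opp oU (Ck_scal c oU (sq _ Phi2)))).
Qed.

Let D_gap tau sig a y: U y -> is_derive y (e_ a) (gap tau sig)
  (2 * (pot tau y * 'D_(e_ a) (pot tau) y - pot sig y * 'D_(e_ a) (pot sig) y - c * (Phi y * 'D_(e_ a) Phi y))).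
move=> Uy'; have dP f: Ck 2 U f -> is_derive y (e_ a) f ('D_(e_ a) f y).
 by move=> hf; apply: derivableP; exact: Ck_der (Ck_pred hf) Uy'.
have ht:= dP _ (Ck_pot 2 tau oU); have hs:= dP _ (Ck_pot 2 sig oU); have hP:= dP _ Phi2.
have h:= is_deriveB (is_deriveB (is_deriveM ht ht) (is_deriveM hs hs)) (is_deriveZ c (is_deriveM hP hP)).
apply: (is_derive_eq h).
rewrite -[LHS]/(pot tau y * _ + pot tau y * _ - (pot sig y * _ + pot sig y * _) - c * (Phi y * _ + Phi y * _)).
by move: ('D_(e_ a) (pot tau) y) ('D_(e_ a) (pot sig) y) ('D_(e_ a) Phi y)=> p q r; ring.
Qed.

Let D2_gap tau sig a b: pot sig y1 = 0 ->
  'D_(e_ a) ('D_(e_ b) (gap tau sig)) y1 =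
  2 * ('D_(e_ a) (pot tau) y1 * 'D_(e_ b) (pot tau) y1 + pot tau y1 * ((a == b)%:R * curv tau)
       - 'D_(e_ a) (pot sig) y1 * 'D_(e_ b) (pot sig) y1
       - c * ('D_(e_ a) Phi y1 * 'D_(e_ b) Phi y1 + Phi y1 * 'D_(e_ a) ('D_(e_ b) Phi) y1)).
move=> s0; pose G y:= 2 * (pot tau y * 'D_(e_ b) (pot tau) y - pot sig y * 'D_(e_ b) (pot sig) y - c * (Phi y *
'D_(e_ b) Phi y)). have -> : 'D_(e_ a) ('D_(e_ b) (gap tau sig)) y1 = 'D_(e_ a) G y1.
 apply: near_eq_derive; apply: (@filterS _ (nbhs y1) _ U)=>[y Uy'|]; last exact: open_nbhs_nbhs.
 by have h:= D_gap tau sig b Uy'; exact: derive_val.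
have dP f: Ck 2 U f -> is_derive y1 (e_ a) f ('D_(e_ a) f y1) by move=> hf; apply: derivableP; exact: Ck_der
(Ck_pred hf) Uy.
have dP2 f: Ck 2 U f -> is_derive y1 (e_ a) ('D_(e_ b) f) ('D_(e_ a) ('D_(e_ b) f) y1) by move=> hf; apply:
derivableP; exact: Ck_der (Ck_D b hf) Uy. have ht:= Ck_pot 2 tau oU; have hs:= Ck_pot 2 sig oU.
have h:= is_deriveZ 2 (is_deriveB (is_deriveB (is_deriveM (dP _ ht) (dP2 _ ht)) (is_deriveM (dP _ hs) (dP2 _
hs))) (is_deriveZ c (is_deriveM (dP _ Phi2) (dP2 _ Phi2)))). have:= derive_val (is_derive:= h).
rewrite -[RHS]/(2 * (pot tau y1 * _ + 'D_(e_ b) (pot tau) y1 * _ - (pot sig y1 * _ + 'D_(e_ b) (pot sig) y1 *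
_) - c * (Phi y1 * _ + 'D_(e_ b) Phi y1 * _))). rewrite !D2_pot s0=> e; apply: (etrans e)=> {e h}.
move: ('D_(e_ a) (pot tau) y1) ('D_(e_ b) (pot tau) y1) ('D_(e_ a) (pot sig) y1) ('D_(e_ b) (pot sig) y1)=> p q r s.
move: ('D_(e_ a) Phi y1) ('D_(e_ b) Phi y1) ('D_(e_ a) ('D_(e_ b) Phi) y1)=> x y z; ring.
Qed.

(** The second order condition, with the first order relations and [grad_pot] for [tau] substituted.
    The resulting form is even in [v], so inward directions suffice. *)
Lemma touch_hessian tau sig: pot sig y1 = 0 -> gap tau sig y1 = 0 ->
  (forall a, 'D_(e_ a) (gap tau sig) y1 = 0) ->
  (forall v, 0 <= co v -> exists2 d, 0 < d & forall s, 0 < s < d -> 0 <= gap tau sig (y1 + s *: v)) ->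
  forall v, c * Phi y1 ^+ 2 * dotp (v *m schS Phi y1) v
    <= - (Q tau tau / 2) * dotp v v - dotp (gradS (pot sig) y1) v ^+ 2.
move=> s0 g0 g1 H.
suff pos v: 0 <= co v -> c * Phi y1 ^+ 2 * dotp (v *m schS Phi y1) v <= - (Q tau tau / 2) * dotp v v - dotp
(gradS (pot sig) y1) v ^+ 2.
 move=> v; case: (lerP 0 (co v))=>[|/ltW v0]; first exact: pos.
 have:= pos (- v); rewrite mulNmx !(dotpNl, dotpNr) !opprK sqrrN mxE oppr_ge0; exact.
move=> v0; have [d d0 Hd]:= H v v0. have:= hessian_ge0 oU (Ck_gap tau sig) Uy g0 g1 d0 Hd.
pose al:= gradS (pot tau) y1; pose be:= gradS (pot sig) y1; pose ph:= gradS Phi y1.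
pose Hv:= \sum_a \sum_b v 0 a * v 0 b * 'D_(e_ a) ('D_(e_ b) Phi) y1.
have gE a: c * (Phi y1 * ph 0 a) = pot tau y1 * al 0 a.
 have h:= D_gap tau sig a Uy; have:= derive_val (is_derive:= h); rewrite g1 s0 mul0r subr0.
 rewrite !mxE; move: ('D_(e_ a) (pot tau) y1) ('D_(e_ a) Phi y1)=> p q; lra.
have P2: c * (Phi y1 * Phi y1) = pot tau y1 * pot tau y1 by have:= g0; rewrite /gap s0; lra.
have dE (x: P) (k: R): \sum_a \sum_b v 0 a * v 0 b * (k * (x 0 a * x 0 b)) = k * dotp x v ^+ 2.
 rewrite expr2 /dotp mulr_suml mulr_sumr; apply: eq_bigr=> a _.
 by rewrite mulr_sumr mulr_sumr; apply: eq_bigr=> b _; ring.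
have -> : \sum_a \sum_b v 0 a * v 0 b * 'D_(e_ a) ('D_(e_ b) (gap tau sig)) y1 = 2 * dotp al v ^+ 2 + 2 * pot
tau y1 * curv tau * dotp v v - 2 * dotp be v ^+ 2 - 2 * c * dotp ph v ^+ 2 - 2 * c * Phi y1 * Hv.
 rewrite -!dE /Hv /dotp !mulr_sumr -!(big_split, sumrB); apply: eq_bigr=> a _ /=.
 have -> : 2 * pot tau y1 * curv tau * (v 0 a * v 0 a) = \sum_b v 0 a * v 0 b * (2 * (pot tau y1 * ((a == b)%:R
 * curv tau))).
  rewrite (bigD1 a) //= eqxx big1 ?addr0=>[|b ba]; first by rewrite mul1r; ring.
  by rewrite eq_sym (negPf ba) mul0r !mulr0.
 rewrite mulr_sumr -!(big_split, sumrB); apply: eq_bigr=> b _ /=. rewrite D2_gap // !mxE.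
 move: ('D_(e_ a) (pot tau) y1) ('D_(e_ b) (pot tau) y1) ('D_(e_ a) (pot sig) y1) ('D_(e_ b) (pot sig) y1)=> p q r s.
 move: ('D_(e_ a) Phi y1) ('D_(e_ b) Phi y1) ('D_(e_ a) ('D_(e_ b) Phi) y1)=> x y z; ring.
have hS: dotp (v *m schS Phi y1) v = Hv / Phi y1 - dotp v v * (dotp ph ph / (2 * Phi y1 ^+ 2)).
 rewrite /dotp [LHS](eq_bigr (fun b=> \sum_a (v 0 a * v 0 b * 'D_(e_ a) ('D_(e_ b) Phi) y1 / Phi y1 - v 0 a * v
 0 b * ((a == b)%:R * (dotp ph ph / (2 * Phi y1 ^+ 2))))))=>[|b _]; last first.
  rewrite mxE mulr_suml; apply: eq_bigr=> a _; rewrite [schS _ _ _ _]mxE -/ph.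
  by move: ('D_(e_ a) ('D_(e_ b) Phi) y1)=> z; ring.
 rewrite exchange_big /= /Hv !mulr_suml -sumrB; apply: eq_bigr=> a _. rewrite sumrB mulr_suml; congr (_ - _).
 rewrite (bigD1 a) //= eqxx [X in _ + X = _]big1 ?addr0 ?mul1r // => b ba.
 by rewrite eq_sym (negPf ba) mul0r mulr0.
have gv: c * (Phi y1 * dotp ph v) = pot tau y1 * dotp al v.
 rewrite /dotp !mulr_sumr; apply: eq_bigr=> a _; rewrite !mulrA -(mulrA c) gE //.
have gg: c ^+ 2 * Phi y1 ^+ 2 * dotp ph ph = pot tau y1 ^+ 2 * dotp al al.
 rewrite /dotp !mulr_sumr; apply: eq_bigr=> a _.
 by have:= gE a; move: (ph 0 a) (al 0 a)=> x z e; rewrite mulrACA -!expr2 -!exprMn -e; ring.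
rewrite hS {hS}; have:= grad_pot tau y1; rewrite -/al -/be.
move: (dotp al al) (dotp ph ph) (dotp al v) (dotp be v) (dotp ph v) (dotp v v) gv gg=> aa pp av bv pv vv gv gg ga.
move: (Phi y1) Phi0 (pot tau y1) (curv tau) Hv (Q tau tau) gv gg ga P2=> f f0 t k H0 q gv gg ga P2 h.
have t0: t * t != 0 by rewrite -P2 gt_eqF // mulr_gt0 // mulr_gt0. have e1: c * pv ^+ 2 = av ^+ 2.
 apply: (mulfI t0); transitivity ((c * (f * pv)) ^+ 2); last by rewrite gv; ring. by rewrite -P2; ring.
have e2: c * pp = aa.
 apply: (mulfI t0); transitivity (c ^+ 2 * f ^+ 2 * pp); last by []. by rewrite -P2; ring.
have -> : c * f ^+ 2 * (H0 / f - vv * (pp / (2 * f ^+ 2))) = c * f * H0 - vv * (c * pp) / 2 by field; rewrite gt_eqF.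
by rewrite e2 ga; nra.
Qed.

Context (y10: 0 <= co y1) (dPhi: co y1 = 0 -> 0 <= 'D_(e_ 0) Phi y1).

Let side_line v: (0 <= co v \/ 0 < co y1) ->
  exists2 d, 0 < d & forall s, 0 < s < d -> U (y1 + s *: v) /\ 0 <= (y1 + s *: v) 0 ord0.
move=> Hv; have /nbhs_ballP [r /= r0 Hr]:= line_near v oU Uy.
have HU s: 0 < s < r -> U (y1 + s *: v) by move=>/andP[s0 sr]; apply: Hr; rewrite -ball_normE /= sub0r normrN
gtr0_norm. case: Hv=>[v0|y0].
 exists r=>// s /[dup] /HU Us /andP[s0 _]; split=>//. by rewrite !mxE addr_ge0 // mulr_ge0 // ltW.
exists (Num.min r (co y1 / (1 + `|co v|))); first by rewrite lt_min r0 divr_gt0.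
move=> s; rewrite lt_min=>/and3P[s0 sr s1]; split; first by apply: HU; rewrite s0.
rewrite !mxE; have h: `|s * co v| <= co y1.
 rewrite normrM gtr0_norm //; apply: le_trans (_: s * (1 + `|co v|) <= _).
  lra.
 by move: s1; rewrite ltr_pdivlMr // =>/ltW.
by have:= ler_norm (- (s * co v)); rewrite normrN; lra.
Qed.

(** At a boundary point the normal derivative of the gap has to be shown to vanish. The reflected
    pair satisfies the same inequality, so both inward derivatives are nonnegative, while their sum
    is [-4] times [c * Phi * 'D_(e_ 0) Phi], which is nonpositive by [dPhi], the sign of the mean
    curvature. *)
Theorem touch tau sig tau' sig': pot sig y1 = 0 -> c * Phi y1 ^+ 2 = pot tau y1 ^+ 2 ->
  (forall y, pot tau' y = pot tau (mrefl y)) -> (forall y, pot sig' y = pot sig (mrefl y)) ->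
  (forall y, U y -> 0 <= co y -> c * Phi y ^+ 2 <= pot tau y ^+ 2 - pot sig y ^+ 2) ->
  (co y1 = 0 -> forall y, U y -> 0 <= co y -> c * Phi y ^+ 2 <= pot tau' y ^+ 2 - pot sig' y ^+ 2) ->
  forall v, c * Phi y1 ^+ 2 * dotp (v *m schS Phi y1) v
    <= - (Q tau tau / 2) * dotp v v - dotp (gradS (pot sig) y1) v ^+ 2.
move=> s0 g0 ht hs H H'. have gap0: gap tau sig y1 = 0 by rewrite /gap s0 -!expr2 g0; ring.
have gapH y: U y -> 0 <= co y -> 0 <= gap tau sig y by move=> Uy' y0; rewrite /gap -!expr2 subr_ge0; exact: H.
have dgap t s: differentiable (gap t s) y1 by exact: Ck_diff oU (Ck_pred (Ck_gap t s)) Uy.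
have dge t s v: gap t s y1 = 0 -> (forall y, U y -> 0 <= co y -> 0 <= gap t s y) -> 0 <= co v \/ 0 < co y1 ->
0 <= 'D_v (gap t s) y1.
 move=> gt gH Hv; have [d d0 Hd]:= side_line Hv.
 apply: (dir_derive_ge0 (d:= d))=>//; first exact: diff_derivable.
 by move=> x /Hd[Ux x0]; rewrite gt; exact: gH.
have dN v: 'D_(- v) (gap tau sig) y1 = - 'D_v (gap tau sig) y1.
 rewrite !(@derive_dirE R) // -sumrN; apply: eq_bigr=> j _; by rewrite mxE mulNr.
apply: touch_hessian=>// [a|v v0]; last first.
 have [d d0 Hd]:= side_line (or_introl v0); exists d=>// s /Hd[Us xs]; exact: gapH.
have two: 0 <= - (e_ a: P) 0 ord0 \/ 0 < co y1 -> 'D_(e_ a) (gap tau sig) y1 = 0.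
 move=> h; apply/eqP; rewrite eq_le; apply/andP; split.
  by rewrite -oppr_ge0 -dN; apply: dge=>//; rewrite mxE.
 apply: dge=>//; left; rewrite mxE; by [].
have [y0|y0]:= ltP 0 (co y1); first by apply: two; right.
have {}y0: co y1 = 0 by apply/eqP; rewrite eq_le y10 andbT; lra. have [->|a0]:= eqVneq a ord0; last first.
 by apply: two; left; rewrite mxE eqxx /= (negPf (_: ord0 != a)) ?oppr0 // eq_sym.
have r1: mrefl y1 = y1 by apply/rowP=> i; rewrite mxE; case: eqP=>// ->; rewrite y0 oppr0.
have dflip N N': (forall y, pot N' y = pot N (mrefl y)) -> 'D_(e_ 0) (pot N') y1 = - 'D_(e_ 0) (pot N) y1.
 move=> hN; have -> : 'D_(e_ 0) (pot N') y1 = 'D_(- e_ 0) (pot N) y1.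
  suff fe: (fun s=> s^-1 *: ((pot N' \o shift y1) (s *: (e_ 0: P)) - pot N' y1)) = (fun s=> s^-1 *: ((pot N
  \o shift y1) (s *: (- e_ 0: P)) - pot N y1)) by rewrite /derive fe.
  apply/funext=> s; rewrite /= !hN r1; congr (_ *: (pot N _ - _)).
  apply/rowP=> i; rewrite !mxE eqxx /=; case: eqP=>[->|_]; last by rewrite mulr0 oppr0 mulr0. lra.
 have df: differentiable (pot N) y1 by apply: Ck_diff oU (Ck_pot 1 N oU) Uy.
 rewrite !(@derive_dirE R) // -sumrN; apply: eq_bigr=> j _; by rewrite mxE mulNr.
have g0': gap tau' sig' y1 = 0 by rewrite /gap ht hs r1.
have h1: 0 <= 'D_(e_ 0) (gap tau sig) y1 by apply: dge=>//; left; rewrite mxE eqxx.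
have h2: 0 <= 'D_(e_ 0) (gap tau' sig') y1.
 apply: dge=>// [y Uy' yy|]; last by left; rewrite mxE eqxx. by rewrite /gap -!expr2 subr_ge0; exact: H'.
move: h1 h2; have k1:= D_gap tau sig 0 Uy; have k2:= D_gap tau' sig' 0 Uy.
have e1:= derive_val (is_derive:= k1); have e2:= derive_val (is_derive:= k2).
move: e1 e2; rewrite (dflip _ _ ht) (dflip _ _ hs) ht hs r1 s0.
move: ('D_(e_ 0) (gap tau sig) y1) ('D_(e_ 0) (gap tau' sig') y1) ('D_(e_ 0) (pot tau) y1) ('D_(e_ 0) (pot sig)
y1)=> p q r s e1 e2 p0 q0.
have: 0 <= c * (Phi y1 * 'D_(e_ 0) Phi y1) by rewrite !mulr_ge0 ?(ltW c0) ?(ltW Phi0) ?dPhi.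
move: (c * _) e1 e2=> w e1 e2; lra.
Qed.

End Touch.

Section ConformalCone.
Context {R n}.
Local Notation V:= 'rV[R]_n.+2.

Lemma Cks_lcone d (U: set 'rV[R]_d) (F: 'rV[R]_d -> 'rV[R]_n): open U -> Cks U F ->
  Cks U (fun x => lcone (F x)).
move=> oU HF k; have hd: Ck k U (fun x=> dotp (F x) (F x)).
 by apply: Ck_sum=>// i; exact: (Ck_mul oU (HF k i) (HF k i)).
apply: ixP=>[||i].
- apply: (@Ck_ext _ _ _ _ (fun x=> 2^-1 * (1 + dotp (F x) (F x))))=>//.
 by move=> x _; rewrite vec0 mulrC. by apply: Ck_scal=>//; apply: Ck_add=>//; exact: Ck_cst.
- apply: (@Ck_ext _ _ _ _ (fun x=> 2^-1 * (1 + - dotp (F x) (F x))))=>//.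
 by move=> x _; rewrite vecl mulrC. by apply: Ck_scal=>//; apply: Ck_add=>//; [exact: Ck_cst|exact: Ck_opp].
- by apply: Ck_ext (HF k i)=>// x _; rewrite vecy.
Qed.

Lemma Q_Dr_lcone d (U: set 'rV[R]_d) (F: 'rV[R]_d -> 'rV[R]_n) x i j: open U -> Cks U F -> U x ->
  Q (Dr i (fun x => lcone (F x)) x) (Dr j (fun x => lcone (F x)) x) = (Dj F x *m (Dj F x)^T) i j.
move=> oU HF Ux; have HL:= Cks_lcone oU HF.
have hl a: Dr a (fun x=> lcone (F x)) x 0 li = - Dr a (fun x=> lcone (F x)) x 0 0.
 rewrite !DrE; have h:= is_deriveN (derivableP (Ck_der (i:= a) (HL 1%N 0) Ux)).
 have -> : (fun y=> lcone (F y) 0 li) = (cst 1: 'rV[R]_d -> R^o) + (- (fun y=> lcone (F y) 0 0)) by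
 apply/funext=> y; rewrite vecl -[RHS]/(1 + - _) vec0; field. by rewrite derive_val add0r.
have hy a k: Dr a (fun x=> lcone (F x)) x 0 (yi k) = Dj F x a k by rewrite DrE mxE; congr ('D_(e_ a) _ x);
apply/funext=> y; rewrite vecy. rewrite Q_ix !hl mulrNN addrK mxE; apply: eq_bigr=> k _.
by rewrite !hy [(_^T) k j]mxE.
Qed.

(** The derivatives of [s] drop out because [Xi] is null and therefore orthogonal to its own
    derivatives. *)
Lemma Q_Dr_scal d (U: set 'rV[R]_d) (s: 'rV[R]_d -> R) (Xi: 'rV[R]_d -> V) x i j :
  open U -> Ck 1 U s -> Cks U Xi -> (forall x, U x -> Q (Xi x) (Xi x) = 0) -> U x ->
  Q (Dr i (fun x => s x *: Xi x) x) (Dr j (fun x => s x *: Xi x) x) = s x ^+ 2 * Q (Dr i Xi x) (Dr j Xi x).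
move=> oU Hs HX X0 Ux; rewrite !(Dr_scal _ oU Hs HX Ux) !QE X0 //. have h a: Q (Dr a Xi x) (Xi x) = 0.
 have:= Q_const a oU HX HX Ux X0; rewrite [X in _ + X]QC=> h; lra.
by rewrite [Q (Xi x) _]QC !h; ring.
Qed.

Lemma Dr_mulmx d e (U: set 'rV[R]_d) (Xi: 'rV[R]_d -> V) (L: 'M[R]_(n.+2, e.+1)) x i :
  open U -> Cks U Xi -> U x -> Dr i (fun x => Xi x *m L) x = Dr i Xi x *m L.
move=> oU HX Ux; rewrite !Dr_row (Dj_comp (g:= fun z=> z *m L)).
- by rewrite Dj_mul -row_mul.
- by move=> k; exact: Cks_diff HX Ux.
- by move=> k; apply: Cks_diff (openT: open [set: V]) _ _=>//; exact: Cks_mul openT.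
Qed.

(** The flat section is isometric to Euclidean space, Lorentz maps preserve [Q], and [Q_Dr_scal]
    supplies the factor. *)
Lemma conf_lcone d (U: set 'rV[R]_d) (F1 F2: 'rV[R]_d -> 'rV[R]_n) (s: 'rV[R]_d -> R) L x :
  open U -> Cks U F1 -> Cks U F2 -> lor L -> Ck 1 U s ->
  (forall x, U x -> lcone (F2 x) = s x *: (lcone (F1 x) *m L)) -> U x ->
  Dj F2 x *m (Dj F2 x)^T = s x ^+ 2 *: (Dj F1 x *m (Dj F1 x)^T).
move=> oU H1 H2 lL Hs e Ux; apply/matrixP=> i j; rewrite [RHS]mxE -!(Q_Dr_lcone _ _ oU) //.
have HL: Cks U (fun x=> lcone (F1 x) *m L) by apply: (@Cks_comp _ _ _ _ U [set: V] (fun x=> lcone (F1 x)) (fun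
z=> z *m L))=>//; [exact: openT|exact: Cks_lcone|exact: Cks_mul openT].
rewrite !(Dr_ext _ oU Ux e) (Q_Dr_scal _ _ oU Hs HL) //; last first.
 by move=> y _; rewrite lL.1; have []:= lconeC (F1 y).
by rewrite !(Dr_mulmx _ _ oU (Cks_lcone oU H1) Ux) lL.1.
Qed.

End ConformalCone.

(** * Folding along the boundary hyperplane *)

Section Fold.
Context {R m}.
Local Notation P:= 'rV[R]_m.+1.
Local Notation V:= 'rV[R]_m.+3.
Implicit Types (x y z: P) (X Y Z: V).
(** The unit vector whose reflection acts as [mrefl] on the flat section; the boundary hyperplane is
    [Q mv X = 0]. *)
Definition mv: V:= vec 0 0 (e_ 0: P).
Definition fold y: P:= \row_i (if i == ord0 then `|y 0 i| else y 0 i).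

Lemma Q_mv X: Q mv X = X 0 (yi 0).
rewrite Q_ix vec0 vecl !mul0r addr0 subr0 (bigD1 ord0) //= big1 ?addr0=>[|i i0].
 by rewrite vecy mxE mul1r.
by rewrite vecy mxE (negPf i0) andbF mul0r.
Qed.

Lemma Q_mvv: Q mv mv = 1. by rewrite Q_mv vecy mxE. Qed.

Lemma mreflK y: mrefl (mrefl y) = y.
by apply/rowP => i; rewrite !mxE; case: eqP=>// ->; rewrite opprK. Qed.

Lemma dotp_mrefl y: dotp (mrefl y) (mrefl y) = dotp y y.
by apply: eq_bigr => i _; rewrite !mxE; case: eqP=>// _; rewrite mulrNN. Qed.

Lemma refl_yi X i: (X *m refl mv) 0 (yi i) = if i == ord0 then - X 0 (yi i) else X 0 (yi i).
rewrite reflE Q_mv !mxE !liftK mxE eqxx /=; case: eqP=>[->|_]; last by rewrite mulr0 subr0.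
by rewrite mulr1; lra.
Qed.

Lemma refl_0l X: ((X *m refl mv) 0 0 = X 0 0) * ((X *m refl mv) 0 li = X 0 li).
have h j: mv 0 j = 0 -> (X *m refl mv) 0 j = X 0 j by move=> h; rewrite reflE 3!mxE h mulr0 subr0.
by split; apply: h; [rewrite vec0|rewrite vecl].
Qed.

Lemma hgt_refl X: hgt (X *m refl mv) = hgt X.
by rewrite /hgt !refl_0l. Qed.

Lemma stereoR X: stereo (X *m refl mv) = mrefl (stereo X).
by apply/rowP => i; rewrite [LHS]mxE hgt_refl refl_yi !mxE; case: eqP=>// _; rewrite mulNr. Qed.

Lemma lcone_mrefl y: lcone (mrefl y) = lcone y *m refl mv.
apply: vecP=>[||i].
- by rewrite refl_0l !vec0 dotp_mrefl.
- by rewrite refl_0l !vecl dotp_mrefl.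
- by rewrite refl_yi !vecy mxE.
Qed.

Lemma pot_refl N y: pot (N *m refl mv) y = pot N (mrefl y).
by rewrite /pot lcone_mrefl -{1}(mulmx1 (lcone y)) -(reflK Q_mvv) mulmxA Q_refl // Q_mvv. Qed.

Lemma fold_ge0 y: 0 <= fold y 0 ord0. by rewrite mxE eqxx. Qed.

Lemma fold_id y: 0 <= co y -> fold y = y.
by move=> y0; apply/rowP => i; rewrite mxE; case: eqP=>// ->; rewrite ger0_norm. Qed.

Lemma fold_refl y: fold (mrefl y) = fold y.
by apply/rowP => i; rewrite !mxE; case: eqP=>// _; rewrite normrN. Qed.

Lemma fold_neg y: co y <= 0 -> fold y = mrefl y.
by move=> y0; rewrite -fold_refl fold_id // mxE eqxx oppr_ge0. Qed.

Lemma fold_cases y: fold y = y \/ fold y = mrefl y.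
by have [/fold_id|/ltW/fold_neg]:= leP 0 (co y); [left|right]. Qed.

Lemma fold_inj y z: fold y = fold z <-> y = z \/ y = mrefl z.
split=>[|[->|->]] //; last exact: fold_refl.
case: (fold_cases y)=>->; case: (fold_cases z)=>-> e; [left|right|right|left]=>//.
 by rewrite -e mreflK.
by rewrite -[y]mreflK e mreflK.
Qed.

Lemma fold_continuous: continuous fold.
move=> y; apply: cont_rV=> j.
rewrite (_: (fun y=> fold y 0 j) = if j == ord0 then (fun y=> `|y 0 j|) else (fun y=> y 0 j)); last first.
 by apply/funext=> z; rewrite mxE; case: eqP.
case: eqP=> _; last exact: coordC. by apply: continuous_comp; [exact: coordC|exact: norm_continuous].
Qed.

Lemma hgt_cont: continuous (fun X: V => hgt X).
by move=> X; apply: (@cvgD _ _ _ (nbhs X) _ (fun X: V => X 0 0) (fun X: V => X 0 li)); exact: coordC. Qed.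

Lemma stereo_cont X: hgt X != 0 -> {for X, continuous (@stereo R m.+1)}.
move=> hX; apply: cont_rV=> j; rewrite (_: (fun Y: V=> stereo Y 0 j) = fun Y: V=> Y 0 (yi j) / hgt Y); last first.
 by apply/funext=> Y; rewrite mxE.
apply: (@cvgM _ _ (nbhs X) _ (fun Y: V=> Y 0 (yi j)) (fun Y: V=> (hgt Y)^-1)); first exact: coordC.
by apply: cvgV=>//; exact: hgt_cont.
Qed.

Lemma lcone_cont: continuous (@lcone R m.+1).
move=> y; apply: (@Cks_cont _ _ _ [set: P])=>//.
by apply: Cks_lcone; [exact: openT|apply: Cks_id; exact: openT].
Qed.

Lemma cap_conic X (A: set V): cone X -> nbhs X A -> (forall Y t, 0 < t -> A Y -> A (t *: Y)) ->
  exists N, cap N X /\ forall Z, cap N Z -> A Z.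
move=> cX nA At; have [N [NX HN]]:= cap_nbhs cX nA; exists N; split=>// Z NZ.
have [[_ Z0] _]:= NZ; have X0:= cX.2.
have -> : Z = (Z 0 0 / X 0 0) *: ((X 0 0 / Z 0 0) *: Z) by rewrite scalerA mulrA divfK ?gt_eqF // divff
?scale1r // gt_eqF. by apply: At; [exact: divr_gt0|exact: HN].
Qed.

Lemma cap_stereo X (A: set P): cone X -> 0 < hgt X -> nbhs (stereo X) A ->
  exists N, cap N X /\ forall Z, cap N Z -> 0 < hgt Z /\ A (stereo Z).
move=> cX hX nA; apply: cap_conic=>//; last first.
 move=> Y t t0 [hY AY]; rewrite hgtZ mulr_gt0 //; split=>//. by rewrite -(@stereo_par _ _ Y) //; exists t.
apply: filterI; last exact: (stereo_cont (lt0r_neq0 hX)).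
by apply: (@hgt_cont X [set r | 0 < r]); apply: open_nbhs_nbhs; split; [exact: open_gt|].
Qed.

Lemma cap_lcone N y: cap N (lcone y) -> nbhs y [set z | cap N (lcone z)].
move=>[_ Ny]; have:= lcone_cont (cap_open Ny); apply: (@filterS _ (nbhs y))=> z Hz. by split=>//; exact: lconeC.
Qed.

End Fold.

Section Local.
Context {R} {d: nat}.
Local Notation P:= 'rV[R]_d.

Lemma within_open {X Y: topologicalType} (S: set X) (f: X -> Y) x (V: set Y) :
  {within S, continuous f} -> S x -> open V -> V (f x) ->
  exists U, [/\ open U, U x & forall z, U z -> S z -> V (f z)].
move=>/subspace_continuousP cf Sx oV Vx.
have: within S (nbhs x) (f @^-1` V) by apply: (cf x Sx); exact: open_nbhs_nbhs.
rewrite /within /= nbhsE=>-[U [oU Ux] HU]. by exists U; split=>// z Uz Sz; exact: HU.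
Qed.

Lemma open_forall {X: topologicalType} n (O: 'I_n -> set X) :
  (forall i, open (O i)) -> open [set x | forall i, O i x].
move=> oO; rewrite openE=> x Hx; rewrite /interior /=. have hf i: nbhs x (O i) by exact: open_nbhs_nbhs.
exact: filter_forall hf.
Qed.

Lemma smooth_map_local e (S: set P) (f: P -> 'rV[R]_e) x: smooth_map_on S f -> S x ->
  exists U F, [/\ open U, U x, Cks U F & forall y, U y -> S y -> F y = f y].
move=> sf Sx; have [U HU]:= choice (fun j=> sf j x Sx). have [F HF]:= choice HU.
exists [set y | forall j, U j y], (fun y=> \row_j F j y); split.
- by apply: open_forall=> j; have []:= HF j.
- by move=> j; have []:= HF j.
- move=> k j; have [_ _ h _]:= HF j.
 apply: (@Ck_sub _ _ _ (U j)); first by []. rewrite (_: (fun y=> _) = F j); first exact: h.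
 by apply/funext=> y; rewrite mxE.
- by move=> y Oy Sy; apply/rowP=> j; rewrite mxE; have [_ _ _ ->]:= HF j.
Qed.

Lemma open_pre {X: topologicalType} (U: set P) (f: P -> X) (W: set X) :
  open U -> (forall x, U x -> {for x, continuous f}) -> open W -> open (U `&` f @^-1` W).
move=> oU cf oW; rewrite openE=> x [Ux Wx]; apply: filterI; first exact: open_nbhs_nbhs.
by apply: (cf x Ux W); exact: open_nbhs_nbhs.
Qed.

Lemma line_limit (f: P -> R) x v r: {for x, continuous f} -> 0 < r ->
  (forall s, 0 < s < r -> f (x + s *: v) = 0) -> f x = 0.
move=> cf r0 H; apply: contrapT=>/eqP fx; have fx0: 0 < `|f x| by rewrite normr_gt0.
have: nbhs x [set y | `|f y - f x| < `|f x|] by exact: (cont_near cf fx0).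
rewrite nbhsE=>-[U [oU Ux] HU]; have /nbhs_ballP [q /= q0 Hq]:= line_near v oU Ux. pose s:= Num.min r q / 2.
have s0: 0 < s by rewrite divr_gt0 // lt_min r0 q0.
have: s < Num.min r q by rewrite gtr_pMr ?invf_lt1 ?ltr1n // lt_min r0 q0. rewrite lt_min=>/andP[sr sq].
have /HU: U (x + s *: v) by apply: Hq; rewrite -ball_normE /= sub0r normrN gtr0_norm.
by rewrite /= H ?s0 // sub0r normrN ltxx.
Qed.

End Local.

Section Side.
Context {R m}.
Local Notation P:= 'rV[R]_m.+1.

(** If [f] moved a boundary point strictly inside, it would do the same with nearby points outside
    the half space, against the hypothesis. *)
Lemma side_zero (U: set P) (f: P -> P) x: open U -> U x -> {for x, continuous f} ->
  (forall z, U z -> 0 <= f z 0 ord0 -> 0 <= co z) -> co x = 0 -> 0 <= f x 0 ord0 -> f x 0 ord0 = 0.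
move=> oU Ux cf H x0; rewrite le_eqVlt=>/orP[/eqP //|fx0]. have n1: nbhs x [set z | 0 < f z 0 ord0].
 apply: (cf [set y: P | 0 < co y]).
 by apply: (@coordC R _ ord0 (f x) [set r | 0 < r]); apply: open_nbhs_nbhs; split; [exact: open_gt|].
have: nbhs x (U `&` [set z | 0 < f z 0 ord0]) by apply: filterI=>//; exact: open_nbhs_nbhs.
rewrite nbhsE=>-[W [oW Wx] HW]. have /nbhs_ballP [q /= q0 Hq]:= line_near (e_ ord0: P) oW Wx.
have q2: 0 < q / 2 by pos.
have /HW [Uz /= fz]: W (x + (- (q / 2)) *: (e_ ord0: P)) by apply: Hq; rewrite -ball_normE /= sub0r opprK
gtr0_norm // gtr_pMr ?invf_lt1 ?ltr1n.
by have:= H _ Uz (ltW fz); rewrite !mxE x0 eqxx /= mulr1 add0r oppr_ge0 leNgt q2.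
Qed.

(** A zero of the first component would be an interior minimum, where a column of the invertible
    [Dj f x] vanishes. *)
Lemma interior_min (U: set P) (f: P -> P) x: open U -> U x -> Cks U f -> Dj f x \in unitmx ->
  (forall z, U z -> 0 <= f z 0 ord0) -> 0 < f x 0 ord0.
move=> oU Ux sf uJ H; rewrite lt_neqAle H // andbT; apply/eqP=> fx0.
have df: differentiable (fun y=> f y 0 ord0) x by exact: Cks_diff sf Ux.
have ge v: 0 <= 'D_v (fun y=> f y 0 ord0) x.
 have /nbhs_ballP [q /= q0 Hq]:= line_near v oU Ux.
 apply: (dir_derive_ge0 (d:= q))=>//; first exact: diff_derivable.
 move=> s /andP[s0 sq]; rewrite -fx0; apply: H; apply: Hq. by rewrite -ball_normE /= sub0r normrN gtr0_norm.
have z0 a: Dj f x a ord0 = 0.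
 rewrite mxE; apply/eqP; rewrite eq_le ge andbT.
 by have:= ge (- e_ a); rewrite deriveE // linearN -deriveE // oppr_ge0.
have: (invmx (Dj f x) *m Dj f x) ord0 ord0 = 1 by rewrite mulVmx // mxE eqxx.
by rewrite mxE big1=>[/esym/eqP|a _]; [rewrite oner_eq0|rewrite z0 mulr0].
Qed.

Definition bproj: 'M[R]_m.+1:= 1%:M - delta_mx ord0 ord0.

Lemma bprojE (y: P) i: (y *m bproj) 0 i = if i == ord0 then 0 else y 0 i.
rewrite mulmxBr mulmx1 !mxE (bigD1 ord0) //= big1=>[|j j0].
 by rewrite mxE eqxx /= addr0; case: eqP=>[->|_]; rewrite ?mulr1 ?subrr // mulr0 subr0.
by rewrite mxE (negPf j0) mulr0.
Qed.

End Side.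

Section Segment.
Context {R} {d: nat}.
Local Notation P:= 'rV[R]_d.

Lemma convex_nbhs (U: set P) x: open U -> U x -> exists B, [/\ open B, convex_at B, B x & B `<=` U].
move=> oU Ux; have: nbhs x U by exact: open_nbhs_nbhs.
move=>/nbhs_ballP [r /= r0 Hr]; exists (ball x r); split=>//; first exact: ball_open.
 exact: ball_convex.
exact: ballxx.
Qed.

Lemma unit_near n (U: set P) (J: P -> 'M[R]_n) x: open U -> (forall i j, Ck 0 U (fun y => J y i j)) ->
  U x -> J x \in unitmx -> exists U', [/\ open U', U' x, U' `<=` U & forall y, U' y -> J y \in unitmx].
move=> oU sJ Ux; rewrite unitmxE unitfE=> Jx.
have sd: Ck 0 U (fun y=> \det (J y) * \det (J y)) by have h:= Ck_det oU sJ; exact: (Ck_mul oU h h).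
have d0: 0 < \det (J x) * \det (J x) by rewrite -expr2 lt_neqAle eq_sym sqrf_eq0 Jx sqr_ge0.
exists (U `&` [set y | 0 < \det (J y) * \det (J y)]); split; [|by []|by move=> y []|move=> y [_ /= h]].
 by apply: (open_pre oU _ (@open_gt R 0))=> z Uz; exact: Ck_cont sd Uz.
rewrite unitmxE unitfE; apply: contraTneq h=>->; by lra.
Qed.

End Segment.

(** * Local models of a manifold *)

Section Manifold.
Context {R m M} {A: atlas R m M} {g: tensor2 A}.
Local Notation P:= 'rV[R]_m.+1.
Local Notation SS:= 'rV[R]_m.+2.
Local Notation V:= 'rV[R]_m.+3.
Local Notation cdom:= (@Defs.dom _ _ _ _).

Section Cell.
(* In the chart [cch] the map [cf], with inverse [ch], straightens the boundary and pulls |dy|^2 back to [cmu] g. *)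
Record cell:= Cell {
  cch: chart A; cO: set P; cW: set P; cf: P -> P; ch: P -> P; cmu: P -> R }.
Record cell_axioms (g: tensor2 A) (k: cell): Prop:= CellAxioms {
  ca_oO: open (cO k);
  ca_oW: open (cW k);
  ca_f: Cks (cO k) (cf k);
  ca_h: Cks (cW k) (ch k);
  ca_fW: forall x, cO k x -> cW k (cf k x);
  ca_hO: forall y, cW k y -> cO k (ch k y);
  ca_hf: forall x, cO k x -> ch k (cf k x) = x;
  ca_fh: forall y, cW k y -> cf k (ch k y) = y;
  ca_img: forall x, cO k x -> 0 <= co x -> img (cch k) x;
  ca_side: forall x, cO k x -> (0 <= co x <-> 0 <= cf k x 0 ord0);
  ca_mu: forall x, cO k x -> 0 <= co x -> 0 < cmu k x;
  ca_conf: forall x, cO k x -> 0 <= co x ->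
    Dj (cf k) x *m (Dj (cf k) x)^T = cmu k x *: g (cch k) x }.
Context (HM: smooth_manifold A) (Hg: riemannian_metric g).

Lemma img_half c x: img (A:= A) c x -> 0 <= co x.
by have [U _ ->]:= sm_img_open HM c=>-[]. Qed.

Lemma img_psi c x: img (A:= A) c x -> cdom c (psi c x) /\ phi c (psi c x) = x.
by move=>[p dp <-]; rewrite (sm_phiK HM dp). Qed.

Lemma img_near c x: img (A:= A) c x -> exists U, [/\ open U, U x & forall z, U z -> 0 <= co z -> img c z].
move=> ix; have [U oU e]:= sm_img_open HM c; exists U; split=>//.
 by move: ix; rewrite e=>-[].
by move=> z Uz z0; rewrite e.
Qed.

Lemma chart_trans (c d: chart A) x: overlap c d x -> exists (U: set P) (T: P -> P),
  [/\ open U, U x, Cks U T & forall z, U z -> 0 <= co z ->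
    [/\ overlap c d z, T z = transition c d z & g c z = Dj T z *m g d (T z) *m (Dj T z)^T]].
move=> ov; have [U1 [T [oU1 U1x sT TE]]]:= smooth_map_local (@sm_compat _ _ _ _ HM c d) ov.
have ix: img c x by have [p [dc _] <-]:= ov; exists p.
have dd: cdom d (psi c x) by have [p [dc dd] <-]:= ov; rewrite (sm_phiK HM).
have [U2 [oU2 U2x HU2]]:= within_open (@sm_psi_cont _ _ _ _ HM c) ix (sm_dom_open HM d) dd.
have [U3 [oU3 U3x HU3]]:= img_near ix.
pose U:= U1 `&` (U2 `&` U3); have oU: open U by apply: openI=>//; exact: openI.
have sTU: Cks U T by apply: Cks_sub sT=> z []. exists U, T; split=>// z [U1z [U2z U3z]] z0.
have ov' w: U w -> 0 <= co w -> overlap c d w.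
 move=>[_ [U2w U3w]] w0; have iw:= HU3 _ U3w w0; have [d1 d2]:= img_psi iw.
 by exists (psi c w)=>//; split=>//; exact: HU2.
have Uz: U z by []. have TzE: T z = transition c d z by apply: TE=>//; exact: ov'. split=>//; first exact: ov'.
rewrite (rm_change Hg (ov' _ Uz z0)) -TzE; suff -> : jac (transition c d) z = Dj T z by [].
apply/matrixP=> a b; rewrite [LHS]mxE [RHS]mxE; apply: (@pd_half _ _ U)=>//.
 by move=> w Uw w0; rewrite TE //; [case: Uw|exact: ov'].
exact: Ck_der (sTU 1%N b) Uz.
Qed.

Section OneCell.
Context {k: cell} (K: cell_axioms g k).

Lemma ch_half y: cW k y -> (0 <= ch k y 0 ord0 <-> 0 <= co y).
by move=> Wy; rewrite (ca_side K (ca_hO K Wy)) (ca_fh K Wy). Qed.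

Lemma cf_zero x: cO k x -> co x = 0 -> cf k x 0 ord0 = 0.
move=> Ox x0; apply: (side_zero (ca_oO K) Ox)=>//; first exact: Cks_cont (ca_f K) Ox.
 by move=> z Oz /(ca_side K Oz).
by apply/(ca_side K Ox); rewrite x0.
Qed.

Lemma ch_zero y: cW k y -> co y = 0 -> ch k y 0 ord0 = 0.
move=> Wy y0; apply: (side_zero (ca_oW K) Wy)=>//; first exact: Cks_cont (ca_h K) Wy.
 by move=> z Wz /(ch_half Wz).
by apply/(ch_half Wy); rewrite y0.
Qed.

Lemma Dj_hf y: cW k y -> Dj (ch k) y *m Dj (cf k) (ch k y) = 1%:M.
move=> Wy; rewrite -Dj_comp; last 2 first.
- by move=> j; exact: Cks_diff (ca_oW K) (ca_h K) Wy.
- by move=> j; apply: Cks_diff (ca_oO K) (ca_f K) _; exact: (ca_hO K).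
by rewrite (Dj_eq (G:= id) (ca_oW K) Wy) ?Dj_id // => z; exact: (ca_fh K).
Qed.

Lemma ch_img y: cW k y -> 0 <= co y -> img (cch k) (ch k y).
by move=> Wy y0; apply: (ca_img K) (ca_hO K Wy) _; apply/ch_half. Qed.

End OneCell.

Section TwoCells.
Context {i j: cell} (I: cell_axioms g i) (J: cell_axioms g j).

(** [Th] extends the change of cells smoothly across the boundary. Its conformality is available
    only on the half space, where the two expressions of the metric can be compared. *)
Lemma trans_chart y z: cW i y -> 0 <= co y -> cW j z -> 0 <= co z ->
  psi (cch i) (ch i y) = psi (cch j) (ch j z) ->
  exists (B: set P) (Th: P -> P), [/\ open B /\ convex_at B, B y, Cks B Th, Th y = z &
    forall y', B y' -> cW i y' /\ cW j (Th y') /\ (0 <= co y' ->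
      [/\ 0 <= Th y' 0 ord0, psi (cch i) (ch i y') = psi (cch j) (ch j (Th y')) &
        Dj Th y' *m (Dj Th y')^T = (cmu j (ch j (Th y')) / cmu i (ch i y'))%:M])].
move=> Wy y0 Wz z0 e; set ci:= cch i; set cj:= cch j. have ix:= ch_img I Wy y0; have jx:= ch_img J Wz z0.
have [dp px]:= img_psi ix; have [dq qx]:= img_psi jx.
set x:= ch i y in e ix dp px; rewrite -e -/ci -/cj in dq qx. have ov: overlap ci cj x by exists (psi ci x).
have [U0 [F [oU0 U0x sF HF]]]:= chart_trans ov. have Fx: F x = ch j z by have [_ ->]:= HF x U0x (img_half ix).
pose U:= U0 `&` cO i; have oU: open U by apply: openI=>//; exact: ca_oO I.
have Ux: U x by split=>//; exact: (ca_hO I). have sFU: Cks U F by apply: Cks_sub sF=> z' [].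
pose U':= U `&` F @^-1` (cO j).
have oU': open U' by apply: open_pre oU _ (ca_oO J)=> z' Uz'; exact: Cks_cont sFU Uz'.
have U'x: U' x by split=>//=; rewrite Fx; exact: (ca_hO J). pose B0:= cW i `&` (ch i) @^-1` U'.
have oB0: open B0 by apply: open_pre (ca_oW I) _ oU'=> z' Wz'; exact: Cks_cont (ca_h I) Wz'.
have: nbhs y B0 by apply: open_nbhs_nbhs. move=>/nbhs_ballP [r /= r0 Hr]; pose Th y':= cf j (F (ch i y')).
have sTh: Cks B0 Th.
 apply: (@Cks_comp _ _ _ _ _ (cO j) (fun y'=> F (ch i y')) (cf j) oB0 (ca_oO J)).
 - by move=> y' [_ []].
 - apply: (@Cks_comp _ _ _ _ _ U (ch i) F oB0 oU)=>//; last by apply: Cks_sub (ca_h I)=> y' [].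
  by move=> y' [_ []].
 - exact: ca_f J.
exists (ball y r), Th; split=>//.
- split; first exact: ball_open.
 exact: ball_convex.
- exact: ballxx.
- by apply: Cks_sub sTh.
- by rewrite /Th Fx (ca_fh J).
move=> y' /Hr By'; have [Wy' [Ux' /= OF]]:= By'; split=>//; split; first exact: (ca_fW J).
move=> y'0; set x':= ch i y' in Ux' OF *. have x'0: 0 <= co x' by apply/(ch_half I).
have [ov' Fx' g2]:= HF _ Ux'.1 x'0.
have [p [pi pj] px']:= ov'; have pE: psi ci x' = p by rewrite -px' (sm_phiK HM).
have Fp: F x' = phi cj p by rewrite Fx' /transition pE.
have F0: 0 <= F x' 0 ord0 by rewrite Fp; apply: (@img_half cj); exists p. split.
- by apply/(ca_side J OF).
- by rewrite /Th -/x' (ca_hf J OF) Fp pE (sm_phiK HM).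
have DT: Dj Th y' = Dj (ch i) y' *m Dj F x' *m Dj (cf j) (F x').
 rewrite /Th (Dj_comp (F:= fun y'=> F (ch i y'))) ?(Dj_comp (F:= ch i)) //.
 - by move=> b; apply: Cks_diff (ca_oW I) (ca_h I) _.
 - by move=> b; apply: Cks_diff oU sFU _.
 - move=> b; apply: (Cks_diff (U:= B0))=>//.
  apply: (@Cks_comp _ _ _ _ _ U (ch i) F oB0 oU)=>//; last by apply: Cks_sub (ca_h I)=> ? [].
  by move=> ? [_ []].
 - by move=> b; apply: Cks_diff (ca_oO J) (ca_f J) _.
have g1:= ca_conf J OF F0; have g3:= ca_conf I Ux'.2 x'0. have mi:= ca_mu I Ux'.2 x'0.
rewrite DT !trmx_mul !mulmxA -(mulmxA _ _ (Dj (cf j) (F x'))^T) g1 /Th -/x' (ca_hf J OF).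
rewrite -scalemxAr -!scalemxAl.
have -> : Dj (ch i) y' *m Dj F x' *m g cj (F x') *m (Dj F x')^T *m (Dj (ch i) y')^T = Dj (ch i) y' *m g ci x'
*m (Dj (ch i) y')^T by rewrite g2 !mulmxA.
have -> : g ci x' = (cmu i x')^-1 *: (Dj (cf i) x' *m (Dj (cf i) x')^T) by rewrite g3 scalerA mulVf ?scale1r // gt_eqF.
rewrite -scalemxAr -scalemxAl !mulmxA (Dj_hf I Wy') mul1mx -trmx_mul (Dj_hf I Wy') trmx1.
by rewrite scalerA scalemx1.
Qed.

Lemma trans_int y z: cW i y -> 0 < co y -> cW j z -> 0 <= co z ->
  psi (cch i) (ch i y) = psi (cch j) (ch j z) -> 0 < co z.
move=> Wy y0 Wz z0 e; have [B [Th [[oB cB] By sTh Thy HB]]]:= trans_chart Wy (ltW y0) Wz z0 e.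
have oBp: open (B `&` [set y': P | 0 < co y']).
 apply: openI=>//; apply: (@open_comp _ _ (fun y': P=> co y') [set r | 0 < r]); last exact: open_gt.
 by move=> *; exact: coordC.
rewrite -Thy; apply: (interior_min oBp); [by split|by apply: Cks_sub sTh=> ? []| |].
 have [Wy' [WT /(_ (ltW y0)) [T0 _ ee]]]:= HB _ By. have: Dj Th y *m (Dj Th y)^T \in unitmx.
  rewrite ee -scalemx1 unitmxZ ?unitmx1 // unitfE gt_eqF // divr_gt0 //.
   by apply: (ca_mu J (ca_hO J WT)); apply/(ch_half J).
  by apply: (ca_mu I (ca_hO I Wy)); apply/(ch_half I)=>//; exact: ltW.
 by rewrite unitmx_mul=>/andP[].
by move=> z' [Bz' /ltW z'0]; have [_ [_ /(_ z'0) []]]:= HB _ Bz'.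
Qed.

End TwoCells.

Section Transition.
Context {i j: cell} (I: cell_axioms g i) (J: cell_axioms g j).

Lemma transition_bd y z: cW i y -> 0 <= co y -> cW j z -> 0 <= co z ->
  psi (cch i) (ch i y) = psi (cch j) (ch j z) -> (co y = 0 <-> co z = 0).
move=> Wy y0 Wz z0 e; split=> h; apply/eqP; rewrite eq_le ?z0 ?y0 andbT leNgt; apply/negP=> p.
 by have:= trans_int J I Wz p Wy y0 (esym e); rewrite h ltxx.
by have:= trans_int I J Wy p Wz z0 e; rewrite h ltxx.
Qed.

(** Liouville's theorem applies on the interior half [Bp] of the ball, which is convex and open and
    on which [Th] is conformal; the formula passes to the boundary by continuity. At a boundary
    point [L] respects the mirror, which makes the folded charts compatible. *)
Lemma transition_lor y z: (2 <= m)%N -> cW i y -> 0 <= co y -> cW j z -> 0 <= co z ->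
  psi (cch i) (ch i y) = psi (cch j) (ch j z) ->
  exists (B: set P) L, [/\ open B, B y, lor L, co y = 0 -> mv *m L = mv &
    (co y = 0 <-> co z = 0) /\
    forall y', B y' -> 0 <= co y' -> exists s z', (y' = y -> z' = z) /\
      [/\ 0 < s /\ cW i y', cW j z' /\ 0 <= co z', lcone y' *m L = s *: lcone z',
        psi (cch i) (ch i y') = psi (cch j) (ch j z') &
        Num.sqrt (cmu i (ch i y')) = s * Num.sqrt (cmu j (ch j z'))]].
move=> m2 Wy y0 Wz z0 e; have [B [Th [[oB cB] By sTh Thy HB]]]:= trans_chart I J Wy y0 Wz z0 e.
pose Bp:= B `&` [set y': P | 0 < co y'].
have oH: open [set y': P | 0 < co y'] by apply: (@open_comp _ _ (fun y': P=> co y') [set r | 0 < r]); [move=>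
*; exact: coordC|exact: open_gt]. have oBp: open Bp by exact: openI. have cBp: convex_at Bp.
 move=> a b t [Ba a0] [Bb b0] t01; split; first exact: cB.
 by move: t01 a0 b0=>/andP[t0 t1] /=; rewrite !mxE; nra.
have [w Bpw]: exists w, Bp w.
 have /nbhs_ballP [q /= q0 Hq]:= line_near (e_ ord0: P) oB By. have q2: 0 < q / 2 by rewrite divr_gt0.
 exists (y + (q / 2) *: (e_ ord0: P)); split.
  by apply: Hq; rewrite -ball_normE /= sub0r normrN gtr0_norm // gtr_pMr ?invf_lt1 ?ltr1n.
 by rewrite /= !mxE eqxx /= mulr1 ltr_wpDl.
pose l2 y':= (Dj Th y' *m (Dj Th y')^T) 0 0.
have l2E y': B y' -> 0 <= co y' -> l2 y' = cmu j (ch j (Th y')) / cmu i (ch i y') by move=>/HB [_ [_ h]] /h [_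
_ ee]; rewrite /l2 ee mxE eqxx.
have mup y': B y' -> 0 <= co y' -> 0 < cmu i (ch i y') /\ 0 < cmu j (ch j (Th y')).
 move=> By' y'0; have [Wy' [WT /(_ y'0) [T0 _ _]]]:= HB _ By'.
 by split; [apply: (ca_mu I (ca_hO I Wy')); apply/(ch_half I)|apply: (ca_mu J (ca_hO J WT)); apply/(ch_half J)].
have l2p y': B y' -> 0 <= co y' -> 0 < l2 y' by move=> By' y'0; rewrite l2E //; have [? ?]:= mup _ By' y'0;
exact: divr_gt0. have sl2 k: Ck k B l2.
 rewrite (_: l2 = fun y'=> \sum_b Dj Th y' 0 b * Dj Th y' 0 b).
  by apply: Ck_sum=>// b; have h:= @Ck_Dj R _ _ k B Th 0 b oB sTh; exact: (Ck_mul oB h h).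
 by apply/funext=> y'; rewrite /l2 mxE; apply: eq_bigr=> b _; rewrite [(_^T) b 0]mxE.
pose sq y':= Num.sqrt (l2 y'). have BpB: Bp `<=` B by move=> y' []. have sTp: Cks Bp Th by exact: Cks_sub sTh.
have l2pp y': Bp y' -> 0 < l2 y' by move=>[By' /ltW y'0]; exact: l2p.
have sqp k: Ck k Bp (fun y'=> (sq y')^-1).
 apply: Ck_inv=>// [y' /l2pp|]; first by rewrite /sq sqrtr_gt0. by apply: Ck_sqrt=>//; exact: Ck_sub (sl2 k).
(* Dividing by the conformal factor makes the lift to the cone isometric, as [liouville]
   requires. *)
have sL:= Cks_lcone oBp sTp. pose Xi y':= (sq y')^-1 *: lcone (Th y'). have sXi: Cks Bp Xi.
 move=> k b; apply: (@Ck_ext _ _ _ _ (fun y'=> (sq y')^-1 * lcone (Th y') 0 b))=>//.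
  by move=> y' _; rewrite [RHS]mxE.
 exact: (Ck_mul oBp (sqp k) (sL k b)).
have cXi y': Bp y' -> cone (Xi y').
 move=> By'; apply: (cone_par (X:= lcone (Th y'))); last exact: lconeC.
 by exists (sq y')^-1=>//; rewrite invr_gt0 sqrtr_gt0 l2pp.
have iXi y' a b: Bp y' -> Q (Dr a Xi y') (Dr b Xi y') = (a == b)%:R.
 move=> By'; rewrite (Q_Dr_scal a b oBp (sqp 1%N) sL) //; last by move=> v _; have []:= lconeC (Th v).
 rewrite (Q_Dr_lcone a b oBp sTp By'); have [By'' y'0]:= By'. have [_ [_ /(_ (ltW y'0)) [_ _ ee]]]:= HB _ By''.
 rewrite ee mxE exprVn sqr_sqrtr; last exact/ltW/l2pp.
 rewrite l2E // ?ltW // -[X in _ * X = _]mulr_natr mulrA mulVf ?mul1r // gt_eqF //.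
 by have [? ?]:= mup _ By'' (ltW y'0); exact: divr_gt0.
have n3: (3 <= m.+1)%N by []. have [L [lL HL]]:= liouville n3 oBp cBp Bpw sXi cXi iXi.
have eqp y': Bp y' -> lcone (Th y') = sq y' *: (lcone y' *m L).
 move=> By'; rewrite -HL // /Xi scalerA divff ?scale1r //. by rewrite gt_eqF // sqrtr_gt0 l2pp.
have eqB y': B y' -> 0 <= co y' -> lcone (Th y') = sq y' *: (lcone y' *m L).
 move=> By' y'0; apply/rowP=> b; apply/eqP; rewrite -subr_eq0; apply/eqP.
 have /nbhs_ballP [q /= q0 Hq]:= line_near (e_ ord0: P) oB By'.
 apply: (@line_limit _ _ (fun y'=> lcone (Th y') 0 b - (sq y' *: (lcone y' *m L)) 0 b) y' (e_ ord0) q)=>//; last first.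
  move=> s /andP[s0 sq']; rewrite eqp ?subrr //; split.
   by apply: Hq; rewrite -ball_normE /= sub0r normrN gtr0_norm.
  by rewrite /= !mxE eqxx /= mulr1 ltr_wpDl.
 have c1:= Ck_cont (Cks_lcone oB sTh 0%N b) By'.
 have c2: {for y', continuous sq} by apply: continuous_comp; [exact: Ck_cont (sl2 0%N) By'|exact: sqrt_continuous].
 have cid: Cks B (fun y=> lcone y *m L).
  apply: (@Cks_comp _ _ _ _ B setT _ (fun z=> z *m L))=>//; [exact: openT|by apply: Cks_lcone=>//; exact:
  Cks_id|exact: Cks_mul openT].
 have c3:= Ck_cont (cid 0%N b) By'.
 have -> : (fun y'=> lcone (Th y') 0 b - (sq y' *: (lcone y' *m L)) 0 b) = (fun y'=> lcone (Th y') 0 b - sq y'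
 * (lcone y' *m L) 0 b) by apply/funext=> u; congr (_ - _); exact: mxE.
 by apply: (@cvgB _ _ _ (nbhs y'))=>//; apply: (@cvgM _ _ (nbhs y')).
have sqgt y': B y' -> 0 <= co y' -> 0 < sq y' by move=> By' y'0; rewrite sqrtr_gt0 l2p.
have bd y': B y' -> 0 <= co y' -> (co y' = 0 <-> Th y' 0 ord0 = 0) by move=> By' y'0; have [Wy' [WT /(_ y'0)
[T0 ee _]]]:= HB _ By'; exact: transition_bd. exists B, L; split=>//; last first.
 split; first by rewrite -Thy; exact: bd.
 move=> y' By' y'0; have [Wy' [WT /(_ y'0) [T0 ee _]]]:= HB _ By'; exists (sq y')^-1, (Th y').
 split; first by move=>->. have s0:= sqgt y' By' y'0; split=>//.
 - by rewrite invr_gt0.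
 - by rewrite eqB // scalerA mulVf ?scale1r // gt_eqF.
 - have [mi mj]:= mup _ By' y'0; rewrite /sq l2E // sqrtrM ?(ltW mj) // sqrtrV ?(ltW mi) //.
  by field; rewrite !gt_eqF ?sqrtr_gt0.
(* [N] is the vector that [L] sends to [mv]. Its potential vanishes on the boundary hyperplane near
   [y], which kills its quadratic part and tangential components, and it is positive inside, which
   leaves [N = mv]. *)
move=> yb; have [L' [lL' LL' L'L]]:= lor_inv lL; set N:= mv *m L'.
have potN y': B y' -> 0 <= co y' -> pot N y' = (sq y')^-1 * Th y' 0 ord0.
 move=> By' y'0; rewrite /pot -(lor_capE mv _ lL LL' lL').
 have -> : lcone y' *m L = (sq y')^-1 *: lcone (Th y') by rewrite eqB // scalerA mulVf ?scale1r // gt_eqF // sqgt.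
 by rewrite QZr Q_mv vecy.
have N0 y': B y' -> co y' = 0 -> pot N y' = 0 by move=> By' y'0; rewrite potN ?y'0 //; have /bd [|-> //]:=
By'; [rewrite y'0|rewrite mulr0].
have N1 a y': B y' -> co y' = 0 -> N 0 (yi (lift ord0 a)) + curv N * y' 0 (lift ord0 a) = 0 by move=> By' y'0;
rewrite -D_pot; exact: (tan_derive oB a By' y'0 N0). have a0: 'I_m:= Ordinal (ltn_trans (ltn0Sn 0) m2).
have K0: curv N = 0.
 have N1D y': B y' -> co y' = 0 -> 'D_(e_ (lift ord0 a0)) (pot N) y' = 0 by move=> By' y'0; rewrite D_pot N1.
 by have:= tan_derive oB a0 By yb N1D; rewrite D2_pot eqxx mul1r.
have Ny a: N 0 (yi (lift ord0 a)) = 0 by have:= N1 a y By yb; rewrite K0 mul0r addr0.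
have NN: Q N N = 1 by rewrite lL'.1 Q_mvv. have pN y': pot N y' = N 0 (yi ord0) * co y' + (N 0 li - N 0 0) / 2.
 rewrite potE K0 mul0r addr0 big_ord_recl big1 ?addr0 // => a _; by rewrite Ny mul0r.
have h1: N 0 li = N 0 0 by have:= N0 y By yb; rewrite pN yb; lra.
have [h2 h3]: N 0 li = 0 /\ N 0 0 = 0 by move: K0; rewrite /curv h1; lra. have wpos: 0 < N 0 (yi ord0).
 have [Bw w0]:= Bpw; have:= potN w Bw (ltW w0); rewrite pN h1 subrr mul0r addr0=> ee.
 have: 0 < N 0 (yi ord0) * co w.
  rewrite ee mulr_gt0 ?invr_gt0 ?sqgt ?ltW //. have [_ [_ /(_ (ltW w0)) [T0 _ _]]]:= HB _ Bw.
  rewrite lt_neqAle T0 andbT; apply/eqP=>/esym/(bd w Bw (ltW w0)) w00. by move: w0; rewrite /= w00 ltxx.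
 by rewrite pmulr_lgt0.
have n1: N 0 (yi ord0) = 1.
 move: NN; rewrite Q_ix h2 h3 big_ord_recl big1=>[|a _]; last by rewrite Ny mul0r.
 move=> sqe; apply/eqP; rewrite -(@eqrXn2 _ 2) ?expr1n ?ltW //; apply/eqP; rewrite -sqe; ring.
have mN: mv = N.
 apply: vecP=>[||a]; [by rewrite vec0 h3|by rewrite vecl h2|rewrite vecy mxE eqxx /=].
 by case: (unliftP ord0 a)=>[b ->|->]; rewrite ?Ny ?n1.
by rewrite {1}mN /N -mulmxA L'L mulmx1.
Qed.

End Transition.
End Cell.

Section Unfold.
Implicit Types (y z: P) (X Y Z: V).

Lemma par_stereoP X Y: cone X -> cone Y -> 0 < hgt X -> 0 < hgt Y -> stereo X = stereo Y -> par X Y.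
move=> cX cY hX hY e; exists (hgt Y / hgt X); first exact: divr_gt0.
by rewrite [X in _ = _ *: X](lconeK cX hX) scalerA divfK ?gt_eqF // e -lconeK.
Qed.

Lemma stereo_scal t y: 0 < t -> stereo (t *: lcone y) = y.
by move=> t0; rewrite -[RHS]stereoK -(@stereo_par _ _ (lcone y)) //; exists t. Qed.

Lemma hgt_scal t y: hgt (t *: lcone y) = t.
by rewrite hgtZ hgt_lcone mulr1. Qed.

(** [E] is the identity or the reflection, whichever brings the projection of [X] to the side where
    [fold] acts trivially. *)
Lemma unfold_ex X: exists E: 'M[R]_m.+3, [/\ lor E, E *m E = 1%:M,
  forall Z, hgt (Z *m E) = hgt Z, forall Z, fold (stereo (Z *m E)) = fold (stereo Z) &
  stereo (X *m E) = fold (stereo X)].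
case: (leP 0 (stereo X 0 ord0))=> h.
 exists 1%:M; split; [exact: lor1|by rewrite mulmx1| | |by rewrite mulmx1 fold_id]=> Z; by rewrite mulmx1.
exists (refl mv); split=>[||Z|Z|].
- by apply: lor_refl; exact: Q_mvv.
- by apply: reflK; exact: Q_mvv.
- exact: hgt_refl.
- by rewrite stereoR fold_refl.
- by rewrite stereoR fold_neg // ltW.
Qed.

End Unfold.

(** The second entry of a value is of degree one in [X], and |dX|^2 divided by its square is the
    metric [g]. Folding makes the model even with respect to the mirror. *)
Definition cell_mirror (g: tensor2 A): mirror R m.+2 M (M * R) :=
  @Mirror R m.+2 M (M * R) {k: cell | cell_axioms g k} fst
    (fun k X=>[/\ cone X, 0 < hgt X & cW (sval k) (fold (stereo X))])
    (fun k X => (psi (cch (sval k)) (ch (sval k) (fold (stereo X))),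
                 hgt X * Num.sqrt (cmu (sval k) (ch (sval k) (fold (stereo X))))))
    mv.
Local Notation S:= (cell_mirror g).
Local Notation mdom:= (@mdom _ _ _ _ S).
Local Notation mmap:= (@mmap _ _ _ _ S).
Local Notation adm:= (@adm _ _ _ _ S).

Section CellMirror.
Context (HM: smooth_manifold A) (Hg: riemannian_metric g) (m2: (2 <= m)%N) (cov: forall p: M, exists k x, [/\ cell_axioms g k, cO k x, 0 <= co x & psi (cch k) x = p]).

Lemma fold_nbhs (U: set P) y: open U -> U (fold y) -> nbhs y (fold @^-1` U).
by move=> oU Uy; apply: (fold_continuous (x:= y)); exact: open_nbhs_nbhs. Qed.

Lemma mmap_side i X E: (forall Z: V, hgt (Z *m E) = hgt Z) ->
  (forall Z: V, fold (stereo (Z *m E)) = fold (stereo Z)) -> mmap i (X *m E) = mmap i X.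
by move=> h1 h2; rewrite /= h1 h2. Qed.

Theorem cell_axiomsM: mirror_axioms S.
split.
- by move=> i X [].
- move=>[k K] X [cX hX WX]; have [N [NX HN]]:= cap_stereo cX hX (fold_nbhs (ca_oW K) WX).
 by exists N; split=>// Z NZ; have [h1 h2]:= HN Z NZ; split=>//; case: NZ.
- exact: Q_mvv.
- move=> p; have [k [x [K Ox x0 xp]]]:= cov p; exists (exist _ k K), (lcone (cf k x))=>/=.
 have f0: 0 <= cf k x 0 ord0 by apply/(ca_side K Ox).
 rewrite stereoK fold_id // hgt_lcone (ca_hf K Ox); split=>//.
 by split; [exact: lconeC|exact: ltr01|exact: (ca_fW K)].
- move=>[i I] [j J] X Y [cX hX WX] [cY hY WY] /= e.
 have [EX [lX EX2 hXE fX sX]]:= unfold_ex X; have [EY [lY EY2 hYE fY sY]]:= unfold_ex Y.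
 have [B [L [oB By lL mvL [zz HB]]]]:= transition_lor HM Hg I J m2 WX (fold_ge0 _) WY (fold_ge0 _) e.
 set y:= fold (stereo X) in By mvL zz HB sX; set z:= fold (stereo Y) in zz HB sY.
 have cX': cone (X *m EX) by exact: lX.2. have cY': cone (Y *m EY) by exact: lY.2.
 have hX': 0 < hgt (X *m EX) by rewrite hXE. have hY': 0 < hgt (Y *m EY) by rewrite hYE.
 exists (EX *m L *m EY); split.
 + by apply: lorM=>//; exact: lorM.
 + have [s [z' [/(_ erefl) zE [[s0 _] _ ee _ _]]]]:= HB y By (fold_ge0 _).
  have: par (X *m EX *m L *m EY) (Y *m EY *m EY).
   apply: lor_par; rewrite (lconeK cX' hX') (lconeK cY' hY') sX sY -scalemxAl ee zE.
   exists (hgt (Y *m EY) / (hgt (X *m EX) * s)); first by rewrite divr_gt0 // mulr_gt0.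
   by rewrite !scalerA; congr (_ *: _); field; rewrite !gt_eqF.
  by rewrite -(mulmxA Y) EY2 mulmx1 !mulmxA.
 (* Away from the boundary the cap is kept on one side. At a boundary point both sides occur, and
    the outer one is reduced to the inner one because [L] then commutes with the reflection. *)
 pose Ay:= [set y': P | B (fold y') /\ (co y = 0 \/ 0 < co y')]. have nA: nbhs (stereo (X *m EX)) Ay.
  rewrite sX; apply: filterI; first by apply: fold_nbhs=>//; rewrite fold_id // fold_ge0.
  have [y0|y0]:= eqVneq (co y) 0; first by apply: filterE=> u; left.
  have yp: 0 < co y by rewrite lt_neqAle eq_sym y0 fold_ge0.
  have: nbhs y [set u: P | 0 < co u] by apply: (@coordC R _ ord0 y [set r | 0 < r]); apply: open_nbhs_nbhs;
  split; [exact: open_gt|]. by apply: (@filterS _ (nbhs y))=> u hu; right.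
 have [N0 [N0X HN0]]:= cap_stereo cX' hX' nA. have [N [NX HN]]:= cap_lor lX N0X cX; exists N; split=>// Z NZ.
 have cZ: cone Z by case: NZ. have [hZ [BZ HZ]]:= HN0 _ (HN _ NZ). have cZ': cone (Z *m EX) by exact: lX.2.
 change (mmap (exist _ i I) Z = mmap (exist _ j J) (Z *m (EX *m L *m EY))).
 rewrite -(mmap_side (exist _ i I) Z hXE fX) !mulmxA (mmap_side (exist _ j J) _ hYE fY).
 set Z':= Z *m EX in hZ BZ HZ cZ' *; move: Z' hZ BZ HZ cZ'=> {NZ HN cZ} Z' hZ BZ HZ cZ'.
 have key Z1: cone Z1 -> 0 < hgt Z1 -> B (fold (stereo Z1)) -> 0 <= stereo Z1 0 ord0 -> mmap (exist _ i I) Z1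
 = mmap (exist _ j J) (Z1 *m L).
  move=> cZ1 hZ1 BZ1 s0; rewrite fold_id // in BZ1. have [s [z' [_ [[sp _] [_ z'0] ee pe me]]]]:= HB _ BZ1 s0.
  rewrite [in RHS](lconeK cZ1 hZ1) -scalemxAl ee scalerA /= fold_id //.
  have hs: 0 < hgt Z1 * s by exact: mulr_gt0. by rewrite stereo_scal // hgt_scal fold_id // pe me mulrA.
 have [s0|s0]:= leP 0 (stereo Z' 0 ord0); first exact: key.
 have y0: co y = 0 by case: HZ=>// /lt_trans/(_ s0); rewrite ltxx. have [L' [lL' LL' L'L]]:= lor_inv lL.
 have mvL': mv *m L' = mv by rewrite -{1}(mvL y0) -mulmxA LL' mulmx1.
 have com: refl mv *m L = L *m refl mv by rewrite -{1}mvL' (refl_conj _ lL lL' LL') -mulmxA L'L mulmx1.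
 have cZr: cone (Z' *m refl mv) by apply: (lor_refl (Q_mvv: Q (mv: V) mv = 1)).2.
 have:= key (Z' *m refl mv) cZr; rewrite hgt_refl stereoR fold_refl=>/(_ hZ BZ). rewrite -mulmxA com mulmxA.
 have fr (W: V): fold (stereo (W *m refl mv)) = fold (stereo W) by rewrite stereoR fold_refl.
 rewrite (mmap_side (exist _ i I) Z' (@hgt_refl _ _) fr) (mmap_side (exist _ j J) (Z' *m L) (@hgt_refl _ _) fr).
 by apply; rewrite mxE eqxx oppr_ge0 ltW.
- move=>[k K] X Y [cX hX WX] [cY hY WY] /=; split.
 move=> e; have [_ e1]:= img_psi HM (ch_img K WX (fold_ge0 _)).
 have [_ e2]:= img_psi HM (ch_img K WY (fold_ge0 _)); rewrite e e2 in e1.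
 have:= congr1 (cf k) e1; rewrite !(ca_fh K) // =>/esym /fold_inj[e'|e'].
  by left; exact: par_stereoP.
 right; apply: par_stereoP=>//; [|by rewrite hgt_refl|by rewrite stereoR].
 by apply: (lor_refl (Q_mvv: Q (mv: V) mv = 1)).2.
 by move=>[/stereo_par ->|/stereo_par ->] //; rewrite stereoR fold_refl.
- move=> i X _ _; apply: mmap_side=> Z; [exact: hgt_refl|by rewrite stereoR fold_refl].
- move=>[k K] X U [cX hX WX] oU /= UX.
 have [U1 [oU1 U1x HU1]]:= within_open (sm_psi_cont HM (c:= cch k)) (ch_img K WX (fold_ge0 _)) oU UX.
 pose B:= cW k `&` ch k @^-1` U1.
 have oB: open B by apply: open_pre (ca_oW K) _ oU1=> y Wy; exact: Cks_cont (ca_h K) Wy.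
 have [N [NX HN]]:= cap_stereo cX hX (fold_nbhs (y:= stereo X) oB (conj WX U1x)).
 exists N; split=>// Z /HN [hZ [WZ UZ]]; apply: HU1=>//. exact: (ch_img K WZ (fold_ge0 _)).
- move=>[k K] X N [cX hX WX] NX /=.
 have [E [lE E2 hE fE sE]]:= unfold_ex X; set y:= fold (stereo X) in sE WX *.
 have y0: 0 <= co y by exact: fold_ge0. have cX': cone (X *m E) by exact: lE.2.
 have QE2 Z: Q N (Z *m E) = Q (N *m E) Z by apply: lor_capE=>//. have Ny: cap (N *m E) (lcone y).
  split; first exact: lconeC. have: 0 < Q (N *m E) (X *m E) by rewrite lE.1; case: NX.
  by rewrite (lconeK cX') ?hE // sE QZr pmulr_rgt0 // hE.
 pose G:= cO k `&` (fun x=> lcone (cf k x)) @^-1` [set Z | 0 < Q (N *m E) Z]. have oG: open G.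
  apply: open_pre (ca_oO K) _ _=>[x Ox|].
   by apply: continuous_comp; [exact: Cks_cont (ca_f K) Ox|exact: lcone_cont].
  by apply: (@open_comp _ _ (Q (N *m E)) [set r | 0 < r]); [move=> *; exact: Q_cont|exact: open_gt].
 have ix:= ch_img K WX y0; have [dp px]:= img_psi HM ix.
 have Gx: G (phi (cch k) (psi (cch k) (ch k y))) by rewrite px; split; [exact: (ca_hO K)|rewrite /= (ca_fh K)
 //; case: Ny]. have [U [oU Ux HU]]:= within_open (sm_phi_cont HM (c:= cch k)) dp oG Gx.
 exists (U `&` cdom (cch k)); split; [by apply: openI=>//; exact: sm_dom_open|by split|].
 move=> q [Uq dq]; have [Oq Nq]:= HU q Uq dq. exists (lcone (cf k (phi (cch k) q)) *m E).
 have f0: 0 <= cf k (phi (cch k) q) 0 ord0 by apply/(ca_side K Oq); apply: (img_half HM (c:= cch k)); exists q.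
 rewrite fE stereoK fold_id // (ca_hf K Oq) (sm_phiK HM) //; split=>//.
 by split; [apply: lE.2; exact: lconeC|rewrite QE2].
Qed.

End CellMirror.

(** * Density of a conformal metric and its points of contact *)

Section Gauge.

Lemma schS_sym (W: set P) (Phi: P -> R) y: open W -> Ck 2 W Phi -> W y -> (schS Phi y)^T = schS Phi y.
move=> oW Phi2 Wy; apply/matrixP=> a b; rewrite mxE.
have e c d: schS Phi y c d = 'D_(e_ c) ('D_(e_ d) Phi) y / Phi y - (c == d)%:R * (dotp (gradS Phi y) (gradS
Phi y) / (2 * Phi y ^+ 2)) by exact: mxE. by rewrite !e (schwarz _ _ oW Phi2 Wy) eq_sym.
Qed.

Context (HM: smooth_manifold A) (Hg: riemannian_metric g).

Lemma tangential_unit (h: tensor2 A) (Hh: riemannian_metric h) c x: img c x -> tangential (h c x) \in unitmx.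
move=> ix; rewrite unitmxE unitfE; apply/eqP=>/eqP/det0P[v v0 vT].
pose w: P:= \row_j if unlift ord0 j is Some a then v 0 a else 0. have w0: w != 0.
 apply: contraNneq v0=> w0; apply/eqP/rowP=> a; have:= congr1 (fun X: P=> X 0 (lift ord0 a)) w0.
 by rewrite !mxE liftK.
have:= rm_pos Hh ix w0; suff -> : bil (h c x) w w = 0 by rewrite ltxx.
rewrite /bil mxE big_ord_recl [w^T _ _]mxE [w _ _]mxE unlift_none mulr0 add0r big1 // => b _.
have -> : (w *m h c x) 0 (lift ord0 b) = (v *m tangential (h c x)) 0 b.
 rewrite !mxE big_ord_recl [w _ _]mxE unlift_none mul0r add0r. by apply: eq_bigr=> a _; rewrite !mxE liftK.
by rewrite vT mxE mul0r.
Qed.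

Lemma metric00_gt0 c x: img c x -> 0 < g c x 0 0.
move=> ix; have e0: (e_ 0: P) != 0.
 by apply/eqP=> h; have:= congr1 (fun X: P=> X 0 0) h; rewrite !mxE eqxx=>/eqP; rewrite oner_eq0.
have:= rm_pos Hg ix e0; rewrite /bil -rowE mxE (bigD1 ord0) //= big1 ?addr0=>[|i i0]; last first.
 by rewrite !mxE (negPf i0) mulr0.
by rewrite !mxE eqxx mulr1.
Qed.

Lemma metric_unit (h: tensor2 A) (Hh: riemannian_metric h) c x: img c x -> h c x \in unitmx.
move=> ix; rewrite unitmxE unitfE; apply/eqP=>/eqP/det0P[v v0 vG].
by have:= rm_pos Hh ix v0; rewrite /bil vG mul0mx mxE ltxx.
Qed.

Lemma pos_near (U: set P) (f: P -> R) x k: open U -> Ck k U f -> U x -> 0 < f x ->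
  open (U `&` [set z | 0 < f z]).
by move=> oU cf Ux fx; apply: (open_pre oU _ (@open_gt R 0)) => z Uz; exact: Ck_cont cf Uz. Qed.

(** [cmu] is controlled on the half space only. One diagonal entry of the conformality relation
    expresses it as a quotient of functions that extend smoothly. *)
Lemma mu_extend k x: cell_axioms g k -> cO k x -> 0 <= co x -> exists (U: set P) (nu: P -> R),
  [/\ open U, U x /\ U `<=` cO k, forall l, Ck l U nu, forall z, U z -> 0 < nu z &
      forall z, U z -> 0 <= co z -> nu z = cmu k z].
move=> K Ox x0; have ix:= ca_img K Ox x0. have gpos:= @metric00_gt0 (cch k).
have [U1 [ga [oU1 U1x sga gaE]]]:= rm_smooth Hg 0 0 ix. pose q z:= (Dj (cf k) z *m (Dj (cf k) z)^T) 0 0.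
have sq l: Ck l (cO k) q.
 rewrite (_: q = fun z=> \sum_b Dj (cf k) z 0 b * Dj (cf k) z 0 b).
  apply: Ck_sum=>[|b]; first exact: ca_oO K.
  by have h:= @Ck_Dj R _ _ l (cO k) (cf k) 0 b (ca_oO K) (ca_f K); exact: (Ck_mul (ca_oO K) h h).
 by apply/funext=> z; rewrite /q mxE; apply: eq_bigr=> b _; rewrite [(_^T) b 0]mxE.
have qE z: cO k z -> 0 <= co z -> q z = cmu k z * g (cch k) z 0 0 by move=> Oz z0; rewrite /q (ca_conf K Oz z0) mxE.
have qx: 0 < q x by rewrite qE // mulr_gt0 ?(ca_mu K) // gpos. have gax: 0 < ga x by rewrite gaE // gpos.
have oV1:= pos_near oU1 (sga 0%N) U1x gax; have oV2:= pos_near (ca_oO K) (sq 0%N) Ox qx.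
set V1:= U1 `&` _ in oV1; set V2:= cO k `&` _ in oV2. exists (V1 `&` V2), (fun z=> q z * (ga z)^-1); split.
- exact: openI.
- by split; [split; split|move=> z [_ []]].
- move=> l; apply: Ck_mul; [exact: openI|by apply: Ck_sub (sq l)=> z [_ []]|].
 by apply: Ck_inv; [exact: openI|move=> z [[]]|apply: Ck_sub (sga l)=> z [[]]].
- by move=> z [[_ gz] [_ qz]]; apply: divr_gt0.
- move=> z [[U1z gz] [Oz qz]] z0; have iz:= ca_img K Oz z0.
 by rewrite qE // gaE // mulfK // gt_eqF // gpos.
Qed.

Context (u: M -> R) (u0: forall p, 0 < u p) (u2: C2_fun A u).

Lemma cell_gauge k x: cell_axioms g k -> cO k x -> 0 <= co x -> exists (U W: set P) (Phi: P -> R),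
  [/\ open U /\ open W, U x, (U `<=` cO k /\ W `<=` cW k) /\
      (forall z, U z -> W (cf k z)) /\ (forall y, W y -> U (ch k y)),
      Ck 2 W Phi /\ forall y, W y -> 0 < Phi y &
      forall z, U z -> 0 <= co z -> Phi (cf k z) = Num.sqrt (cmu k z / u (psi (cch k) z))].
move=> K Ox x0; have [U1 [nu [oU1 [U1x U1O] snu nu0 nuE]]]:= mu_extend K Ox x0.
have ix:= ca_img K Ox x0; have [U2 [om [oU2 U2x som omE]]]:= u2 ix. have omx: 0 < om x by rewrite omE.
have oU3:= pos_near oU2 som U2x omx; set U3:= U2 `&` _ in oU3.
pose U:= U1 `&` U3; have oU: open U by exact: openI. pose W:= cW k `&` ch k @^-1` U.
have oW: open W by apply: (open_pre (ca_oW K))=>// y Wy; exact: Cks_cont (ca_h K) Wy.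
have UO: U `<=` cO k by move=> z [/U1O]. pose Psi z:= Num.sqrt (nu z * (om z)^-1). have sPsi: Ck 2 U Psi.
 have hp z: U z -> 0 < nu z * (om z)^-1 by move=>[U1z [_ oz]]; apply: divr_gt0=>//; exact: nu0.
 apply: Ck_sqrt=>//; apply: Ck_mul=>//; first by apply: Ck_sub (snu 2%N)=> z [].
 by apply: Ck_inv=>// [z [_ []]//|]; apply: Ck_sub som=> z [_ []].
exists U, W, (fun y=> Psi (ch k y)); split.
- by [].
- by split.
- split; first by split=>// y [].
 split; last by move=> y []. by move=> z Uz; have Oz:= UO _ Uz; split; [exact: (ca_fW K)|rewrite /= (ca_hf K)].
- split; last first.
 by move=> y [_ [U1y [_ oy]]]; rewrite sqrtr_gt0 divr_gt0 // nu0.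
 apply: (Ck_comp oW oU (F:= ch k))=>//; first by move=> y []. by move=> j; apply: Ck_sub (ca_h K 2%N j)=> y [].
- move=> z Uz z0; have Oz:= UO _ Uz; have [U1z [U2z _]]:= Uz.
 by rewrite /Psi (ca_hf K Oz) (nuE z U1z z0) (omE z U2z (ca_img K Oz z0)).
Qed.

(** The metric |dX|^2 / cell_dens^2 is [u] times [g]. *)
Definition cell_dens (t: M * R): R:= t.2 / Num.sqrt (u t.1).
Implicit Type i: midx S.

Lemma cell_densE i X: mdom i X ->
  let x:= ch (sval i) (fold (stereo X)) in
  cell_dens (mmap i X) = hgt X * Num.sqrt (cmu (sval i) x / u (psi (cch (sval i)) x)).
case: i=> k K [cX hX WX] /=; have x0:= (ch_half K WX).2 (fold_ge0 _). have mp:= ca_mu K (ca_hO K WX) x0.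
by rewrite /cell_dens /= sqrtrM ?(ltW mp) // sqrtrV ?mulrA // ltW.
Qed.

Lemma dens_gauge i X: mdom i X -> exists (U W: set P) (Phi: P -> R),
  [/\ open U /\ open W, W (fold (stereo X)), (U `<=` cO (sval i) /\ W `<=` cW (sval i)) /\
      (forall z, U z -> W (cf (sval i) z)) /\ (forall y, W y -> U (ch (sval i) y)),
      Ck 2 W Phi /\ forall y, W y -> 0 < Phi y &
      (forall z, U z -> 0 <= co z -> Phi (cf (sval i) z) = Num.sqrt (cmu (sval i) z / u (psi (cch (sval i)) z))) /\
      (forall Z, cone Z -> 0 < hgt Z -> W (fold (stereo Z)) -> mdom i Z /\ cell_dens (mmap i Z) = hgt Z * Phi (fold (stereo Z)))].
case: i=> k K [cX hX WX]; have x0:= (ch_half K WX).2 (fold_ge0 _).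
have [U [W [Phi [oUW Ux [[UO WO] [UW WU]] sP PE]]]]:= cell_gauge K (ca_hO K WX) x0.
exists U, W, Phi; split=>//; first by rewrite -(ca_fh K WX); exact: UW.
split=>// Z cZ hZ WZ; have dZ: mdom (exist _ k K) Z by split=>//; exact: WO.
split=>//; rewrite cell_densE //=; congr (_ * _); rewrite -PE ?(ca_fh K) //; [exact: WO|exact: WU|].
by apply/(ch_half K (WO _ WZ)); exact: fold_ge0.
Qed.

Theorem cell_weight: weight_axioms S cell_dens.
split.
- move=> i X dX; have [U [W [Phi [_ WX _ [_ P0] [_ H]]]]]:= dens_gauge dX.
 have [cX hX _]:= dX; have [_ ->]:= H X cX hX WX; apply: mulr_gt0=>//; exact: P0.
- move=> i X t [cX hX WX] t0; rewrite /cell_dens /= -(@stereo_par _ _ X) ?hgtZ; last by exists t.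
 by rewrite !mulrA.
- move=> i X N c dX lt; have [U [W [Phi [[oU oW] WX _ [P2 P0] [_ H]]]]]:= dens_gauge dX.
 have [cX hX _]:= dX; rewrite (H X cX hX WX).2 in lt. pose F Z:= Q N Z - c * (hgt Z * Phi (fold (stereo Z))).
 have cF: {for X, continuous F}.
  have c1: {for X, continuous (fun Z: V=> Phi (fold (stereo Z)))}.
   apply: (@continuous_comp _ _ _ (@stereo R m.+1) (fun y=> Phi (fold y)) X).
    exact: (stereo_cont (lt0r_neq0 hX)).
   by apply: continuous_comp; [exact: fold_continuous|exact: Ck_cont P2 WX].
  apply: (@cvgB _ _ _ (nbhs X)); first exact: Q_cont. apply: (@cvgM _ _ (nbhs X)); first exact: cvg_cst.
  by apply: (@cvgM _ _ (nbhs X))=>//; exact: hgt_cont.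
 have n1: nbhs X [set Z | 0 < F Z] by apply: (cF [set r | 0 < r]); apply: open_nbhs_nbhs; split; [exact:
 open_gt|rewrite /F /= subr_gt0].
 have n2: nbhs X [set Z: V | 0 < hgt Z] by apply: (@hgt_cont _ _ X [set r | 0 < r]); apply: open_nbhs_nbhs;
 split; [exact: open_gt|]. have n3: nbhs X [set Z: V | W (fold (stereo Z))].
  exact: (stereo_cont (lt0r_neq0 hX) (fold_nbhs oW WX)).
 have [|N' [NX HN]]:= cap_conic cX (filterI n1 (filterI n2 n3)).
  move=> Y t t0 [FY [hY WY]]; have pY: par Y (t *: Y) by exists t.
  split; last by split; rewrite /= ?hgtZ ?mulr_gt0 // -(stereo_par pY).
  rewrite /F /= -(stereo_par pY) hgtZ QZr; move: FY; rewrite /F /= => FY.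
  move: (mulr_gt0 t0 FY); rewrite (_: t * (Q N Y - _) = t * Q N Y - c * (t * hgt Y * Phi (fold (stereo Y)))) //.
  by ring.
 exists N'; split=>// Z NZ; have [FZ [hZ WZ]]:= HN Z NZ. have cZ: cone Z by case: NZ.
 by rewrite (H Z cZ hZ WZ).2 -subr_gt0.
Qed.

Context (k: nat) (k1: (m.+1 <= 2 * k)%N) (k2: (k <= m.+1)%N) (m2: (2 <= m)%N).

Let gt:= rescale u g.
Context (sig_pos: forall c x, img c x -> exists2 lam, eigenvalues_wrt (gt c x) (schouten (gt c) x) lam & Gamma k lam).
Context (bd_pos: forall c x, bimg c x -> exists2 h, mean_curvature (gt c) x h & 0 <= h).

(** [B] is [Phi ^+ 2] times the Schouten matrix in flat coordinates, so its eigenvalues are those of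
    the rescaled metric, and [be] is the gradient of the potential of [sig]. Unfolding turns the
    inequality on a cap into one on the half space. *)
Lemma touch_cell i X (tau sig: V) c: mdom i X -> 0 < c -> Q sig X = 0 ->
  c * cell_dens (mmap i X) ^+ 2 = Q tau X ^+ 2 ->
  (exists N, cap N X /\ forall Z, cap N Z -> c * cell_dens (mmap i Z) ^+ 2 <= Q tau Z ^+ 2 - Q sig Z ^+ 2) ->
  exists (B: 'M[R]_m.+1) (lam be: P), [/\ B^T = B, char_poly B = \prod_i ('X - (lam 0 i)%:P), Gamma k lam,
    dotp be be = Q sig sig &
    forall v, c * dotp (v *m B) v <= - (Q tau tau / 2) * dotp v v - dotp be v ^+ 2].
move=> dX c0 sX eX [N [NX HN]].
have [U [W [Phi [[oU oW] WX [[UO WO] [UW WU]] [P2 P0] [PE H]]]]]:= dens_gauge dX.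
case: i dX eX HN UO WO UW WU PE H=> j J dX eX HN /= UO WO UW WU PE H.
have [cX hX _]:= dX; have [E [lE E2 hE fE sE]]:= unfold_ex X; set y1:= fold (stereo X) in WX sE *.
have y10: 0 <= co y1 by exact: fold_ge0. set x1:= ch j y1; have Ux1: U x1 by exact: WU.
have x10: 0 <= co x1 by apply/(ch_half J)=>//; exact: WO. have fx1: cf j x1 = y1 by apply: (ca_fh J); exact: WO.
pose G:= gt (cch j).
have GE x: U x -> half_space x -> G x = (Phi (cf j x) ^- 2) *: (Dj (cf j) x *m (Dj (cf j) x)^T).
 move=> Ux x0; rewrite PE // (ca_conf J (UO _ Ux) x0) scalerA /G /gt /rescale; congr (_ *: _).
 have mp:= ca_mu J (UO _ Ux) x0; rewrite sqr_sqrtr; last by apply/ltW/divr_gt0.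
 by rewrite invf_div divfK // gt_eqF.
have sf: Cks U (cf j) by apply: Cks_sub (ca_f J). have sh: Cks W (ch j) by apply: Cks_sub (ca_h J).
have hf x: U x -> ch j (cf j x) = x by move=>/UO; exact: (ca_hf J). have ix1:= ca_img J (UO _ Ux1) x10.
have sch:= conf_sch m2 oU oW sf sh UW hf P2 P0 GE Ux1 x10. have P10: 0 < Phi y1 by exact: P0.
have uJ: Dj (cf j) x1 \in unitmx by have:= Dj_hf J (WO _ WX)=>/mulmx1_unit [].
have [lam /= el Gl]:= sig_pos ix1. have G1:= GE x1 Ux1 x10; rewrite fx1 in G1 sch.
have pn: Phi y1 ^- 2 != 0 by rewrite invr_eq0 expf_neq0 // gt_eqF.
rewrite -/(G) sch in el; have cp:= (eigenvalues_conj _ _ uJ pn G1).1 el; rewrite invrK in cp.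
pose tau1:= tau *m E; pose sig1:= sig *m E. have QE T Z: Q T (Z *m E) = Q (T *m E) Z by apply: lor_capE.
have XE: X = hgt X *: (lcone y1 *m E).
 have cXE: cone (X *m E) by exact: lE.2.
 have:= lconeK cXE; rewrite hE sE=>/(_ hX) e; rewrite scalemxAl -e -mulmxA E2 mulmx1 //.
have sig0: pot sig1 y1 = 0.
 move: sX; rewrite XE QZr QE=>/eqP; rewrite mulf_eq0 gt_eqF //= =>/eqP //.
have tau0: c * Phi y1 ^+ 2 = pot tau1 y1 ^+ 2.
 move: eX; rewrite (H X cX hX WX).2 {3}XE QZr QE !exprMn mulrCA=>/mulfI; apply. by rewrite expf_neq0 // gt_eqF.
have near E1: lor E1 -> (forall Z, hgt (Z *m E1) = hgt Z) -> (forall Z, fold (stereo (Z *m E1)) = fold (stereo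
Z)) -> cap N (lcone y1 *m E1) -> exists U1, [/\ open U1, U1 y1 & forall y, U1 y -> W y -> 0 <= co y -> c * Phi
y ^+ 2 <= Q tau (lcone y *m E1) ^+ 2 - Q sig (lcone y *m E1) ^+ 2].
 move=> lE1 hE1 fE1 N1; have [L' [lL' LL' _]]:= lor_inv lE1.
 have: nbhs y1 [set z | cap (N *m L') (lcone z)] by apply: cap_lcone; split; [exact: lconeC|rewrite -(lor_capE
 _ _ lE1 LL' lL'); case: N1]. rewrite nbhsE=>-[U1 [oU1 U1y] HU1]; exists U1; split=>// y /HU1 [_ Ny] Wy y0.
 have cZ: cone (lcone y *m E1) by apply: lE1.2; exact: lconeC.
 have fz: fold (stereo (lcone y *m E1)) = y by rewrite fE1 stereoK fold_id.
 have hZ: 0 < hgt (lcone y *m E1) by rewrite hE1 hgt_lcone.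
 have WZ: W (fold (stereo (lcone y *m E1))) by rewrite fz.
 have NZ: cap N (lcone y *m E1) by split=>//; rewrite (lor_capE _ _ lE1 LL' lL').
 by have:= HN _ NZ; rewrite (H _ cZ hZ WZ).2 hE1 hgt_lcone fz mul1r.
have NX1: cap N (lcone y1 *m E).
 apply: (cap_par (X:= X))=>//; apply: par_sym; exists (hgt X)=>//.
have [U1 [oU1 U1y H1]]:= near E lE hE fE NX1.
(* Around a boundary ray the cap also contains mirror images, which yields the inequality for the
   reflected pair required by [touch]. *)
have [U2 [oU2 U2y H2]]: exists U2, [/\ open U2, U2 y1 & co y1 = 0 -> forall y, U2 y -> W y -> 0 <= co y -> c *
Phi y ^+ 2 <= Q tau (lcone y *m (refl mv *m E)) ^+ 2 - Q sig (lcone y *m (refl mv *m E)) ^+ 2].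
 have [yb|yb]:= eqVneq (co y1) 0; last by exists setT; split=>//; [exact: openT|move/eqP; rewrite (negPf yb)].
 have lr: lor (refl (mv: V)) by apply: lor_refl; exact: Q_mvv.
 have my: mrefl y1 = y1 by rewrite -fold_neg ?fold_id ?yb.
 have [||||U2 [oU2 U2y H2]]:= near (refl mv *m E); last by exists U2; split.
 - exact: lorM.
 - by move=> Z; rewrite mulmxA hE hgt_refl.
 - by move=> Z; rewrite mulmxA fE stereoR fold_refl.
 - by rewrite mulmxA -lcone_mrefl my.
have dPhi: co y1 = 0 -> 0 <= 'D_(e_ 0) Phi y1.
 move=> yb; have x1b: co x1 = 0 by exact: (ch_zero J (WO _ WX)). have [s hs s0]:= bd_pos (conj ix1 x1b).
 have uT: tangential (G x1) \in unitmx.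
  rewrite /G /gt /rescale (_: tangential _ = u (psi (cch j) x1) *: tangential (g (cch j) x1)).
   by rewrite unitmxZ ?(tangential_unit Hg) // unitfE gt_eqF.
  by apply/matrixP=> a b; rewrite !mxE.
 have ff:= conf_sff oU oW sf sh UW hf P2 P0 GE (fun x Ux=> cf_zero J (UO _ Ux)) (fun x Ux x0=> (ca_side J (UO _
 Ux)).1 x0) Ux1 x1b. have:= (mean_curvatureP (ltnW m2) uT ff s).1 hs; rewrite fx1=> <- //.
pose Ut:= W `&` (U1 `&` U2). have oUt: open Ut by apply: openI=>//; exact: openI.
have tc:= touch oUt (Ck_sub (fun y (h: Ut y)=> h.1) P2) (conj WX (conj U1y U2y)) P10 c0 y10 dPhi (tau:= tau1)
(sig:= sig1) sig0 tau0 (pot_refl tau1) (pot_refl sig1).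
exists (Phi y1 ^+ 2 *: schS Phi y1), lam, (gradS (pot sig1) y1); split=>//.
- by rewrite linearZ /= (schS_sym oW P2 WX).
- by rewrite grad_pot sig0 mulr0 addr0 /sig1 lE.1.
- move=> v; rewrite -scalemxAr dotpZl mulrA -[Q tau tau](lE.1 tau tau); apply: tc.
 by move=> y [Wy [U1y' _]] y0; rewrite /pot -!QE; exact: H1.
 move=> yb y [Wy [_ U2y']] y0; have:= H2 yb y U2y' Wy y0.
 by rewrite /pot !mulmxA !QE -!/(pot _ _) !pot_refl /pot !lcone_mrefl.
Qed.

Theorem cell_density: density_axioms S cell_dens.
split; first exact: cell_weight.
- move=> i X tau sig c dX tt ss ts sX c0 eX HN.
 have [B [lam [be [Bs cB Gl bb HB]]]]:= touch_cell dX c0 sX eX HN.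
 have be0: be != 0 by apply: contra_eq_neq bb=>->; rewrite dotp0l ss eq_sym oner_eq0.
 (* The eigenvalues of the cylinder: every direction is bounded by [1 / (2 c)], and the unit
    direction [be] by [1 / (2 c) - 1 / c], which is the opposite number. *)
 have a0: 0 < (2 * c)^-1 by rewrite invr_gt0 mulr_gt0.
 have HB2 v: dotp (v *m B) v <= (2 * c)^-1 * dotp v v - dotp be v ^+ 2 / c.
  rewrite -(ler_pM2l c0); apply: le_trans (HB v) _; rewrite tt le_eqVlt; apply/orP; left; apply/eqP.
  by field; rewrite gt_eqF.
 apply: (Gamma_spread k1 k2 a0 _ _ Gl).
  apply: (eigenvalue_le cB)=> v; apply: le_trans (HB2 v) _. by rewrite gerBl divr_ge0 ?sqr_ge0 // ltW.
 apply: (exists_eigenvalue_le Bs cB be0); apply: le_trans (HB2 be) _.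
 rewrite bb ss le_eqVlt; apply/orP; left; apply/eqP; by field; rewrite gt_eqF.
- move=> i X Y c dX [YY Y0] c0 eX [N [NX HN]].
 have cd Z: cap N Z -> mdom i Z -> 0 < c * cell_dens (mmap i Z) by move=> _ dZ; rewrite mulr_gt0 // (wa_pos
 cell_weight). have c20: 0 < c ^+ 2 by exact: exprn_gt0.
 have [||B [lam [be [Bs cB Gl _ HB]]]]:= @touch_cell i X Y 0 (c ^+ 2) dX c20 (Q0l _).
 - by rewrite -exprMn eX sqrrN.
 - have [N2 [NX2 HN2]]: exists N2, cap N2 X /\ forall Z, cap N2 Z -> mdom i Z.
  case: i dX {cd eX HN} => j J [cX hX WX]. have [N2 [? HN2]]:= cap_stereo cX hX (fold_nbhs (ca_oW J) WX).
  by exists N2; split=>// Z NZ; have [? ?]:= HN2 Z NZ; split=>//; case: NZ.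
  have [N3 [NX3 HN3]]:= capI NX NX2; exists N3; split=>// Z /HN3 [N1Z /HN2 dZ].
  rewrite Q0l expr0n subr0 -exprMn -[Q Y Z ^+ 2]sqrrN ler_sqr ?nnegrE ?HN ?(ltW (cd Z N1Z dZ)) //.
  exact: le_trans (ltW (cd Z N1Z dZ)) (HN Z N1Z).
 (* With a null [tau] and [sig = 0] the Schouten form is nonpositive, which contradicts the positive
    trace. *)
 have k0: (0 < k)%N by case: (k) k1=>//; rewrite muln0.
 have:= Gamma_trace k0 Gl; apply/negP; rewrite -leNgt; apply: sumr_le0=> a _.
 apply: (eigenvalue_le cB)=> v; rewrite mul0r -(pmulr_rle0 _ c20); apply: le_trans (HB v) _.
 by rewrite YY mul0r oppr0 mul0r sub0r oppr_le0 sqr_ge0.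
Qed.

End Gauge.

(** * Umbilic hypersurfaces of Euclidean space lie in spheres or hyperplanes *)

Section UmbilicSphere.
Context (m2: (2 <= m)%N).
Local Notation lf a:= (lift ord0 a).
Context (B: set P) (oB: open B) (cB: convex_at B) (F: P -> P) (sF: Cks B F) (uF: forall x, B x -> Dj F x \in unitmx).

Let J x:= Dj F x.

Let Pm x:= invmx (Dj F x).

Let H2 x i j: P:= \row_a 'D_(e_ i) ('D_(e_ j) (fun y => F y 0 a)) x.
Context (umb: forall x, B x -> co x = 0 -> exists rho: R, forall a b: 'I_m,
  (H2 x (lf a) (lf b) *m Pm x) 0 0 = rho * dotp (row (lf a) (J x)) (row (lf b) (J x))).

Let sg:= [set x | B x /\ co x = 0].

Let D_const (f: P -> R) (k: R) x v: B x -> (forall y, B y -> f y = k) -> 'D_v f x = 0.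
move=> Bx H; have -> : 'D_v f x = 'D_v (cst k: P -> R^o) x.
 by apply: near_eq_derive; apply: (@filterS _ (nbhs x) _ B)=>//; exact: open_nbhs_nbhs.
exact: derive_cst.
Qed.

Let q x:= \sum_b Pm x b 0 * Pm x b 0.

(** Column 0 of the inverse [Pm] is orthogonal to the tangential rows of [J]; normalised, it is the
    unit normal of the image of the boundary. *)
Let nu x: P:= \row_b ((Num.sqrt (q x))^-1 * Pm x b 0).

Let JP x: B x -> J x *m Pm x = 1%:M. by move=> Bx; rewrite mulmxV // uF. Qed.

Let PJ x: B x -> Pm x *m J x = 1%:M. by move=> Bx; rewrite mulVmx // uF. Qed.

Let q_gt0 x: B x -> 0 < q x.
move=> Bx; have q0: 0 <= q x by apply: sumr_ge0=> b _; rewrite -expr2 sqr_ge0.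
rewrite lt_neqAle q0 andbT eq_sym psumr_eq0; last by move=> b _; rewrite -expr2 sqr_ge0.
apply/allP=> h; have:= congr1 (fun X: 'M[R]_m.+1=> X 0 0) (JP Bx); rewrite !mxE eqxx big1=>[/esym/eqP|b _].
 by rewrite oner_eq0.
by have:= h b (mem_index_enum b); rewrite /= mulf_eq0 orbb=>/eqP ->; rewrite mulr0.
Qed.

Let sPm b c k: Ck k B (fun x => Pm x b c).
by apply: Ck_invmx=>// i j; exact: Ck_Dj. Qed.

Let snu: Cks B nu.
move=> k b; apply: (@Ck_ext _ _ _ _ (fun x=> (Num.sqrt (q x))^-1 * Pm x b 0))=>//.
 by move=> x _; rewrite mxE.
apply: Ck_mul=>//; apply: Ck_inv=>//; first by move=> x Bx; rewrite sqrtr_gt0 q_gt0. apply: Ck_sqrt=>//.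
have h (c: 'I_m.+1): Ck k B (fun x=> Pm x c 0 * Pm x c 0) by exact: (Ck_mul oB (sPm c 0 k) (sPm c 0 k)).
exact: (Ck_sum (index_enum 'I_m.+1) xpredT oB h).
Qed.

Let nn x: B x -> dotp (nu x) (nu x) = 1.
move=> Bx; have q0:= q_gt0 Bx. rewrite /dotp (eq_bigr (fun b=> (q x)^-1 * (Pm x b 0 * Pm x b 0)))=>[|b _].
 by rewrite -mulr_sumr mulVf // gt_eqF.
by rewrite !mxE mulrACA -expr2 exprVn sqr_sqrtr // ltW.
Qed.

Let nuJ x i: B x -> dotp (nu x) (row i (J x)) = (Num.sqrt (q x))^-1 * (i == 0)%:R.
move=> Bx; have:= congr1 (fun X: 'M[R]_m.+1=> X i 0) (JP Bx); rewrite [RHS]mxE [LHS]mxE=> <-.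
by rewrite /dotp mulr_sumr; apply: eq_bigr=> b _; rewrite [nu x 0 b]mxE [row i _ 0 b]mxE -mulrA (mulrC (J x i b)).
Qed.

Let span0 x (w: P): B x -> dotp (nu x) w = 0 -> (forall a, dotp (row (lf a) (J x)) w = 0) -> w = 0.
move=> Bx wn wJ; apply: dotp_eq0; have wE: w = w *m Pm x *m J x by rewrite -mulmxA PJ // mulmx1.
rewrite {1}wE mulmx_sum_row /dotp.
have -> : \sum_i (\sum_i0 (w *m Pm x) 0 i0 *: row i0 (J x)) 0 i * w 0 i = \sum_j (w *m Pm x) 0 j * dotp (row j (J x)) w.
 rewrite (eq_bigr (fun i=> \sum_j (w *m Pm x) 0 j * (row j (J x) 0 i * w 0 i)))=>[|i _].
  by rewrite exchange_big; apply: eq_bigr=> j _; rewrite /dotp mulr_sumr.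
 by rewrite summxE mulr_suml; apply: eq_bigr=> j _; rewrite [X in X * _]mxE mulrA.
rewrite big_ord_recl big1 ?addr0=>[|a _]; last by rewrite wJ mulr0.
suff -> : (w *m Pm x) 0 ord0 = 0 by rewrite mul0r.
have s0: (Num.sqrt (q x))^-1 != 0 by rewrite invr_eq0 gt_eqF // sqrtr_gt0 q_gt0.
apply: (mulfI s0); rewrite mulr0 -wn mxE mulr_sumr; apply: eq_bigr=> b _.
by rewrite [nu x 0 b]mxE -mulrA; congr (_ * _); exact: mulrC.
Qed.

Let dR (G1 G2: P -> P) x i: Cks B G1 -> Cks B G2 -> B x ->
  is_derive x (e_ i) (fun y => dotp (G1 y) (G2 y)) (dotp (row i (Dj G1 x)) (G2 x) + dotp (G1 x) (row i (Dj G2 x))).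
move=> s1 s2 Bx; have d1 b: is_derive x (e_ i) (fun y=> G1 y 0 b) (Dj G1 x i b).
 by rewrite mxE; apply: derivableP; exact: Ck_der (s1 1%N b) Bx.
have d2 b: is_derive x (e_ i) (fun y=> G2 y 0 b) (Dj G2 x i b) by rewrite mxE; apply: derivableP; exact:
Ck_der (s2 1%N b) Bx. pose f b: P -> R^o:= (fun y=> G1 y 0 b: R^o) * (fun y=> G2 y 0 b: R^o).
have hs:= is_derive_sum (fun b: 'I_m.+1=> is_deriveM (d1 b) (d2 b)).
rewrite (_: (fun y=> dotp (G1 y) (G2 y)) = \sum_b f b); last by apply/funext=> y; rewrite fct_sumE.
apply: (is_derive_eq hs); rewrite /dotp -big_split; apply: eq_bigr=> b _.
by rewrite !mxE -[LHS]/(_ * _ + _ * _) addrC; congr (_ + _); exact: mulrC.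
Qed.

Let rowJ i: Cks B (fun x => row i (J x)).
by move=> k b; apply: (Ck_ext oB _ (@Ck_Dj R _ _ k B F i b oB sF)) => x _; rewrite [RHS]mxE. Qed.

Let Dj_rowJ x i j: B x -> row i (Dj (fun y => row j (J y)) x) = H2 x i j.
move=> Bx; apply/rowP=> b; rewrite !mxE; congr ('D_(e_ i) _ x). by apply/funext=> y; rewrite !mxE.
Qed.

Let a0: 'I_m:= Ordinal (ltn_trans (ltn0Sn 0) m2).

(** On the boundary this is the principal curvature; written out from one tangential direction it is
    a smooth function on all of [B]. *)
Let rho x:= - dotp (row (lf a0) (Dj nu x)) (row (lf a0) (J x)) / dotp (row (lf a0) (J x)) (row (lf a0) (J x)).

Let JJ x a: B x -> 0 < dotp (row (lf a) (J x)) (row (lf a) (J x)).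
move=> Bx; apply: dotp_gt0; apply/eqP=> h; have:= congr1 (fun X: 'M[R]_m.+1=> X (lf a) (lf a)) (JP Bx).
rewrite !mxE eqxx big1=>[/esym/eqP|b _]; first by rewrite oner_eq0.
by have:= congr1 (fun X: P=> X 0 b) h; rewrite !mxE=>->; rewrite mul0r.
Qed.

Let weingarten x a: sg x -> row (lf a) (Dj nu x) = - rho x *: row (lf a) (J x).
move=>[Bx x0]; have [r0 Hr]:= umb Bx x0.
have h1 b i: dotp (row (lf b) (Dj nu x)) (row (lf i) (J x)) = - ((Num.sqrt (q x))^-1 * r0) * dotp (row (lf b)
(J x)) (row (lf i) (J x)).
 have h:= dR (lf b) snu (rowJ (lf i)) Bx.
 have e: 'D_(e_ (lf b)) (fun y=> dotp (nu y) (row (lf i) (J y))) x = 0 by apply: (D_const _ Bx)=> y By; rewrite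
 nuJ // mulr0. have:= derive_val (is_derive:= h); rewrite e Dj_rowJ // =>/esym/eqP; rewrite addr_eq0=>/eqP ->.
 rewrite mulNr -mulrA -Hr mxE mulr_sumr; congr (- _); apply: eq_bigr=> c _.
 by rewrite [nu x 0 c]mxE -mulrA; congr (_ * _); exact: mulrC.
have rE: rho x = (Num.sqrt (q x))^-1 * r0 by rewrite /rho h1 -mulNr opprK mulfK // gt_eqF // JJ.
apply/eqP; rewrite -subr_eq0 scaleNr opprK; apply/eqP; apply: (span0 Bx)=>[|i].
 rewrite dotpDr dotpZr nuJ // mulr0 mulr0 addr0. have h:= dR (lf a) snu snu Bx.
 have e: 'D_(e_ (lf a)) (fun y=> dotp (nu y) (nu y)) x = 0.
  exact: (D_const _ Bx nn).
 have:= derive_val (is_derive:= h); rewrite e dotpC=> ee; lra.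
by rewrite dotpDr dotpZr dotpC h1 rE (dotpC (row (lf i) _)); ring.
Qed.

Let srho: forall k, Ck k B rho.
move=> k; have sd (G1 G2: P -> P): Cks B G1 -> Cks B G2 -> Ck k B (fun x=> dotp (G1 x) (G2 x)).
 by move=> s1 s2; apply: Ck_sum=>// b; exact: (Ck_mul oB (s1 k b) (s2 k b)).
have sn: Cks B (fun x=> row (lf a0) (Dj nu x)) by move=> l b; apply: (Ck_ext oB _ (@Ck_Dj R _ _ l B nu (lf a0)
b oB snu))=> x _; rewrite [RHS]mxE. apply: (Ck_mul oB (Ck_opp oB (sd _ _ sn (rowJ (lf a0))))).
by apply: Ck_inv=>//; [move=> x Bx; exact: JJ|apply: sd; exact: rowJ].
Qed.

(** The Codazzi equation: equality of the mixed derivatives of the normal in two tangential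
    directions gives a linear relation between two rows of [J] with the derivatives of [rho] as
    coefficients, and these rows are independent. *)
Let rho_const x a: sg x -> 'D_(e_ (lf a)) rho x = 0.
move=>[Bx x0]; have [b ba]: exists b: 'I_m, b != a.
 have [a1|]:= eqVneq (Ordinal m2) a; last by exists (Ordinal m2).
 by exists a0; rewrite -a1; apply/eqP=>/(congr1 val).
have dz i j c: 'D_(e_ (lf j)) (fun y=> Dj nu y (lf i) c + rho y * J y (lf i) c) x = 0.
 apply: (tan_derive oB j Bx x0)=> y By y0.
 have:= congr1 (fun X: P=> X 0 c) (weingarten i (conj By y0)); rewrite !mxE=>->. by rewrite mulNr addNr.
have dE i j c: 'D_(e_ (lf j)) (fun y=> Dj nu y (lf i) c) x + ('D_(e_ (lf j)) rho x * J x (lf i) c + rho x * H2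
x (lf j) (lf i) 0 c) = 0.
 have d1: is_derive x (e_ (lf j)) (fun y=> Dj nu y (lf i) c) ('D_(e_ (lf j)) (fun y=> Dj nu y (lf i) c) x) by
 apply: derivableP; apply: Ck_der (@Ck_Dj R _ _ 1%N B nu (lf i) c oB snu) Bx.
 have d2: is_derive x (e_ (lf j)) rho ('D_(e_ (lf j)) rho x) by apply: derivableP; exact: Ck_der (srho 1%N) Bx.
 have d3: is_derive x (e_ (lf j)) (fun y=> J y (lf i) c) (H2 x (lf j) (lf i) 0 c).
  rewrite mxE (_: (fun y=> J y (lf i) c) = 'D_(e_ (lf i)) (fun y=> F y 0 c)).
   by apply: derivableP; exact: Ck_der (Ck_D _ (sF 2%N c)) Bx.
  by apply/funext=> y; rewrite mxE.
 have h:= is_deriveD d1 (is_deriveM d2 d3); rewrite -[RHS](dz i j c).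
 have:= derive_val (is_derive:= h)=>->; congr (_ + _).
 by rewrite addrC -[RHS]/(_ * _ + _ * _); congr (_ + _); exact: mulrC.
have sym c: 'D_(e_ (lf a)) (fun y=> Dj nu y (lf b) c) x = 'D_(e_ (lf b)) (fun y=> Dj nu y (lf a) c) x.
 have e i: (fun y=> Dj nu y (lf i) c) = 'D_(e_ (lf i)) (fun y=> nu y 0 c) by apply/funext=> y; rewrite mxE.
 by rewrite !e; exact: schwarz oB (snu 2%N c) Bx.
have symH: H2 x (lf a) (lf b) = H2 x (lf b) (lf a) by apply/rowP=> c; rewrite [LHS]mxE [RHS]mxE; exact: schwarz
oB (sF 2%N c) Bx. have lin c: 'D_(e_ (lf a)) rho x * J x (lf b) c = 'D_(e_ (lf b)) rho x * J x (lf a) c.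
 have:= dE b a c; have:= dE a b c; rewrite sym symH.
 move: ('D_(e_ (lf a)) rho x) ('D_(e_ (lf b)) rho x) ('D_(e_ (lf b)) _ x)=> s t w; lra.
move: ('D_(e_ (lf a)) rho x) ('D_(e_ (lf b)) rho x) lin=> s t lin.
have: s * (J x *m Pm x) (lf b) (lf b) = t * (J x *m Pm x) (lf a) (lf b).
 rewrite [in LHS]mxE [in RHS]mxE !mulr_sumr; apply: eq_bigr=> c _; by rewrite !mulrA lin.
have dl c c': (J x *m Pm x) c c' = (c == c')%:R by rewrite (JP Bx) [LHS]mxE.
by rewrite !dl eqxx mulr1 (inj_eq lift_inj) eq_sym (negPf ba) mulr0.
Qed.

(** The unit spacelike vector of the sphere or hyperplane through [F x] with normal [nu x] and
    curvature [rho x]; by [weingarten] and [rho_const] it is constant along the boundary. *)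
Let Nf x: V:= vec (dotp (nu x) (F x) + rho x * ((1 + dotp (F x) (F x)) / 2))
  (- dotp (nu x) (F x) + rho x * ((1 - dotp (F x) (F x)) / 2)) (nu x + rho x *: F x).

Lemma umbilic_sphere x0: B x0 -> co x0 = 0 -> exists N: V, Q N N = 1 /\
  forall x, B x -> co x = 0 -> pot N (F x) = 0.
move=> Bx0 x00; exists (Nf x0). have QN x: B x -> Q (Nf x) (Nf x) = 1.
 move=> Bx; rewrite Q_vec !(dotpDl, dotpDr, dotpZl, dotpZr) nn // (dotpC (F x)).
 by move: (dotp (nu x) (F x)) (dotp (F x) (F x)) (rho x)=> s t r; field.
split=>[|x Bx xb]; first exact: QN.
(* Constancy along the boundary is reduced to an open convex set by composing with the projection
   [bproj] to the boundary hyperplane. *)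
have Nconst (f: P -> R): Ck 1 B f -> (forall z a, sg z -> 'D_(e_ (lf a)) f z = 0) -> f x = f x0.
 move=> sf Hf; pose D0: 'M[R]_m.+1:= bproj; have D0E:= @bprojE R m. pose B':= [set y: P | B (y *m D0)].
 have oB': open B'.
  apply: (@open_comp _ _ (fun y: P=> y *m D0) B)=>// y _.
  by apply: (@Cks_cont R _ _ setT)=>//; exact: Cks_mul openT.
 have cB': convex_at B'.
  move=> y z t By Bz t01; rewrite /B' /= mulmxDl -scalemxAl mulmxBl; exact: cB.
 have sg0 y: B' y -> sg (y *m D0) by move=> By; split=>//; rewrite D0E.
 have fix0 (y: P): co y = 0 -> y *m D0 = y by move=> y0; apply/rowP=> i; rewrite D0E; case: eqP=>// ->.
 have sf': Ck 1 B' (fun y=> f (y *m D0)) by apply: (Ck_comp oB' oB (F:= fun y=> y *m D0))=>// j; apply: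
 (Cks_mul D0 oB').
 rewrite -(fix0 x xb) -(fix0 x0 x00); apply: (const_convex oB' cB' sf'); rewrite /B' /= ?fix0 //. move=> z i Bz.
 have h:= @derive_chain R _ _ (fun y: P=> y *m D0) f z (e_ i) (fun j=> @Cks_diff R _ _ B' _ z j oB' (Cks_mul
 D0 oB') Bz) (Ck_diff oB sf Bz).
 rewrite derive_val big1 // => c _; have [->|[c' ->]]: c = ord0 \/ exists c', c = lf c'.
  by case: (unliftP ord0 c)=>[c' ->|->]; [right; exists c'|left].
  have -> : (fun y: P=> (y *m D0) 0 ord0) = cst 0 :> (P -> R^o) by apply/funext=> y; rewrite D0E.
  by rewrite derive_cst mul0r.
 by rewrite (Hf _ c' (sg0 z Bz)) mulr0.
have snF k: Ck k B (fun y=> dotp (nu y) (F y)) by apply: Ck_sum=>// b; exact: (Ck_mul oB (snu k b) (sF k b)).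
have sFF k: Ck k B (fun y=> dotp (F y) (F y)) by apply: Ck_sum=>// b; exact: (Ck_mul oB (sF k b) (sF k b)).
have d1 z a: sg z -> is_derive z (e_ (lf a)) (fun y=> dotp (nu y) (F y)) (- (rho z * dotp (row (lf a) (J z)) (F z))).
 move=>[Bz z0]; apply: (is_derive_eq (dR (lf a) snu sF Bz)).
 by rewrite weingarten // nuJ // mulr0 addr0 dotpZl mulNr.
have d2 z a: sg z -> is_derive z (e_ (lf a)) (fun y=> dotp (F y) (F y) / 2) (dotp (row (lf a) (J z)) (F z)).
 move=>[Bz z0]; have h:= is_deriveZ 2^-1 (dR (lf a) sF sF Bz).
 rewrite (_: (fun y=> dotp (F y) (F y) / 2) = 2^-1 \*: (fun y=> dotp (F y) (F y): R^o)).
  by apply: (is_derive_eq h); rewrite (dotpC (F z)) -[LHS]/(_ * _) /J; field.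
 by apply/funext=> y; rewrite /= mulrC.
have d3 z a: sg z -> is_derive z (e_ (lf a)) rho 0.
 move=> sz; rewrite -(rho_const a sz); apply: derivableP; exact: Ck_der (srho 1%N) sz.1.
have key (s1 s2: R) z a: sg z -> s2 = 1 \/ s2 = -1 -> s1 = s2 -> 'D_(e_ (lf a)) (fun y=> s1 * dotp (nu y) (F
y) + rho y * (2^-1 + s2 * (dotp (F y) (F y) / 2))) z = 0.
 move=> sz hs e; have h:= is_deriveD (is_deriveZ s1 (d1 z a sz)) (is_deriveM (d3 z a sz) (is_deriveD
 (is_derive_cst (2^-1: R^o) z (e_ (lf a))) (is_deriveZ s2 (d2 z a sz)))).
 have:= derive_val (is_derive:= h)=>->.
 rewrite -[LHS]/(s1 * _ + (rho z * (0 + s2 * _) + _ * 0)) mulr0 addr0 add0r e; ring.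
have sgen (s1 s2: R): Ck 1 B (fun y=> s1 * dotp (nu y) (F y) + rho y * (2^-1 + s2 * (dotp (F y) (F y) / 2))).
 have h2: Ck 1 B (fun y=> s2 * (dotp (F y) (F y) / 2)).
  apply: (Ck_ext oB _ (Ck_scal (s2 / 2) oB (sFF 1%N)))=> y _; by move: (dotp _ _)=> w; field.
 exact: (Ck_add oB (Ck_scal s1 oB (snF 1%N)) (Ck_mul oB (srho 1%N) (Ck_add oB (Ck_cst 1 2^-1 oB) h2))).
have -> : Nf x0 = Nf x.
 apply: vecP=>[||b].
 - have:= Nconst _ (sgen 1 1) (fun z a sz=> key 1 1 z a sz (or_introl erefl) erefl).
  rewrite !vec0 !mul1r=> e; rewrite !mulrDl !mul1r -e; congr (_ + _ * (_ + _)).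
 - have:= Nconst _ (sgen (-1) (-1)) (fun z a sz=> key (-1) (-1) z a sz (or_intror erefl) erefl).
  by rewrite !vecl !mulN1r=> e; rewrite !mulrBl !mul1r -e.
 - have sb: Ck 1 B (fun y=> nu y 0 b + rho y * F y 0 b).
  exact: (Ck_add oB (snu 1%N b) (Ck_mul oB (srho 1%N) (sF 1%N b))).
  have:= Nconst _ sb; rewrite !vecy !mxE=>-> // z a sz.
  have dn: is_derive z (e_ (lf a)) (fun y=> nu y 0 b) (Dj nu z (lf a) b) by rewrite mxE; apply: derivableP;
  exact: Ck_der (snu 1%N b) sz.1.
  have dF: is_derive z (e_ (lf a)) (fun y=> F y 0 b) (J z (lf a) b) by rewrite mxE; apply: derivableP; exact:
  Ck_der (sF 1%N b) sz.1. have h:= is_deriveD dn (is_deriveM (d3 z a sz) dF).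
  have:= derive_val (is_derive:= h)=>->.
  have:= congr1 (fun X: P=> X 0 b) (weingarten a sz); rewrite [LHS]mxE [RHS]mxE [X in _ * X]mxE=>->.
  by rewrite -[LHS]/(_ + (rho z * _ + _ * 0)) mulr0 addr0 mulNr addNr.
by rewrite /pot Q_vec !(dotpDl, dotpZl); field.
Qed.

End UmbilicSphere.

(** * Cells of a locally conformally flat manifold with umbilic boundary *)

Section FlatCells.
Context (HM: smooth_manifold A) (Hg: riemannian_metric g).

Lemma make_cell c (U: set P) (F: P -> P) x0: open U -> Cks U F -> U x0 -> img (A:= A) c x0 ->
  Dj F x0 \in unitmx -> (forall x, U x -> (0 <= co x <-> 0 <= F x 0 ord0)) ->
  (forall x, U x -> img c x -> exists2 mu, 0 < mu & Dj F x *m (Dj F x)^T = mu *: g c x) ->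
  exists k, [/\ cell_axioms g k, cO k x0 & cch k = c].
move=> oU sF Ux0 ix0 uJ side conf. have [U1 [oU1 U1x HU1]]:= img_near HM ix0.
have oU2: open (U `&` U1) by exact: openI.
have [D1 [W [h [[oO oW] [Ox0 OU] _ hf [fh sh]]]]]:= loc_inverse oU2 (Cks_sub (fun x (p: (U `&` U1) x)=> p.1)
sF) (conj Ux0 U1x) uJ.
have [mu Hmu]: exists mu: P -> R, forall x, U x -> img c x -> 0 < mu x /\ Dj F x *m (Dj F x)^T = mu x *: g c x.
 have h0 x: exists r: R, U x -> img c x -> 0 < r /\ Dj F x *m (Dj F x)^T = r *: g c x.
  have [[Ux ix]|n]:= pselect (U x /\ img c x); last by exists 0=> Ux ix; case: n.
  by have [r r0 e]:= conf x Ux ix; exists r.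
 have [mu Hmu]:= choice h0; by exists mu.
exists (Cell c D1 W F h mu); split=>//; split=>//=.
- by apply: Cks_sub sF=> x /OU[].
- by move=> x /hf[].
- by move=> y /fh[].
- by move=> x /hf[].
- by move=> y /fh[].
- by move=> x /OU[_ U1x'] x0'; exact: HU1.
- by move=> x /OU[Ux _]; exact: side.
- by move=> x /OU[Ux U1x'] x0'; have []:= Hmu x Ux (HU1 _ U1x' x0').
- by move=> x /OU[Ux U1x'] x0'; have []:= Hmu x Ux (HU1 _ U1x' x0').
Qed.

Context (LCF: locally_conformally_flat g) (UB: umbilic_boundary g) (m2: (2 <= m)%N).

Lemma flat_local p: exists (c: chart A) (U: set P) (F: P -> P),
  [/\ cdom c p, open U /\ convex_at U, U (phi c p), Cks U F &
    [/\ forall x, U x -> Dj F x \in unitmx, forall x, U x -> 0 <= co x -> img c x &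
        forall x, U x -> 0 <= co x -> exists2 mu, 0 < mu & Dj F x *m (Dj F x)^T = mu *: g c x]].
have [c [D1 [f [[dp oO Ox] [sf _ conf]]]]]:= LCF p. have ix: img c (phi c p) by exists p.
have [U1 [F [oU1 U1x sF FE]]]:= smooth_map_local sf (conj Ox ix). have [U2 [oU2 U2x HU2]]:= img_near HM ix.
pose U3:= U1 `&` (D1 `&` U2). have oU3: open U3 by apply: openI=>//; exact: openI.
have sF3: Cks U3 F by apply: Cks_sub sF=> ? [].
have conf3 x: U3 x -> 0 <= co x -> exists2 mu, 0 < mu & Dj F x *m (Dj F x)^T = mu *: g c x.
 move=> U3x x0; have [U1x' [Ox' U2x']]:= U3x; have ix':= HU2 _ U2x' x0.
 have [mu mu0 e]:= conf x (conj Ox' ix'); exists mu=>//; rewrite -e. have -> // : Dj F x = jac f x.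
 apply/matrixP=> a b; rewrite [LHS]mxE [RHS]mxE; apply/esym/(pd_half (U:= U3))=>//.
  by move=> y [U1y [Oy U2y]] y0; rewrite FE //; split=>//; exact: HU2.
 exact: Ck_der (sF3 1%N b) U3x.
have U3x: U3 (phi c p) by []. have x0:= img_half HM ix. have uF: Dj F (phi c p) \in unitmx.
 have [mu mu0 e]:= conf3 _ U3x x0.
 have: Dj F (phi c p) *m (Dj F (phi c p))^T \in unitmx by rewrite e unitmxZ ?(metric_unit Hg) // unitfE gt_eqF.
 by rewrite unitmx_mul=>/andP[].
have [U4 [oU4 U4x U43 uF4]]:= unit_near oU3 (fun i j=> @Ck_Dj R _ _ 0 U3 F i j oU3 sF3) U3x uF.
have [B [oB cB Bx BU]]:= convex_nbhs oU4 U4x.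
exists c, B, F; split=>//; first by apply: Cks_sub sF3=> y /BU/U43.
split=>[x /BU/uF4 //|x /BU/U43 [_ [_ U2y]]|x /BU/U43]; [exact: HU2|exact: conf3].
Qed.

Lemma flat_umbilic c (U: set P) (F: P -> P) x0: open U -> U x0 -> co x0 = 0 -> Cks U F ->
  (forall x, U x -> Dj F x \in unitmx) -> (forall x, U x -> 0 <= co x -> img (A:= A) c x) ->
  (forall x, U x -> 0 <= co x -> exists2 mu, 0 < mu & Dj F x *m (Dj F x)^T = mu *: g c x) ->
  exists (B: set P) (N: V), [/\ open B /\ convex_at B, B x0, B `<=` U, Q N N = 1 &
    forall x, B x -> co x = 0 -> pot N (F x) = 0].
move=> oU Ux0 x00 sF uF HU conf. have ix: img c x0 by apply: HU=>//; rewrite x00.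
have [U1 [ga [oU1 U1x sga gaE]]]:= rm_smooth Hg 0 0 ix. have gax: 0 < ga x0 by rewrite gaE // metric00_gt0.
have oV1:= pos_near oU1 (sga 0%N) U1x gax.
have [B [oB cB Bx0 BU]]:= convex_nbhs (openI oV1 oU) (conj (conj U1x gax) Ux0).
have BUU: B `<=` U by move=> x /BU[]. have BU1 x: B x -> U1 x /\ 0 < ga x by move=>/BU[[]].
have sFB: Cks B F by exact: Cks_sub sF. pose q z:= (Dj F z *m (Dj F z)^T) 0 0.
have qE z: q z = \sum_b Dj F z 0 b * Dj F z 0 b by rewrite /q mxE; apply: eq_bigr=> b _; rewrite [(_^T) b 0]mxE.
have q0 z: B z -> 0 < q z.
 move=>/BUU/uF uz; have -> : q z = dotp (row 0 (Dj F z)) (row 0 (Dj F z)).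
  by rewrite qE; apply: eq_bigr=> b _; rewrite !mxE.
 apply: dotp_gt0; apply: contraTneq uz=> r0; rewrite -row_free_unit; apply/negP=> rf.
 have: (e_ 0: P) *m Dj F z = 0 *m Dj F z by rewrite -rowE r0 mul0mx.
 move=>/(row_free_inj rf) /rowP /(_ 0); rewrite !mxE eqxx=>/eqP; by rewrite oner_eq0.
pose E z:= ga z * (q z)^-1.
have E0 z: B z -> 0 < E z by move=> Bz; have [_ ?]:= BU1 z Bz; apply: divr_gt0=>//; exact: q0.
have GE z: B z -> half_space z -> g c z = E z *: (Dj F z *m (Dj F z)^T).
 move=> Bz z0; have Uz:= BUU _ Bz; have iz:= HU z Uz z0; have [mu mu0 e]:= conf z Uz z0.
 have [U1z _]:= BU1 z Bz.
 have -> : E z = mu^-1 by rewrite /E gaE // /q e mxE invfM mulrCA divff ?mulr1 // gt_eqF // metric00_gt0.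
 by rewrite e scalerA mulVf ?scale1r // gt_eqF.
have sE: Ck 1 B E.
 apply: Ck_mul=>//; first by apply: Ck_sub (sga 1%N)=> z /BU1[].
 apply: Ck_inv=>//; apply: (Ck_ext oB (fun z _=> esym (qE z))).
 have h (b: 'I_m.+1): Ck 1 B (fun z=> Dj F z 0 b * Dj F z 0 b) by have h:= @Ck_Dj R _ _ 1 B F 0 b oB sFB;
 exact: (Ck_mul oB h h). exact: (Ck_sum (index_enum 'I_m.+1) xpredT oB h).
(* The solution of ['D_(e_ i) E = - 2 * E * dotp (row i J) v], the relation between factor and
   gradient on which the flat frame computation rests. *)
pose v x: P:= - (2 * E x)^-1 *: ((\row_j 'D_(e_ j) E x) *m (invmx (Dj F x))^T).
have dE x i: B x -> is_derive x (e_ i) E (- 2 * (E x * dotp (row i (Dj F x)) (v x))).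
 move=> Bx; have en: E x != 0 by rewrite gt_eqF // E0.
 have -> : - 2 * (E x * dotp (row i (Dj F x)) (v x)) = 'D_(e_ i) E x.
  rewrite /v dotpZr; have -> : dotp (row i (Dj F x)) ((\row_j 'D_(e_ j) E x) *m (invmx (Dj F x))^T) = 'D_(e_ i) E x.
   transitivity (((\row_j 'D_(e_ j) E x) *m (Dj F x *m invmx (Dj F x))^T) 0 i); last first.
    by rewrite mulmxV ?uF ?trmx1 ?mulmx1 ?mxE //; exact: BUU.
   rewrite trmx_mul mulmxA [RHS]mxE; apply: eq_bigr=> b _.
   by rewrite [row i _ 0 b]mxE [(Dj F x)^T b i]mxE mulrC.
  by move: ('D_(e_ i) E x)=> w; field.
 by apply: derivableP; exact: Ck_der sE Bx.
pose H2 x i j: P:= \row_a 'D_(e_ i) ('D_(e_ j) (fun y=> F y 0 a)) x.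
have dJ x i j a: B x -> is_derive x (e_ i) (fun y=> Dj F y j a) (H2 x i j 0 a).
 move=> Bx; rewrite mxE (_: (fun y=> Dj F y j a) = 'D_(e_ j) (fun y=> F y 0 a)).
  by apply: derivableP; exact: Ck_der (Ck_D j (sFB 2%N a)) Bx.
 by apply/funext=> y; rewrite mxE.
have FC x i j: B x -> H2 x i j = H2 x j i by move=> Bx; apply/rowP=> a; rewrite [LHS]mxE [RHS]mxE; exact:
(schwarz i j oB (sFB 2%N a) Bx).
have JP x: B x -> Dj F x *m invmx (Dj F x) = 1%:M by move=>/BUU/uF ux; rewrite mulmxV.
have [|N [NN HN]]:= @umbilic_sphere m2 B oB cB F sFB (fun x Bx=> uF x (BUU x Bx)) _ x0 Bx0 x00.
 move=> x Bx xb; have ibx: img c x by apply: HU; [exact: BUU|rewrite xb]. have [mu ff]:= UB (conj ibx xb).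
 exact: (@umbilic_gauge R m B oB (g c) (Dj F) (fun x=> invmx (Dj F x)) E v H2 E0 GE JP dJ FC dE x mu Bx xb ff).
by exists B, N; split.
Qed.

End FlatCells.

Section Straighten.
Definition ml: V:= vec 0 1 0.

Lemma Q_ml X: Q ml X = X 0 li.
by rewrite Q_ix vec0 vecl mul0r subr0 mul1r big1 ?add0r // => i _; rewrite vecy mxE mul0r. Qed.

Lemma hgt_refl_ml X: hgt (X *m refl ml) = X 0 0 - X 0 li.
rewrite reflE Q_ml /hgt; have e j: (X - (2 * X 0 li) *: ml) 0 j = X 0 j - 2 * X 0 li * ml 0 j by rewrite 3!mxE.
by rewrite !e vec0 vecl; ring.
Qed.

(** A Lorentz map carries the sphere of the boundary to the hyperplane [Q mv X = 0]. Two corrections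
    keep this: the reflection in [ml] moves the image of [x0] away from infinity, and the reflection
    in [mv] puts the interior on the positive side. *)
Lemma straighten (U: set P) (F: P -> P) x0 N: open U -> U x0 -> co x0 = 0 -> Cks U F ->
  (forall x, U x -> Dj F x \in unitmx) -> Q N N = 1 -> (forall x, U x -> co x = 0 -> pot N (F x) = 0) ->
  exists (L: 'M[R]_m.+3) (B: set P), [/\ lor L, open B /\ convex_at B, B x0 /\ B `<=` U,
    forall x, B x -> 0 < hgt (lcone (F x) *m L) &
    forall x, B x -> (co x = 0 -> Q mv (lcone (F x) *m L) = 0) /\
      0 < 'D_(e_ 0) (fun y => stereo (lcone (F y) *m L) 0 0) x].
move=> oU Ux0 x00 sF uF NN HN.
have [L0 lL0 [L0v L0h]]: exists2 L0: 'M[R]_m.+3, lor L0 & (forall x, U x -> co x = 0 -> Q mv (lcone (F x) *m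
L0) = 0) /\ 0 < hgt (lcone (F x0) *m L0).
 have [L1 lL1 L1v]: exists2 L1: 'M[R]_m.+3, lor L1 & forall x, U x -> co x = 0 -> Q mv (lcone (F x) *m L1) = 0.
  have [le|/ltW le]:= leP (Q N mv) 0.
   have [L lL NL]:= lor_to NN (Q_mvv: Q (mv: V) mv = 1) le.
   by exists L=>// x Ux xb; rewrite -NL lL.1; exact: HN.
  have NN': Q (- N) (- N) = 1 by rewrite QNl QNr opprK.
  have [|L lL NL]:= lor_to NN' (Q_mvv: Q (mv: V) mv = 1); first by rewrite QNl oppr_le0.
  by exists L=>// x Ux xb; rewrite -NL lL.1 QNl -/(pot _ _) HN // oppr0.
 have cX: cone (lcone (F x0) *m L1) by apply: lL1.2; exact: lconeC.
 have:= hgt_ge0 cX; rewrite le_eqVlt=>/orP[/eqP h0|h0]; last by exists L1.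
 have mm: Q (ml: V) ml = 1 by rewrite Q_ml vecl.
 exists (L1 *m refl ml); first by apply: lorM=>//; exact: lor_refl. split=>[x Ux xb|].
  by rewrite mulmxA reflE QDr QNr QZr L1v // Q_mv vecy mxE mulr0 subr0.
 by rewrite mulmxA hgt_refl_ml; have:= cX.2; move: h0; rewrite /hgt; lra.
have sLG (L: 'M[R]_m.+3): Cks U (fun x=> lcone (F x) *m L).
 apply: (@Cks_comp _ _ _ _ U setT (fun x=> lcone (F x)) (fun z=> z *m L))=>//.
 - exact: openT.
 - exact: Cks_lcone.
 - exact: Cks_mul openT.
have shg (L: 'M[R]_m.+3) k: Ck k U (fun x=> hgt (lcone (F x) *m L)) by exact: (Ck_add oU (sLG L k 0) (sLG L k li)).
have oV:= pos_near oU (shg L0 0%N) Ux0 L0h; set V1:= U `&` _ in oV. have V1x0: V1 x0 by split.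
have V1U: V1 `<=` U by move=> x []. pose F2 (L: 'M[R]_m.+3) x: P:= stereo (lcone (F x) *m L).
have sF2 L: (forall x, V1 x -> 0 < hgt (lcone (F x) *m L)) -> Cks V1 (F2 L).
 move=> hp k j; apply: (@Ck_ext _ _ _ _ (fun x=> (lcone (F x) *m L) 0 (yi j) * (hgt (lcone (F x) *m L))^-1))=>//.
  by move=> x _; rewrite [RHS]mxE.
 apply: Ck_mul=>//; first by apply: Ck_sub (sLG L k (yi j)). by apply: Ck_inv=>//; exact: Ck_sub (shg L k).
have fin L (lL: lor L) (Lv: forall x, U x -> co x = 0 -> Q mv (lcone (F x) *m L) = 0) (Lh: forall x, V1 x ->
0 < hgt (lcone (F x) *m L)): 0 < 'D_(e_ 0) (fun y=> F2 L y 0 0) x0 -> exists (L: 'M[R]_m.+3) (B: set P), [/\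
lor L, open B /\ convex_at B, B x0 /\ B `<=` U, forall x, B x -> 0 < hgt (lcone (F x) *m L) & forall x, B x ->
(co x = 0 -> Q mv (lcone (F x) *m L) = 0) /\ 0 < 'D_(e_ 0) (fun y=> stereo (lcone (F y) *m L) 0 0) x].
 move=> D0; have oV2:= pos_near oV (Ck_D 0 (sF2 L Lh 1%N 0)) V1x0 D0.
 have [B [oB cB Bx BV]]:= convex_nbhs oV2 (conj V1x0 D0).
 exists L, B; split=>//; first by split=>// x /BV[/V1U].
  by move=> x /BV[/Lh].
 by move=> x /BV[V1x Dx]; split=>//; apply: Lv; exact: V1U.
have h1 x: V1 x -> 0 < hgt (lcone (F x) *m L0) by move=>[].
have [D0|D0]:= ltP 0 ('D_(e_ 0) (fun y=> F2 L0 y 0 0) x0); first exact: (fin L0).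
have lr: lor (refl (mv: V)) by apply: lor_refl; exact: Q_mvv.
have h2 x: V1 x -> 0 < hgt (lcone (F x) *m (L0 *m refl mv)) by move=> V1x; rewrite mulmxA hgt_refl h1.
apply: (fin (L0 *m refl mv))=>//; first exact: lorM.
 by move=> x Ux xb; rewrite mulmxA reflE QDr QNr QZr L0v // mulr0 mul0r subr0.
have -> : (fun y=> F2 (L0 *m refl mv) y 0 0) = (- (fun y=> F2 L0 y 0 0: R^o)) by apply/funext=> y; rewrite /F2
mulmxA stereoR mxE eqxx.
have dF2: derivable (fun y=> F2 L0 y 0 0: R^o) x0 (e_ 0) by exact: Ck_der (sF2 L0 h1 1%N 0) V1x0.
(* The normal derivative cannot vanish, for then a whole column of an invertible Jacobian would be
   zero. *)
rewrite deriveN // oppr_gt0 lt_neqAle D0 andbT; apply/eqP=> D00.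
have lc x: V1 x -> lcone (F2 L0 x) = (hgt (lcone (F x) *m L0))^-1 *: (lcone (F x) *m L0).
 move=> V1x; have cx: cone (lcone (F x) *m L0) by apply: lL0.2; exact: lconeC.
 by rewrite [X in _ *: X](lconeK cx (h1 x V1x)) scalerA mulVf ?scale1r // gt_eqF // h1.
have sh1: Ck 1 V1 (fun x=> (hgt (lcone (F x) *m L0))^-1) by apply: Ck_inv=>//; exact: Ck_sub (shg L0 1%N).
have cf:= conf_lcone oV (Cks_sub V1U sF) (sF2 L0 h1) lL0 sh1 lc V1x0.
have: Dj (F2 L0) x0 *m (Dj (F2 L0) x0)^T \in unitmx.
 rewrite cf unitmxZ ?unitmx_mul ?unitmx_tr ?uF // unitfE expf_neq0 // invr_eq0 gt_eqF // h1 //.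
rewrite unitmx_mul=>/andP[uJ _]. have J0 i: Dj (F2 L0) x0 i 0 = 0.
 have [->|[a ->]]: i = ord0 \/ exists a, i = lift ord0 a.
  by case: (unliftP ord0 i)=>[a ->|->]; [right; exists a|left]. by rewrite mxE.
 rewrite mxE; apply: (tan_derive oV a V1x0 x00)=> y V1y yb.
 by have:= L0v y (V1U _ V1y) yb; rewrite Q_mv=> e; rewrite [LHS]mxE [X in X * _]e mul0r.
have: (invmx (Dj (F2 L0) x0) *m Dj (F2 L0) x0) 0 0 = 1 by rewrite mulVmx // mxE eqxx.
by rewrite mxE big1=>[/esym/eqP|a _]; [rewrite oner_eq0|rewrite J0 mulr0].
Qed.

End Straighten.

Section FlatCell.
Context (HM: smooth_manifold A) (Hg: riemannian_metric g)
  (LCF: locally_conformally_flat g) (UB: umbilic_boundary g) (m2: (2 <= m)%N).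

Theorem flat_cell p: exists k x, [/\ cell_axioms g k, cO k x, 0 <= co x & psi (cch k) x = p].
have [c [U [F [dp [oU cU] Ux sF [uF HU conf]]]]]:= flat_local HM Hg LCF p.
set x0:= phi c p in Ux; have ix: img c x0 by exists p. have xp: psi c x0 = p by exact: (sm_phiK HM).
have xg:= img_half HM ix.
suff [k [K Ok kc]]: exists k, [/\ cell_axioms g k, cO k x0 & cch k = c] by exists k, x0; rewrite kc.
have confi x: U x -> img c x -> exists2 mu, 0 < mu & Dj F x *m (Dj F x)^T = mu *: g c x by move=> Ux'
/(img_half HM); exact: conf. have [x00|x0n]:= eqVneq (co x0) 0; last first.
 have xp0: 0 < co x0 by rewrite lt_neqAle eq_sym x0n xg.
 have oU1:= pos_near oU (Ck_coord 0 ord0 oU) Ux xp0; set U1:= U `&` _ in oU1.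
 (* At an interior point any flat map serves: a translation puts the image at height 1, so that both
    sides of the side condition hold nearby. *)
 pose a:= 1 - F x0 0 ord0; pose F1 x: P:= F x + a *: (e_ ord0: P).
 have F1E: (fun j x=> F1 x 0 j) = (fun j x=> F x 0 j + a * (e_ ord0: P) 0 j) by apply/funext=> j;
 apply/funext=> x; rewrite mxE [X in _ + X]mxE.
 have F1j j x: F1 x 0 j = F x 0 j + a * (e_ ord0: P) 0 j by rewrite mxE [X in _ + X]mxE. have sF1: Cks U F1.
  move=> k j; apply: (Ck_ext oU _ (Ck_add oU (sF k j) (Ck_cst k (a * (e_ ord0: P) 0 j) oU)))=> x _.
  by rewrite F1j.
 have DF1 x: U x -> Dj F1 x = Dj F x.
  move=> Ux'; apply/matrixP=> i j; rewrite [LHS]mxE [RHS]mxE.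
  have h:= is_deriveD (derivableP (Ck_der (i:= i) (sF 1%N j) Ux')) (is_derive_cst (a * (e_ ord0: P) 0 j: R^o)
  x (e_ i)).
  have -> : (fun y=> F1 y 0 j) = (fun y=> F y 0 j: R^o) + cst (a * (e_ ord0: P) 0 j) by apply/funext=> y; rewrite F1j.
  by rewrite derive_val addr0.
 have sF11: Cks U1 F1 by apply: Cks_sub sF1=> x [].
 have F1p: 0 < F1 x0 0 ord0 by rewrite F1j mxE !eqxx mulr1 /a addrCA subrr addr0.
 have oU2:= pos_near oU1 (sF11 0%N ord0) (conj Ux xp0) F1p; set U2:= U1 `&` _ in oU2.
 have U2U: U2 `<=` U by move=> x [[]]. apply: (make_cell HM oU2 (Cks_sub U2U sF1) _ ix).
 - by split; [split|].
 - by rewrite DF1 // uF.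
 - by move=> x [[_ /= h1] /= h2]; rewrite !ltW.
 - by move=> x /U2U Ux' ix'; rewrite DF1 //; exact: confi.
have [B0 [N [[oB0 cB0] B0x B0U NN HN]]]:= flat_umbilic Hg UB m2 oU Ux x00 sF uF HU conf.
have sF0:= Cks_sub B0U sF.
have [L [B [lL [oB cB] [Bx BB0] hp HB]]]:= straighten oB0 B0x x00 sF0 (fun x Bx=> uF x (B0U x Bx)) NN HN.
have BU: B `<=` U by move=> x /BB0/B0U. pose F2 x:= stereo (lcone (F x) *m L).
have sLG: Cks B (fun x=> lcone (F x) *m L).
 apply: (@Cks_comp _ _ _ _ B setT (fun x=> lcone (F x)) (fun z=> z *m L))=>//.
 - exact: openT.
 - by apply: Cks_lcone=>//; exact: Cks_sub sF.
 - exact: Cks_mul openT.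
have sh k: Ck k B (fun x=> (hgt (lcone (F x) *m L))^-1).
 apply: Ck_inv=>//; exact: (Ck_add oB (sLG k 0) (sLG k li)).
have sF2: Cks B F2.
 move=> k j; apply: (Ck_ext oB _ (Ck_mul oB (sLG k (yi j)) (sh k)))=> x _; by rewrite [RHS]mxE.
have lc x: B x -> lcone (F2 x) = (hgt (lcone (F x) *m L))^-1 *: (lcone (F x) *m L).
 move=> Bx'; have cx: cone (lcone (F x) *m L) by apply: lL.2; exact: lconeC.
 by rewrite [X in _ *: X](lconeK cx (hp x Bx')) scalerA mulVf ?scale1r // gt_eqF // hp.
have cf x (Bx': B x):= conf_lcone oB (Cks_sub BU sF) sF2 lL (sh 1%N) lc Bx'.
have hn x: B x -> (hgt (lcone (F x) *m L))^-1 != 0 by move=> Bx'; rewrite invr_eq0 gt_eqF // hp.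
pose D0: 'M[R]_m.+1:= bproj; have D0E:= @bprojE R m. pose B4:= B `&` (fun y: P=> y *m D0) @^-1` B.
have sD0: Cks [set: P] (fun y: P=> y *m D0) by exact: Cks_mul openT.
have oB4: open B4 by apply: (open_pre oB _ oB)=> y _; exact: (Cks_cont sD0 I).
(* Along the segment from the boundary projection of [x] to [x], the mean value theorem writes the
   first component as [co x] times a positive derivative, so the sides correspond. *)
have B4B: B4 `<=` B by move=> y []. have F20 x: B4 x -> exists2 d, 0 < d & F2 x 0 ord0 = co x * d.
 move=>[Bx' Bx0']; have [z Bz e]:= segment_mvt oB cB (sF2 1%N ord0) Bx0' Bx'.
 have [_ dz]:= HB z Bz; exists ('D_(e_ 0) (fun y=> F2 y 0 ord0) z)=>//.
 have b0: (x *m D0) 0 ord0 = 0 by rewrite D0E. have z0: F2 (x *m D0) 0 ord0 = 0.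
  have [/(_ b0) e1 _]:= HB _ Bx0'; move: e1; rewrite Q_mv=> e1. by rewrite [LHS]mxE [X in X * _]e1 mul0r.
 move: e; rewrite z0 subr0=>->; rewrite (bigD1 ord0) //= big1=>[|j j0]; last first.
  by rewrite mxE [X in _ + X]mxE D0E (negPf j0) subrr mul0r.
 by rewrite addr0 mxE [X in _ + X]mxE b0 subr0.
apply: (make_cell HM oB4 (Cks_sub B4B sF2) _ ix).
- split=>//=; rewrite (_: x0 *m D0 = x0) //; apply/rowP=> i; rewrite D0E; by case: eqP=>// ->.
- have: Dj F2 x0 *m (Dj F2 x0)^T \in unitmx by rewrite cf // unitmxZ ?unitmx_mul ?unitmx_tr ?uF // unitfE
expf_neq0 // hn.
 by rewrite unitmx_mul=>/andP[].
- by move=> x B4x; have [d d0 ->]:= F20 x B4x; rewrite pmulr_lge0.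
- move=> x /B4B Bx' ix'; have [mu mu0 e]:= confi x (BU _ Bx') ix'.
 exists ((hgt (lcone (F x) *m L))^-1 ^+ 2 * mu); first by rewrite mulr_gt0 // lt_neqAle eq_sym sqrf_eq0 hn // sqr_ge0.
 by rewrite cf // e scalerA.
Qed.

End FlatCell.

(** * The hemisphere as a slice of the cone *)

Section SphereModel.
Implicit Types (x: SS) (y: P) (X Y: V) (B: 'M[R]_m.+3).
(** Identifies the sphere with the slice of height 1 of the cone; [sph] is the way back from
    rays. *)
Definition up x: V:= \row_i (if unlift ord0 i is Some j then x 0 j else 1).
Definition sph X: SS:= \row_j (X 0 (lift ord0 j) / X 0 0).

Lemma up0 x: up x 0 0 = 1. by rewrite mxE unlift_none. Qed.

Lemma upS x j: up x 0 (lift ord0 j) = x 0 j. by rewrite mxE liftK. Qed.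

Lemma Q_sum X Y: Q X Y = \sum_j X 0 (lift ord0 j) * Y 0 (lift ord0 j) - X 0 0 * Y 0 0.
by rewrite /Q /dotp big_ord_recl /=; ring. Qed.

Lemma Q_up x z: Q (up x) (up z) = dotp x z - 1.
by rewrite Q_sum !up0 mulr1; congr (_ - _); apply: eq_bigr => j _; rewrite !upS. Qed.

Lemma cone_up x: dotp x x = 1 -> cone (up x).
by move=> xx; split; rewrite ?Q_up ?xx ?subrr // up0. Qed.

Lemma sph_up x: sph (up x) = x.
by apply/rowP => j; rewrite mxE upS up0 divr1. Qed.

Lemma sphZ (t: R) X: t != 0 -> sph (t *: X) = sph X.
move=> t0; apply/rowP=> j; rewrite [LHS]mxE [RHS]mxE 2!(mxE _ _ 0) invfM mulrACA divff // mul1r. by [].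
Qed.

Lemma up_sph X: cone X -> up (sph X) = (X 0 0)^-1 *: X.
move=>[_ X0]; apply/rowP=> i; rewrite [RHS]mxE; case: (unliftP ord0 i)=>[j ->|->].
 by rewrite upS mxE mulrC.
by rewrite up0 mulVf // gt_eqF.
Qed.

Lemma sph_dotp X: cone X -> dotp (sph X) (sph X) = 1.
by move=> cX; apply/eqP; rewrite -subr_eq0 -Q_up up_sph // QZl QZr cX.1 !mulr0.
Qed.

Lemma Q_mv_up x: Q mv (up x) = co x.
by rewrite Q_mv -(upS x); congr (up x 0 _); apply: val_inj. Qed.

Lemma sph_mv X: Q mv X = X 0 0 * sph X 0 ord0 \/ X 0 0 = 0.
have [->|n]:= eqVneq (X 0 0) 0; [by right|left].
rewrite Q_mv mxE mulrCA divff // mulr1; by congr (X 0 _); apply: val_inj.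
Qed.

Lemma half_sph X: cone X -> 0 <= Q mv X -> half_sphere (sph X).
move=> cX; have:= cX.2; case: (sph_mv X)=>[-> X0|->]; last by rewrite ltxx.
by rewrite pmulr_rge0 // => h; split=>//; exact: sph_dotp.
Qed.

(** Changes of stereographic projection that respect the mirror; a nontrivial one is needed at the
    boundary point of the hemisphere that projects to infinity. *)
Definition flip B:= [/\ lor B, B *m B = 1%:M & forall X, Q mv (X *m B) = Q mv X].

Lemma flip_ex X: cone X -> exists B, flip B /\ 0 < hgt (X *m B).
move=> cX; have:= hgt_ge0 cX; rewrite le_eqVlt=>/orP[/eqP h0|h0]; last first.
 by exists 1%:M; rewrite mulmx1; split=>//; split=>[||Y]; rewrite ?mulmx1 //; exact: lor1.
have mm: Q (ml: V) ml = 1 by rewrite Q_ml vecl.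
exists (refl ml); split; last by rewrite hgt_refl_ml; have:= cX.2; move: h0; rewrite /hgt; lra.
split=>[||Y]; first exact: lor_refl.
 exact: reflK.
by rewrite reflE QDr QNr QZr [Q mv ml]Q_mv vecy mxE mulr0 subr0.
Qed.

Lemma flip_lor B: flip B -> lor B. by case. Qed.

(** Inverse stereographic projection onto the sphere, with the pole selected by [B]; [mst] is the
    projection itself. *)
Definition msig B y: SS:= sph (lcone y *m B).
Definition mst B x: P:= stereo (up x *m B).

Lemma msig_half B y: flip B -> 0 <= co y -> half_sphere (msig B y).
move=>[lB _ Bm] y0; apply: half_sph; first by apply: lB.2; exact: lconeC. by rewrite Bm Q_mv vecy.
Qed.

Lemma mst_half B x: flip B -> half_sphere x -> 0 < hgt (up x *m B) -> 0 <= mst B x 0 ord0.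
move=>[lB _ Bm] [xx x0] h; rewrite mxE mulr_ge0 ?invr_ge0 ?(ltW h) //. by rewrite -Q_mv Bm Q_mv_up.
Qed.

Lemma msigK B x: flip B -> half_sphere x -> 0 < hgt (up x *m B) -> msig B (mst B x) = x.
move=>[lB BB Bm] [xx x0] h; have cx: cone (up x *m B) by apply: lB.2; exact: cone_up.
have hn: hgt (up x *m B) != 0 by rewrite gt_eqF.
rewrite /msig -(sphZ _ hn) scalemxAl -lconeK // -mulmxA BB mulmx1. exact: sph_up.
Qed.

Lemma up_continuous: continuous up.
move=> x; apply: cont_rV=> i. case: (unliftP ord0 i)=>[j ->|->].
 rewrite (_: (fun x=> _) = (fun x: SS=> x 0 j)); first exact: coord_continuous.
 by apply/funext=> z; rewrite upS.
rewrite (_: (fun x=> _) = (fun x: SS=> 1)); first exact: cst_continuous. by apply/funext=> z; rewrite up0.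
Qed.

Lemma up_mul_continuous B: continuous (fun x => up x *m B).
move=> x; have h: {for up x, continuous (fun z: V=> z *m B)} by exact: (Cks_cont (Cks_mul B openT) I).
exact: (@continuous_comp _ _ _ up _ x (@up_continuous x) h).
Qed.

Lemma mst_continuous B x: hgt (up x *m B) != 0 -> {for x, continuous (mst B)}.
by move=> h; exact: (@continuous_comp _ _ _ (fun z: SS=> up z *m B) _ x (@up_mul_continuous B x) (stereo_cont h)).
Qed.

Lemma hgt_up_cont B: continuous (fun x => hgt (up x *m B)).
by move=> x; exact: (@continuous_comp _ _ _ (fun z: SS=> up z *m B) _ x (@up_mul_continuous B x) (@hgt_cont _ _ _)).
Qed.

Section Sigma.
Context (B: 'M[R]_m.+3) (lB: lor B).
Local Notation tau y:= ((lcone y *m B) 0 0).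

Lemma tau_gt0 y: 0 < tau y.
by have []: cone (lcone y *m B) by apply: lB.2; exact: lconeC. Qed.

Lemma Cks_lB: Cks [set: P] (fun y => lcone y *m B).
apply: (@Cks_comp _ _ _ _ setT setT (@lcone R m.+1) (fun z=> z *m B))=>//.
- exact: openT.
- exact: openT.
- by apply: (@Cks_lcone R m.+1 m.+1 setT id); [exact: openT|exact: Cks_id openT].
- exact: Cks_mul openT.
Qed.

Lemma Ck_tauV k: Ck k [set: P] (fun y => (tau y)^-1).
have h (y: P): [set: P] y -> 0 < tau y by move=> _; exact: tau_gt0.
exact: (Ck_inv openT h (Cks_lB k 0)). Qed.

Lemma Cks_msig: Cks [set: P] (msig B).
move=> k j; apply: (Ck_ext openT _ (Ck_mul openT (Cks_lB k (lift ord0 j)) (Ck_tauV k)))=> y _.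
by rewrite [RHS]mxE.
Qed.

Lemma up_msig y: up (msig B y) = (tau y)^-1 *: (lcone y *m B).
by apply: up_sph; apply: lB.2; exact: lconeC. Qed.

Lemma Cks_up_msig: Cks [set: P] (fun y => up (msig B y)).
move=> k j; apply: (Ck_ext openT _ (Ck_mul openT (Ck_tauV k) (Cks_lB k j)))=> y _. by rewrite up_msig [RHS]mxE.
Qed.

Lemma Dr_up i y: (Dr i (fun z => up (msig B z)) y 0 0 = 0) *
  (forall j, Dr i (fun z => up (msig B z)) y 0 (lift ord0 j) = Dj (msig B) y i j).
split=>[|j]; rewrite DrE.
 rewrite (_: (fun z=> _) = cst 1) ?derive_cst //. by apply/funext=> z; rewrite up0.
by rewrite mxE; congr ('D_ _ _ _); apply/funext=> z; rewrite upS.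
Qed.

Lemma conformal_msig y: Dj (msig B) y *m (Dj (msig B) y)^T = ((tau y)^-1 ^+ 2)%:M.
apply/matrixP=> i j.
have -> : (Dj (msig B) y *m (Dj (msig B) y)^T) i j = Q (Dr i (fun z=> up (msig B z)) y) (Dr j (fun z=> up (msig
B z)) y).
 rewrite Q_sum !Dr_up mul0r subr0 mxE; apply: eq_bigr=> b _. by rewrite !Dr_up [(_^T) b j]mxE.
have ext k: Dr k (fun z=> up (msig B z)) y = Dr k (fun z=> (tau z)^-1 *: (lcone z *m B)) y by apply: (Dr_ext k
(openT: open [set: P]) I)=> z _; exact: up_msig.
rewrite !ext (Q_Dr_scal i j openT (Ck_tauV 1%N) Cks_lB _ (I: [set: P] y)); last first.
 by move=> z _; rewrite lB.1 (lconeC z).1.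
have sl: Cks [set: P] (fun z=> lcone (id z)) by apply: Cks_lcone; [exact: openT|exact: Cks_id openT].
rewrite !(Dr_mulmx B _ openT sl I) lB.1 (Q_Dr_lcone i j openT (Cks_id openT) (I: [set: P] y)).
by rewrite Dj_id mul1mx trmx1 !mxE mulr_natr.
Qed.

Lemma msig_tangent i y: dotp (row i (Dj (msig B) y)) (msig B y) = 0.
have h0 z: [set: P] z -> Q (up (msig B z)) (up (msig B z)) = 0 by move=> _; rewrite Q_up sph_dotp ?subrr //;
apply: lB.2; exact: lconeC. have:= Q_const i openT Cks_up_msig Cks_up_msig (I: [set: P] y) h0.
rewrite [X in _ + X]QC=> h1; have: Q (Dr i (fun z=> up (msig B z)) y) (up (msig B y)) = 0 by move: (Q _ _) h1=> q; lra.
rewrite Q_sum Dr_up mul0r subr0=> <-; apply: eq_bigr=> j _. by rewrite Dr_up upS mxE.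
Qed.

End Sigma.
End SphereModel.

(** * Cells and a global model from a conformal covering *)

Section CoverCells.
Context (HM: smooth_manifold A) (Hg: riemannian_metric g) {F: SS -> M} (HF: conformal_covering g F).

Lemma derive_row (U: set SS) (G: SS -> P) x v: open U -> Cks U G -> U x -> 'D_v G x = v *m Dj G x.
move=> oU sG Ux; have dG j: differentiable (fun y=> G y 0 j: R^o) x by exact: Cks_diff oU sG Ux.
rewrite derive_mx; last by apply/derivable_mxP=> i j; rewrite (ord1 i); exact: diff_derivable (dG j).
by apply/rowP=> j; rewrite mxE; exact: derive_Dj (dG j).
Qed.

Lemma Dj_half (U: set P) (G H: P -> P) y: open U -> Cks U G -> Cks U H -> U y -> 0 <= co y ->
  (forall z, U z -> 0 <= co z -> G z = H z) -> Dj G y = Dj H y.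
move=> oU sG sH Uy y0 e; apply/matrixP=> i j; rewrite [LHS]mxE [RHS]mxE.
have dG: derivable (fun z=> G z 0 j: R^o) y (e_ i) by exact: Ck_der (sG 1%N j) Uy.
have dH: derivable (fun z=> H z 0 j: R^o) y (e_ i) by exact: Ck_der (sH 1%N j) Uy.
rewrite -(@pd_half R m U (fun z=> H z 0 j) _ y i oU Uy y0 _ dG)=>[|z Uz z0]; last by rewrite e.
exact: (@pd_half R m U (fun z=> H z 0 j) _ y i oU Uy y0 (fun _ _ _=> erefl) dH).
Qed.

Lemma pull_local (B: 'M[R]_m.+3) c (U: set SS) (G: SS -> P) y: flip B ->
  open U -> Cks U G -> (forall z, U z -> half_sphere z -> cdom c (F z) /\ G z = phi c (F z)) ->
  U (msig B y) -> 0 <= co y ->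
  exists2 nu, 0 < nu & Dj (fun z => G (msig B z)) y *m g c (G (msig B y)) *m (Dj (fun z => G (msig B z)) y)^T = nu%:M.
move=> fB oU sG HG Uy y0; have hs:= msig_half fB y0; have [dc ec]:= HG _ Uy hs.
have [U' [G' [mu [[oU' U'x sG' HG'] [mu0 conf]]]]]:= HF.2 c (msig B y) hs dc. have sG1: Cks U' G' by [].
have oUU: open (U `&` U') by exact: openI. have sB:= Cks_msig (flip_lor fB).
have oW: open ([set: P] `&` (msig B) @^-1` (U `&` U')) by apply: (open_pre openT _ oUU)=> z _; exact: (Cks_cont sB I).
set W:= _ `&` _ in oW. have sW: Cks W (msig B) by apply: Cks_sub sB. have Wy: W y by split=>//; split.
have sGW: Cks W (fun z=> G (msig B z)) by apply: (@Cks_comp _ _ _ _ W U (msig B) G)=>// z [_ []].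
have sGW': Cks W (fun z=> G' (msig B z)) by apply: (@Cks_comp _ _ _ _ W U' (msig B) G')=>// z [_ []].
have e z: W z -> 0 <= co z -> G (msig B z) = G' (msig B z).
 move=>[_ [Uz U'z]] z0; have hz:= msig_half fB z0. by rewrite (HG _ Uz hz).2 (HG' _ U'z hz).2.
rewrite (Dj_half oW sGW sGW' Wy y0 e) (e y Wy y0).
have -> : Dj (fun z=> G' (msig B z)) y = Dj (msig B) y *m Dj G' (msig B y) by apply: Dj_comp=> j; [exact:
Cks_diff oW sW Wy|exact: Cks_diff oU' sG1 U'x]. exists (mu * ((lcone y *m B) 0 0)^-1 ^+ 2).
 by rewrite mulr_gt0 // exprn_gt0 // invr_gt0 (tau_gt0 (flip_lor fB)).
apply/matrixP=> i j. have:= conf _ _ (msig_tangent (flip_lor fB) i y) (msig_tangent (flip_lor fB) j y).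
rewrite !(derive_row _ oU' sG1 U'x).
have -> : dotp (row i (Dj (msig B) y)) (row j (Dj (msig B) y)) = (Dj (msig B) y *m (Dj (msig B) y)^T) i j by
rewrite [RHS]mxE; apply: eq_bigr=> b _; rewrite [(_^T) b j]mxE !(mxE _ _ 0).
rewrite (conformal_msig (flip_lor fB))=> h; rewrite [RHS]mxE -[RHS]mulrnAr.
rewrite [((_ ^+ 2)%:M) i j]mxE in h; rewrite -h /bil -!row_mul.
rewrite [RHS]mxE [LHS]mxE [RHS]mxE; apply: eq_bigr=> b _; congr (_ * _). by rewrite [LHS]mxE [RHS]mxE [RHS]mxE.
Qed.

(** The covering, read through [msig] and the chart [c], is a local diffeomorphism that is conformal
    on the half space, and the map of the cell is its local inverse. *)
Lemma cover_cell c x: half_sphere x -> cdom c (F x) -> exists k (B: 'M[R]_m.+3) y,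
  [/\ cell_axioms g k /\ cch k = c, flip B, cW k y,
  0 <= co y /\ msig B y = x &
  forall z, cW k z -> 0 <= co z -> psi (cch k) (ch k z) = F (msig B z)].
move=> hx dc; have [B [fB hB]]:= flip_ex (cone_up hx.1). have [U [G [mu0 [[oU Ux sG0 HG] _]]]]:= HF.2 c x hx dc.
have sG: Cks U G by []. pose y0:= mst B x; have y00: 0 <= co y0 by exact: mst_half.
have xE: msig B y0 = x by exact: msigK.
have oW: open ([set: P] `&` (msig B) @^-1` U) by apply: (open_pre openT _ oU)=> z _; exact: (Cks_cont (Cks_msig
(flip_lor fB)) I). set W:= _ `&` _ in oW; have Wy: W y0 by split; rewrite // /preimage /= xE.
pose h z:= G (msig B z).
have sh: Cks W h by apply: (@Cks_comp _ _ _ _ W U (msig B) G oW oU _ _ sG)=>[z []//|]; exact: Cks_sub (Cks_msig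
(flip_lor fB)).
have hE z: W z -> 0 <= co z -> cdom c (F (msig B z)) /\ h z = phi c (F (msig B z)) by move=>[_ Uz] z0; apply:
HG=>//; exact: msig_half. have conf z (Wz: W z) (z0: 0 <= co z):= pull_local fB oU sG HG Wz.2 z0.
have [nu nu0 cf0]:= conf _ Wy y00. have uh: Dj h y0 \in unitmx.
 have: nu%:M \in (unitmx: pred 'M[R]_m.+1) by rewrite -scalemx1 unitmxZ ?unitmx1 // unitfE gt_eqF.
 by rewrite -cf0 !unitmx_mul=>/andP[/andP[]].
have [D1 [W1 [f [[oD oW1] [Dy DW] uD hf [fh sf]]]]]:= loc_inverse oW sh Wy uh.
have [T [oT eT]]: exists T, open T /\ img c = T `&` half_space by have [T oT e]:= sm_img_open HM c; exists T.
(* A local section of the covering shows that chart points on the inner side come from hemisphere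
   points near [x]; this is the half of the side condition that the chart map alone does not
   give. *)
have [_ _ /(_ (F x)) [Vs [I [s [[oV Vp _] [sc sS _ sx]]]]]]:= HF.1. have [i0 six]:= sx x hx Vp.
have near3: nbhs x [set z: SS | 0 < hgt (up z *m B) /\ D1 (mst B z)].
 have n1: nbhs x [set z: SS | 0 < hgt (up z *m B)] by apply: (@hgt_up_cont B x [set r | 0 < r]); apply:
 open_nbhs_nbhs; split; [exact: open_gt|]. have n2: nbhs x (mst B @^-1` D1).
  have hn: hgt (up x *m B) != 0 by rewrite gt_eqF. by apply: (mst_continuous hn); apply: open_nbhs_nbhs.
 exact: (@filterI _ (nbhs x) _ _ _ n1 n2).
move: near3; rewrite nbhsE=>-[N3 [oN3 N3x] HN3]. have N3s: N3 (s i0 (F x)) by rewrite six.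
have [VU [oVU VUx HVU]]:= within_open (sc i0) Vp oN3 N3s. have ix: img c (phi c (F x)) by exists (F x).
have pK: psi c (phi c (F x)) = F x by exact: (sm_phiK HM).
have VVx: (Vs `&` VU) (psi c (phi c (F x))) by rewrite pK.
have [T2 [oT2 T2x HT2]]:= within_open (@sm_psi_cont _ _ _ _ HM c) ix (openI oV oVU) VVx.
have oT3: open (T `&` T2) by apply: openI=>//; exact: oT.
have hx1: h y0 = phi c (F x) by rewrite (hE _ Wy y00).2 xE.
have Tx: T (h y0) by rewrite hx1; move: ix; rewrite eT=>-[].
have oD2: open (D1 `&` h @^-1` (T `&` T2)) by apply: (open_pre oD _ oT3)=> z /DW Wz; exact: (Cks_cont sh Wz).
have hD z: D1 z -> 0 <= co z -> img c (h z) /\ psi c (h z) = F (msig B z).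
 move=>/DW Wz z0; have [dz ->]:= hE z Wz z0; split; first by exists (F (msig B z)). exact: (sm_phiK HM).
have side z: (W1 `&` (T `&` T2)) z -> 0 <= co z <-> 0 <= f z 0 ord0.
 move=>[W1z [Tz T2z]]; have [Dz hz]:= fh z W1z; split=> z0; last first.
  by rewrite -hz; apply: (img_half HM); exact: (hD _ Dz z0).1.
 have iz: img c z by rewrite eT. have [Vz VUz]:= HT2 z T2z iz; have [hs Fz]:= sS i0 _ Vz.
 have [hgz Dz']:= HN3 _ (HVU _ VUz Vz); have y'0:= mst_half fB hs hgz.
 have e:= msigK fB hs hgz; have:= (hE _ (DW _ Dz') y'0).2.
 by rewrite e Fz (img_psi HM iz).2=> <-; rewrite (hf _ Dz').2.
have sfO: Cks (W1 `&` (T `&` T2)) f by apply: Cks_sub sf=> z [].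
have cfz z: (W1 `&` (T `&` T2)) z -> 0 <= co z -> exists2 r, 0 < r & Dj f z *m (Dj f z)^T = r *: g c z.
 move=> Oz z0; have f0:= (side z Oz).1 z0; have [Dz hz]:= fh z Oz.1.
 have [r r0]:= conf _ (DW _ Dz) f0; rewrite -/(h (f z)) hz -/h=> e. have inv: Dj f z *m Dj h (f z) = 1%:M.
  rewrite -(@Dj_comp _ _ _ _ f h z)=>[|j|j].
  - rewrite -[RHS](Dj_id z); apply: (Dj_eq oW1 Oz.1)=> w W1w; exact: (fh w W1w).2.
  - exact: Cks_diff oW1 sf Oz.1.
  - exact: Cks_diff oW sh (DW _ Dz).
 exists r^-1; first by rewrite invr_gt0. have:= congr1 (fun X: 'M[R]_m.+1=> Dj f z *m X *m (Dj f z)^T) e.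
 rewrite !mulmxA inv mul1mx -mulmxA -trmx_mul inv trmx1 mulmx1=>->.
 by rewrite mul_mx_scalar -scalemxAl scalerA mulVf ?scale1r // gt_eqF.
have [mu Hmu]: exists mu: P -> R, forall z, (W1 `&` (T `&` T2)) z -> 0 <= co z -> 0 < mu z /\ Dj f z *m (Dj f
z)^T = mu z *: g c z.
 have h0 z: exists r: R, (W1 `&` (T `&` T2)) z -> 0 <= co z -> 0 < r /\ Dj f z *m (Dj f z)^T = r *: g c z.
  have [[Oz z0]|n]:= pselect ((W1 `&` (T `&` T2)) z /\ 0 <= co z); last by exists 0=> Oz z0; case: n.
  by have [r r0 e]:= cfz z Oz z0; exists r.
 have [mu Hmu]:= choice h0; by exists mu.
exists (Cell c (W1 `&` (T `&` T2)) (D1 `&` h @^-1` (T `&` T2)) f h mu), B, y0; split=>//=.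
- split=>//; split=>//=.
 + exact: openI.
 + by apply: Cks_sub sh=> z [/DW].
 + by move=> z [W1z Tz]; have [Dz hz]:= fh z W1z; split; rewrite // /preimage /= hz.
 + by move=> z [Dz Tz]; have []:= hf z Dz.
 + by move=> z [/fh[]].
 + by move=> z [/hf[]].
 + by move=> z [_ [Tz _]] z0; rewrite eT.
 + by move=> z Oz z0; have []:= Hmu z Oz z0.
 + by move=> z Oz z0; have []:= Hmu z Oz z0.
- by split=>//; rewrite /preimage /= hx1; split=>//; rewrite -hx1.
- by move=> z [Dz _] z0; exact: (hD z Dz z0).2.
Qed.

End CoverCells.

Section CoverModel.
Context (HM: smooth_manifold A) (Hg: riemannian_metric g) (m2: (2 <= m)%N) {F: 'rV[R]_m.+2 -> M} (HF: conformal_covering g F).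

Lemma cover_cov c x: img c x -> exists k y,
  [/\ cell_axioms g k, cch k = c, cW k y, 0 <= co y & ch k y = x].
move=> ix; have [dc px]:= img_psi HM ix; have [_ Fs _]:= HF.1.
have [z hz Fz]: (F @` half_sphere) (psi c x) by rewrite Fs.
have [|k [B [y [[K kc] fB Wy [y0 e] He]]]]:= @cover_cell HM _ HF c z hz; first by rewrite Fz.
exists k, y; split=>//; have:= He y Wy y0; rewrite e Fz kc.
have ik: img c (ch k y) by rewrite -kc; exact: (ch_img K).
by move=>/(congr1 (phi c)); rewrite (img_psi HM ik).2 px.
Qed.

Lemma cover_points p: exists k x, [/\ cell_axioms g k, cO k x, 0 <= co x & psi (cch k) x = p].
have [c dc]:= sm_cover HM p; have ix: img c (phi c p) by exists p.
have [k [y [K kc Wy y0 e]]]:= cover_cov ix; exists k, (ch k y); split=>//.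
- exact: (ca_hO K Wy).
- exact: (ch_half K Wy).2.
- by rewrite e kc; exact: (sm_phiK HM).
Qed.

Lemma flip_mv (B: 'M[R]_m.+3): flip B -> mv *m B = mv.
move=>[lB BB Bm]; have h X: Q (mv *m B - mv) X = 0.
 by rewrite QDl QNl -[X in Q (_ *m _) X]mulmx1 -BB mulmxA lB.1 Bm subrr.
have TT: Q (e_ 0: V) (e_ 0) < 0 by rewrite Qe0 mxE !eqxx /=; lra.
by have /eqP:= sp_orth0 TT (h _) (h _); rewrite subr_eq0=>/eqP.
Qed.

Lemma flip_refl (B: 'M[R]_m.+3): flip B -> refl mv *m B = B *m refl mv.
move=> fB; have [lB BB Bm]:= fB.
by have:= refl_conj mv lB lB BB; rewrite (flip_mv fB)=> e; rewrite {1}e -mulmxA BB mulmx1.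
Qed.

(** The fold of the flat coordinates, carried out on the cone, where no ray is at infinity. *)
Definition vfold (X: V): V:= if 0 <= Q mv X then X else X *m refl mv.

Lemma fold_stereo X: cone X -> 0 < hgt X -> fold (stereo X) = stereo (vfold X).
move=> cX hX; have e: Q mv X = hgt X * stereo X 0 ord0.
 by rewrite Q_mv mxE mulrCA divff ?mulr1 // gt_eqF.
rewrite /vfold e pmulr_rge0 //; case: ifPn=>[s0|]; first by rewrite fold_id.
by rewrite -ltNge=>/ltW s0; rewrite fold_neg // stereoR.
Qed.

(** Doubling the covering by the mirror gives a map [p] from the whole cone to M. It is locally the
    point part of a cell model, and [glue_models] supplies the scales. *)
Lemma cover_model: exists E, forall X, cone X -> adm E X.
have H:= cell_axiomsM HM Hg m2 cover_points. have d3: (3 <= m.+2)%N by exact: ltnW. have t0: M * R:= (F 0, 0).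
have rm: lor (refl (mv: V)) by apply: lor_refl; exact: Q_mvv.
have vc X: cone X -> cone (vfold X) by rewrite /vfold; case: ifP=>// _; exact: rm.2.
have vQ X: 0 <= Q mv (vfold X).
 rewrite /vfold; case: ifPn=>//; rewrite -ltNge=>/ltW h. by rewrite reflE QDr QNr QZr Q_mvv; lra.
pose p (X: V):= F (sph (vfold X)).
suff loc: forall X, cone X -> exists E N, [/\ adm E X, cap N X & forall Z, cap N Z -> mpt S (E Z) = p Z].
 exact: (glue_models H d3 t0 loc).
move=> X cX; rewrite {}/p. have hs:= half_sph (vc _ cX) (vQ X). have [c dc]:= sm_cover HM (F (sph (vfold X))).
have [k [B [y [[K _] fB Wy [y0 ye] He]]]]:= @cover_cell HM _ HF c _ hs dc. have [lB BB Bm]:= fB.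
have vB Z: vfold (Z *m B) = vfold Z *m B by rewrite /vfold Bm; case: ifP=>// _; rewrite -!mulmxA (flip_refl fB).
have hB Z: hgt (vfold Z) = hgt Z by rewrite /vfold; case: ifP=>// _; rewrite hgt_refl.
have pXy: par (lcone y) (vfold X *m B).
 have cy: cone (lcone y *m B) by apply: lB.2; exact: lconeC. have: par (lcone y *m B) (vfold X).
  apply: (@par_trans _ _ _ (up (sph (vfold X)))).
   rewrite -ye /msig up_sph //; exists ((lcone y *m B) 0 0)^-1=>//. by rewrite invr_gt0; exact: cy.2.
  rewrite up_sph; last exact: vc. exists (vfold X 0 0); first exact: (vc _ cX).2.
  by rewrite scalerA divff ?scale1r // gt_eqF //; exact: (vc _ cX).2.
 by move=>/(lor_par B); rewrite -mulmxA BB mulmx1.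
pose i: midx S:= exist _ k K. have dX: mdom i (X *m B).
 have h0: 0 < hgt (X *m B).
  rewrite -hB vB; have [t tp ->]:= pXy; by rewrite hgtZ hgt_lcone mulr1.
 have cXB: cone (X *m B) by exact: lB.2. split=>//=; rewrite fold_stereo // vB -(stereo_par pXy) stereoK //.
have [N [NX HN]]:= ma_dom_open H dX. have [N' [N'X HN']]:= cap_lor lB NX cX.
exists (fun Z=> mmap i (Z *m B)), N'; split=>//.
 by exists i, B, N'; split=>// Z /HN' /HN.
move=> Z N'Z; have [cZ hZ Wz]:= HN _ (HN' _ N'Z). rewrite /= in cZ hZ Wz *; rewrite He //; last exact: fold_ge0.
congr F; rewrite fold_stereo // vB /msig. have cv: cone (vfold Z *m B) by apply: lB.2; apply: vc; exact: N'Z.1.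
have hv: 0 < hgt (vfold Z *m B) by rewrite -vB hB.
rewrite -(@sphZ (hgt (vfold Z *m B))); last by rewrite gt_eqF.
by rewrite scalemxAl -lconeK // -mulmxA BB mulmx1.
Qed.

End CoverModel.

Section Charts.
Context (HM: smooth_manifold A) (Hg: riemannian_metric g).

(** A change of charts taking an interior point to the boundary would have an interior minimum of
    its first coordinate. *)
Lemma boundary_chart (c d: chart A) p: cdom c p -> cdom d p -> phi c p 0 ord0 = 0 -> phi d p 0 ord0 = 0.
move=> dc dd c0; have ic: img c (phi c p) by exists p. have idp: img d (phi d p) by exists p.
have:= img_half HM idp; rewrite le_eqVlt=>/orP[/eqP //|dp]. have ov: overlap d c (phi d p) by exists p.
have [U [T [oU Ux sT HT]]]:= chart_trans HM Hg ov. have oV: open (U `&` [set z: P | 0 < co z]).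
 exact: (pos_near oU (Ck_coord 0 ord0 oU) Ux dp).
have [_ Tx gx]:= HT _ Ux (ltW dp). have TE: T (phi d p) = phi c p by rewrite Tx /transition (sm_phiK HM).
have uT: Dj T (phi d p) \in unitmx by have:= metric_unit Hg idp; rewrite gx !unitmx_mul=>/andP[/andP[]].
have: 0 < T (phi d p) 0 ord0.
 apply: (interior_min oV _ _ uT); [by split|by apply: Cks_sub sT=> z []|].
 move=> z [Uz /= /ltW z0]; have [[q [dq cq] qz] -> _]:= HT z Uz z0.
 by apply: (@img_half HM c); rewrite /transition -qz (sm_phiK HM) //; exists q.
by rewrite TE c0 ltxx.
Qed.

End Charts.

Section SphereChart.

Lemma half_sphere_compact: compact (@half_sphere R m).
apply: (dotp_compact (B:= 1)); last by move=> x [-> _].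
have -> : @half_sphere R m = [set x | dotp x x = 1] `&` [set x | 0 <= co x] by [].
apply: closedI; first by apply: closedEQ; exact: dotp2_cont.
apply: (@closed_comp _ _ (fun x: SS=> co x) [set r | 0 <= r]); last exact: closed_ge.
by move=> x _; exact: coordC.
Qed.

Lemma Cks_up (U: set SS): open U -> Cks U (up).
move=> oU k i; case: (unliftP ord0 i)=>[j ->|->].
 by apply: (Ck_ext oU _ (Ck_coord k j oU))=> x _; rewrite upS.
by apply: (Ck_ext oU _ (Ck_cst k 1 oU))=> x _; rewrite up0.
Qed.

(** [x] and the rescaled rows of [J] form an orthonormal basis, in which a tangent vector has no
    component along [x]. *)
Lemma sphere_frame (J: 'M[R]_(m.+1, m.+2)) (x v: SS) (t: R): dotp x x = 1 -> t != 0 ->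
  J *m J^T = (t ^+ 2)%:M -> (forall i, dotp (row i J) x = 0) -> dotp v x = 0 ->
  v = (t ^- 2 *: (v *m J^T)) *m J.
move=> xx t0 JJ Jx vx. have xxT: x *m x^T = 1%:M.
 apply/matrixP=> i j; rewrite !ord1 [LHS]mxE [RHS]mxE eqxx -xx. by apply: eq_bigr=> b _; rewrite [(_^T) b 0]mxE.
have JxT: J *m x^T = 0.
 apply/matrixP=> i j; rewrite !ord1 [RHS]mxE; transitivity (dotp (row i J) x); last exact: Jx.
 by rewrite [LHS]mxE; apply: eq_bigr=> b _; rewrite [(_^T) b 0]mxE [row i J 0 b]mxE.
have vxT: v *m x^T = 0.
 apply/matrixP=> i j; rewrite !ord1 [RHS]mxE; transitivity (dotp v x); last exact: vx.
 by rewrite [LHS]mxE; apply: eq_bigr=> b _; rewrite [(_^T) b 0]mxE.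
have h: col_mx x (t^-1 *: J) *m row_mx x^T (t^-1 *: J)^T = 1%:M :> 'M[R]_(1 + m.+1).
 rewrite mul_col_row xxT linearZ /= -scalemxAl JxT scaler0.
 rewrite -scalemxAr -[x *m J^T]trmxK trmx_mul trmxK JxT trmx0 scaler0.
 rewrite -scalemxAl -scalemxAr JJ !scale_scalar_mx.
 rewrite (_: t^-1 * (t^-1 * t ^+ 2) = 1) -?scalar_mx_block //.
 by rewrite mulrA -invfM -expr2 mulVf // expf_neq0.
have:= mulmx1C h; rewrite mul_row_col=> e.
have e': v = (v *m (t^-1 *: J)^T) *m (t^-1 *: J) by rewrite -{1}[v]mulmx1 -e mulmxDr !mulmxA vxT mul0mx add0r.
by rewrite {1}e' [(_ *: J)^T]linearZ /= -!scalemxAr -!scalemxAl scalerA -invfM -expr2.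
Qed.

End SphereChart.

(** * Round metrics and the conformal map from the hemisphere *)

Section HalfSphere.
Context (HM: smooth_manifold A) (Hg: riemannian_metric g) (m2: (2 <= m)%N) (cov: forall p: M, exists k x, [/\ cell_axioms g k, cO k x, 0 <= co x & psi (cch k) x = p]).

Let H:= cell_axiomsM HM Hg m2 cov.

Let d3: (3 <= m.+2)%N:= ltnW m2.

Lemma lcone_dom (i: midx S) z: cW (sval i) (fold z) -> mdom i (lcone z).
by move=> Wz; split; rewrite ?hgt_lcone ?stereoK //; exact: lconeC. Qed.

Lemma lcone_map (i: midx S) z: mmap i (lcone z) =
  (psi (cch (sval i)) (ch (sval i) (fold z)), Num.sqrt (cmu (sval i) (ch (sval i) (fold z)))).
by rewrite /= hgt_lcone stereoK mul1r. Qed.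

Lemma boundary_dom: mboundary A !=set0 -> exists i X, mdom i X /\ Q (mvec S) X = 0.
move=>[p [c dc c0]]; have [k [x [K Ox x0 px]]]:= cov p.
have ix:= ca_img K Ox x0; have [dk xE]:= img_psi HM ix; rewrite px in dk xE.
have k0: co x = 0 by rewrite -xE; exact: (boundary_chart HM Hg dc dk c0).
exists (exist _ k K), (lcone (cf k x)); split; last by rewrite /= Q_mv vecy; exact: cf_zero K _ Ox k0.
apply: lcone_dom=>/=; rewrite fold_id; first exact: (ca_fW K). by rewrite (cf_zero K Ox k0).
Qed.

Context {E: V -> M * R} (aE: forall X, cone X -> adm E X)
  (onto: forall p: M, exists X, [/\ slice X, 0 <= Q mv X & (E X).1 = p])
  (mirE: forall X, cone X -> E (X *m refl mv) = E X)
  (injE: forall X Y, cone X -> cone Y -> 0 <= Q mv X -> 0 <= Q mv Y -> (E X).1 = (E Y).1 -> par X Y).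

(** Near [y] the global model is the cell model moved by some [L]. At a boundary ray [L] must also
    carry the mirror vector to itself, so that the inner side of the cell goes to the half of the
    cone on which the model is injective. *)
Lemma half_local k y (K: cell_axioms g k): cW k y -> 0 <= co y -> exists (B: set P) (L: 'M[R]_m.+3),
  [/\ open B, B y, lor L, co y = 0 -> mv *m L = mv & forall z, B z -> cW k z /\
    (0 <= co z -> 0 <= Q mv (lcone z *m L) /\
       E (lcone z *m L) = (psi (cch k) (ch k z), Num.sqrt (cmu k (ch k z))))].
move=> Wy y0; set goal:= (exists B L, _); pose i: midx S:= exist _ k K; pose X0: V:= lcone y.
have rm: lor (refl (mv: V)) by apply: lor_refl; exact: Q_mvv.
have d0: mdom i X0 by apply: lcone_dom; rewrite /= fold_id. have cX0: cone X0 by exact: lconeC.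
have aX: adm (mmap i) X0.
 have [N [NX HN]]:= ma_dom_open H d0; exists i, 1%:M, N; split=>//; first exact: lor1.
 by move=> Z NZ; rewrite mulmx1; split=>//; exact: HN.
have [X [sX X1 pX]]:= onto (mmap i X0).1.
have [L [lL pL [N1 [N1X HN1]]]]:= adm_cmp H aX (aE (sliceC sX)) (esym pX). have QL: 0 <= Q mv (X0 *m L).
 have [t t0 e]:= pL; rewrite -(pmulr_rge0 _ t0) -QZr -e; exact: X1.
have oWy: nbhs y (cW k) by apply: open_nbhs_nbhs; split=>//; exact: ca_oW K.
have fin N2 L2: lor L2 -> cap N2 X0 -> (forall Z, cap N2 Z -> mmap i Z = E (Z *m L2)) -> (co y = 0 -> mv *m L2
= mv) -> (forall z, cap N2 (lcone z) -> 0 <= co z -> 0 <= Q mv (lcone z *m L2)) -> goal.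
 move=> l2 N2X e2 b2 q2; have n2: nbhs y (cW k `&` [set z | cap N2 (lcone z)]).
  exact: (@filterI _ (nbhs y) _ _ _ oWy (cap_lcone N2X)).
 move: n2; rewrite nbhsE=>-[B [oB By] HB]; rewrite /goal; exists B, L2; split=>// z /HB [Wz Nz]; split=>// z0.
 by split; [exact: q2|rewrite -e2 // lcone_map fold_id].
move: QL; rewrite le_eqVlt=>/orP[/eqP q0|qp]; last first.
 have c1: cap mv (X0 *m L) by split=>//; exact: lL.2.
 have [N2 [N2X HN2]]:= cap_lor lL c1 cX0; have [N3 [N3X HN3]]:= capI N1X N2X.
 apply: (fin N3 L)=>//; first by move=> Z /HN3 [/HN1].
  (* If a boundary ray landed strictly inside, two nearby rays exchanged by the reflection would
     have the same value on the side where [injE] holds. *)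
  move=> yb; exfalso; have n3:= cap_lcone N3X; move: n3; rewrite nbhsE=>-[U [oU Uy] HU].
  have /nbhs_ballP [r /= r0 Hr]:= line_near (e_ ord0: P) oU Uy. have r2: 0 < r / 2 by rewrite divr_gt0.
  have rr: r / 2 < r by rewrite gtr_pMr // invf_lt1 ?ltr1n.
  have /HU h1: U (y + (r / 2) *: (e_ ord0: P)) by apply: Hr; rewrite -ball_normE /= sub0r normrN gtr0_norm.
  have /HU h2: U (y + (- (r / 2)) *: (e_ ord0: P)) by apply: Hr; rewrite -ball_normE /= sub0r opprK gtr0_norm.
  set z:= y + _ in h1; set z':= y + _ in h2. have zz: z' = mrefl z.
   apply/rowP=> j; rewrite [RHS]mxE !mxE eqxx /=; have [->|j0]:= eqVneq j ord0; first by rewrite yb; ring.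
   by rewrite !mulr0.
  have [a1 b1]:= HN3 _ h1; have [a2 b2]:= HN3 _ h2.
  have ez: (E (lcone z *m L)).1 = (E (lcone z' *m L)).1 by rewrite -(HN1 _ a1) -(HN1 _ a2) !lcone_map zz fold_refl.
  have [_ q1]:= HN2 _ b1; have [_ q2]:= HN2 _ b2.
  have:= injE (lL.2 _ (lconeC z)) (lL.2 _ (lconeC z')) (ltW q1) (ltW q2) ez. have [L' [lL' LL' _]]:= lor_inv lL.
  move=>/(lor_par L'); rewrite -!mulmxA LL' !mulmx1=>/stereo_par; rewrite !stereoK zz.
  move=>/(congr1 (fun w: P=> co w)); rewrite [mrefl z 0 ord0]mxE eqxx /z !mxE yb eqxx /= mulr1 add0r; lra.
 by move=> z /HN3 [_ /HN2 [_ /ltW]].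
(* [T] is the mirror of the model transported to the cell. It preserves the cell model near [X0], so
   by [rigid2] it is the identity or the reflection, and it is not the identity. *)
have [L' [lL' LL' L'L]]:= lor_inv lL. pose T:= L *m refl mv *m L'.
have lT: lor T by apply: lorM=>//; exact: lorM.
have XT: X0 *m T = X0 by rewrite /T !mulmxA reflE -q0 mulr0 scale0r subr0 -mulmxA LL' mulmx1.
have c1: cap N1 (X0 *m T) by rewrite XT.
have [N2 [N2X HN2]]:= cap_lor lT c1 cX0; have [N3 [N3X HN3]]:= capI N1X N2X.
have [N4 [N4X HN4]]:= ma_dom_open H d0; have c4: cap N4 (X0 *m T) by rewrite XT.
have [N5 [N5X HN5]]:= cap_lor lT c4 cX0; have [N6 [N6X HN6]]:= capI N4X N5X. have [N7 [N7X HN7]]:= capI N3X N6X.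
have Tm: T = refl mv.
 have [e|e]: 1%:M = T \/ 1%:M = T *m refl mv.
 - apply: (@rigid2 _ _ d3 1%:M T (T *m refl mv) X0 N7)=>//; [exact: lor1|exact: lorM|].
  move=> Z /HN7 [/HN3 [n1 /HN2 n2] /HN6 [n4 /HN5 n5]]; rewrite mulmx1 mulmxA.
  have []:= (ma_fold H (HN4 _ n4) (HN4 _ n5)).1; [|by left|by right].
  congr (_.1); rewrite HN1 // HN1 // /T !mulmxA -(mulmxA _ L' L) L'L mulmx1 mirE //. by apply: lL.2; case: n1.
 - exfalso; have r1: refl (mv: V) = 1%:M.
  have:= congr1 (fun X: 'M[R]_m.+3=> L' *m X *m L) e.
  by rewrite /T !mulmxA mulmx1 L'L mul1mx -mulmxA L'L mulmx1.
  have:= congr1 (fun X: 'M[R]_m.+3=> (mv: V) *m X) r1.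
  rewrite mulmx1 refl_self ?Q_mvv // =>/(congr1 (Q (mv: V))); rewrite QNr Q_mvv; lra.
 - by rewrite -[T]mulmx1 -(reflK (Q_mvv: Q (mv: V) mv = 1)) mulmxA -e mul1mx.
have LT: L *m refl mv = refl mv *m L by rewrite -[in RHS]Tm /T -!mulmxA L'L mulmx1. pose W:= (mv: V) *m L.
have WW: Q W W = 1 by rewrite lL.1 Q_mvv. have WE: W = Q mv W *: mv.
 have: W *m refl mv = - W by rewrite /W -mulmxA LT mulmxA refl_self ?Q_mvv // mulNmx.
 rewrite reflE=> e; have: 2 *: W = 2 *: (Q mv W *: mv).
  by rewrite scalerA scaler_nat mulr2n; apply/eqP; rewrite -subr_eq0 -addrA e subrr.
 by apply: scalerI; rewrite pnatr_eq0.
have W2: Q mv W ^+ 2 = 1 by move: WW; rewrite {1}WE {1}WE QZl QZr Q_mvv mulr1 expr2. have yb: co y = 0.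
 have -> : co y = Q mv X0 by rewrite Q_mv vecy. have:= lL.1 mv X0; rewrite -/W WE QZl -q0 mulr0=> <- //.
have fin2 L2: lor L2 -> (mv: V) *m L2 = mv -> (forall Z, cap N1 Z -> mmap i Z = E (Z *m L2)) -> goal.
 move=> l2 m2' e2; apply: (fin N1 L2)=>// z _ z0. by rewrite -[X in Q X _]m2' l2.1 Q_mv vecy.
have [w1|wn]:= eqVneq (Q mv W) 1; first by apply: (fin2 L)=>//; rewrite -/W WE w1 scale1r.
(* When [L] reverses [mv], composing with the reflection corrects the sign and leaves the values of
   [E] unchanged. *)
have w1: Q mv W = -1 by move/eqP: W2; rewrite sqrf_eq1 (negPf wn) /= =>/eqP.
apply: (fin2 (L *m refl mv)); first exact: lorM.
 by rewrite mulmxA -/W WE w1 scaleN1r mulNmx refl_self ?Q_mvv // opprK.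
by move=> Z N1Z; rewrite HN1 // mulmxA mirE //; apply: lL.2; case: N1Z.
Qed.

Section RoundMetric.
Context (covc: forall c x, img (A:= A) c x -> exists k y,
  [/\ cell_axioms g k, cch k = c, cW k y, 0 <= co y & ch k y = x]).
Context (s: R).

Lemma C2_one: C2_fun A (fun _ => 1: R).
move=> c x _; exists [set: P], (fun _=> 1: R); split=>//; first exact: openT. exact: Ck_cst openT.
Qed.

Let wt:= cell_weight Hg (fun _: M => ltr01: 0 < (1: R)) C2_one.

Let densE (t: M * R): cell_dens (fun _ => 1) t = t.2.
by rewrite /cell_dens sqrtr1 divr1. Qed.

Lemma E_pos X: cone X -> 0 < (E X).2.
by move=> cX; have:= adm_gt0 wt (aE cX); rewrite densE. Qed.

Lemma E_hom X t: cone X -> 0 < t -> (E (t *: X)).2 = t * (E X).2.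
by move=> cX t0; have:= adm_hom wt (aE cX) t0; rewrite !densE. Qed.

Definition obs: V:= Num.sqrt (1 + s ^+ 2) *: (e_ 0: V) - s *: mv.

Let a2: Num.sqrt (1 + s ^+ 2) ^+ 2 = 1 + s ^+ 2.
by rewrite sqr_sqrtr // addr_ge0 // sqr_ge0. Qed.

Lemma obs_mv: Q obs mv = - s.
by rewrite !QE Qe0 Q_mvv vec0; ring. Qed.

Lemma obs0: obs 0 0 = Num.sqrt (1 + s ^+ 2).
rewrite /obs mxE [X in X + _]mxE [X in _ + X]mxE [X in _ - X]mxE vec0 mxE !eqxx /=.
by rewrite mulr1 mulr0 subr0.
Qed.

Lemma obs_obs: Q obs obs = -1.
rewrite {2}/obs QDr QNr !QZr obs_mv QC Qe0 obs0; move: a2; move: (Num.sqrt _)=> r h.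
have -> : r * - r - s * - s = - r ^+ 2 + s ^+ 2 by ring. by rewrite h; ring.
Qed.

Lemma obs_neg X: cone X -> Q obs X < 0.
move=>[XX X0]; rewrite QC; apply: Q_lt0=>//; rewrite ?XX ?obs_obs ?ltrN10 //.
by rewrite obs0 sqrtr_gt0 ltr_pwDl // sqr_ge0.
Qed.

Definition sel p: V:= sval (cid (onto p)).

Lemma selP p: [/\ slice (sel p), 0 <= Q mv (sel p) & (E (sel p)).1 = p].
by rewrite /sel; case: cid. Qed.

(** [g] is |dX|^2 divided by the square of the scale [(E X).2], so this factor turns it into |dX|^2
    / (Q obs X)^2. By homogeneity the representative chosen by [sel] does not matter, as [cfacE]
    shows. *)
Definition cfac p: R:= ((E (sel p)).2 / Q obs (sel p)) ^+ 2.

Lemma cfac_gt0 p: 0 < cfac p.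
have [sX _ _]:= selP p; have cX:= sliceC sX.
by rewrite exprn_even_gt0 //= mulf_neq0 ?invr_eq0 // ?(gt_eqF (E_pos cX)) // lt_eqF // obs_neg.
Qed.

Lemma cfacE X: cone X -> 0 <= Q mv X -> cfac (E X).1 = ((E X).2 / Q obs X) ^+ 2.
move=> cX X0; have [sY Y0 eY]:= selP (E X).1; have cY:= sliceC sY. have [t t0 e]:= injE cY cX Y0 X0 eY.
by rewrite {2 3}e E_hom // QZr -mulf_div divff ?mul1r // gt_eqF.
Qed.

(** In the flat coordinates of a cell the round metric is |dy|^2 / (pot N)^2, with [N] the pull-back
    of [- obs]. At the boundary [L] fixes [mv], which keeps [Q N mv = s], the mean curvature to
    be. *)
Lemma round_local c x: img (A:= A) c x -> exists (k: cell) (D W: set P) (N: V),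
  [/\ cell_axioms g k /\ cch k = c, [/\ open D, open W, D x, D `<=` cO k & W `<=` cW k],
    forall z, D z -> W (cf k z),
    [/\ Q N N = -1, forall y, 0 < pot N y & co x = 0 -> Q N mv = s] &
    forall z, D z -> 0 <= co z -> cfac (psi c z) = cmu k z / pot N (cf k z) ^+ 2 /\
      rescale cfac g c z = pot N (cf k z) ^- 2 *: (Dj (cf k) z *m (Dj (cf k) z)^T)].
move=> ix; have [k [y [K kc Wy y0 xE]]]:= covc ix. have [B [L [oB By lL bL HB]]]:= half_local K Wy y0.
have [L' [lL' LL' L'L]]:= lor_inv lL. pose N:= - (obs *m L').
have NE z: pot N z = - Q obs (lcone z *m L) by rewrite /pot QNl (lor_capE _ _ lL LL' lL').
have oD: open (cO k `&` cf k @^-1` B) by apply: (open_pre (ca_oO K) _ oB)=> z Oz; exact: Cks_cont (ca_f K) Oz.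
have fy: cf k x = y by rewrite -xE (ca_fh K). have xO: cO k x by rewrite -xE; exact: (ca_hO K).
exists k, (cO k `&` cf k @^-1` B), B, N; split=>//.
- split=>//; first by split; rewrite // /preimage /= fy.
 by move=> z Bz; have []:= HB z Bz.
- by move=> z [].
- split.
 + by rewrite QNl QNr opprK lL'.1 obs_obs.
 + by move=> z; rewrite NE oppr_gt0 obs_neg //; apply: lL.2; exact: lconeC.
 + move=> x0; have yb: co y = 0 by rewrite -fy; exact: cf_zero K _ xO x0.
  have e: (mv: V) *m L' = mv by rewrite -{1}(bL yb) -mulmxA LL' mulmx1.
  by rewrite QNl -[X in Q _ X]e lL'.1 obs_mv opprK.
move=> z [Oz Bfz] z0; have f0:= (ca_side K Oz).1 z0; have [Wfz /(_ f0) [q0 Ez]]:= HB _ Bfz.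
have cL: cone (lcone (cf k z) *m L) by apply: lL.2; exact: lconeC. have mu0:= ca_mu K Oz z0.
have fac: cfac (psi c z) = cmu k z / pot N (cf k z) ^+ 2.
 have:= cfacE cL q0; rewrite Ez /= (ca_hf K Oz) kc=>->. by rewrite expr_div_n sqr_sqrtr ?(ltW mu0) // NE sqrrN.
by split=>//; rewrite /rescale fac mulrC -scalerA (ca_conf K Oz z0) kc.
Qed.

Definition ground: tensor2 A:= rescale cfac g.

Lemma ground_metric: riemannian_metric ground.
split.
- by move=> c x ix; rewrite /ground /rescale linearZ /= (rm_sym Hg).
- move=> c x ix v v0; rewrite /ground /rescale /bil -scalemxAr -scalemxAl mxE.
 by rewrite mulr_gt0 ?cfac_gt0 //; exact: (rm_pos Hg ix v0).
- move=> c i j x ix; have [k [D [W [N [[K kc] [oD oW Dx DO WO] DW [NN N0 _] HD]]]]]:= round_local ix.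
 exists D, (fun z=> pot N (cf k z) ^- 2 * \sum_b Dj (cf k) z i b * Dj (cf k) z j b); split=>//.
 + move=> l; have sD: Cks D (cf k) by apply: Cks_sub (ca_f K).
  have h2: Ck l D (fun z=> \sum_b Dj (cf k) z i b * Dj (cf k) z j b).
   have h (b: 'I_m.+1): Ck l D (fun z=> Dj (cf k) z i b * Dj (cf k) z j b).
    exact: (Ck_mul oD (@Ck_Dj R _ _ l D (cf k) i b oD sD) (@Ck_Dj R _ _ l D (cf k) j b oD sD)).
   exact: (Ck_sum (index_enum 'I_m.+1) xpredT oD h).
  have h3: Ck l D (fun z=> pot N (cf k z)).
   exact: (Ck_comp oD openT (fun z _=> I) (fun j=> sD l j) (Ck_pot l N openT)).
  have h4: Ck l D (fun z=> pot N (cf k z) ^+ 2).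
   apply: (Ck_ext oD _ (Ck_mul oD h3 h3))=> z _; by rewrite expr2.
  have p0 z: D z -> 0 < pot N (cf k z) ^+ 2 by move=> _; rewrite exprn_gt0.
  exact: (Ck_mul oD (Ck_inv oD p0 h4) h2).
 + move=> z Dz iz; have [_ e]:= HD z Dz (img_half HM iz).
  rewrite /ground e [RHS]mxE; congr (_ * _); rewrite [RHS]mxE; apply: eq_bigr=> b _. by rewrite [(_^T) b j]mxE.
- move=> c d x ov; rewrite /ground /rescale (rm_change Hg ov) -scalemxAr -scalemxAl.
 congr (cfac _ *: _); have [p [dc dd] <-]:= ov. by rewrite /transition (sm_phiK HM dc) (sm_phiK HM dd).
Qed.

Lemma schS_pot (N: V) (y: P): Q N N = -1 -> 0 < pot N y -> schS (pot N) y = (2^-1 / pot N y ^+ 2)%:M.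
move=> NN N0; apply/matrixP=> a b; rewrite [LHS]mxE [RHS]mxE D2_pot grad_pot NN.
move: (pot N y) (curv N) N0=> r q r0; rewrite -[RHS]mulr_natl; move: ((a == b)%:R: R)=> e.
by field; rewrite gt_eqF.
Qed.

Lemma ground_sectional: constant_sectional_curvature ground 1.
move=> c x X Y ix rf; have [k [D [W [N [[K kc] [oD oW Dx DO WO] DW [NN N0 _] HD]]]]]:= round_local ix.
have sD: Cks D (cf k) by apply: Cks_sub (ca_f K). have sW: Cks W (ch k) by apply: Cks_sub (ca_h K).
apply: (conformal_sectional oD oW sD sW DW _ (Ck_pot 2 N oW) _ _ Dx (img_half HM ix) rf)=>//.
- by move=> z /DO Oz; exact: (ca_hf K).
- by move=> z Dz z0; have []:= HD z Dz z0.
- by rewrite schS_pot // mul1r.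
Qed.

Lemma ground_mean: constant_mean_curvature ground s.
move=> c x [ix x0]; have [k [D [W [N [[K kc] [oD oW Dx DO WO] DW [NN N0 Nb] HD]]]]]:= round_local ix.
have sD: Cks D (cf k) by apply: Cks_sub (ca_f K). have sW: Cks W (ch k) by apply: Cks_sub (ca_h K).
apply/(mean_curvatureP (k:= s) (ltnW m2) (tangential_unit ground_metric ix))=>//.
have -> : s = 'D_(e_ 0) (pot N) (cf k x) by rewrite D_pot (cf_zero K (DO _ Dx) x0) mulr0 addr0 -Q_mv QC Nb.
apply: (conf_sff oD oW sD sW DW _ (Ck_pot 2 N oW) _ _ _ _ Dx x0)=>//.
- by move=> z /DO Oz; exact: (ca_hf K).
- by move=> z Dz z0; have []:= HD z Dz z0.
- by move=> z /DO Oz z0; exact: (cf_zero K Oz z0).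
- by move=> z /DO Oz z0; exact: (ca_side K Oz).1.
Qed.

Lemma ground_schouten c x: img (A:= A) c x -> exists2 lam,
  eigenvalues_wrt (ground c x) (schouten (ground c) x) lam & Gamma m.+1 lam.
move=> ix; have [k [D [W [N [[K kc] [oD oW Dx DO WO] DW [NN N0 _] HD]]]]]:= round_local ix.
have sD: Cks D (cf k) by apply: Cks_sub (ca_f K). have sW: Cks W (ch k) by apply: Cks_sub (ca_h K).
exists (const_mx 2^-1); last by apply/Gamma_full=> i; rewrite mxE invr_gt0.
have x0:= img_half HM ix; have [_ GE]:= HD x Dx x0.
have -> : schouten (ground c) x = Dj (cf k) x *m schS (pot N) (cf k x) *m (Dj (cf k) x)^T.
 apply: (conf_sch m2 oD oW sD sW DW _ (Ck_pot 2 N oW) _ _ Dx x0)=>//.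
 - by move=> z /DO Oz; exact: (ca_hf K).
 - by move=> z Dz z0; have []:= HD z Dz z0.
have uJ: Dj (cf k) x \in unitmx.
 have:= metric_unit ground_metric ix; rewrite /ground GE unitmxZ ?unitmx_mul.
  by move=>/andP[].
 by rewrite unitfE invr_eq0 expf_neq0 // gt_eqF.
apply/(eigenvalues_conj (schS (pot N) (cf k x)) (const_mx 2^-1) uJ _ GE).
 by rewrite invr_eq0 expf_neq0 // gt_eqF.
have pn: pot N (cf k x) != 0 by rewrite gt_eqF.
rewrite schS_pot // invrK scale_scalar_mx mulrC divfK ?expf_neq0 // char_poly_scalar.
by under eq_bigr do rewrite mxE; rewrite prodr_const card_ord.
Qed.

Lemma ground_C2 (r: R): C2_fun A (fun p => cfac p `^ r).
move=> c x ix; have [k [D [W [N [[K kc] [oD oW Dx DO WO] DW [NN N0 _] HD]]]]]:= round_local ix.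
have sD: Cks D (cf k) by apply: Cks_sub (ca_f K).
have [U [nu [oU [Ux UO] snu nu0 nuE]]]:= mu_extend Hg K (DO _ Dx) (img_half HM ix).
have oV: open (U `&` D) by exact: openI.
exists (U `&` D), (fun z=> (nu z * (pot N (cf k z) * pot N (cf k z))^-1) `^ r); split=>//.
- have sU: Cks (U `&` D) (cf k) by apply: Cks_sub sD=> z [].
 have h3: Ck 2 (U `&` D) (fun z=> pot N (cf k z)).
  exact: (Ck_comp oV openT (fun z _=> I) (fun j=> sU 2%N j) (Ck_pot 2 N openT)).
 have p0 z: (U `&` D) z -> 0 < pot N (cf k z) * pot N (cf k z) by move=> _; rewrite mulr_gt0.
 have h1: Ck 2 (U `&` D) nu by apply: Ck_sub (snu 2%N)=> z [].
 have q0 z: (U `&` D) z -> 0 < nu z * (pot N (cf k z) * pot N (cf k z))^-1 by move=> h; rewrite mulr_gt0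
 ?invr_gt0 ?p0 //; apply: nu0; case: h.
 exact: (Ck_powR r oV q0 (Ck_mul oV h1 (Ck_inv oV p0 (Ck_mul oV h3 h3)))).
- move=> z [Uz Dz] iz; have z0:= img_half HM iz; have [-> _]:= HD z Dz z0.
 by rewrite nuE // expr2.
Qed.

End RoundMetric.

Definition cmap (x: SS): M:= (E (up x)).1.

Lemma cmap_cont: {within half_sphere, continuous cmap}.
apply/subspace_continuousP=> x hx O1; rewrite /= nbhsE=>-[U [oU Ux] HU]. have cx:= cone_up hx.1.
have [N [NX HN]]:= adm_cont H (aE cx) oU Ux. have n1: nbhs x [set z | 0 < Q N (up z)].
 have:= @up_continuous x _ (cap_open NX.2); exact.
apply: (@filterS _ (nbhs x) _ _ _ _ n1)=> z /= Nz hz; apply: HU.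
by apply: (HN (up z)); split=>//; exact: cone_up hz.1.
Qed.

Lemma cmap_inj x y: half_sphere x -> half_sphere y -> cmap x = cmap y -> x = y.
move=> hx hy e; have q z: half_sphere z -> 0 <= Q mv (up z: V) by move=>[_ z0]; rewrite Q_mv_up.
have [t t0 e']:= injE (cone_up hx.1) (cone_up hy.1) (q _ hx) (q _ hy) e.
by rewrite -(sph_up x) -(sph_up y) e' sphZ // gt_eqF.
Qed.

Lemma cmap_inv p: exists x, half_sphere x /\ cmap x = p.
have [X [[XX X0] Xm <-]]:= onto p; have cX: cone X by split=>//; rewrite X0.
exists (sph X); split; first exact: half_sph. by rewrite /cmap up_sph // X0 invr1 scale1r.
Qed.

(** A continuous bijection from the compact hemisphere to a Hausdorff space is a homeomorphism, that
    is, a covering with a single sheet. *)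
Lemma cmap_covering: covering_map half_sphere cmap.
have [inv Hinv]:= choice cmap_inv.
have invK x: half_sphere x -> inv (cmap x) = x by move=> hx; have [h1 h2]:= Hinv (cmap x); exact: cmap_inj.
have cinv: continuous inv.
 apply/continuous_closedP=> C cC. have -> : inv @^-1` C = cmap @` (C `&` half_sphere).
  apply/seteqP; split=>[p /= Cp|_ [x [Cx hx] <-] /=]; last by rewrite invK.
  by have [h1 h2]:= Hinv p; exists (inv p).
 apply: compact_closed; first exact: sm_hausdorff HM.
 apply: continuous_compact; first by apply: continuous_subspaceW cmap_cont=> x [].
 rewrite setIC; apply: compact_closedI cC; exact: half_sphere_compact.
split; first exact: cmap_cont.
 by apply/seteqP; split=>// p _; have [h1 h2]:= Hinv p; exists (inv p).
move=> p; exists [set: M], unit, (fun _=> inv); split.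
 by split=>//; [exact: openT|move=>[] []].
split.
- by move=> _; apply: continuous_subspaceT.
- by move=> _ q _; exact: Hinv.
- move=> _; exists [set: SS]; first exact: openT.
 rewrite setTI; apply/seteqP; split=>[_ [q _ <-]|x hx]; first by have []:= Hinv q.
 by exists (cmap x)=>//; exact: invK.
- by move=> x hx _; exists tt; exact: invK.
Qed.

(** Near [x] the map is the inverse [ch k] of a cell after the stereographic projection [st] twisted
    by [L'], and both are conformal. *)
Lemma cmap_local (x: SS): half_sphere x -> exists (k: cell) (D: set SS) (G: SS -> P) (mu: R),
  [/\ cell_axioms g k, [/\ open D, D x, Cks D G & 0 < mu],
    forall w, D w -> half_sphere w -> [/\ img (cch k) (G w), 0 <= G w 0 ord0 & cmap w = psi (cch k) (G w)] &
    forall v w, dotp v x = 0 -> dotp w x = 0 ->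
      ((v *m Dj G x) *m g (cch k) (G x) *m (w *m Dj G x)^T) 0 0 = mu * dotp v w].
move=> hx; have [k [x1 [K Ox x10 xp]]]:= cov (cmap x).
set y1:= cf k x1; have y10: 0 <= co y1 by exact: (ca_side K Ox).1. have Wy: cW k y1 by exact: (ca_fW K).
have [B [L [oB By lL bL HB]]]:= half_local K Wy y10. have [L' [lL' LL' L'L]]:= lor_inv lL.
have cu: cone (up x):= cone_up hx.1. have pyx: par (lcone y1) (up x *m L').
 have [_ /(_ y10) [q0 Ey]]:= HB _ By. have: par (lcone y1 *m L) (up x).
  apply: injE=>//; first by apply: lL.2; exact: lconeC.
   by rewrite Q_mv_up; case: hx.
  by rewrite Ey /= (ca_hf K) // xp.
 by move=>/(lor_par L'); rewrite -mulmxA LL' mulmx1.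
pose st w: P:= stereo (up w *m L').
have hx0: 0 < hgt (up x *m L') by have [t t0 ->]:= pyx; rewrite hgtZ hgt_lcone mulr1.
have stx: st x = y1 by rewrite /st -(stereo_par pyx) stereoK. have sUL: Cks [set: SS] (fun w=> up w *m L').
 apply: (@Cks_comp _ _ _ _ [set: SS] [set: V] (up) (fun z=> z *m L'))=>//; try exact: openT.
  exact: Cks_up openT.
 exact: Cks_mul openT.
have shg l: Ck l [set: SS] (fun w=> hgt (up w *m L')) by exact: (Ck_add openT (sUL l 0) (sUL l li)).
pose D1:= [set w: SS | 0 < hgt (up w *m L')].
have oD1: open D1 by apply: (@open_comp _ _ (fun w: SS=> hgt (up w *m L')) [set r | 0 < r])=>[w _|]; [exact:
hgt_up_cont|exact: open_gt]. have sst: Cks D1 st.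
 move=> l j; apply: (Ck_ext oD1 _ (Ck_mul oD1 (Ck_sub (@subsetT _ D1) (sUL l (yi j))) (Ck_inv oD1 (fun w (h :
 D1 w)=> h) (Ck_sub (@subsetT _ D1) (shg l)))))=> w _. by rewrite [RHS]mxE.
(* Away from the boundary the half space is imposed by hand; at a boundary point it is respected
   because [L] fixes [mv]. *)
pose B':= B `&` [set z: P | co y1 = 0 \/ 0 < co z]. have oB': open B'.
 have [yb|yn]:= eqVneq (co y1) 0.
  rewrite (_: B' = B) //; apply/seteqP; split=>[z []//|z Bz]; split=>//; by left.
 rewrite (_: B' = B `&` [set z: P | 0 < co z]).
  apply: openI=>//; apply: (@open_comp _ _ (fun z: P=> co z) [set r | 0 < r]); last exact: open_gt.
  by move=> z _; exact: coordC.
 by apply/seteqP; split=> z [Bz]; [case=>// h; rewrite h eqxx in yn|split=>//; right].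
have oD: open (D1 `&` st @^-1` B') by apply: (open_pre oD1 _ oB')=> w Dw; exact: Cks_cont sst Dw.
set D:= _ `&` _ in oD. have B'y: B' y1.
 split=>//; have [yb|yn]:= eqVneq (co y1) 0; first by left. by right; rewrite lt_neqAle eq_sym yn.
have Dx: D x by split; rewrite // /preimage /= stx. have B'W z: B' z -> cW k z by move=>[/HB[]].
have sstD: Cks D st by apply: Cks_sub sst=> w []. pose G w:= ch k (st w). have sG: Cks D G.
 apply: (@Cks_comp _ _ _ _ D (cW k) st (ch k) oD (ca_oW K) _ sstD (ca_h K))=> w [_ /B'W //].
have lc w: D w -> half_sphere w -> up w *m L' = hgt (up w *m L') *: lcone (st w) by move=>[Dw _] hw; apply:
lconeK=>//; apply: lL'.2; exact: cone_up hw.1. have st0 w: D w -> half_sphere w -> 0 <= st w 0 ord0.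
 move=> Dw hw; have [D1w [_ [yb|/ltW //]]]:= Dw.
 have e: (mv: V) *m L' = mv by rewrite -{1}(bL yb) -mulmxA LL' mulmx1.
 have:= lL'.1 mv (up w); rewrite e (lc w Dw hw) QZr Q_mv_up=> h.
 have -> : st w 0 ord0 = Q mv (lcone (st w)) by rewrite Q_mv vecy. by rewrite -(pmulr_rge0 _ D1w) h; case: hw.
have GE w: D w -> half_sphere w -> [/\ img (cch k) (G w), 0 <= G w 0 ord0 & cmap w = psi (cch k) (G w)].
 move=> Dw hw; have [D1w [Bw _]]:= Dw; have s0:= st0 w Dw hw. have [Ww /(_ s0) [_ Ew]]:= HB _ Bw.
 split; first exact: ch_img K _ Ww s0.
  exact: (ch_half K Ww).2.
 have pw: par (lcone (st w) *m L) (up w).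
  exists (hgt (up w *m L'))=>//. by rewrite scalemxAl -(lc w Dw hw) -mulmxA L'L mulmx1.
 have cl: cone (lcone (st w) *m L) by apply: lL.2; exact: lconeC.
 by have:= adm_pt_par H (aE cl) pw; rewrite /cmap /= => <-; rewrite Ew.
have mu0: 0 < cmu k x1 by exact: (ca_mu K). have Gx: G x = x1 by rewrite /G stx (ca_hf K).
pose ta:= ((lcone y1 *m L) 0 0)^-1. have ta0: 0 < ta by rewrite invr_gt0; exact: (tau_gt0 lL).
have cs:= conformal_msig lL y1; have ct i:= msig_tangent lL i y1. have sx: msig L y1 = x.
 have [t t0 e]:= pyx; have e2: up x = t *: (lcone y1 *m L).
  by rewrite scalemxAl -e -mulmxA L'L mulmx1.
 by rewrite -[RHS]sph_up e2 sphZ // gt_eqF.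
have stK z: st (msig L z) = z.
 rewrite /st (up_msig lL) -scalemxAl -mulmxA LL' mulmx1; apply: stereo_scal.
 by rewrite invr_gt0; exact: (tau_gt0 lL).
have Dst: Dj (msig L) y1 *m Dj st x = 1%:M.
 have dm j: differentiable (fun z=> msig L z 0 j) y1 by exact: Cks_diff openT (Cks_msig lL) I.
 have dst j: differentiable (fun w=> st w 0 j) (msig L y1) by rewrite sx; exact: Cks_diff oD sstD Dx.
 have:= Dj_comp dm dst; rewrite sx=> <-; rewrite -[RHS](Dj_id y1). by apply: (Dj_eq openT I)=> z _; exact: stK.
have DG: Dj G x = Dj st x *m Dj (ch k) y1.
 rewrite -stx; apply: Dj_comp=> j; first exact: Cks_diff oD sstD Dx.
 by rewrite stx; exact: Cks_diff (ca_oW K) (ca_h K) Wy.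
have hgh: Dj (ch k) y1 *m g (cch k) x1 *m (Dj (ch k) y1)^T = ((cmu k x1)^-1)%:M.
 have -> : g (cch k) x1 = (cmu k x1)^-1 *: (Dj (cf k) x1 *m (Dj (cf k) x1)^T) by rewrite (ca_conf K) // scalerA
 mulVf ?scale1r // gt_eqF.
 have hf: Dj (ch k) y1 *m Dj (cf k) x1 = 1%:M by have:= Dj_hf K Wy; rewrite {2}/y1 (ca_hf K).
 by rewrite -scalemxAr -scalemxAl !mulmxA hf mul1mx -trmx_mul hf trmx1 scalemx1.
exists k, D, G, ((cmu k x1)^-1 * ta ^- 2); split=>//.
 by split=>//; rewrite mulr_gt0 // invr_gt0 // exprn_gt0.
(* Tangent vectors of the sphere at [x] are images under [Dj (msig L) y1], which [Dj st x]
   inverts. *)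
move=> v w vx wx. have rep (u: SS): dotp u x = 0 -> exists2 a: P, u = a *m Dj (msig L) y1 & u *m Dj st x = a.
 move=> ux; have ct' i: dotp (row i (Dj (msig L) y1)) x = 0 by rewrite -sx; exact: ct.
 have e:= sphere_frame hx.1 (lt0r_neq0 ta0) cs ct' ux. exists (ta ^- 2 *: (u *m (Dj (msig L) y1)^T))=>//.
 by rewrite {1}e -mulmxA Dst mulmx1.
have [a va sa]:= rep v vx; have [b wb sb]:= rep w wx.
transitivity ((a *m (Dj (ch k) y1 *m g (cch k) x1 *m (Dj (ch k) y1)^T) *m b^T) 0 0).
 by rewrite Gx DG !mulmxA sa sb trmx_mul !mulmxA.
rewrite hgh mul_mx_scalar -scalemxAl [LHS]mxE. rewrite -mulrA; congr (_ * _).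
have -> : dotp v w = (a *m (Dj (msig L) y1 *m (Dj (msig L) y1)^T) *m b^T) 0 0.
 rewrite mulmxA -mulmxA -trmx_mul -va -wb mxE; apply: eq_bigr=> i _. by rewrite [(_^T) i 0]mxE.
rewrite cs mul_mx_scalar -scalemxAl [in RHS]mxE mulrA mulVf ?mul1r //. by rewrite expf_neq0 // gt_eqF.
Qed.

Theorem cmap_conformal: conformal_covering g cmap.
split; first exact: cmap_covering.
move=> c x hx dx; have [k [D [G [mu [K [oD Dx sG mu0] GE conf]]]]]:= cmap_local hx.
have [ix x0 px]:= GE x Dx hx; have [dk pk]:= img_psi HM ix.
have ov: overlap (cch k) c (G x) by exists (cmap x); rewrite ?px // in dx *; split.
have [U [T [oU Ux sT HT]]]:= chart_trans HM Hg ov.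
have oV: open (D `&` G @^-1` U) by apply: (open_pre oD _ oU)=> z Dz; exact: Cks_cont sG Dz.
have Vx: (D `&` G @^-1` U) x by []. have sGV: Cks (D `&` G @^-1` U) G by apply: Cks_sub sG=> z [].
have sTG: Cks (D `&` G @^-1` U) (fun z=> T (G z)) by apply: (@Cks_comp _ _ _ _ _ U G T oV oU _ sGV sT)=> z [].
exists (D `&` G @^-1` U), (fun z=> T (G z)), mu; split; split=>//.
 move=> w [Dw Uw] hw; have [iw w0 pw]:= GE w Dw hw. have [[q [qk qc] qe] Tw _]:= HT _ Uw w0.
 have e: cmap w = q by rewrite pw -qe (sm_phiK HM qk). by rewrite e Tw /transition -qe (sm_phiK HM qk).
move=> v w vx wx; rewrite !(derive_row _ oV sTG Vx).
have -> : Dj (fun z=> T (G z)) x = Dj G x *m Dj T (G x) by apply: Dj_comp=> j; [exact: Cks_diff oV sGV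
Vx|exact: Cks_diff oU sT Ux]. rewrite -(conf v w vx wx) /bil; have [_ _ ->]:= HT _ Ux x0.
by rewrite !trmx_mul !mulmxA.
Qed.

End HalfSphere.

(** * Coverings by the hemisphere, round metrics and positive type *)

Section Assembly.
Context (HM: smooth_manifold A) (Hg: riemannian_metric g) (m2: (2 <= m)%N) (bM: mboundary A !=set0).

Lemma half_sphere_model :
  (forall p: M, exists k x, [/\ cell_axioms g k, cO k x, 0 <= co x & psi (cch k) x = p]) ->
  (exists E, forall X, cone X -> adm E X) -> exists E: V -> M * R,
  [/\ forall X, cone X -> adm E X,
      forall p: M, exists X, [/\ slice X, 0 <= Q mv X & (E X).1 = p],
      forall X, cone X -> E (X *m refl mv) = E X &
      forall X Y, cone X -> cone Y -> 0 <= Q mv X -> 0 <= Q mv Y -> (E X).1 = (E Y).1 -> par X Y].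
move=> cov exE; have H:= cell_axiomsM HM Hg m2 cov.
have wt:= cell_weight Hg (fun _: M=> ltr01: 0 < (1: R)) (C2_one).
exact: (half_model H (ltnW m2) wt (sm_hausdorff HM) (sm_connected HM) (boundary_dom HM Hg cov bM) exE).
Qed.

Lemma covered_metric (s: R): covered_by_half_sphere g -> exists u: M -> R,
  [/\ forall p, 0 < u p,
      riemannian_metric (rescale u g),
      constant_sectional_curvature (rescale u g) 1 /\ constant_mean_curvature (rescale u g) s,
      forall r, C2_fun A (fun p => u p `^ r) &
      forall c x, img c x -> exists2 lam,
        eigenvalues_wrt (rescale u g c x) (schouten (rescale u g c) x) lam & Gamma m.+1 lam].
move=>[F HF]; have cov:= cover_points HM HF; have covc:= cover_cov HM HF.
have [E [aE onto mirE injE]]:= half_sphere_model cov (cover_model HM Hg m2 HF). exists (cfac onto s); split.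
- exact: (cfac_gt0 Hg aE onto s).
- exact: (ground_metric HM Hg m2 cov aE onto mirE injE covc s).
- split; first exact: (ground_sectional HM Hg m2 cov aE onto mirE injE covc).
 exact: (ground_mean HM Hg m2 cov aE onto mirE injE covc).
- exact: (ground_C2 HM Hg m2 cov aE onto mirE injE covc s).
- exact: (ground_schouten HM Hg m2 cov aE onto mirE injE covc).
Qed.

Lemma C2_powR (w: M -> R) (r: R): (forall p, 0 < w p) -> C2_fun A w -> C2_fun A (fun p => w p `^ r).
move=> w0 w2 c x ix; have [U [f [oU Ux sf fE]]]:= w2 c x ix. have fx: 0 < f x by rewrite fE.
have oV:= pos_near oU sf Ux fx. exists (U `&` [set z | 0 < f z]), (fun z=> f z `^ r); split=>//.
 by apply: (Ck_powR r oV (fun z (h: (U `&` [set z | 0 < f z]) z)=> h.2)); apply: Ck_sub sf=> z [].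
by move=> z [Uz _] iz; rewrite fE.
Qed.

(** The round metric with minimal boundary, mean curvature 0, has all Schouten eigenvalues equal to
    1/2; the exponent [(n - 2) / 4] makes its conformal factor the power [4 / (n - 2)] of a
    function. *)
Lemma covered_positive: covered_by_half_sphere g -> positive_type g (Gamma m.+1).
move=>/(covered_metric 0) [u [u0 Hu [_ mc] u2 sc]].
pose n: R:= m.+1%:R; have n2: n - 2 != 0 by rewrite subr_eq0 /n eqr_nat gtn_eqF.
exists (fun p=> u p `^ ((n - 2) / 4)); first by split=>// p; rewrite powR_gt0.
have -> : rescale (fun p=> (u p `^ ((n - 2) / 4)) `^ (4 / (n - 2))) g = rescale u g.
 congr (rescale _ g); apply/funext=> p; rewrite -powRrM.
 by rewrite mulrA divfK ?pnatr_eq0 // divff // powRr1 // ltW.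
by split=>// c x bx; exists 0=>//; exact: mc.
Qed.

Lemma positive_covered (k: nat) (C: set P): locally_conformally_flat g -> umbilic_boundary g ->
  compact [set: M] -> (m.+1 <= 2 * k)%N -> (k <= m.+1)%N -> C `<=` Gamma k -> positive_type g C ->
  covered_by_half_sphere g.
move=> LCF UB cM k1 k2 CG [w [w0 w2] [sig bd]]. pose n: R:= m.+1%:R; pose u p:= w p `^ (4 / (n - 2)).
have cov:= flat_cell HM Hg LCF UB m2. have H:= cell_axiomsM HM Hg m2 cov.
have u0 p: 0 < u p by rewrite powR_gt0.
have sig' c x: img c x -> exists2 lam, eigenvalues_wrt (rescale u g c x) (schouten (rescale u g c) x) lam &
Gamma k lam by move=>/sig [lam h1 h2]; exists lam=>//; exact: CG.
have HD:= cell_density Hg u0 (C2_powR _ w0 w2) k1 k2 m2 sig' bd.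
have M0: exists _: M, True by have [p _]:= bM; exists p.
have exE:= sphere_exists H (ltnW m2) HD (sm_hausdorff HM) cM (sm_connected HM) M0.
have [E [aE onto mirE injE]]:= half_sphere_model cov exE.
exists (cmap (E:= E)); exact: (cmap_conformal HM Hg m2 cov aE onto mirE injE).
Qed.

End Assembly.

End Manifold.

(* The dimension is n = m.+1. *)
Theorem proposition1 (R : realType) (m : nat) (n_ge3 : (3 <= m.+1)%N) :
  (forall (M : topologicalType) (A : atlas R m M) (g : tensor2 A),
     compact_manifold_with_boundary A -> riemannian_metric g ->
     covered_by_half_sphere g ->
     forall c : R, exists gh : tensor2 A,
       [/\ riemannian_metric gh, conformal g gh,
           constant_sectional_curvature gh 1 & constant_mean_curvature gh c])
  /\
  (forall (M : topologicalType) (A : atlas R m M) (g : tensor2 A),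
     compact_manifold_with_boundary A -> riemannian_metric g ->
     locally_conformally_flat g -> umbilic_boundary g ->
     let i := covered_by_half_sphere g in
     let ii := positive_type g (Gamma m.+1) in
     let iii := exists (k : nat) (C : set 'rV[R]_m.+1),
       [/\ (m.+1 <= 2 * k)%N /\ (k <= m.+1)%N, admissible_cone C,
           C `<=` Gamma k & positive_type g C] in
     (i <-> ii) /\ (ii <-> iii)).
Proof.
split=> [M A g [HM _ bM] Hg cv c|M A g [HM cM bM] Hg LCF UB i ii iii].
 have [u [u0 Hu [sc mc] _ _]]:= covered_metric HM Hg n_ge3 bM c cv.
 by exists (rescale u g); split=> //; exists u.
have i2: i -> ii by exact: covered_positive HM Hg n_ge3 bM. have i3: ii -> iii.
 move=> h; exists m.+1, (Gamma m.+1); split=> //; first by rewrite leq_pmull. exact: Gamma_full_cone.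
have i1: iii -> i by move=> [k [C [[k1 k2] _ CG h]]]; exact: (positive_covered HM Hg n_ge3 bM LCF UB cM k1 k2 CG h).
by split; split=> // h; [apply: i1; exact: i3|apply: i2; exact: i1].
Qed.
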